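(* Let $\lambda\in P_0^+$. The assignment $$w_\lambda\ \mapsto\ w:=\sum_{\mu\in P^+,\ \overline{\mu}=\lambda} w_\mu$$ induces an injective homomorphism of $L^\Gamma(\mathfrak g)$-modules $$W^\Gamma(\lambda)\hookrightarrow\bigoplus_{\mu\in P^+,\ \overline{\mu}=\lambda}W(\mu),$$ where each $L(\mathfrak g)$-module $W(\mu)$ is regarded as an $L^\Gamma(\mathfrak g)$-module by restriction.
   Context: Let $\mathfrak g$ be a finite-dimensional simple complex Lie algebra with Cartan subalgebra $\mathfrak h$, triangular decomposition $\mathfrak g=\mathfrak n^-\oplus\mathfrak h\oplus\mathfrak n^+$, simple roots $\alpha_i$, Chevalley generators $X_i^\pm,H_i$ and fundamental weights $\omega_i$ ($i\in I$). $P^+$ is the $\mathbb Z_+$-span of the $\omega_i$, with $\mathbb Z_+$ the non-negative integers. Let $\sigma$ be a diagram automorphism of $\mathfrak g$ of order $m$ (so $\sigma(X_i^\pm)=X^\pm_{\sigma(i)}$, $\sigma(H_i)=H_{\sigma(i)}$ for an order $m$ automorphism of the Dynkin diagram), $\Gamma=\langle\sigma\rangle\cong\mathbb Z/m\mathbb Z$, and $\zeta$ a fixed primitive $m$-th root of unity. Put $\mathfrak g_s=\{x\in\mathfrak g:\sigma(x)=\zeta^s x\}$. The fixed-point algebra $\mathfrak g_0$ is simple with Cartan subalgebra $\mathfrak h_0=\mathfrak h\cap\mathfrak g_0$ and positive part $\mathfrak n_0^+=\mathfrak n^+\cap\mathfrak g_0$. Fix a set $I_0\subset I$ of representatives of the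 $\Gamma$-orbits on $I$; the simple roots of $\mathfrak g_0$ are the restrictions $\alpha_i|_{\mathfrak h_0}$, $i\in I_0$, and $Q_0^+$ is their $\mathbb Z_+$-span. For $\mu\in\mathfrak h^*$ write $\overline\mu=\mu|_{\mathfrak h_0}$. $P_0^+$ is the $\mathbb Z_+$-span of the $\overline{\omega_i}$, $i\in I_0$; equivalently $P_0^+=\{\overline\mu:\mu\in P^+\}$. (These are all dominant integral weights of $\mathfrak g_0$, unless $\mathfrak g$ is of type $A_{2n}$ and $m=2$, when $P_0^+$ is spanned by the fundamental weights of $\mathfrak g_0$ other than the last one, and twice the last one.) Let $A=\mathbb C[t^{\pm1}]$ and, for a Lie algebra $\mathfrak a$, $L(\mathfrak a)=\mathfrak a\otimes A$ with bracket $[x\otimes a,y\otimes b]=[x,y]\otimes ab$. $\Gamma$ acts on $L(\mathfrak g)$ by Lie algebra automorphisms, $\sigma(x\otimes t^k)=\sigma(x)\otimes\zeta^kt^k$; $L^\Gamma(\mathfrak g)=L(\mathfrak g)^\Gamma$ is the twisted loop algebra, which contains $\mathfrak g_0=\mathfrak g_0\otimes 1$. Untwisted global Weyl module: for $\mu\in P^+$, $W(\mu)$ is the $L(\mathfrak g)$-module generated by a nonzero vector $w_\mu$ with defining relations $L(\mathfrak n^+)w_\mu=0$, $(H\otimes1)w_\mu=\mu(H)w_\mu$ for $H\in\mathfrak h$, $(X_i^-\otimes1)^{\mu(H_i)+1}w_\mu=0$ for $i\in I$. Twisted global Weyl module: for $\lambda\in P_0^+$, let $V(\lambda)$ be the simple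 finite-dimensional $\mathfrak g_0$-module of highest weight $\lambda$ and $P^\Gamma(V(\lambda))=U(L^\Gamma(\mathfrak g))\otimes_{U(\mathfrak g_0)}V(\lambda)$. Then $W^\Gamma(\lambda)$ is the quotient of $P^\Gamma(V(\lambda))$ by the $L^\Gamma(\mathfrak g)$-submodule generated by all $\mathfrak h_0$-weight spaces of weights $\mu$ with $\lambda-\mu\notin Q_0^+$. $w_\lambda\in W^\Gamma(\lambda)$ denotes the image of $1\otimes v_\lambda$, with $v_\lambda$ a highest weight vector of $V(\lambda)$. *)

(* Defs.v *)
From HB Require Import structures.
From mathcomp Require Import all_boot all_order all_algebra all_fingroup.
From mathcomp Require Import generic_quotient complex finmap.
From mathcomp Require Import boolp classical_sets cardinality fsbigop reals.
From mathcomp Require Import monalg.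

Set Implicit Arguments.
Unset Strict Implicit.
Unset Printing Implicit Defensive.

Import GRing.Theory.

Local Open Scope classical_set_scope.
Local Open Scope ring_scope.
Local Open Scope quotient_scope.

Section ModuleQuotient.
Variables (R : pzRingType) (M : lmodType R).

(* The submodule generated by S. *)
Inductive submod_gen (S : set M) : set M :=
| submod_gen_in x : S x -> submod_gen S x
| submod_gen0 : submod_gen S 0
| submod_genD x y : submod_gen S x -> submod_gen S y -> submod_gen S (x + y)
| submod_genZ a x : submod_gen S x -> submod_gen S (a *: x).

Variable S : set M.

Definition modquot_rel (x y : M) : bool := `[< submod_gen S (x - y) >].

Lemma submod_genN x : submod_gen S x -> submod_gen S (- x).
Proof. by move=> Sx; rewrite -scaleN1r; exact: submod_genZ. Qed.

Lemma modquot_rel_equiv : equiv_class_of modquot_rel.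
Proof.
split=> [x|x y|y x z].
- by apply/asboolP; rewrite subrr; exact: submod_gen0.
- by apply/asboolP/asboolP => /submod_genN; rewrite opprB.
- move=> /asboolP xy /asboolP yz; apply/asboolP.
  by have := submod_genD xy yz; rewrite subrKA.
Qed.

Canonical modquot_equiv := EquivRelPack modquot_rel_equiv.

(* M modulo the submodule generated by S; modcl is the projection. *)
Definition modquot : Type := {eq_quot modquot_equiv}.
HB.instance Definition _ := Choice.on modquot.
HB.instance Definition _ := EqQuotient.on modquot.

Definition modcl (x : M) : modquot := \pi x.

Lemma modclP x y : modcl x = modcl y <-> submod_gen S (x - y).
Proof. by split=> [/eqmodP/asboolP//|xy]; apply/eqmodP/asboolP. Qed.

Lemma modcl_repr (u : modquot) : modcl (repr u) = u.
Proof. exact: reprK. Qed.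

Definition mq_zero : modquot := modcl 0.
Definition mq_opp (u : modquot) : modquot := modcl (- repr u).
Definition mq_add (u v : modquot) : modquot := modcl (repr u + repr v).
Definition mq_scale (a : R) (u : modquot) : modquot := modcl (a *: repr u).

Lemma repr_modcl x : submod_gen S (repr (modcl x) - x).
Proof. by apply/modclP; rewrite modcl_repr. Qed.

Lemma mq_addE x y : mq_add (modcl x) (modcl y) = modcl (x + y).
Proof.
apply/modclP; rewrite opprD addrACA.
exact: submod_genD (repr_modcl _) (repr_modcl _).
Qed.

Lemma mq_oppE x : mq_opp (modcl x) = modcl (- x).
Proof. by apply/modclP; rewrite -opprD; exact/submod_genN/repr_modcl. Qed.

Lemma mq_scaleE a x : mq_scale a (modcl x) = modcl (a *: x).
Proof. by apply/modclP; rewrite -scalerBr; exact/submod_genZ/repr_modcl. Qed.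

Lemma modcl_ind (P : modquot -> Prop) : (forall x, P (modcl x)) -> forall u, P u.
Proof. by move=> Px u; rewrite -(modcl_repr u). Qed.

Fact mq_addA : associative mq_add.
Proof.
by elim/modcl_ind=> x; elim/modcl_ind=> y; elim/modcl_ind=> z; rewrite !mq_addE addrA.
Qed.
Fact mq_addC : commutative mq_add.
Proof. by elim/modcl_ind=> x; elim/modcl_ind=> y; rewrite !mq_addE addrC. Qed.
Fact mq_add0 : left_id mq_zero mq_add.
Proof. by elim/modcl_ind=> x; rewrite mq_addE add0r. Qed.
Fact mq_addN : left_inverse mq_zero mq_opp mq_add.
Proof. by elim/modcl_ind=> x; rewrite mq_oppE mq_addE addNr. Qed.

HB.instance Definition _ :=
  GRing.isZmodule.Build modquot mq_addA mq_addC mq_add0 mq_addN.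

Lemma mq_addDE (u v : modquot) : u + v = mq_add u v.
Proof. by []. Qed.

Fact mq_scaleA a b u : mq_scale a (mq_scale b u) = mq_scale (a * b) u.
Proof. by elim/modcl_ind: u => x; rewrite !mq_scaleE scalerA. Qed.
Fact mq_scale1 : left_id 1 mq_scale.
Proof. by elim/modcl_ind=> x; rewrite mq_scaleE scale1r. Qed.
Fact mq_scaleDr : right_distributive mq_scale +%R.
Proof.
by move=> a; elim/modcl_ind=> x; elim/modcl_ind=> y;
  rewrite [modcl x + _]mq_addDE mq_addE !mq_scaleE mq_addDE mq_addE scalerDr.
Qed.
Fact mq_scaleDl u : {morph mq_scale^~ u : a b / a + b}.
Proof. by move=> a b; elim/modcl_ind: u => x; rewrite mq_addDE !mq_scaleE mq_addE scalerDl. Qed.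

HB.instance Definition _ := GRing.Zmodule_isLmodule.Build R modquot
  mq_scaleA mq_scale1 mq_scaleDr mq_scaleDl.

Fact modcl_is_linear : linear modcl.
Proof. by move=> a x y; rewrite mq_addDE -mq_addE -mq_scaleE. Qed.
HB.instance Definition _ := GRing.isLinear.Build R M modquot *:%R modcl modcl_is_linear.

End ModuleQuotient.

Section DirectSum.
Variables (R : pzRingType) (I : choiceType) (V : I -> lmodType R).

(* The direct sum: finitely supported families. *)
Record dsum := DSum {
  dval :> forall i, V i;
  dvalP : finite_set [set i | dval i <> 0] }.

HB.instance Definition _ := gen_eqMixin dsum.
HB.instance Definition _ := gen_choiceMixin dsum.

Lemma dsumP (x y : dsum) : (forall i, x i = y i) -> x = y.
Proof.
case: x y => [x xP] [y yP] /= xy; have {}xy : x = y by apply: functional_extensionality_dep.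
by case: y / xy yP => yP; congr DSum; exact: Prop_irrelevance.
Qed.

Fact dsum0_subproof : finite_set [set i : I | 0 <> 0 :> V i].
Proof. by rewrite (_ : mkset _ = set0) // -subset0 => i. Qed.
Fact dsumN_subproof (x : dsum) : finite_set [set i | - x i <> 0].
Proof. by apply: sub_finite_set (dvalP x) => i /= + xi0; rewrite xi0 oppr0. Qed.
Fact dsumD_subproof (x y : dsum) : finite_set [set i | x i + y i <> 0].
Proof.
have fxy : finite_set ([set i | x i <> 0] `|` [set i | y i <> 0]).
  by rewrite finite_setU; split; exact: dvalP.
apply: sub_finite_set fxy => i /= xyi; apply: contrapT => /not_orP[] /contrapT x0 /contrapT y0.
by apply: xyi; rewrite x0 y0 addr0.
Qed.
Fact dsumZ_subproof a (x : dsum) : finite_set [set i | a *: x i <> 0].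
Proof. by apply: sub_finite_set (dvalP x) => i /= + xi0; rewrite xi0 scaler0. Qed.

Definition dsum_zero := DSum dsum0_subproof.
Definition dsum_opp x := DSum (dsumN_subproof x).
Definition dsum_add x y := DSum (dsumD_subproof x y).
Definition dsum_scale a x := DSum (dsumZ_subproof a x).

Fact dsum_addA : associative dsum_add.
Proof. by move=> x y z; apply: dsumP => i /=; rewrite addrA. Qed.
Fact dsum_addC : commutative dsum_add.
Proof. by move=> x y; apply: dsumP => i /=; rewrite addrC. Qed.
Fact dsum_add0 : left_id dsum_zero dsum_add.
Proof. by move=> x; apply: dsumP => i /=; rewrite add0r. Qed.
Fact dsum_addN : left_inverse dsum_zero dsum_opp dsum_add.
Proof. by move=> x; apply: dsumP => i /=; rewrite addNr. Qed.
HB.instance Definition _ :=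
  GRing.isZmodule.Build dsum dsum_addA dsum_addC dsum_add0 dsum_addN.

Fact dsum_scaleA a b x : dsum_scale a (dsum_scale b x) = dsum_scale (a * b) x.
Proof. by apply: dsumP => i /=; rewrite scalerA. Qed.
Fact dsum_scale1 : left_id 1 dsum_scale.
Proof. by move=> x; apply: dsumP => i /=; rewrite scale1r. Qed.
Fact dsum_scaleDr : right_distributive dsum_scale +%R.
Proof. by move=> a x y; apply: dsumP => i /=; rewrite scalerDr. Qed.
Fact dsum_scaleDl x : {morph dsum_scale^~ x : a b / a + b}.
Proof. by move=> a b; apply: dsumP => i /=; rewrite scalerDl. Qed.
HB.instance Definition _ := GRing.Zmodule_isLmodule.Build R dsum
  dsum_scaleA dsum_scale1 dsum_scaleDr dsum_scaleDl.

Lemma dsum0E i : (0 : dsum) i = 0. Proof. by []. Qed.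
Lemma dsumDE (x y : dsum) i : (x + y) i = x i + y i. Proof. by []. Qed.
Lemma dsumZE a (x : dsum) i : (a *: x) i = a *: x i. Proof. by []. Qed.
Lemma dsum_sumE J (r : seq J) (P : pred J) (F : J -> dsum) i :
  (\sum_(j <- r | P j) F j) i = \sum_(j <- r | P j) F j i.
Proof. exact: (big_morph (fun x : dsum => x i)). Qed.

Fact dsingle_subproof i (x : V i) :
  finite_set [set j | dfwith (fun k => 0 : V k) x j <> 0].
Proof.
apply: sub_finite_set (finite_set1 i) => j /=; have [->//|ji] := eqVneq j i.
by rewrite dfwith_out // eq_sym.
Qed.
Definition dsingle i (x : V i) : dsum := DSum (dsingle_subproof x).

Lemma dsingle_in i (x : V i) : dsingle x i = x.
Proof. exact: dfwith_in. Qed.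
Lemma dsingle_out i (x : V i) j : i != j -> dsingle x j = 0.
Proof. by move=> ij; exact: dfwith_out. Qed.

Fact dsingle_is_linear i : linear (@dsingle i).
Proof.
move=> a x y; apply: dsumP => j; rewrite dsumDE dsumZE.
case: (eqVneq i j) => [<-|ij]; first by rewrite !dsingle_in.
by rewrite !dsingle_out// scaler0 addr0.
Qed.
HB.instance Definition _ i :=
  GRing.isLinear.Build R (V i) dsum *:%R (@dsingle i) (@dsingle_is_linear i).

Definition dsupp (x : dsum) : seq I := fset_set [set i | x i <> 0].

Lemma dsupp_uniq x : uniq (dsupp x). Proof. exact: fset_uniq. Qed.
Lemma mem_dsupp (x : dsum) i : (i \in dsupp x) = (x i != 0).
Proof.
rewrite /dsupp in_fset_set; last exact: dvalP.
by apply/idP/idP; rewrite inE => /eqP.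
Qed.

Lemma dsum_big (x : dsum) : x = \sum_(i <- dsupp x) dsingle (x i).
Proof.
apply: dsumP => i; rewrite dsum_sumE.
have [ix|] := boolP (i \in dsupp x); last first.
  rewrite mem_dsupp negbK => /eqP xi0; rewrite xi0 big1_seq // => j /andP[_].
  rewrite mem_dsupp => xj; rewrite dsingle_out //.
  by apply: contra_neq xj => ->.
rewrite (bigD1_seq i) ?dsupp_uniq // dsingle_in big1 => [|j ji].
  exact/esym/addr0.
by rewrite dsingle_out.
Qed.

End DirectSum.

HB.mixin Record Lmodule_isLie (K : fieldType) g of GRing.Lmodule K g := {
  lie : g -> g -> g;
  lie_linearl : forall y, linear (lie^~ y);
  lie_linearr : forall x, linear (lie x);
  liexx : forall x, lie x x = 0;
  lie_jacobi : forall x y z,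
    lie x (lie y z) + lie y (lie z x) + lie z (lie x y) = 0
}.

#[short(type="lieAlgType")]
HB.structure Definition LieAlgebra (K : fieldType) :=
  { g of Lmodule_isLie K g & GRing.Lmodule K g }.

#[short(type="fdLieAlgType")]
HB.structure Definition FDLieAlgebra (K : fieldType) :=
  { g of LieAlgebra K g & Vector K g }.

Section LieTheory.
Variables (K : fieldType) (g : lieAlgType K).

HB.instance Definition _ (x : g) :=
  GRing.isLinear.Build K g g *:%R (lie x) (@lie_linearr K g x).

Lemma lie0l y : lie 0 y = 0 :> g.
Proof. by have := @lie_linearl K g y (-1) 0 0; rewrite scaler0 addr0 => ->; rewrite scaleN1r addNr. Qed.
Lemma lieDl (x x' y : g) : lie (x + x') y = lie x y + lie x' y.
Proof. by rewrite -[x]scale1r lie_linearl !scale1r. Qed.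
Lemma lieZl a (x y : g) : lie (a *: x) y = a *: lie x y.
Proof. by rewrite -[a *: x]addr0 lie_linearl lie0l addr0. Qed.
Lemma lie0r x : lie x 0 = 0 :> g.
Proof. exact: (linear0 (lie x)). Qed.
Lemma lieDr (x y y' : g) : lie x (y + y') = lie x y + lie x y'.
Proof. exact: (linearD (lie x)). Qed.
Lemma lieZr a (x y : g) : lie x (a *: y) = a *: lie x y.
Proof. exact: (linearZ_LR (lie x)). Qed.
Lemma lieC (x y : g) : lie x y = - lie y x.
Proof.
apply/eqP; rewrite -addr_eq0; apply/eqP.
have := liexx (x + y); rewrite lieDl !linearD /= !liexx add0r addr0 //.
Qed.
End LieTheory.

Record lieHom (K : fieldType) (g g' : lieAlgType K) := LieHom {
  lieHom_fun :> {linear g -> g'};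
  lieHomP : {morph lieHom_fun : x y / lie x y} }.

Section FixedSubalgebra.
Variables (K : fieldType) (g : lieAlgType K) (phi : lieHom g g).

(* The subalgebra of fixed points of phi. *)
Record fixlie := FixLie { fixval :> g; fixvalP : phi fixval == fixval }.
HB.instance Definition _ := [isSub for fixval].
HB.instance Definition _ := [Choice of fixlie by <:].

Fact fixlie_submod : submod_closed [pred x : g | phi x == x].
Proof.
split=> [|a x y]; rewrite !inE ?linear0 // => /eqP xE /eqP yE.
by rewrite linearP xE yE.
Qed.
HB.instance Definition _ := GRing.SubChoice_isSubLmodule.Build K g _ fixlie fixlie_submod.

Fact fixlie_lie_subproof (x y : fixlie) : phi (lie (val x) (val y)) == lie (val x) (val y).
Proof. by rewrite lieHomP (eqP (valP x)) (eqP (valP y)). Qed.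
Definition fixlie_lie (x y : fixlie) := FixLie (fixlie_lie_subproof x y).

Fact fixlie_linearl y : linear (fixlie_lie^~ y).
Proof. by move=> a x z; apply: val_inj; rewrite /= lieDl lieZl. Qed.
Fact fixlie_linearr x : linear (fixlie_lie x).
Proof. by move=> a y z; apply: val_inj; rewrite /= linearP. Qed.
Fact fixlie_xx x : fixlie_lie x x = 0.
Proof. by apply: val_inj; rewrite /= liexx. Qed.
Fact fixlie_jacobi x y z :
  fixlie_lie x (fixlie_lie y z) + fixlie_lie y (fixlie_lie z x) + fixlie_lie z (fixlie_lie x y) = 0.
Proof. by apply: val_inj; rewrite /= lie_jacobi. Qed.
HB.instance Definition _ := Lmodule_isLie.Build K fixlie
  fixlie_linearl fixlie_linearr fixlie_xx fixlie_jacobi.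

Fact fixval_lie : {morph (val : fixlie -> g) : x y / lie x y}.
Proof. by []. Qed.
Definition fixincl : lieHom fixlie g := LieHom fixval_lie.

End FixedSubalgebra.

Section AlgebraQuotient.
Variables (K : fieldType) (A : algType K) (S : set A).

(* The two-sided ideal generated by S is the K-span of this set. *)
Definition ideal_mults : set A :=
  [set z | exists a r b, S r /\ z = a * r * b].

Definition algquot : Type := modquot ideal_mults.
HB.instance Definition _ := GRing.Lmodule.on algquot.

Local Notation cl := (@modcl K A ideal_mults : A -> algquot).
Local Notation I := (submod_gen ideal_mults).

Lemma ideal_mulM a x b : I x -> I (a * x * b).
Proof.
elim=> [_ [c [r [d [rr ->]]]]||y z _ Iy _ Iz|k y _ Iy].
- by apply: submod_gen_in; exists (a * c), r, (d * b); split; rewrite ?mulrA.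
- by rewrite mulr0 mul0r; exact: submod_gen0.
- by rewrite mulrDr mulrDl; exact: submod_genD.
- by rewrite -scalerAr -scalerAl; exact: submod_genZ.
Qed.

Definition aq_one : algquot := cl 1.
Definition aq_mul (u v : algquot) : algquot := cl (repr u * repr v).

Lemma aq_mulE x y : aq_mul (cl x) (cl y) = cl (x * y).
Proof.
apply/modclP; set x' := repr _; set y' := repr _.
have -> : x' * y' - x * y = 1 * (x' - x) * y' + x * (y' - y) * 1.
  by rewrite mul1r mulr1 mulrBl mulrBr subrKA.
by apply: submod_genD; apply: ideal_mulM; exact: repr_modcl.
Qed.

Lemma algquot_ind (P : algquot -> Prop) : (forall x, P (cl x)) -> forall u, P u.
Proof. exact: modcl_ind. Qed.

Fact aq_mulA : associative aq_mul.
Proof.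
elim/algquot_ind=> x; elim/algquot_ind=> y; elim/algquot_ind=> z.
by rewrite (aq_mulE y) (aq_mulE x) (aq_mulE x) (aq_mulE (x * y)) mulrA.
Qed.
Fact aq_mul1l : left_id aq_one aq_mul.
Proof. by elim/algquot_ind=> x; rewrite (aq_mulE 1) mul1r. Qed.
Fact aq_mul1r : right_id aq_one aq_mul.
Proof. by elim/algquot_ind=> x; rewrite (aq_mulE x 1) mulr1. Qed.
Fact aq_mulDl : left_distributive aq_mul +%R.
Proof.
elim/algquot_ind=> x; elim/algquot_ind=> y; elim/algquot_ind=> z.
by rewrite (aq_mulE x) (aq_mulE y) -!(linearD (@modcl K A ideal_mults)) (aq_mulE (x + y)) mulrDl.
Qed.
Fact aq_mulDr : right_distributive aq_mul +%R.
Proof.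
elim/algquot_ind=> x; elim/algquot_ind=> y; elim/algquot_ind=> z.
by rewrite (aq_mulE x) (aq_mulE x z) -!(linearD (@modcl K A ideal_mults)) (aq_mulE x) mulrDr.
Qed.
HB.instance Definition _ := GRing.Zmodule_isPzRing.Build algquot
  aq_mulA aq_mul1l aq_mul1r aq_mulDl aq_mulDr.

Lemma aq_clM x y : cl (x * y) = cl x * cl y.
Proof. by rewrite -aq_mulE. Qed.

Lemma aq_clZ a x : cl (a *: x) = a *: cl x.
Proof. exact: (linearZ_LR (@modcl K A ideal_mults)). Qed.

Fact aq_scalerAl a (u v : algquot) : a *: (u * v) = (a *: u) * v.
Proof.
elim/algquot_ind: u => x; elim/algquot_ind: v => y.
by rewrite -aq_clM -!aq_clZ scalerAl aq_clM.
Qed.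
Fact aq_scalerAr a (u v : algquot) : a *: (u * v) = u * (a *: v).
Proof.
elim/algquot_ind: u => x; elim/algquot_ind: v => y.
by rewrite -aq_clM -!aq_clZ scalerAr aq_clM.
Qed.

End AlgebraQuotient.

Section EnvelopingRelations.
Variables (K : fieldType) (g : lieAlgType K) (F : algType K) (gen : g -> F).

Inductive env_rel : set F :=
| env_rel_lin a x y : env_rel (gen (a *: x + y) - (a *: gen x + gen y))
| env_rel_lie x y : env_rel (gen (lie x y) - (gen x * gen y - gen y * gen x)).

Lemma env_rel_kill (A : algType K) (phi : {lrmorphism F -> A}) :
    linear (phi \o gen) ->
    (forall x y, phi (gen (lie x y)) =
       phi (gen x) * phi (gen y) - phi (gen y) * phi (gen x)) ->
  forall z, submod_gen (ideal_mults env_rel) z -> phi z = 0.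
Proof.
move=> lin_phi lie_phi z.
elim=> [_ [a [r [b [rr ->]]]]||x y _ x0 _ y0|k x _ x0].
- rewrite !rmorphM /=; suff -> : phi r = 0 by rewrite mulr0 mul0r.
  case: rr => [c x y|x y].
    by rewrite linearB linearP /= [phi (gen _)]lin_phi subrr.
  rewrite (_ : phi _ = phi (gen (lie x y)) -
      (phi (gen x) * phi (gen y) - phi (gen y) * phi (gen x))).
    by rewrite lie_phi subrr.
  by rewrite !rmorphB !rmorphM.
- by rewrite linear0.
- by rewrite linearD /= x0 y0 addr0.
- by rewrite linearZ /= x0 scaler0.
Qed.

End EnvelopingRelations.

Section Enveloping.
Variables (K : fieldType) (g : lieAlgType K).

(* The free associative algebra on the set g; the relations env_rel_lin
   turn it into the tensor algebra of the vector space g. *)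
Definition free_alg : Type := {malg K[{fmonom g}]}.
HB.instance Definition _ := GRing.Lalgebra.on free_alg.

Fact free_alg_scalerAr a (x y : free_alg) : a *: (x * y) = x * (a *: y).
Proof.
have malgC_comm (z : {malg K[{fmonom g}]}) : a%:MP * z = z * a%:MP.
  rewrite !malgM_def fgmulUg fgmulgU; apply: eq_bigr => m _.
  by rewrite mulrC mul1m mulm1.
have scaleE (z : free_alg) : a *: z = (a%:MP : free_alg) * z.
  exact/esym/mul_malgC.
by rewrite !scaleE mulrA [_ * x]malgC_comm mulrA.
Qed.
HB.instance Definition _ :=
  GRing.Lalgebra_isAlgebra.Build K free_alg free_alg_scalerAr.

Definition letter (x : g) : free_alg := mkmalgU (fmu x) 1.

Section FreeLift.
Variables (A : algType K) (f : g -> A).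

Definition word_eval (m : {fmonom g}) : A := \prod_(x <- m) f x.

Fact word_eval_mult : mmorphism word_eval.
Proof.
by split=> [m n|]; rewrite /word_eval ?fm1 ?big_nil // fmM big_cat.
Qed.
HB.instance Definition _ := monalg.isMultiplicative.Build {fmonom g} A word_eval
  word_eval_mult.

Definition free_lift : free_alg -> A :=
  @mmap {fmonom g} K A (in_alg A) word_eval.

Fact free_lift_linear : linear free_lift.
Proof.
move=> a x y; rewrite /free_lift raddfD; congr (_ + _).
by rewrite [LHS]mmapZ /= mulr_algl.
Qed.
HB.instance Definition _ :=
  GRing.isLinear.Build K free_alg A *:%R free_lift free_lift_linear.

Fact free_lift_monoid : monoid_morphism free_lift.
Proof.
have [|fM f1] := @commr_mmap_is_multiplicative _ _ _ (in_alg A) word_eval.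
  by move=> x m m'; rewrite /GRing.comm /= mulr_algl mulr_algr.
by split.
Qed.
HB.instance Definition _ :=
  GRing.isMonoidMorphism.Build free_alg A free_lift free_lift_monoid.

Lemma free_lift_letter x : free_lift (letter x) = f x.
Proof. by rewrite /free_lift mmapU /= scale1r mul1r /word_eval fmU big_seq1. Qed.

End FreeLift.

Local Notation rel := (env_rel letter).
Local Notation I := (submod_gen (ideal_mults rel)).

Lemma free_lift_ideal (A : algType K) (f : {linear g -> A}) :
    (forall x y, f (lie x y) = f x * f y - f y * f x) ->
  forall z, I z -> free_lift f z = 0.
Proof.
move=> f_lie; apply: (@env_rel_kill _ _ _ _ A (free_lift f)) => [a x y|x y].
  by rewrite [LHS]free_lift_letter linearP; congr (_ *: _ + _); rewrite [RHS]free_lift_letter.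
move: (f_lie x y).
by rewrite -(free_lift_letter f (lie x y)) -(free_lift_letter f x) -(free_lift_letter f y).
Qed.

(* U(g), with emb the canonical map from g; its modules are the g-modules. *)
Definition env : Type := algquot rel.
HB.instance Definition _ := GRing.Lmodule.on env.
HB.instance Definition _ := GRing.PzRing.on env.

Definition envcl (x : free_alg) : env := modcl (ideal_mults rel) x.

Lemma envclP x y : envcl x = envcl y <-> I (x - y).
Proof. exact: modclP. Qed.
Lemma env_ind (P : env -> Prop) : (forall x, P (envcl x)) -> forall u, P u.
Proof. exact: modcl_ind. Qed.

(* The trivial representation shows that 1 survives in the quotient. *)
Fact env_1neq0 : 1 != 0 :> env.
Proof.
apply/eqP => /(envclP 1 0); rewrite subr0.
move=> /(@free_lift_ideal K^o (\0 : {linear g -> K^o})) /= h.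
have /eqP : free_lift (\0 : g -> K^o) 1 = 0.
  by apply: h => x y; rewrite mulr0 subr0.
by rewrite rmorph1 oner_eq0.
Qed.
HB.instance Definition _ := GRing.PzSemiRing_isNonZero.Build env env_1neq0.
HB.instance Definition _ :=
  GRing.Lmodule_isLalgebra.Build K env (@aq_scalerAl K free_alg rel).
HB.instance Definition _ :=
  GRing.Lalgebra_isAlgebra.Build K env (@aq_scalerAr K free_alg rel).

Fact envcl_linear : linear envcl.
Proof. exact: (linearP (@modcl K free_alg (ideal_mults rel))). Qed.
HB.instance Definition _ :=
  GRing.isLinear.Build K free_alg env *:%R envcl envcl_linear.
Fact envcl_monoid : monoid_morphism envcl.
Proof. by split; [reflexivity | exact: (@aq_clM K free_alg rel)]. Qed.
HB.instance Definition _ :=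
  GRing.isMonoidMorphism.Build free_alg env envcl envcl_monoid.

Lemma env_relP r : rel r -> envcl r = 0.
Proof.
move=> rr; rewrite -(linear0 envcl); apply/envclP; rewrite subr0.
by apply: submod_gen_in; exists 1, r, 1; rewrite mul1r mulr1.
Qed.

Definition emb (x : g) : env := envcl (letter x).

Fact emb_is_linear : linear emb.
Proof.
move=> a x y; rewrite /emb -linearP; apply/eqP; rewrite -subr_eq0 -linearB.
exact/eqP/env_relP/env_rel_lin.
Qed.
HB.instance Definition _ := GRing.isLinear.Build K g env *:%R emb emb_is_linear.

Lemma emb_lie x y : emb (lie x y) = emb x * emb y - emb y * emb x.
Proof.
rewrite /emb -!rmorphM -linearB; apply/eqP; rewrite -subr_eq0 -linearB.
exact/eqP/env_relP/env_rel_lie.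
Qed.

Section Lift.
Variables (A : algType K) (f : {linear g -> A}).
Hypothesis f_lie : forall x y, f (lie x y) = f x * f y - f y * f x.

Definition env_lift (u : env) : A :=
  free_lift f (repr (u : modquot (ideal_mults rel))).

Lemma env_liftE x : env_lift (envcl x) = free_lift f x.
Proof.
apply/eqP; rewrite -subr_eq0 -(linearB (free_lift f)); apply/eqP.
by apply: free_lift_ideal => //; exact: repr_modcl.
Qed.

Lemma env_lift_emb x : env_lift (emb x) = f x.
Proof. by rewrite env_liftE free_lift_letter. Qed.

Lemma env_lift_linear : linear env_lift.
Proof.
move=> a; elim/env_ind=> x; elim/env_ind=> y.
by rewrite -(linearP envcl) !env_liftE (linearP (free_lift f)).
Qed.

Lemma env_lift_monoid : monoid_morphism env_lift.
Proof.
split=> [|u v]; first by rewrite (env_liftE 1) rmorph1.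
elim/env_ind: u => x; elim/env_ind: v => y.
by rewrite -(rmorphM envcl) !env_liftE (rmorphM (free_lift f)).
Qed.

End Lift.
End Enveloping.

Section EnvelopingMap.
Variables (K : fieldType) (g g' : lieAlgType K) (phi : lieHom g g').

(* U(phi) : U(g) -> U(g'). *)
Definition env_map : env g -> env g' := env_lift (@emb K g' \o phi).

Fact env_map_lie x y : (@emb K g' \o phi) (lie x y) =
  (@emb K g' \o phi) x * (@emb K g' \o phi) y
  - (@emb K g' \o phi) y * (@emb K g' \o phi) x.
Proof. by rewrite /= lieHomP emb_lie. Qed.

Fact env_map_linear : linear env_map.
Proof. exact/env_lift_linear/env_map_lie. Qed.
HB.instance Definition _ :=
  GRing.isLinear.Build K (env g) (env g') *:%R env_map env_map_linear.
Fact env_map_monoid : monoid_morphism env_map.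
Proof. exact/env_lift_monoid/env_map_lie. Qed.
HB.instance Definition _ :=
  GRing.isMonoidMorphism.Build (env g) (env g') env_map env_map_monoid.

Lemma env_map_emb x : env_map (emb x) = emb (phi x).
Proof. by rewrite /env_map env_lift_emb //; exact: env_map_lie. Qed.

End EnvelopingMap.

Section DirectSumFold.
Variables (R : pzRingType) (I : choiceType) (V : I -> lmodType R).
Variables (W : lmodType R) (F : forall i, V i -> W).

Definition dsum_fold (x : dsum V) : W := \sum_(i <- dsupp x) F (x i).

Hypothesis F_lin : forall i, linear (@F i).

Let F0 i : F (0 : V i) = 0.
Proof.
by have := @F_lin i (-1) 0 0; rewrite !scaleN1r addNr => ->; rewrite addNr.
Qed.

Lemma dsum_foldw (s : seq I) (x : dsum V) :
  uniq s -> {subset dsupp x <= s} -> dsum_fold x = \sum_(i <- s) F (x i).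
Proof.
move=> us xs; rewrite [RHS](bigID (mem (dsupp x))) /= [X in _ = _ + X]big1 ?addr0.
  rewrite -[RHS]big_filter; apply: perm_big; apply: uniq_perm.
  - exact: dsupp_uniq.
  - exact: filter_uniq.
  by move=> i; rewrite mem_filter; case: (boolP (i \in dsupp x)) => // /xs.
by move=> i; rewrite mem_dsupp negbK => /eqP ->.
Qed.

Lemma dsum_fold_linear : linear dsum_fold.
Proof.
move=> a x y; set s := undup (dsupp x ++ dsupp y).
have us : uniq s := undup_uniq _.
have xs : {subset dsupp x <= s} by move=> i ix; rewrite mem_undup mem_cat ix.
have ys : {subset dsupp y <= s} by move=> i iy; rewrite mem_undup mem_cat iy orbT.
rewrite (dsum_foldw us xs) (dsum_foldw us ys) (@dsum_foldw s) //.
  rewrite scaler_sumr -big_split; apply: eq_bigr => i _.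
  by rewrite dsumDE dsumZE F_lin.
move=> i; rewrite mem_dsupp dsumDE dsumZE => xyi; apply: contraR xyi.
rewrite mem_undup mem_cat !mem_dsupp negb_or !negbK => /andP[/eqP -> /eqP ->].
by rewrite scaler0 addr0.
Qed.

Lemma dsum_fold_single i (x : V i) : dsum_fold (dsingle x) = F x.
Proof.
rewrite (@dsum_foldw [:: i]) ?big_seq1 ?dsingle_in // => j.
rewrite mem_dsupp inE; apply: contra_neqT => ji.
by rewrite dsingle_out // eq_sym.
Qed.

End DirectSumFold.

Lemma dsum_ind (R : pzRingType) (I : choiceType) (V : I -> lmodType R)
    (P : dsum V -> Prop) :
  P 0 -> (forall x y, P x -> P y -> P (x + y)) ->
  (forall i (x : V i), P (dsingle x)) -> forall x, P x.
Proof.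
by move=> P0 PD P1 x; rewrite (dsum_big x); apply: (big_ind P) => // i _; exact: P1.
Qed.

Section LoopAlgebra.
Variables (K : fieldType) (g : lieAlgType K).

(* g tensor K[t, 1/t]: the coefficient of an element at k : int is the
   coefficient of t^k, and tmono k x is x tensor t^k. *)
Definition loop : Type := dsum (fun _ : int => g : lmodType K).
HB.instance Definition _ := GRing.Lmodule.on loop.

Definition tmono (k : int) (x : g) : loop :=
  @dsingle K int (fun _ => g) k x.
Fact tmono_is_linear k : linear (tmono k).
Proof. exact: dsingle_is_linear. Qed.
HB.instance Definition _ k :=
  GRing.isLinear.Build K g loop *:%R (tmono k) (tmono_is_linear k).

Lemma loop_ind (P : loop -> Prop) :
  P 0 -> (forall x y, P x -> P y -> P (x + y)) ->
  (forall k x, P (tmono k x)) -> forall x, P x.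
Proof. exact: dsum_ind. Qed.

Definition loop_lie (x y : loop) : loop :=
  dsum_fold (fun k (u : g) => dsum_fold (fun l (v : g) => tmono (k + l) (lie u v)) y) x.

Fact loop_lie_inner k (u : g) :
  linear (dsum_fold (fun l (v : g) => tmono (k + l) (lie u v)) : loop -> loop).
Proof. by apply: dsum_fold_linear => l a v w; rewrite !linearP. Qed.

Fact loop_lie_outer (y : loop) k :
  linear (fun u : g => dsum_fold (fun l (v : g) => tmono (k + l) (lie u v)) y : loop).
Proof.
move=> a u v; rewrite /dsum_fold scaler_sumr -big_split; apply: eq_bigr => l _.
by rewrite lieDl lieZl linearP.
Qed.

Fact loop_linearl y : linear (loop_lie^~ y).
Proof. by apply: dsum_fold_linear => k; exact: loop_lie_outer. Qed.

Fact loop_linearr x : linear (loop_lie x).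
Proof.
move=> a y z; rewrite /loop_lie /dsum_fold scaler_sumr -big_split.
by apply: eq_bigr => k _; exact: loop_lie_inner.
Qed.

Lemma loop_lie_mono k l u v :
  loop_lie (tmono k u) (tmono l v) = tmono (k + l) (lie u v).
Proof.
rewrite /loop_lie /tmono dsum_fold_single; last by move=> i; exact: loop_lie_outer.
by rewrite dsum_fold_single // => i a w w'; rewrite -/(tmono _ _) !linearP.
Qed.

Let lieD x x' y : loop_lie (x + x') y = loop_lie x y + loop_lie x' y.
Proof. by have := loop_linearl y 1 x x'; rewrite !scale1r. Qed.
Let lieDr x y y' : loop_lie x (y + y') = loop_lie x y + loop_lie x y'.
Proof. by have := loop_linearr x 1 y y'; rewrite !scale1r. Qed.
Let lie0 y : loop_lie 0 y = 0.
Proof. by apply: (addIr (loop_lie 0 y)); rewrite -lieD !add0r. Qed.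
Let lie0r x : loop_lie x 0 = 0.
Proof. by apply: (addIr (loop_lie x 0)); rewrite -lieDr !add0r. Qed.

Fact loop_lieC x y : loop_lie x y = - loop_lie y x.
Proof.
elim/loop_ind: x => [|x x' Px Px'|k u]; first by rewrite lie0 lie0r oppr0.
  by rewrite lieD lieDr Px Px' opprD.
elim/loop_ind: y => [|y y' Py Py'|l v]; first by rewrite lie0 lie0r oppr0.
  by rewrite lieD lieDr Py Py' opprD.
by rewrite !loop_lie_mono lieC linearN addrC.
Qed.

Fact loop_xx x : loop_lie x x = 0.
Proof.
elim/loop_ind: x => [|x y Px Py|k u]; first exact: lie0.
  by rewrite lieD !lieDr Px Py [loop_lie x y]loop_lieC add0r addr0 addNr.
by rewrite loop_lie_mono liexx linear0.
Qed.

Fact loop_jacobi x y z : loop_lie x (loop_lie y z) + loop_lie y (loop_lie z x)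
  + loop_lie z (loop_lie x y) = 0.
Proof.
have addJ (a b c a' b' c' : loop) : a + b + c = 0 -> a' + b' + c' = 0 ->
    (a + a') + (b + b') + (c + c') = 0.
  by move=> h h'; rewrite (addrACA a) (addrACA (a + b)) h h' addr0.
elim/loop_ind: x => [|x x' Px Px'|k u]; first by rewrite !(lie0, lie0r) !addr0.
  by rewrite !(lieD, lieDr); exact: addJ.
elim/loop_ind: y => [|y y' Py Py'|l v]; first by rewrite !(lie0, lie0r) !addr0.
  by rewrite !(lieD, lieDr); exact: addJ.
elim/loop_ind: z => [|z z' Pz Pz'|n w]; first by rewrite !(lie0, lie0r) !addr0.
  by rewrite !(lieD, lieDr); exact: addJ.
rewrite !loop_lie_mono.
have -> : l + (n + k) = k + (l + n) by rewrite addrA addrC.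
have -> : n + (k + l) = k + (l + n) by rewrite addrC addrA.
by rewrite -!linearD lie_jacobi linear0.
Qed.

HB.instance Definition _ := Lmodule_isLie.Build K loop
  loop_linearl loop_linearr loop_xx loop_jacobi.

Lemma lie_tmono k l u v : lie (tmono k u) (tmono l v) = tmono (k + l) (lie u v).
Proof. exact: loop_lie_mono. Qed.

End LoopAlgebra.

Section LoopTwist.
Variables (K : fieldType) (g : lieAlgType K) (sigma : lieHom g g) (zeta : K).
Hypothesis zeta_neq0 : zeta != 0.

(* x tensor t^k |-> sigma(x) tensor zeta^k t^k *)
Definition loop_twist_fun (x : loop g) : loop g :=
  dsum_fold (fun k (u : g) => tmono k (zeta ^ k *: sigma u)) x.

Fact loop_twist_inner k : linear (fun u : g => tmono k (zeta ^ k *: sigma u)).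
Proof. by move=> a u v; rewrite linearP scalerDr !scalerA mulrC -scalerA linearP. Qed.

Fact loop_twist_linear : linear loop_twist_fun.
Proof. exact/dsum_fold_linear/loop_twist_inner. Qed.
HB.instance Definition _ := GRing.isLinear.Build K (loop g) (loop g) *:%R
  loop_twist_fun loop_twist_linear.

Lemma loop_twist_mono k u :
  loop_twist_fun (tmono k u) = tmono k (zeta ^ k *: sigma u).
Proof. by rewrite /loop_twist_fun dsum_fold_single //; exact: loop_twist_inner. Qed.

Fact loop_twist_lie : {morph loop_twist_fun : x y / lie x y}.
Proof.
have twD x y : loop_twist_fun (x + y) = loop_twist_fun x + loop_twist_fun y.
  exact: (linearD loop_twist_fun).
have tw0 : loop_twist_fun 0 = 0 by exact: (linear0 loop_twist_fun).
elim/loop_ind=> [y|x x' Px Px' y|k u y]; first by rewrite lie0l tw0 lie0l.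
  by rewrite lieDl !twD lieDl Px Px'.
elim/loop_ind: y => [|y y' Py Py'|l v]; first by rewrite lie0r tw0 lie0r.
  by rewrite lieDr !twD lieDr Py Py'.
rewrite lie_tmono !loop_twist_mono lie_tmono lieHomP lieZl lieZr scalerA.
by rewrite expfzDr.
Qed.

Definition loop_twist : lieHom (loop g) (loop g) := LieHom loop_twist_lie.

Fact const_loop_subproof (x : fixlie sigma) :
  loop_twist (tmono 0 (val x)) == tmono 0 (val x).
Proof. by rewrite /= loop_twist_mono expr0z scale1r (eqP (valP x)). Qed.
(* The inclusion x |-> x tensor 1 of g_0 into the twisted loop algebra. *)
Definition const_loop_fun (x : fixlie sigma) : fixlie loop_twist :=
  FixLie (const_loop_subproof x).
Fact const_loop_linear : linear const_loop_fun.
Proof. by move=> a x y; apply: val_inj; rewrite /= linearP. Qed.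
HB.instance Definition _ := GRing.isLinear.Build K (fixlie sigma)
  (fixlie loop_twist) *:%R const_loop_fun const_loop_linear.
Fact const_loop_lie : {morph const_loop_fun : x y / lie x y}.
Proof. by move=> x y; apply: val_inj; rewrite /= lie_tmono addr0. Qed.
Definition const_loop : lieHom (fixlie sigma) (fixlie loop_twist) :=
  LieHom const_loop_lie.

End LoopTwist.

Section Restriction.
Variables R S : pzRingType.

(* Restriction of scalars along phi. *)
Definition resmod (phi : {rmorphism R -> S}) (M : lmodType S) : Type := M.

Variables (phi : {rmorphism R -> S}) (M : lmodType S).
HB.instance Definition _ := GRing.Zmodule.on (resmod phi M).

Definition res_scale (r : R) (x : resmod phi M) : resmod phi M := phi r *: (x : M).
Fact res_scaleA a b x : res_scale a (res_scale b x) = res_scale (a * b) x.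
Proof. by rewrite /res_scale scalerA rmorphM. Qed.
Fact res_scale1 : left_id 1 res_scale.
Proof. by move=> x; rewrite /res_scale rmorph1 scale1r. Qed.
Fact res_scaleDr : right_distributive res_scale +%R.
Proof. by move=> a x y; exact: (@scalerDr S M). Qed.
Fact res_scaleDl x : {morph res_scale^~ x : a b / a + b}.
Proof. by move=> a b; rewrite /res_scale rmorphD; exact: (@scalerDl S M). Qed.
HB.instance Definition _ := GRing.Zmodule_isLmodule.Build R (resmod phi M)
  res_scaleA res_scale1 res_scaleDr res_scaleDl.

End Restriction.

Section ExtensionOfScalars.
Variables (R0 R : pzRingType) (phi : {rmorphism R0 -> R}) (V : lmodType R0).

Local Notation free := (dsum (fun _ : V => R^o : lmodType R)).
Local Notation pure r v := (@dsingle R V (fun _ => R^o) v r).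

(* R tensor_(R0) V: in the free R-module on the set V, the element with
   coefficient r at v stands for the pure tensor of r and v; additivity in r
   is built in. *)
Inductive tensor_rel : set free :=
| tensor_add r v w : tensor_rel (pure r (v + w) - (pure r v + pure r w))
| tensor_bal r r0 v : tensor_rel (pure (r * phi r0) v - pure r (r0 *: v)).

Definition extmod : Type := modquot tensor_rel.
HB.instance Definition _ := GRing.Lmodule.on extmod.

Definition tens (r : R) (v : V) : extmod := modcl tensor_rel (pure r v).

End ExtensionOfScalars.

Lemma prim_root_neq0 (K : fieldType) n (z : K) : n.-primitive_root z -> z != 0.
Proof.
move=> hz; apply: contraTneq (prim_order_gt0 hz) => z0.
by have := prim_expr_order hz; rewrite z0 expr0n; case: n {hz} => //= n /esym/eqP; rewrite oner_eq0.
Qed.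

(* Z_+-span of the F i, i in J. *)
Definition nspan (V : nmodType) (I : finType) (J : {set I}) (F : I -> V) : set V :=
  [set v | exists c : I -> nat, v = \sum_(i in J) F i *+ c i].

Definition lie_simple (K : fieldType) (g : fdLieAlgType K) : Prop :=
  (exists x y : g, lie x y <> 0) /\
  forall J : {vspace g}, (forall x y, y \in J -> lie x y \in J) ->
    J = 0%VS \/ J = fullv.

Section CartanSubalgebra.
Variables (K : fieldType) (g : fdLieAlgType K) (h : {vspace g}).

(* Nilpotency of h: all long enough iterated brackets of elements vanish. *)
Record cartan_subalgebra : Prop := {
  cartan_closed : forall x y, x \in h -> y \in h -> lie x y \in h;
  cartan_nilpotent : exists n, forall (s : seq g) (y : g),
    size s = n -> {subset s <= h} -> y \in h -> foldr lie y s = 0;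
  cartan_normalizer : forall x, (forall y, y \in h -> lie x y \in h) -> x \in h
}.

Definition dual : Type := 'Hom(subvs_of h, K^o).
HB.instance Definition _ := Vector.on dual.

(* The value of mu at x, meant for x in h (vsproj h is the identity there). *)
Definition ev (mu : dual) (x : g) : K := (mu : 'Hom(_, _)) (vsproj h x).

Definition root_space (a : dual) : set g :=
  [set x | forall y, y \in h -> lie y x = ev a y *: x].

Definition is_root (a : dual) : Prop :=
  a <> 0 /\ exists2 x, root_space a x & x <> 0.

End CartanSubalgebra.

Section Dual.
Variables (K : fieldType) (g : fdLieAlgType K) (h h0 : {vspace g}).

Lemma evD (mu nu : dual h) x : ev (mu + nu) x = ev mu x + ev nu x.
Proof. by rewrite /ev [LHS](add_lfunE (mu : 'Hom(_, _)) (nu : 'Hom(_, _))). Qed.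
Lemma ev0 x : ev (0 : dual h) x = 0.
Proof. exact: (@zero_lfunE K (subvs_of h) K^o). Qed.
Lemma ev_sum J (r : seq J) (F : J -> dual h) x :
  ev (\sum_(j <- r) F j) x = \sum_(j <- r) ev (F j) x.
Proof.
apply: (big_ind2 (fun mu k => ev mu x = k)) => //; first exact: ev0.
by move=> mu k nu l <- <-; exact: evD.
Qed.
Lemma evMn (mu : dual h) n x : ev (mu *+ n) x = ev mu x *+ n.
Proof. by elim: n => [|n IHn]; rewrite ?mulr0n ?ev0// !mulrS evD IHn. Qed.
Lemma ev_linear (mu : dual h) : linear (ev mu : g -> K^o).
Proof. by move=> a x y; rewrite /ev !linearP. Qed.

Lemma ev_sumr (mu : dual h) J (r : seq J) (F : J -> g) :
  ev mu (\sum_(j <- r) F j) = \sum_(j <- r) ev mu (F j).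
Proof.
apply: (big_ind2 (fun x k => ev mu x = k)) => // [|x k y l <- <-].
  by rewrite /ev !linear0.
by rewrite /ev !linearD.
Qed.

Definition restrict (mu : dual h) : dual h0 :=
  linfun (fun x : subvs_of h0 => ev mu (vsval x) : K^o).

Lemma restrictE mu x : x \in h0 -> ev (restrict mu) x = ev mu x.
Proof.
have lin : linear (fun x : subvs_of h0 => ev mu (vsval x) : K^o).
  by move=> a u v; rewrite !linearP ev_linear.
pose F := GRing.isLinear.Build _ _ _ _ _ lin.
pose L : {linear subvs_of h0 -> K^o} := HB.pack (fun x : subvs_of h0 => ev mu (vsval x) : K^o) F.
by move=> xh; rewrite {1}/ev /restrict [LHS](lfunE L) /= vsprojK.
Qed.
End Dual.

(* sroot is a base of the root system of (g, cartan); this fixes the triangular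
   decomposition, with nplus below the sum of the positive root spaces. *)
Record chevalley (K : fieldType) (g : fdLieAlgType K) := Chevalley {
  cartan : {vspace g};
  cartanP : cartan_subalgebra cartan;
  node : finType;
  sroot : node -> dual cartan;
  sroot_root : forall i, is_root (sroot i);
  sroot_free : free [seq sroot i | i : node];
  sroot_base : forall b, is_root b ->
    nspan [set: node]%SET sroot b \/ nspan [set: node]%SET sroot (- b);
  Xplus : node -> g;
  Xminus : node -> g;
  coroot : node -> g;
  XplusP : forall i, root_space (sroot i) (Xplus i);
  XminusP : forall i, root_space (- sroot i) (Xminus i);
  corootP : forall i, coroot i \in cartan;
  Xplus_Xminus : forall i, lie (Xplus i) (Xminus i) = coroot i;
  sroot_coroot : forall i, ev (sroot i) (coroot i) = 2%:R;
  fweight : node -> dual cartan;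
  fweightP : forall i j, ev (fweight i) (coroot j) = (i == j)%:R
}.

Arguments sroot {K g} c _.
Arguments fweight {K g} c _.
Arguments Xplus {K g} c _.
Arguments Xminus {K g} c _.
Arguments coroot {K g} c _.

Section Chevalley.
Variables (K : fieldType) (g : fdLieAlgType K) (c : chevalley g).

Definition dominant : set (dual (cartan c)) := nspan [set: node c]%SET (fweight c).

Definition nplus : set g :=
  [set x | exists s : seq g, x \in <<s>>%VS /\
     forall y, y \in s -> exists b : dual (cartan c),
       [/\ is_root b, nspan [set: node c]%SET (sroot c) b & root_space b y]].

Record diagram_aut (m : nat) := DiagramAut {
  node_perm : {perm node c};
  node_perm_order : #[node_perm]%g = m;
  node_perm_cartan : forall i j,
    ev (sroot c (node_perm j)) (coroot c (node_perm i)) = ev (sroot c j) (coroot c i);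
  daut :> lieHom g g;
  daut_bij : bijective daut;
  daut_Xplus : forall i, daut (Xplus c i) = Xplus c (node_perm i);
  daut_Xminus : forall i, daut (Xminus c i) = Xminus c (node_perm i);
  daut_coroot : forall i, daut (coroot c i) = coroot c (node_perm i)
}.

(* Untwisted global Weyl module: U(L(g)) modulo the left ideal generated by
   the annihilators of the generator. *)
Section Weyl.
Variable mu : dual (cartan c).
Local Notation U := (env (loop g)).

Inductive weyl_rel : set U^o :=
| weyl_nplus (x : loop g) : (forall k, nplus (x k)) -> weyl_rel (emb x)
| weyl_cartan x : x \in cartan c -> weyl_rel (emb (tmono 0 x) - (ev mu x)%:A)
| weyl_lower i n : ev mu (coroot c i) = n%:R ->
    weyl_rel (emb (tmono 0 (Xminus c i)) ^+ n.+1).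

Definition weyl : Type := modquot weyl_rel.
HB.instance Definition _ := GRing.Lmodule.on weyl.
Definition weyl_gen : weyl := modcl weyl_rel 1.
End Weyl.

Section Twisted.
Variables (m : nat) (sigma : diagram_aut m).
Variables (zeta : K) (zeta_prim : m.-primitive_root zeta).
Let zeta_neq0 : zeta != 0 := prim_root_neq0 zeta_prim.

Definition g0 : lieAlgType K := fixlie sigma.
Definition Lgamma : lieAlgType K := fixlie (loop_twist sigma zeta_neq0).

Definition h0 : {vspace g} := (cartan c :&: fixedSpace (linfun sigma))%VS.

Variable I0 : {set node c}.

Definition Q0plus : set (dual h0) := nspan I0 (fun i => restrict h0 (sroot c i)).
Definition P0plus : set (dual h0) := nspan I0 (fun i => restrict h0 (fweight c i)).

Section HighestWeight.
Variables (lambda : dual h0) (V : lmodType (env g0)) (v : V).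

(* V is a simple finite-dimensional g_0-module of highest weight lambda, with
   highest weight vector v. *)
Record simple_fd_hw : Prop := {
  fd_module : exists (n : nat) (e : 'I_n -> V),
    forall x, exists a : 'I_n -> K, x = \sum_i (a i)%:A *: e i;
  simple_module : forall N : set V, N 0 ->
    (forall x y, N x -> N y -> N (x + y)) -> (forall u x, N x -> N (u *: x)) ->
    N = [set 0] \/ N = setT;
  hw_neq0 : v <> 0;
  hw_nplus : forall x : g0, nplus (val x) -> emb x *: v = 0;
  hw_cartan : forall x : g0, val x \in cartan c ->
    emb x *: v = (ev lambda (val x))%:A *: v
}.

(* P^Gamma(V) *)
Definition projmod : lmodType (env Lgamma) :=
  extmod (env_map (const_loop sigma zeta_neq0)) V.

Definition weight_space (M : lmodType (env Lgamma)) (mu : dual h0) : set M :=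
  [set p | forall x : g0, val x \in h0 ->
     emb (const_loop sigma zeta_neq0 x) *: p = (ev mu (val x))%:A *: p].

Definition high_weights : set projmod :=
  [set p | exists mu, ~ Q0plus (lambda - mu) /\ weight_space mu p].

(* W^Gamma(lambda), for V = V(lambda) with highest weight vector v *)
Definition tweyl : lmodType (env Lgamma) := modquot high_weights.
Definition tweyl_gen : tweyl := modcl high_weights (tens _ 1 v).

Definition fiber : set (dual (cartan c)) :=
  [set mu | dominant mu /\ restrict h0 mu = lambda].

(* The sum of the coroots is fixed by sigma, and on it mu takes the value
   given by the sum of the coordinates of mu. *)
Lemma fiber_finite : [pchar K] =i pred0 -> finite_set fiber.
Proof.
move=> /pcharf0P charK.
pose H := \sum_i coroot c i.
have Hh : H \in cartan c by apply: memv_suml => i _; exact: corootP.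
have Hh0 : H \in h0.
  rewrite memv_cap Hh; apply/fixedSpaceP; rewrite lfunE /= linear_sum /=.
  rewrite [RHS](reindex_inj (@perm_inj _ (node_perm sigma))).
  by apply: eq_bigr => i _; exact: daut_coroot.
have evH a : ev (\sum_(i in [set: node c]%SET) fweight c i *+ a i) H
    = (\sum_i a i)%:R.
  rewrite [X in ev X _](eq_bigl xpredT); last by move=> i; rewrite finset.in_setT.
  rewrite ev_sum natr_sum; apply: eq_bigr => i _.
  rewrite evMn /H ev_sumr (bigD1 i) //= fweightP eqxx big1 ?addr0 // => j ji.
  by rewrite fweightP eq_sym (negbTE ji).
have [->|/set0P[mu0 [[a0 ->] rmu0]]] := eqVneq fiber set0; first exact: finite_set0.
pose N := \sum_i a0 i.
apply: (@sub_finite_set _ _ ((fun a : {ffun node c -> 'I_N.+1} =>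
  \sum_(i in [set: node c]%SET) fweight c i *+ a i) @` setT)); last first.
  exact/finite_image/finite_finset.
move=> _ [[a ->] ra].
have natK_inj k l : k%:R = l%:R :> K -> k = l.
  wlog kl : k l / (k <= l)%N => [hw|e].
    by case/orP: (leq_total k l) => kl; [exact: hw | move/esym/hw => ->].
  apply/eqP; rewrite eqn_leq kl -subn_eq0 -charK natrB // e.
  by rewrite subrr eqxx.
have aN : (\sum_i a i)%N = N.
  by apply: natK_inj; rewrite -!evH -(restrictE _ Hh0) ra -rmu0 restrictE.
have ltaN i : (a i < N.+1)%N by rewrite ltnS -aN (bigD1 i) //= leq_addr.
exists [ffun i => Ordinal (ltaN i)] => //.
by apply: eq_bigr => i _; rewrite ffunE.
Qed.



Definition res_weyl (mu : dual (cartan c)) : lmodType (env Lgamma) :=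
  resmod (env_map (fixincl (loop_twist sigma zeta_neq0))) (weyl mu).

Definition weyl_sum : lmodType (env Lgamma) :=
  dsum (fun mu : fiber => res_weyl (val mu)).

(* A finite sum, by fiber_finite. *)
Definition weyl_sum_gen : weyl_sum :=
  \sum_(mu \in [set: fiber])
    @dsingle _ fiber (fun mu => res_weyl (val mu)) mu (weyl_gen (val mu)).

End HighestWeight.
End Twisted.
End Chevalley.

(* Main.v *)
Require Import Defs.
From HB Require Import structures.
From mathcomp Require Import all_boot all_order all_algebra all_fingroup.
From mathcomp Require Import complex ring zify.
From mathcomp Require Import boolp classical_sets functions cardinality fsbigop reals.
From mathcomp Require Import finmap monalg.

(* The map exists by the universal property of W = W^Gamma(lambda), proved with
   the Casimir operator of g_0: all that is needed of the target vector w is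
   that L^Gamma(n^+) kills it, that it has weight lambda, and that the f_O, the
   sums of the X_i^- over the sigma-orbits O, act nilpotently on it.

   For injectivity, let u w_lambda be nonzero in W and suppose that u kills all
   w_mu. It is enough to map W to an L(g)-module N, linearly over L^Gamma(g),
   so that u w_lambda stays nonzero and the image of w_lambda satisfies
   L(n^+) w = 0 and (X_i^-)^k w = 0 for large k: then w is a sum of h-weight
   vectors satisfying the relations of the w_mu, so u w = 0, a contradiction.
   By the universal property the elements of U(L^Gamma(h)) act on W by
   commuting endomorphisms; let S be the ring of these. The relations
   (e_O t^m)^n f_O^(n+1) w_lambda = 0 and their analogues for t^-m give a
   polynomial q in S[t^m], monic with constant term 1, such that the projections
   of x t^k q(t) to L^Gamma(g) kill W. After adjoining the roots of q to S and
   localizing S without killing u w_lambda, the roots of q can be multiplied by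
   m-th roots of unity so that a - zeta^k b is invertible for any two of them
   and 0 < k < m. Hence, modulo the polynomials acting by zero, S[t] contains
   an idempotent e whose m translates under t -> zeta t are orthogonal with
   sum 1, and x t^k -> m x t^k e(t) extends the action of L^Gamma(g) to L(g). *)

Set Implicit Arguments.
Unset Strict Implicit.
Unset Printing Implicit Defensive.

Import Order.TTheory GRing.Theory Num.Theory.

Local Open Scope ring_scope.

(** * Linear algebra *)

(** Geometrically, [W] lives over the zeros of [q] on the punctured [t]-line, and the twisted
    algebra sees this line only up to [t -> zeta t]. To act with all of [L(g)] one has to choose,
    over the support, one of the [m] preimages under [t -> t^m]; the idempotent [e] is the
    characteristic function of the chosen sheet. Such a choice exists only locally. This is why a
    single vector [u w_lambda] is fixed beforehand: the map to [N] may have a kernel, as long as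
    that vector survives, so it is allowed to invert every scalar no power of which kills the
    current nonzero multiple of the vector. The constant term 1 of [q] keeps the roots away from 0,
    where the [m] sheets would meet. Nilpotency has to be carried in both directions between the
    orbit sums [f_O] and the single [X_i^-]. From [X_i^-] to [f_O] it rests on the fact that the
    nodes of an orbit form copies of [A_1] or of [A_2]; from [f_O] back to [X_i^-] it is a
    reflection argument for the sl2 triple of the orbit. *)

Section ModuleReflection.
Variables (K : pzRingType) (M : lmodType K).

Inductive mterm :=
  | MVar of nat | MZero | MAdd of mterm & mterm | MOpp of mterm
  | MScale of K & mterm | MNat of nat & mterm.

Fixpoint meval (env : seq M) t : M :=
  match t with
  | MVar n => nth 0 env n | MZero => 0
  | MAdd t u => meval env t + meval env u | MOpp t => - meval env t
  | MScale a t => a *: meval env t | MNat n t => meval env t *+ n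
  end.

Fixpoint mcoef t (i : nat) : K :=
  match t with
  | MVar n => if n == i then 1 else 0 | MZero => 0
  | MAdd t u => mcoef t i + mcoef u i | MOpp t => - mcoef t i
  | MScale a t => a * mcoef t i | MNat n t => n%:R * mcoef t i
  end.

(** A conjunction that unfolds by computation, so that [repeat split] leaves one scalar identity for
    each atom. *)
Fixpoint all_below (n : nat) (P : nat -> Prop) : Prop :=
  if n is n'.+1 then P n' /\ all_below n' P else True.

Lemma mevalE env t : meval env t = \sum_(i < size env) mcoef t i *: nth 0 env i.
Proof.
elim: t => [n||t IHt u IHu|t IHt|a t IHt|n t IHt] /=; rewrite ?IHt ?IHu.
- have [lt_n|ge_n] := ltnP n (size env).
    rewrite (bigD1 (Ordinal lt_n)) //= eqxx scale1r big1 ?addr0 // => i /eqP ni.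
    by rewrite ifN ?scale0r //; apply/eqP => e; apply: ni; apply: val_inj.
  rewrite nth_default // big1 // => i _; rewrite ifN ?scale0r //.
  by apply: contraTneq (ltn_ord i) => <-; rewrite -leqNgt.
- by rewrite big1 // => i _; rewrite scale0r.
- by rewrite -big_split; apply: eq_bigr => i _; rewrite scalerDl.
- by rewrite -sumrN; apply: eq_bigr => i _; rewrite scaleNr.
- by rewrite scaler_sumr; apply: eq_bigr => i _; rewrite scalerA.
- by rewrite -sumrMnl; apply: eq_bigr => i _; rewrite mulr_natl scalerMnl.
Qed.

Lemma meval_eq env t u :
  all_below (size env) (fun i => mcoef t i = mcoef u i) -> meval env t = meval env u.
Proof.
rewrite !mevalE => tu; apply: eq_bigr => i _; congr (_ *: _).
elim: (size env) (nat_of_ord i) (ltn_ord i) tu => // n IHn j.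
by rewrite ltnS leq_eqVlt => /orP[/eqP -> [] //|/IHn + [_]].
Qed.

End ModuleReflection.

(** Atoms are compared up to conversion, since equal vectors are often displayed through different
    module structures. *)
Ltac lm_pos x l :=
  lazymatch l with
  | cons ?y ?l' => match constr:(Set) with
      | _ => let _ := match constr:(Set) with _ => first [constr_eq x y | unify x y] end in constr:(0%N)
      | _ => let n := lm_pos x l' in constr:(S n) end
  end.
Ltac lm_add x l :=
  match constr:(Set) with
  | _ => let _ := lm_pos x l in l
  | _ => constr:(cons x l)
  end.
Ltac lm_atoms t l :=
  lazymatch t with
  | (?a + ?b)%R => let l := lm_atoms a l in lm_atoms b l
  | (- ?a)%R => lm_atoms a l
  | (_ *: ?a)%R => lm_atoms a l
  | (?a *+ _)%R => lm_atoms a l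
  | 0%R => l
  | _ => lm_add t l
  end.
Ltac lm_reify K t l :=
  lazymatch t with
  | (?a + ?b)%R => let a := lm_reify K a l in let b := lm_reify K b l in constr:(@MAdd K a b)
  | (- ?a)%R => let a := lm_reify K a l in constr:(@MOpp K a)
  | (?k *: ?a)%R => let a := lm_reify K a l in constr:(@MScale K k a)
  | (?a *+ ?n)%R => let a := lm_reify K a l in constr:(@MNat K n a)
  | 0%R => constr:(@MZero K)
  | _ => let n := lm_pos t l in constr:(@MVar K n)
  end.
(* Reduces an equation between linear combinations to the equality of the
   coefficients of each atom. *)
Ltac lmod_pre K M :=
  lazymatch goal with
  | |- ?x = ?y =>
    let l := lm_atoms x (@nil M) in let l := lm_atoms y l in
    let tx := lm_reify K x l in let ty := lm_reify K y l in
    apply: (@meval_eq K M l tx ty); rewrite /all_below /=; repeat split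
  end.
Ltac lmod K M := lmod_pre K M; try ring.

Notation linE T := (linearD T, linearB T, linearN T, linearZ_LR T, linear0 T).

Definition mklin (K : pzRingType) (M N : lmodType K) (f : M -> N) (lf : linear f) :
  {linear M -> N} := HB.pack f (GRing.isLinear.Build K M N *:%R f lf).

Lemma linDE (K : pzRingType) (M N : lmodType K) (f : M -> N) : linear f ->
  {morph f : x y / x + y}.
Proof. by move=> lf x y; rewrite -[f]/(mklin lf : M -> N) linearD. Qed.

(** * Polynomials acting through an operator *)

Section PolynomialAction.
Variables (S : comNzRingType) (M : zmodType) (sa : S -> M -> M) (X : M -> M).
Hypotheses (saDl : forall s t m, sa (s + t) m = sa s m + sa t m)
  (saDr : forall s m m', sa s (m + m') = sa s m + sa s m')
  (saM : forall s t m, sa (s * t) m = sa s (sa t m))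
  (XD : forall m m', X (m + m') = X m + X m')
  (Xsa : forall s m, X (sa s m) = sa s (X m)).

Implicit Types (q r : {poly S}) (m : M).

(** [M] is only a group and [S] acts through a bare function: the same construction serves for the
    scalars of a field, for functions on [int] with the shift as [X], for companion matrices and for
    germs. *)
Definition pact (q : {poly S}) (m : M) := \sum_(i < size q) sa q`_i (iter i X m).

Let sa0l m : sa 0 m = 0.
Proof. by apply: (addIr (sa 0 m)); rewrite -saDl !add0r. Qed.
Let sa0r s : sa s 0 = 0.
Proof. by apply: (addIr (sa s 0)); rewrite -saDr !add0r. Qed.
Let X0 : X 0 = 0.
Proof. by apply: (addIr (X 0)); rewrite -XD !add0r. Qed.
Let iterXD i m m' : iter i X (m + m') = iter i X m + iter i X m'.
Proof. by elim: i => //= i ->. Qed.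

Lemma pact_widen n q m : (size q <= n)%N -> pact q m = \sum_(i < n) sa q`_i (iter i X m).
Proof.
move=> le_n; rewrite /pact (big_ord_widen n (fun i => sa q`_i (iter i X m))) // big_mkcond.
by apply: eq_bigr => i _; case: ltnP => // le_i; rewrite nth_default.
Qed.

Lemma pactDl q r m : pact (q + r) m = pact q m + pact r m.
Proof.
set n := maxn (size q) (size r).
rewrite !(@pact_widen n) ?leq_maxl ?leq_maxr ?size_polyD // -big_split.
by apply: eq_bigr => i _; rewrite coefD saDl.
Qed.

Lemma pactDr q m m' : pact q (m + m') = pact q m + pact q m'.
Proof. by rewrite -big_split; apply: eq_bigr => i _; rewrite iterXD saDr. Qed.

Lemma pactC s m : pact s%:P m = sa s m.
Proof. by rewrite (@pact_widen 1) ?size_polyC ?leq_b1 // big_ord1 coefC. Qed.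

Lemma pactZ s q m : pact (s *: q) m = sa s (pact q m).
Proof.
rewrite (@pact_widen (size q)) ?size_scale_leq // (big_morph _ (saDr s) (sa0r s)).
by apply: eq_bigr => i _; rewrite coefZ saM.
Qed.

Lemma pactMX q m : pact (q * 'X) m = pact q (X m).
Proof.
rewrite (@pact_widen (size q).+1); last first.
  by rewrite (leq_trans (size_polyMleq _ _)) // size_polyX addnC.
rewrite big_ord_recl coefMX /= sa0l add0r; apply: eq_bigr => i _.
by rewrite coefMX /= -iterS iterSr.
Qed.

Lemma pact_comm q m : pact q (X m) = X (pact q m).
Proof.
rewrite (big_morph _ XD X0); apply: eq_bigr => i _.
by rewrite -iterSr Xsa.
Qed.

Lemma pactM q r m : pact (q * r) m = pact q (pact r m).
Proof.
elim/poly_ind: q r m => [|q c IHq] r m.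
  by rewrite mul0r /pact size_poly0 !big_ord0.
rewrite mulrDl mul_polyC -mulrA ['X * r]mulrC !pactDl IHq pactMX pactC pactZ.
by rewrite pactMX pact_comm.
Qed.

Lemma pact_fun (T : M -> M) : (forall m m', T (m + m') = T m + T m') ->
  (forall s m, T (sa s m) = sa s (T m)) -> (forall m, T (X m) = X (T m)) ->
  forall q m, T (pact q m) = pact q (T m).
Proof.
move=> TD Tsa TX q m.
have T0 : T 0 = 0 by apply: (addIr (T 0)); rewrite -TD !add0r.
rewrite (big_morph _ TD T0); apply: eq_bigr => i _; rewrite Tsa; congr (sa _ _).
by elim: (nat_of_ord i) => //= j <-.
Qed.

End PolynomialAction.

Section Operators.
Variables (K : fieldType) (M : lmodType K).
Implicit Types (T : {linear M -> M}) (s : seq K) (m x y : M).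

Lemma iter_linear T k : linear (iter k T).
Proof. by elim: k => // k IHk a x y /=; rewrite IHk linearP. Qed.

Lemma iter_linD T k x y : iter k T (x + y) = iter k T x + iter k T y.
Proof. exact: linDE (iter_linear T k) x y. Qed.
Lemma iter_linZ T k a x : iter k T (a *: x) = a *: iter k T x.
Proof. exact: (linearZ_LR (mklin (iter_linear T k))). Qed.
Lemma iter_linB T k x y : iter k T (x - y) = iter k T x - iter k T y.
Proof. exact: (linearB (mklin (iter_linear T k))). Qed.
Lemma iter_lin0 T k : iter k T 0 = 0.
Proof. exact: (linear0 (mklin (iter_linear T k))). Qed.

Lemma iter_le0 T k l m : (k <= l)%N -> iter k T m = 0 -> iter l T m = 0.
Proof. by move=> /subnK <- m0; rewrite [LHS](ssrnat.iterD (l - k) k T m) m0 iter_lin0. Qed.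

(** Local finiteness of [T] is recorded by such products of [T - l]; this makes sense in modules of
    any dimension, and the list [s] carries the possible eigenvalues. *)
Definition tprod T s m := foldr (fun l x => T x - l *: x) m s.

Lemma tprod_linear T s : linear (tprod T s).
Proof.
elim: s => // l s IHs a x y; rewrite /= IHs linearP /=.
by rewrite /tprod; set u := foldr _ _ _; set v := foldr _ _ _; lmod K M.
Qed.

Lemma tprodB T s x y : tprod T s (x - y) = tprod T s x - tprod T s y.
Proof. exact: (linearB (mklin (tprod_linear T s))). Qed.
Lemma tprodZ T s a x : tprod T s (a *: x) = a *: tprod T s x.
Proof. exact: (linearZ_LR (mklin (tprod_linear T s))). Qed.
Lemma tprod0 T s : tprod T s 0 = 0.
Proof. exact: (linear0 (mklin (tprod_linear T s))). Qed.

Lemma tprod_comm T (U : {linear M -> M}) s m :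
  (forall x, T (U x) = U (T x)) -> tprod T s (U m) = U (tprod T s m).
Proof. by move=> TU; elim: s => //= l s ->; rewrite TU (linearB U) (linearZ_LR U). Qed.

Lemma tprodT T s m : tprod T s (T m) = T (tprod T s m).
Proof. exact: tprod_comm. Qed.

Lemma tprod_cat T s t m : tprod T (s ++ t) m = tprod T s (tprod T t m).
Proof. exact: foldr_cat. Qed.

Lemma tprodC T s t m : tprod T s (tprod T t m) = tprod T t (tprod T s m).
Proof. by elim: t => //= l t IHt; rewrite tprodB tprodT tprodZ IHt. Qed.

Lemma tprod_cat0l T s t m : tprod T s m = 0 -> tprod T (s ++ t) m = 0.
Proof. by move=> m0; rewrite tprod_cat tprodC m0 tprod0. Qed.
Lemma tprod_cat0r T s t m : tprod T t m = 0 -> tprod T (s ++ t) m = 0.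
Proof. by move=> m0; rewrite tprod_cat m0 tprod0. Qed.

Lemma tprod_eigen T s m a : T m = a *: m -> tprod T s m = (\prod_(l <- s) (a - l)) *: m.
Proof.
move=> Tm; elim: s => [|l s IHs] /=; first by rewrite big_nil scale1r.
by rewrite IHs big_cons linearZ /= Tm; lmod K M.
Qed.

Lemma tprod_eigen_eq0 T s m a : T m = a *: m -> a \notin s -> tprod T s m = 0 -> m = 0.
Proof.
move=> Tm as_; rewrite (tprod_eigen _ Tm) => /eqP; rewrite scaler_eq0 => /orP[|/eqP //].
by rewrite prodf_seq_eq0 => /hasP[l ls]; rewrite subr_eq0 => /eqP al; rewrite al ls in as_.
Qed.

(** Coprimality of the two products, by induction: [T m - l *: m] is killed by the shorter product
    and by that of [t], hence is zero, and an eigenvalue [l] outside [t] forces [m = 0]. *)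
Lemma tprod_disjoint T s t m :
  (forall l, l \in s -> l \notin t) -> tprod T s m = 0 -> tprod T t m = 0 -> m = 0.
Proof.
elim: s m => //= l s IHs m dst; rewrite -tprodT -tprodZ -tprodB => m0 t0.
have {}m0 : T m - l *: m = 0.
  apply: IHs m0 _; first by move=> k ks; apply: dst; rewrite inE ks orbT.
  by rewrite tprodB tprodT tprodZ t0 linear0 scaler0 subr0.
apply: (@tprod_eigen_eq0 T t m l) => //; first exact/subr0_eq.
by apply: dst; rewrite inE eqxx.
Qed.

(** A product of shifts by nonzero [l] has nonzero constant term, so [T] is inverted on [m] by a
    polynomial in [T]; the preimage therefore stays in the stable set [S]. *)
Lemma tprod_onto T s (S : M -> Prop) m :
  (forall x y, S x -> S y -> S (x + y)) -> (forall a x, S x -> S (a *: x)) ->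
  (forall x, S x -> S (T x)) ->
  0 \notin s -> S m -> tprod T s m = 0 -> exists2 m', S m' & T m' = m.
Proof.
move=> SD SZ ST; elim: s m => [|l s IHs] m /=.
  by move=> _ Sm m0; rewrite m0; exists 0; rewrite ?linear0 // -m0.
rewrite inE negb_or eq_sym => /andP[l0 s0] Sm; rewrite -tprodT -tprodZ -tprodB => m0.
have [|y Sy Ty] := IHs _ s0 _ m0.
  by apply: SD; [exact: ST | rewrite -scaleNr; exact: SZ].
exists (l^-1 *: (m - y)); first by apply/SZ/SD => //; rewrite -scaleN1r; exact: SZ.
rewrite linearZ linearB /= Ty opprB addrCA subrr addr0.
by rewrite scalerA mulVf // scale1r.
Qed.

Section EigenSum.
Variables (T : {linear M -> M}) (S : M -> Prop).
Hypotheses (SD : forall x y, S x -> S y -> S (x + y)) (SZ : forall a x, S x -> S (a *: x))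
  (ST : forall x, S x -> S (T x))
  (ss : forall a x, S x -> T (T x - a *: x) = a *: (T x - a *: x) -> T x = a *: x).

Let E : set M := [set x | S x /\ exists a, T x = a *: x].

Let S00 x : S x -> S 0.
Proof. by move=> /(SZ 0); rewrite scale0r. Qed.

(** Writes a sum of eigenvectors as an image under [T - l] plus an eigenvector for [l]: an
    eigenvector with value [a] other than [l] is divided by [a - l]. *)
Let span_split l x : S x -> submod_gen E x -> exists x' y,
  [/\ submod_gen E x', S x', S y, T y = l *: y & x = T x' - l *: x' + y].
Proof.
move=> /S00 S0.
elim=> {x} [x [Sx [a Tx]]||x y _ [x' [x1 [ex' Sx' Sx1 Tx1 ->]]] _ [y' [y1 [ey' Sy' Sy1 Ty1 ->]]]
    |a x _ [x' [x1 [ex' Sx' Sx1 Tx1 ->]]]].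
- have [al|al] := eqVneq a l.
    exists 0, x; split=> //; [exact: submod_gen0 | by rewrite -al |].
    by rewrite linear0 scaler0 subrr add0r.
  have al0 : a - l != 0 by rewrite subr_eq0.
  exists ((a - l)^-1 *: x), 0; split=> //; rewrite ?linear0 ?scaler0 //.
  + by apply/submod_genZ/submod_gen_in; split; last exists a.
  + exact: SZ.
  rewrite linearZ /= Tx addr0 scalerA [l *: _]scalerA -scalerBl.
  by rewrite mulrC -mulrBl divff // scale1r.
- exists 0, 0; split=> //; rewrite ?linear0 ?scaler0 //; first exact: submod_gen0.
  by rewrite !addr0.
- exists (x' + y'), (x1 + y1); split; rewrite ?linearD /= ?Tx1 ?Ty1 ?scalerDr //.
  + exact: submod_genD.
  + exact: SD.
  + exact: SD.
  by set u := T x'; set v := T y'; lmod K M.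
- exists (a *: x'), (a *: x1); split; rewrite ?linearZ /= ?Tx1.
  + exact: submod_genZ.
  + exact: SZ.
  + exact: SZ.
  + by rewrite !scalerA mulrC.
  by set u := T x'; lmod K M.
Qed.

(** By induction [T m - l *: m] is a sum of eigenvectors. Correcting [m] by [x'] leaves only the
    part [y] of eigenvalue [l], and [ss], which excludes Jordan blocks, makes the corrected vector
    an eigenvector. *)
Lemma eigen_sum s m : S m -> tprod T s m = 0 -> submod_gen E m.
Proof.
elim: s m => [|l s IHs] m Sm /=; first by move=> ->; exact: submod_gen0.
rewrite -tprodT -tprodZ -tprodB => m0.
have Sm1 : S (T m - l *: m) by apply: SD; [exact: ST | rewrite -scaleNr; exact: SZ].
have [x' [y [ex' Sx' Sy Ty e]]] := span_split l Sm1 (IHs _ Sm1 m0).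
have SB : S (m - x') by apply: SD => //; rewrite -scaleN1r; exact: SZ.
have e' : T (m - x') - l *: (m - x') = y.
  rewrite linearB scalerBr /= opprB addrCA -[y](addKr (T x' - l *: x')) -e.
  by set u := T x'; set v := T m; lmod K M.
rewrite -(subrK x' m); apply: submod_genD => //; apply: submod_gen_in; split=> //.
by exists l; apply: ss => //; rewrite e'.
Qed.

End EigenSum.

Lemma eigen_avoid T m a : submod_gen [set v | exists2 b, b != a & T v = b *: v] m ->
  T m = a *: m -> m = 0.
Proof.
move=> gm Tm; have [s as_ sm] : exists2 s : seq K, a \notin s & tprod T s m = 0.
  elim: gm => {m Tm} [m [b ba Tm]||x y _ [s s0 sx] _ [t t0 ty]|k x _ [s s0 sx]].
  - by exists [:: b]; rewrite ?inE 1?eq_sym //= Tm subrr.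
  - by exists [::].
  - exists (s ++ t); first by rewrite mem_cat negb_or s0.
    by rewrite (linDE (tprod_linear T (s ++ t))) tprod_cat0l // tprod_cat0r // addr0.
  - by exists s => //; rewrite tprodZ sx scaler0.
exact: tprod_eigen_eq0 Tm as_ sm.
Qed.
End Operators.

Section FiniteDimensional.
Variables (K : closedFieldType) (V : vectType K).

(** The iterates of [T] on a vector are dependent; over a closed field the relation splits into
    factors [T - l]. Concatenating the lists over a basis gives one list for all vectors. *)
Lemma fd_tprod (T : {linear V -> V}) : exists s, forall x, tprod T s x = 0.
Proof.
have local (x : V) : exists s, tprod T s x = 0.
  set n := \dim (fullv : {vspace V}).
  pose X := [tuple iter i T x | i < n.+1].
  have : ~~ free X.
    apply/negP; rewrite /free size_tuple => /eqP dX.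
    by have := dimvS (subvf <<X>>); rewrite dX ltnn.
  move=> /freeP nf.
  have [k] : exists k : 'I_n.+1 -> K, ~ (\sum_(i < n.+1) k i *: X`_i = 0 -> forall i, k i = 0).
    by apply/existsNP.
  move=> /not_implyP[sk0 /existsNP[i0 /eqP ki0]].
  pose q := \poly_(i < n.+1) (k (inord i)).
  have q0 : q != 0.
    apply: contraNneq ki0 => q0.
    by have := coef0 K i0; rewrite -q0 coef_poly ltn_ord inord_val => ->.
  have [r qr] := closed_field_poly_normal q.
  pose act := @pact K V (fun a m => a *: m) T.
  have Dl (s t : K) (m : V) : (s + t) *: m = s *: m + t *: m by rewrite scalerDl.
  have Mx (s t : K) (m : V) : (s * t) *: m = s *: (t *: m) by rewrite scalerA.
  have Ts (s : K) m : T (s *: m) = s *: T m by rewrite linearZ.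
  have actprod s m : act (\prod_(z <- s) ('X - z%:P)) m = tprod T s m.
    elim: s m => [|z s IHs] m; rewrite ?big_nil ?big_cons.
      by rewrite /act -polyC1 pactC // scale1r.
    have Dr (a : K) (u v : V) : a *: (u + v) = a *: u + a *: v by rewrite scalerDr.
    rewrite mulrC /act pactM //; last exact: linearD.
    rewrite /= -tprodT -tprodZ -tprodB -IHs; congr (act _ _).
    rewrite -polyCN pactDl // pactC // scaleNr; congr (_ - _).
    by rewrite -['X]mul1r pactMX // -polyC1 pactC // scale1r.
  exists r; have : act q x = 0.
    rewrite /act (@pact_widen _ _ _ _ _ n.+1) ?size_poly // -[RHS]sk0.
    apply: eq_bigr => i _; rewrite coef_poly ltn_ord inord_val; congr (_ *: _).
    by rewrite -tnth_nth tnth_mktuple.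
  have Dr (a : K) (u v : V) : a *: (u + v) = a *: u + a *: v by rewrite scalerDr.
rewrite qr /act pactZ // -/act actprod => /eqP; rewrite scaler_eq0 lead_coef_eq0 (negPf q0).
  by move/eqP.
pose b := vbasis (fullv : {vspace V}).
have [s sP] : exists s, forall x, x \in (b : seq V) -> tprod T s x = 0.
  elim: (b : seq V) => [|y t [s IHs]]; first by exists [::].
  have [s' s'0] := local y; exists (s' ++ s) => x; rewrite inE => /orP[/eqP -> |/IHs ?].
    exact: tprod_cat0l.
  exact: tprod_cat0r.
exists s => x; have := memvf x; rewrite -[fullv](span_basis (vbasisP _)) => /coord_span ->.
rewrite -[tprod T s]/(mklin (tprod_linear T s) : V -> V) linear_sum big1 // => i _.
by rewrite linearZ /= sP ?scaler0 // mem_nth // size_tuple.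
Qed.

End FiniteDimensional.

(** * Representations of sl2 *)

Record sl2 (K : fieldType) (M : lmodType K) (E F H : {linear M -> M}) : Prop := {
  sl2_EF : forall m, E (F m) = F (E m) + H m;
  sl2_HE : forall m, H (E m) = E (H m) + 2%:R *: E m;
  sl2_HF : forall m, H (F m) = F (H m) - 2%:R *: F m }.

Lemma opp_linear (K : pzRingType) (M : lmodType K) (T : {linear M -> M}) :
  linear (fun m => - T m).
Proof. by move=> a x y; rewrite linearP opprD scalerN. Qed.

Lemma sl2_sym (K : fieldType) (M : lmodType K) (E F H : {linear M -> M}) :
  sl2 E F H -> sl2 F E (mklin (opp_linear H)).
Proof.
case=> EF HE HF; split=> m; rewrite /= ?EF ?HE ?HF.
- by rewrite addrK.
- by rewrite opprB linearN addrC.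
- by rewrite opprD linearN.
Qed.

Section Sl2Theory.
Variables (K : numFieldType) (M : lmodType K) (E F H : {linear M -> M}).
Hypothesis sl : sl2 E F H.
Let EF := sl2_EF sl.
Let HE := sl2_HE sl.
Let HF := sl2_HF sl.

Lemma sl2_HFk k m : H (iter k F m) = iter k F (H m) - (2 * k)%:R *: iter k F m.
Proof.
elim: k => [|k IHk] /=; first by rewrite muln0 scale0r subr0.
rewrite HF IHk linearB linearZ_LR /= mulnS natrD.
by set u := F _; set v := F _; lmod K M.
Qed.

Lemma sl2_HEk k m : H (iter k E m) = iter k E (H m) + (2 * k)%:R *: iter k E m.
Proof.
elim: k => [|k IHk] /=; first by rewrite muln0 scale0r addr0.
rewrite HE IHk linearD linearZ_LR /= mulnS natrD.
by set u := E _; set v := E _; lmod K M.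
Qed.

Lemma sl2_EFk k m : E m = 0 ->
  E (iter k.+1 F m) = k.+1%:R *: iter k F (H m - k%:R *: m).
Proof.
move=> Em; elim: k => [|k IHk].
  by rewrite /= EF Em linear0 add0r scale0r subr0 scale1r.
rewrite [in LHS]iterS EF IHk sl2_HFk linearZ_LR /= !iter_linB !iter_linZ /= linearB linearZ_LR /=.
by rewrite !(linE F) /= natrM -[k.+2%:R]natr1 -[k.+1%:R]natr1; set u := F _; set v := F _; lmod K M.
Qed.

Lemma sl2_EkF k m :
  iter k.+1 E (F m) = F (iter k.+1 E m) + k.+1%:R *: iter k E (H m + k%:R *: m).
Proof.
elim: k m => [|k IHk] m.
  by rewrite /= EF scale0r addr0 scale1r.
rewrite iterSr EF iter_linD IHk -iterSr -!iter_linZ -addrA; congr (_ + _).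
rewrite !iterSr -iter_linD; congr (iter _ _ _); rewrite !(linE E) /=.
rewrite HE -[k.+2%:R]natr1 -[k.+1%:R]natr1.
by set u := E m; set v := E _; lmod K M.
Qed.

(** Since [E (F^(n+1) m) = (n+1) F^n (H m - n m)], the vector [H m - n m] is again killed by [E] and
    by a smaller power of [F]. *)
Lemma sl2_tprod n m : E m = 0 -> iter n F m = 0 ->
  tprod H [seq k%:R | k <- iota 0 n] m = 0.
Proof.
elim: n m => [//|n IHn] m Em Fm.
have : E (iter n.+1 F m) = 0 by rewrite Fm linear0.
rewrite sl2_EFk // => /eqP; rewrite scaler_eq0 pnatr_eq0 orFb => /eqP Fm'.
rewrite -(addn1 n) iotaD map_cat tprod_cat /= add0n IHn //.
rewrite linearB linearZ_LR /= Em scaler0 subr0.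
have := HE m; rewrite Em linear0 scaler0 addr0 => /esym ->; exact: erefl.
Qed.

Lemma hw_nat n m a : E m = 0 -> H m = a *: m -> iter n F m = 0 -> m <> 0 ->
  exists2 k, (k < n)%N & a = k%:R.
Proof.
move=> Em Hm; elim: n => [//|n IHn] Fm m0.
have [/IHn/(_ m0)[k kn ->]|Fm'] := eqVneq (iter n F m) 0.
  by exists k => //; rewrite ltnW.
exists n => //; have : E (iter n.+1 F m) = 0 by rewrite Fm linear0.
rewrite sl2_EFk // Hm -scalerBl iter_linZ => /eqP; rewrite !scaler_eq0 pnatr_eq0 /=.
by rewrite (negPf Fm') orbF subr_eq0 => /eqP.
Qed.

(** In [E (F^(n+1) m) = (n+1)(k-n) F^n m] the scalar is nonzero for [n > k], so the exponent of a
    vanishing power descends to [k+1]. *)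
Lemma hw_kill n m k : E m = 0 -> H m = k%:R *: m -> iter n F m = 0 -> iter k.+1 F m = 0.
Proof.
move=> Em Hm; elim: n => [m0|n IHn Fm]; first by rewrite -[m]/(iter 0 F m) m0 iter_lin0.
have [nk|kn] := leqP n.+1 k.+1; first exact: iter_le0 nk Fm.
apply: IHn; have : E (iter n.+1 F m) = 0 by rewrite Fm linear0.
rewrite sl2_EFk // Hm -scalerBl iter_linZ => /eqP; rewrite !scaler_eq0 pnatr_eq0 /=.
by rewrite subr_eq0 eqr_nat ltn_eqF //= => /eqP.
Qed.

(** Injectivity of [E^n] from weight [-n] to weight [n] on vectors on which [F] is nilpotent.
    Induction on the exponent of [F]: the vector [F u] has weight [-n-2] and satisfies the same
    hypotheses, so [F u = 0]; then the powers of [E] are removed one at a time. *)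
Lemma sl2_reflect k n u : iter k F u = 0 -> H u = - n%:R *: u -> iter n E u = 0 -> u = 0.
Proof.
elim: k n u => [//|k IHk] n u Fu Hu Eu.
have Fu0 : F u = 0.
  apply: (IHk n.+2); rewrite -?iterSr //.
    by rewrite HF Hu linearZ_LR /= -[n.+2%:R]natr1 -[n.+1%:R]natr1; set v := F u; lmod K M.
  by rewrite sl2_EkF !iterS iter_linD iter_linZ Hu iter_linZ Eu !(scaler0, linear0, addr0).
have desc j : (j <= n)%N -> iter (n - j) E u = 0.
  elim: j => [|j IHj] jn; first by rewrite subn0.
  have := IHj (ltnW jn); rewrite -(subnSK jn).
  set i := (n - j.+1)%N => Ei.
  have ni : (i < n)%N by rewrite /i; lia.
  (* Here [0 = E^(i+1) (F u)] reads [(i+1)(i-n) E^i u = 0], with [i < n]. *)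
  have := sl2_EkF i u; rewrite Fu0 iter_lin0 Ei linear0 add0r Hu -scalerDl iter_linZ => /esym/eqP.
  rewrite !scaler_eq0 pnatr_eq0 /= => /orP[|/eqP //].
  by rewrite addrC subr_eq0 eqr_nat ltn_eqF.
by have := desc n (leqnn n); rewrite subnn.
Qed.

Hypotheses (nilE : forall m, exists n, iter n E m = 0) (nilF : forall m, exists n, iter n F m = 0).

Lemma hw_exists a m : H m = a *: m -> m <> 0 ->
  exists n, [/\ iter n E m <> 0, E (iter n E m) = 0 & H (iter n E m) = (a + (2 * n)%:R) *: iter n E m].
Proof.
move=> Hm m0; have [n] := nilE m; elim: n => [//|n IHn] En.
have [/IHn //|En0] := eqVneq (iter n E m) 0.
exists n; split=> //; first exact/eqP.
by rewrite sl2_HEk Hm iter_linZ scalerDl.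
Qed.

Lemma sl2_eig_int a m : H m = a *: m -> m <> 0 -> exists z : int, a = z%:~R.
Proof.
move=> Hm /(hw_exists Hm)[n [n0 En /[dup] Hn]]; have [N FN] := nilF (iter n E m).
move=> /(hw_nat En)/(_ FN n0)[k _ e]; exists (k%:Z - (2 * n)%:Z).
by rewrite rmorphB /= -!pmulrn -e addrK.
Qed.

Let T : {linear M -> M} := mklin (fun a x y =>
  etrans (congr1 E (linearP F a x y)) (linearP E a (F x) (F y))).

Let HT x : H (T x) = T (H x).
Proof. by rewrite /= HE HF linearB linearZ_LR /= addrNK. Qed.

Let TE k s x : H x = k%:R *: x -> tprod T s (E x) = E (tprod T [seq l + k%:R | l <- s] x).
Proof.
move=> Hx; elim: s => //= l s ->; set z := tprod _ _ x.
have Hz : H z = k%:R *: z by rewrite -tprodZ -Hx tprod_comm.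
have -> : F (E z) = E (F z) - k%:R *: z by rewrite EF Hz addrK.
by rewrite /= !(linE E) /=; lmod K M.
Qed.

(** The numbers [(j+1)(k+1+j)] are the eigenvalues of [E F] on the weight [k+1] part of the simple
    modules of highest weight [k+1+2j]. That they are nonzero makes [E F] onto in [EF_onto]. *)
Lemma EF_tprod n k y : iter n E y = 0 -> H y = k.+1%:R *: y ->
  tprod T [seq (j.+1 * (k.+1 + j))%:R | j <- iota 0 n] y = 0.
Proof.
elim: n k y => [|n IHn] k y Ey Hy //.
have HEy : H (E y) = k.+3%:R *: E y.
  by rewrite HE Hy linearZ_LR /= -scalerDl -natrD addn2.
have := IHn k.+2 (E y); rewrite -iterSr => /(_ Ey HEy); rewrite (TE _ Hy) -map_comp /=.
rewrite (iotaDl 1 0) -map_comp mul1n addn0; set s1 := map _ _; set s2 := map _ _.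
have -> : s1 = s2.
  by apply: eq_map => j /=; rewrite -natrD; congr (_%:R); lia.
rewrite -/T => Ez; rewrite EF Ez linear0 add0r -tprod_comm; last by move=> x; rewrite HT.
by rewrite Hy tprodZ subrr.
Qed.

Lemma EF_onto k y : H y = k.+1%:R *: y ->
  exists2 y', H y' = k.+1%:R *: y' & E (F y') = y.
Proof.
move=> Hy; have [n Ey] := nilE y.
apply: (@tprod_onto K M T _ (fun m => H m = k.+1%:R *: m) y _ _ _ _ Hy (EF_tprod Ey Hy)).
- by move=> u v Hu Hv; rewrite linearD Hu Hv scalerDr.
- by move=> a u Hu; rewrite linearZ_LR /= Hu !scalerA mulrC.
- by move=> u Hu; rewrite HT Hu linearZ_LR.
- by apply/mapP => -[j _ /esym/eqP]; rewrite pnatr_eq0.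
Qed.

Lemma tprod_simple s a (v : M) : uniq s -> tprod H s v = 0 ->
  H (H v - a *: v) = a *: (H v - a *: v) -> H v = a *: v.
Proof.
set u := H v - a *: v => us sv Hu; apply/subr0_eq; rewrite -/u.
have su : tprod H s u = 0 by rewrite tprodB tprodT tprodZ sv linear0 scaler0 subr0.
have [as_|as_] := boolP (a \in s); last exact: tprod_eigen_eq0 Hu as_ su.
case/splitPr: as_ us sv {su} => s1 s2; rewrite cat_uniq /= negb_or => /and3P[_ /andP[as1 _] /andP[as2 _]].
rewrite tprod_cat /= -tprodT -tprodZ -tprodB -tprod_cat => /(tprod_eigen_eq0 Hu); apply.
by rewrite mem_cat negb_or as1.
Qed.

(** Local nilpotency of [E] and [F] excludes Jordan blocks of [H]. Induct on the exponent of [E] on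
    [v]: then [E v] is an eigenvector, so [u] is killed by [E] and, if nonzero, has a natural number
    [k] as weight. *)
Lemma sl2_semisimple a v : H (H v - a *: v) = a *: (H v - a *: v) -> H v = a *: v.
Proof.
have [n] := nilE v; elim: n v a => [v a /= -> _|n IHn v a]; first by rewrite linear0 scaler0.
rewrite iterSr => En; set u := H v - a *: v => Hu.
have He : H (E v) = (a + 2%:R) *: E v.
  apply: IHn => //; have -> : H (E v) - (a + 2%:R) *: E v = E u.
    by rewrite HE /u !(linE E) /=; lmod K M.
  by rewrite HE Hu linearZ_LR scalerDl.
have Eu : E u = 0.
  have EHv : E (H v) = H (E v) - 2%:R *: E v by rewrite HE addrK.
  by rewrite /u !(linE E) /= EHv He; lmod K M.
have [u0|/eqP u0] := eqVneq u 0; first exact/subr0_eq.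
have [N FN] := nilF u; have [k _ ak] := hw_nat Eu Hu FN u0.
have He' : H (E v) = k.+2%:R *: E v by rewrite He ak -natrD addn2.
(* Subtracting [F y'], which has weight [a], makes [v] singular and leaves [u] unchanged; on a
   singular vector [sl2_tprod] gives a product with simple roots. *)
have [y' Hy' Ey'] := EF_onto He'.
have HFy : H (F y') = a *: F y'.
  by rewrite HF Hy' linearZ_LR /= ak -scalerBl -natrB // subn2.
have Ev' : E (v - F y') = 0 by rewrite linearB Ey' subrr.
have uE : H (v - F y') - a *: (v - F y') = u.
  by rewrite linearB HFy scalerBr /u; set x := F y'; set w := H v; lmod K M.
have [N' FN'] := nilF (v - F y').
have := @tprod_simple _ a (v - F y') _ (sl2_tprod Ev' FN').
rewrite uE => /(_ _ Hu) e; case: u0; rewrite -uE e ?subrr //.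
by rewrite map_inj_uniq ?iota_uniq // => i j /eqP; rewrite eqr_nat => /eqP.
Qed.

End Sl2Theory.

(** * Traces on subquotients, bases of special vectors, weight decompositions *)

Section Trace.
Variables (K : fieldType) (V : lmodType K) (P : V -> Prop) (n : nat).
Variables (u : 'I_n -> V) (phi : 'I_n -> {linear V -> K^o}).
Hypotheses (P_phi : forall i x, P x -> phi i x = 0).

(** The trace on the subquotient [(P + span u) / P]. In [trace_modC] the hypotheses say that [P] and
    [P + span u] are stable, so that commutators are traceless there. *)
Definition trace_mod (T : V -> V) := \sum_i (phi i (T (u i)) : K).

Lemma trace_modC (E F : {linear V -> V}) :
  (forall x, P x -> P (E x)) -> (forall x, P x -> P (F x)) ->
  (forall j, P (E (u j) - \sum_k (phi k (E (u j)) : K) *: u k)) ->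
  (forall j, P (F (u j) - \sum_k (phi k (F (u j)) : K) *: u k)) ->
  trace_mod (E \o F) = trace_mod (F \o E).
Proof.
have expand (A B : {linear V -> V}) : (forall x, P x -> P (A x)) ->
    (forall j, P (B (u j) - \sum_k (phi k (B (u j)) : K) *: u k)) ->
    trace_mod (A \o B) = \sum_i \sum_k (phi k (B (u i)) : K) * (phi i (A (u k)) : K).
  move=> PA PB; apply: eq_bigr => i _ /=.
  have /(P_phi i) := PA _ (PB i); rewrite linearB linearB /= => /subr0_eq ->.
  by rewrite !linear_sum; apply: eq_bigr => k _; rewrite linearZ_LR linearZ_LR.
move=> PE PF uE uF; rewrite (expand E F) // (expand F E) // exchange_big.
by apply: eq_bigr => i _; apply: eq_bigr => k _; rewrite mulrC.
Qed.

End Trace.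

Section VectorSpaces.
Variables (K : fieldType) (V : vectType K).

(** A subspace of largest dimension inside [P] already contains every vector of [P]. *)
Lemma vspace_of (P : V -> Prop) : P 0 -> (forall x y, P x -> P y -> P (x + y)) ->
  (forall a x, P x -> P (a *: x)) -> exists U : {vspace V}, forall x, x \in U <-> P x.
Proof.
move=> P0 PD PZ.
pose Q n := `[< exists2 U : {vspace V}, (forall x, x \in U -> P x) & \dim U = n >].
have exQ : exists n, Q n.
  exists 0%N; apply/asboolP; exists 0%VS; last exact: dimv0.
  by move=> x; rewrite memv0 => /eqP ->.
have boundQ n : Q n -> (n <= \dim (fullv : {vspace V}))%N.
  by move=> /asboolP[U _ <-]; exact/dimvS/subvf.
have [n /asboolP[U UP dU] maxU] := ex_maxnP exQ boundQ.
exists U => x; split; first exact: UP.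
move=> Px; have [//|xU] := boolP (x \in U).
suff : (n.+1 <= n)%N by rewrite ltnn.
apply: maxU; apply/asboolP; exists (U + <[x]>)%VS.
  by move=> y /memv_addP[y1 /UP Py1 [_ /vlineP[a ->] ->]]; exact/PD/PZ.
rewrite dimv_disjoint_sum ?dim_vline ?dU.
  by rewrite addnC; case: eqVneq xU => [->|]; rewrite ?mem0v.
apply/eqP; rewrite -subv0; apply/subvP => y; rewrite memv_cap => /andP[yU /vlineP[a ya]].
have [a0|a0] := eqVneq a 0; first by rewrite ya a0 scale0r mem0v.
by case/negP: xU; rewrite -[x](scalerK a0) -ya memvZ.
Qed.

(** [W] is any set, for instance that of all weight vectors, so that the basis can be chosen inside
    it: a longest family from [W] that is independent modulo [P]. *)
Lemma basis_mod (P : {vspace V}) (W : V -> Prop) :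
  exists n (u : 'I_n -> V) (phi : 'I_n -> {linear V -> K^o}),
  [/\ forall i, W (u i), forall i x, x \in P -> phi i x = 0,
      forall i j, phi i (u j) = (j == i)%:R &
      forall x, W x -> x - \sum_k (phi k x : K) *: u k \in P].
Proof.
pose Q n := `[< exists s : seq V, [/\ size s = n, forall x, x \in s -> W x & free (s ++ vbasis P)] >].
have exQ : exists n, Q n.
  exists 0%N; apply/asboolP; exists [::]; split=> //=.
  exact/basis_free/vbasisP.
have boundQ n : Q n -> (n <= \dim (fullv : {vspace V}))%N.
  move=> /asboolP[s [<- _ /eqP fs]]; have := dimvS (subvf <<s ++ vbasis P>>).
  by rewrite fs size_cat; apply: leq_trans; exact: leq_addr.
have [n /asboolP[s [sn Ws fs]] maxs] := ex_maxnP exQ boundQ.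
have {maxs} spanW x : W x -> x \in <<s ++ vbasis P>>%VS.
  move=> Wx; have [//|xs] := boolP (x \in <<s ++ vbasis P>>%VS).
  suff : (n.+1 <= n)%N by rewrite ltnn.
  apply: maxs; apply/asboolP; exists (x :: s); rewrite /= sn free_cons xs fs; split=> // y.
  by rewrite inE => /orP[/eqP -> //|/Ws].
case: n / sn => {exQ boundQ Q}.
pose X := cat_tuple (in_tuple s) (vbasis P).
pose phi i : {linear V -> K^o} := coord X (lshift (\dim P) i).
exists (size s), (fun i => s`_i), phi.
have Xl (i : 'I_(size s)) : X`_(lshift (\dim P) i) = s`_i by rewrite /= nth_cat ltn_ord.
have Xr (i : 'I_(\dim P)) : X`_(rshift (size s) i) = (vbasis P)`_i.
  by rewrite /= nth_cat ltnNge leq_addr /= addKn.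
split=> [i|i x xP|i j|x Wx].
- exact/Ws/mem_nth.
- move: xP; rewrite -(span_basis (vbasisP P)) => /coord_span ->.
  rewrite linear_sum big1 // => k _; rewrite linearZ_LR /= -Xr coord_free //.
  by rewrite eq_rlshift scaler0.
- by rewrite -(Xl j) /phi [LHS](@coord_free _ _ _ X (lshift _ j) (lshift _ i) fs) eq_lshift.
have xE := @coord_span K V _ X x (spanW x Wx).
rewrite {1}[x]xE big_split_ord /=.
rewrite [X in X + _ - _](_ : _ = \sum_k (phi k x : K) *: s`_k); last first.
  by apply: eq_bigr => i _; rewrite -Xl.
rewrite addrAC subrr add0r; apply: memv_suml => i _; apply: memvZ.
by rewrite -[_ ++ _]/(tval X) Xr vbasis_mem // mem_nth // size_tuple.
Qed.

End VectorSpaces.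

Section Weights.
Variables (K : fieldType) (M : lmodType K) (J : eqType).

Lemma weight_decomp (Om : J -> Prop) (wt : J -> M -> Prop) x :
  (forall j, wt j 0) -> (forall j u v, wt j u -> wt j v -> wt j (u + v)) ->
  (forall j a u, wt j u -> wt j (a *: u)) ->
  submod_gen [set v | exists2 j, Om j & wt j v] x ->
  exists (s : seq J) (v : J -> M), [/\ uniq s, forall j, j \in s -> Om j,
    forall j, wt j (v j) & x = \sum_(j <- s) v j].
Proof.
move=> wt0 wtD wtZ; elim=> {x} [x [j Oj wx]||x y _ [s [v [us Os wv ->]]] _ [t [w [ut Ot ww ->]]]
    |a x _ [s [v [us Os wv ->]]]].
- exists [:: j], (fun k => if k == j then x else 0); split=> //.
  + by move=> k; rewrite inE => /eqP ->.
  + by move=> k; case: eqP => [->|_].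
  + by rewrite big_seq1 eqxx.
- by exists [::], (fun=> 0); split=> //; rewrite big_nil.
- exists (undup (s ++ t)), (fun j => (if j \in s then v j else 0) + (if j \in t then w j else 0)).
  split; first exact: undup_uniq.
  + by move=> j; rewrite mem_undup mem_cat => /orP[/Os|/Ot].
  + by move=> j; apply: wtD; case: ifP.
  have widen (r u : seq J) (f : J -> M) : uniq r -> uniq u -> {subset r <= u} ->
      \sum_(j <- u) (if j \in r then f j else 0) = \sum_(j <- r) f j.
    move=> ur uu ru; rewrite -big_mkcond /= -big_filter; apply: perm_big.
    apply: uniq_perm; rewrite ?filter_uniq // => j; rewrite mem_filter.
    by apply/andP/idP => [[]//|jr]; split=> //; exact: ru.
  by rewrite big_split !widen ?undup_uniq // => j; rewrite mem_undup mem_cat => ->; rewrite ?orbT.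
- by exists s, (fun j => a *: v j); split=> [||j|]; rewrite ?scaler_sumr; auto.
Qed.

Lemma weight_component (X : Type) (T : X -> M -> M) (E : M -> Prop)
    (chi : J -> X -> K) (s : seq J) (v : J -> M) :
  (forall x y, E x -> E y -> E (x + y)) -> (forall a x, E x -> E (a *: x)) ->
  (forall x, linear (T x)) -> (forall x u, E u -> E (T x u)) ->
  uniq s -> {in s &, forall j k, j != k -> exists x, chi j x != chi k x} ->
  {in s, forall j x, T x (v j) = chi j x *: v j} ->
  E (\sum_(j <- s) v j) -> {in s, forall j, E (v j)}.
Proof.
move=> ED EZ Tlin ET us; elim: s us v => [//|j s IHs] /= /andP[js us] v sep wv Es.
have Tsum x (t : seq J) (w : J -> M) : T x (\sum_(k <- t) w k) = \sum_(k <- t) T x (w k).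
  exact: (linear_sum (mklin (Tlin x))).
have TZ x a m : T x (a *: m) = a *: T x m by exact: (linearZ_LR (mklin (Tlin x))).
have Etail : {in s, forall k, E (v k)}.
  move=> k ks; have kj : k != j by apply: contraNneq js => <-.
  have [||x jk] := sep k j _ _ kj; rewrite ?inE ?ks ?eqxx ?orbT //.
  (* Applying [T x - chi j x] to the sum removes its [j]-th term; [x] is chosen so that the [k]-th
     term survives. *)
  pose w l := (chi l x - chi j x) *: v l.
  have Ew : E (\sum_(l <- s) w l).
    have -> : \sum_(l <- s) w l = T x (\sum_(l <- j :: s) v l) + - chi j x *: \sum_(l <- j :: s) v l.
      rewrite Tsum scaler_sumr -big_split big_cons /= wv ?inE ?eqxx // scaleNr subrr add0r.
      by apply: eq_big_seq => l ls; rewrite /w wv ?inE ?ls ?orbT // -scalerDl.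
    by apply: ED; [exact: ET | exact: EZ].
  have := IHs us w _ _ Ew k ks; have ne : chi k x - chi j x != 0 by rewrite subr_eq0.
  have -> : v k = (chi k x - chi j x)^-1 *: w k by rewrite /w scalerK.
  move=> Ewk; apply: EZ; apply: Ewk.
    by move=> a b as_ bs; apply: sep; rewrite inE ?as_ ?bs orbT.
  move=> l ls y; rewrite /w TZ wv ?inE ?ls ?orbT // !scalerA mulrC //.
move=> k; rewrite inE => /orP[/eqP ->|]; last exact: Etail.
have -> : v j = \sum_(l <- j :: s) v l + (-1) *: \sum_(l <- s) v l.
  by rewrite big_cons scaleN1r addrK.
apply: (ED) => //; apply: (EZ); move: Etail; elim: (s) => [_|l t IHt Et].
  by rewrite big_nil -(scale0r (\sum_(l <- j :: s) v l)); exact: EZ.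
rewrite big_cons; apply: ED; first by apply: Et; rewrite inE eqxx.
by apply: IHt => m mt; apply: Et; rewrite inE mt orbT.
Qed.

End Weights.

(** * Structure of a simple Lie algebra with a Chevalley basis *)

Section LieBasics.
Variables (K : fieldType) (L : lieAlgType K).

Lemma lieNl (x y : L) : lie (- x) y = - lie x y.
Proof. by rewrite -scaleN1r lieZl scaleN1r. Qed.
Lemma lieNr (x y : L) : lie x (- y) = - lie x y.
Proof. exact: (linearN (lie x)). Qed.
Lemma lieBr (x y y' : L) : lie x (y - y') = lie x y - lie x y'.
Proof. by rewrite lieDr lieNr. Qed.
Lemma lie_suml I (r : seq I) (P : pred I) (f : I -> L) y :
  lie (\sum_(i <- r | P i) f i) y = \sum_(i <- r | P i) lie (f i) y.
Proof. by apply: (big_morph (fun x => lie x y)) => [x x'|]; rewrite ?lieDl ?lie0l. Qed.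
Lemma lie_sumr I (r : seq I) (P : pred I) (f : I -> L) x :
  lie x (\sum_(i <- r | P i) f i) = \sum_(i <- r | P i) lie x (f i).
Proof. exact: (linear_sum (lie x)). Qed.

Lemma lieJ (x y z : L) : lie x (lie y z) = lie (lie x y) z + lie y (lie x z).
Proof.
have /eqP := lie_jacobi x y z; rewrite -addrA addr_eq0 => /eqP ->.
by rewrite [lie z (lie _ _)]lieC [lie z x]lieC lieNr opprD !opprK addrC.
Qed.
End LieBasics.

Section DualBasics.
Variables (K : fieldType) (g : fdLieAlgType K) (h : {vspace g}).

Lemma evN (mu : dual h) x : ev (- mu) x = - ev mu x.
Proof. by apply: (addIr (ev mu x)); rewrite -evD !addNr ev0. Qed.
Lemma evB (mu nu : dual h) x : ev (mu - nu) x = ev mu x - ev nu x.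
Proof. by rewrite evD evN. Qed.
Lemma evZ a (mu : dual h) x : ev (a *: mu) x = a * ev mu x.
Proof. exact: (scale_lfunE a (mu : 'Hom(_, _))). Qed.
Lemma evDr (mu : dual h) x y : ev mu (x + y) = ev mu x + ev mu y.
Proof. by have := ev_linear mu 1 x y; rewrite !scale1r. Qed.
Lemma ev0r (mu : dual h) : ev mu 0 = 0.
Proof. by rewrite /ev !linear0. Qed.
Lemma evZr (mu : dual h) a x : ev mu (a *: x) = a * ev mu x.
Proof. by have := ev_linear mu a x 0; rewrite ev0r !addr0. Qed.
Lemma evNr (mu : dual h) x : ev mu (- x) = - ev mu x.
Proof. by rewrite -scaleN1r evZr mulN1r. Qed.

Lemma dual_ext (mu nu : dual h) : (forall y, y \in h -> ev mu y = ev nu y) -> mu = nu.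
Proof.
move=> e; apply: (proj1 (@lfunP K (subvs_of h) K^o mu nu)) => u.
by have := e (vsval u) (subvsP u); rewrite /ev vsvalK.
Qed.

Lemma dual_of (f : g -> K) : {in h &, forall x y, f (x + y) = f x + f y} ->
  (forall a, {in h, forall x, f (a *: x) = a * f x}) ->
  exists mu : dual h, {in h, forall y, ev mu y = f y}.
Proof.
move=> fD fZ; have lin : linear (fun u : subvs_of h => f (vsval u) : K^o).
  by move=> a x y; rewrite linearP /= fD ?fZ ?memvZ ?subvsP.
exists (linfun (mklin lin)) => y yh; rewrite /ev [LHS](lfunE (mklin lin)) /=.
by rewrite vsprojK.
Qed.
End DualBasics.

Section Structure.
Variables (K : numClosedFieldType) (g : fdLieAlgType K).
Hypothesis g_simple : lie_simple g.
Variable c : chevalley g.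

Local Notation I := (node c).
Local Notation h := (cartan c).
Local Notation al := (sroot c).
Local Notation Xp := (Xplus c).
Local Notation Xm := (Xminus c).
Local Notation H := (coroot c).

Let hlie := cartan_closed (@cartanP K g c).

Lemma coroot_central i y : y \in h -> lie (H i) y = 0.
Proof.
move=> yh; rewrite lieC -Xplus_Xminus lieJ.
have -> : lie y (Xp i) = ev (al i) y *: Xp i by exact: XplusP.
have -> : lie y (Xm i) = ev (- al i) y *: Xm i by exact: XminusP.
by rewrite evN lieZl lieZr scaleNr subrr oppr0.
Qed.

Lemma coroot_lie_Xp i j : lie (H i) (Xp j) = ev (al j) (H i) *: Xp j.
Proof. exact/XplusP/corootP. Qed.
Lemma coroot_lie_Xm i j : lie (H i) (Xm j) = - ev (al j) (H i) *: Xm j.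
Proof. by rewrite -evN; exact/XminusP/corootP. Qed.

Lemma coroot_neq0 i : H i <> 0.
Proof. by move=> H0; have := sroot_coroot i; rewrite H0 ev0r => /esym/eqP; rewrite pnatr_eq0. Qed.

Lemma Xp_neq0 i : Xp i <> 0.
Proof. by move=> X0; apply: (@coroot_neq0 i); rewrite -Xplus_Xminus X0 lie0l. Qed.

Lemma sroot_indep (a : I -> K) :
  {in h, forall y, \sum_i a i * ev (al i) y = 0} -> forall i, a i = 0.
Proof.
move=> a0 i.
have /freeP fr : free (in_tuple [seq al i | i : I]) := sroot_free c.
have sz : size [seq al i | i : I] = #|I| by rewrite size_map -cardE.
have ir : (enum_rank i < size [seq al i | i : I])%N by rewrite sz ltn_ord.
have := fr (fun k => a (nth i (enum I) k)) _ (Ordinal ir).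
rewrite /= nth_enum_rank; apply.
apply: dual_ext => y yh; rewrite ev0 -[RHS](a0 y yh) ev_sum.
pose G j := a j * ev (al j) y.
transitivity (\sum_(j <- enum I) G j); last by rewrite big_enum.
rewrite (big_nth i) -{1}(size_map al) big_mkord; apply: eq_bigr => j _.
have jI : (j < size (enum I))%N by have := ltn_ord j; rewrite [X in (_ < X)%N]sz cardE.
by rewrite evZ (nth_map i _ _ jI).
Qed.

(* The value at y of the root with coordinates n over the simple roots. *)
Definition wtv (n : I -> nat) (y : g) : K := \sum_i (n i)%:R * ev (al i) y.

Lemma wtv_nspan n : exists2 b : dual h, nspan [set: I]%SET al b & forall y, ev b y = wtv n y.
Proof.
exists (\sum_(i in [set: I]%SET) al i *+ n i); first by exists n.
move=> y; rewrite big_mkcond ev_sum /=; apply: eq_bigr => i _.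
by rewrite finset.in_setT evMn mulr_natl.
Qed.

Lemma nspanE b : nspan [set: I]%SET al b -> exists n, forall y, ev b y = wtv n y.
Proof.
move=> [n ->]; exists n => y; rewrite big_mkcond ev_sum /=; apply: eq_bigr => i _.
by rewrite finset.in_setT evMn mulr_natl.
Qed.

Lemma root_sign (b : dual h) : is_root b -> exists n, (exists i, n i <> 0%N) /\
  ((forall y, ev b y = wtv n y) \/ (forall y, ev b y = - wtv n y)).
Proof.
move=> rb; have b0 := rb.1; have [n ne] : exists n,
  (forall y, ev b y = wtv n y) \/ (forall y, ev b y = - wtv n y).
  case: (sroot_base rb) => /nspanE[n nb]; exists n; [by left | right => y].
  by rewrite -nb evN opprK.
exists n; split=> //; apply: contrapT => /forallNP n0; apply: b0; apply: dual_ext => y _.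
have n0' i : n i = 0%N by apply: contrapT; exact: n0.
have w0 : wtv n y = 0 by rewrite /wtv big1 // => i _; rewrite n0' mul0r.
by rewrite ev0; case: ne => ->; rewrite w0 ?oppr0.
Qed.

Lemma wtv_inj n k : {in h, forall y, wtv n y = wtv k y} -> n =1 k.
Proof.
move=> e i; apply/eqP; rewrite -(eqr_nat K) -subr_eq0; apply/eqP; move: i.
apply: sroot_indep => y yh; have /eqP := e y yh; rewrite -subr_eq0 -sumrB => /eqP e0.
by rewrite -[RHS]e0; apply: eq_bigr => i _; rewrite mulrBl.
Qed.

Lemma wtvD n k y : wtv (fun i => n i + k i)%N y = wtv n y + wtv k y.
Proof. by rewrite -big_split; apply: eq_bigr => i _; rewrite natrD mulrDl. Qed.

Lemma wtv_delta j y : wtv (fun i => (i == j) : nat) y = ev (al j) y.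
Proof.
rewrite /wtv (bigD1 j) //= eqxx mul1r big1 ?addr0 // => i /negPf ->.
by rewrite mul0r.
Qed.

(** A root has coordinates of one sign over the simple roots and these are unique, so a root cannot
    be a difference of two nonzero combinations with disjoint supports. *)
Lemma no_mixed_root n k x : {in h, forall y, lie y x = (wtv n y - wtv k y) *: x} -> x <> 0 ->
  (forall i, n i = 0%N \/ k i = 0%N) -> (forall i, n i = 0%N) \/ (forall i, k i = 0%N).
Proof.
move=> wx x0 disj; have [[bn nbn evbn] [bk nbk evbk]] := (wtv_nspan n, wtv_nspan k).
have evb y : ev (bn - bk) y = wtv n y - wtv k y by rewrite evB evbn evbk.
have [b0|b0] := EM (bn - bk = 0).
  have nk : n =1 k by apply: wtv_inj => y _; apply/eqP; rewrite -subr_eq0 -evb b0 ev0.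
  by left => i; have := disj i; rewrite -nk; case.
have rb : is_root (bn - bk) by split=> //; exists x => // y yh; rewrite wx // evb.
have [l [_ [le|le]]] := root_sign rb.
  right=> i; have e : n =1 (fun i => l i + k i)%N.
    by apply: wtv_inj => y _; rewrite wtvD -le evb subrK.
  by have [|//] := disj i; rewrite e => /eqP; rewrite addn_eq0 => /andP[_ /eqP].
left=> i; have e : k =1 (fun i => l i + n i)%N.
  apply: wtv_inj => y _; rewrite wtvD -[wtv l y]opprK -le evb opprB subrK //.
by have [//|] := disj i; rewrite e => /eqP; rewrite addn_eq0 => /andP[_ /eqP].
Qed.

Lemma Xp_Xm i j : i != j -> lie (Xp i) (Xm j) = 0.
Proof.
move=> ij; apply: contrapT => x0.
have [y yh|k||/(_ j)] := @no_mixed_root (fun k => (k == i) : nat) (fun k => (k == j) : nat) _ _ x0.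
- rewrite !wtv_delta lieJ.
  have -> : lie y (Xp i) = ev (al i) y *: Xp i by exact: XplusP.
  have -> : lie y (Xm j) = ev (- al j) y *: Xm j by exact: XminusP.
  by rewrite evN lieZl lieZr -scalerDl.
- by case: (eqVneq k i) => [->|]; [right; rewrite (negPf ij) | left].
- by move/(_ i); rewrite eqxx.
- by rewrite eqxx.
Qed.

Lemma lie_sl2 i : sl2 (lie (Xp i)) (lie (Xm i)) (lie (H i)).
Proof.
split=> m /=.
- by rewrite lieJ Xplus_Xminus addrC.
- by rewrite lieJ coroot_lie_Xp sroot_coroot lieZl addrC.
- by rewrite lieJ coroot_lie_Xm sroot_coroot lieZl addrC scaleNr.
Qed.

End Structure.

(** * Lie's theorem for a nilpotent subalgebra *)

Section CommonEigenvector.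
Variables (K : numClosedFieldType) (g : fdLieAlgType K) (h : {vspace g}).
Hypotheses (hlie : forall x y, x \in h -> y \in h -> lie x y \in h)
  (hnil : exists n, forall (s : seq g) (y : g),
    size s = n -> {subset s <= h} -> y \in h -> foldr lie y s = 0).

Let hstable (U : {vspace g}) := {in h, forall y, {in U, forall x, lie y x \in U}}.

(** Lie's theorem for [h] acting on [E / P]: on a stable subspace [U] above [P] of least dimension
    every element of [h] acts by a scalar modulo [P]. *)
Lemma common_eigenvector (P E : {vspace g}) : (P <= E)%VS -> ~~ (E <= P)%VS ->
  hstable P -> hstable E -> exists x, [/\ x \in E, x \notin P &
    {in h, forall y, exists a, lie y x - a *: x \in P}].
Proof.
move=> PE nEP hP hE.
pose Q n := `[< exists U : {vspace g}, [/\ (P <= U)%VS, (U <= E)%VS, ~~ (U <= P)%VS, hstable U & \dim U = n] >].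
have exQ : exists n, Q n by exists (\dim E); apply/asboolP; exists E.
have [n /asboolP[U [PU UE nUP hU dU]] minU] := ex_minnP exQ.
(* Minimality in usable form: a linear condition that holds on [P] and at one vector of [U] outside
   [P], and that [h] preserves, holds on all of [U]. *)
have {minU} minU (S : g -> Prop) (x0 : g) : (forall x y, S x -> S y -> S (x + y)) ->
    (forall a x, S x -> S (a *: x)) -> {in P, forall x, S x} ->
    x0 \in U -> x0 \notin P -> S x0 -> {in h, forall y x, x \in U -> S x -> S (lie y x)} ->
    {in U, forall x, S x}.
  move=> SD SZ SP Ux0 Px0 Sx0 hS.
  have [|x y [Ux Sx] [Uy Sy]|a x [Ux Sx]|U' U'P] := @vspace_of K g (fun x => x \in U /\ S x).
  - by split; [exact: mem0v | apply: SP; exact: mem0v].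
  - by split; [exact: memvD | exact: SD].
  - by split; [exact: memvZ | exact: SZ].
  have U'U : (U' <= U)%VS by apply/subvP => x /U'P[].
  suff /eqP <- : U' == U by move=> x /U'P[].
  rewrite -(geq_leqif (dimv_leqif_eq U'U)) dU; apply: minU; apply/asboolP.
  exists U'; split=> //.
  - by apply/subvP => x xP; apply/U'P; split; [exact: (subvP PU) | exact: SP].
  - exact: subv_trans UE.
  - by apply/subvPn; exists x0 => //; apply/U'P.
  - by move=> y yh x /U'P[Ux Sx]; apply/U'P; split; [exact: hU | exact: hS].
have /subvPn[x0 x0U x0P] := nUP.
have [N hN] := hnil.
pose lc k z := exists s y, [/\ size s = k, {subset s <= h}, y \in h & z = foldr lie y s].
have lch k z : lc k z -> z \in h.
  move=> [s [y [_ sh yh ->]]]; elim: s sh => //= a s IHs sh; apply: hlie.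
    by apply: sh; rewrite inE eqxx.
  by apply: IHs => b bs; apply: sh; rewrite inE bs orbT.
(* Downward induction on the length of the bracket [z]. Its brackets with [h] act by scalars, which
   are zero because commutators are traceless; so [z] commutes with [h] modulo [P], and its
   eigenspace in [U], being stable, is everything. *)
have scalar d k z : (k + d)%N = N -> lc k z -> exists a, {in U, forall x, lie z x - a *: x \in P}.
  elim: d k z => [|d IHd] k z.
    rewrite addn0 => -> [s [y [sN sh yh ->]]]; rewrite hN //; exists 0 => x _.
    by rewrite lie0l scale0r subrr mem0v.
  move=> kd lz; have zh := lch _ _ lz.
  have comm y : y \in h -> {in U, forall x, lie (lie y z) x \in P}.
    move=> yh; have [||a aP] := IHd k.+1 (lie y z); first by rewrite addSnnS.
      have [s [y' [sk sh y'h ->]]] := lz; exists (y :: s), y'; split=> //=; first by rewrite sk.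
      by move=> b; rewrite inE => /orP[/eqP ->|/sh].
    have [r [u [phi [uU phiP phiu uE]]]] := basis_mod P (fun x => x \in U).
    have r0 : (0 < r)%N.
      case: r u phi uU phiP phiu uE => // u phi _ _ _ /(_ x0 x0U).
      by rewrite big_ord0 subr0 (negPf x0P).
    have := @trace_modC K g (fun x => x \in P) r u phi phiP (lie y) (lie z).
    move=> /(_ (hP _ yh) (hP _ zh)) tr.
    have {}tr : trace_mod u phi (lie (lie y z)) = 0.
      have -> : trace_mod u phi (lie (lie y z)) = trace_mod u phi (lie y \o lie z) - trace_mod u phi (lie z \o lie y).
        by rewrite -sumrB; apply: eq_bigr => i _ /=; rewrite lieJ linearD /= addrK.
      by rewrite tr ?subrr // => j; apply: uE; apply: hU.
    have : trace_mod u phi (lie (lie y z)) = r%:R * a.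
      rewrite /trace_mod (eq_bigr (fun=> a)) => [|i _].
        by rewrite sumr_const card_ord mulr_natl.
      have /(phiP i) := aP _ (uU i); rewrite linearB linearZ_LR /= phiu eqxx.
      by move/eqP; rewrite subr_eq0 => /eqP ->; exact: mulr1.
    rewrite tr => /esym/eqP; rewrite mulf_eq0 pnatr_eq0 eqn0Ngt r0 /= => /eqP a0.
    by move=> x /aP; rewrite a0 scale0r subr0.
  have [a [x1 [x1U x1P x1a]]] : exists a x1, [/\ x1 \in U, x1 \notin P & lie z x1 - a *: x1 \in P].
    have [s s0] := fd_tprod (lie z).
    have : tprod (lie z) s x0 \in P by rewrite s0 mem0v.
    elim: s {s0} x0 x0U x0P => [|a s IHs] x xU xP /=; first by rewrite (negPf xP).
    rewrite -tprodT -tprodZ -tprodB => sP.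
    have [x1P|x1P] := boolP (lie z x - a *: x \in P); first by exists a, x.
    by apply: IHs x1P sP; rewrite rpredB ?rpredZ // hU.
  exists a; apply: (minU _ x1) => //.
  - by move=> x y Sx Sy; rewrite linearD scalerDr opprD addrACA rpredD.
  - by move=> b x Sx; rewrite linearZ_LR /= scalerA mulrC -scalerA -scalerBr rpredZ.
  - by move=> x xP; rewrite rpredB ?rpredZ // hP.
  move=> y yh x xU Sx; rewrite lieJ.
  have -> : lie (lie z y) x + lie y (lie z x) - a *: lie y x = lie y (lie z x - a *: x) - lie (lie y z) x.
    by rewrite (lieC z y) lieNl !(linE (lie y)) /=; lmod K g.
  by rewrite rpredB ?comm // hP.
exists x0; split=> // [|y yh]; first exact: (subvP UE).
have [||a aP] := scalar N 0%N y; rewrite ?add0n //; last by exists a; exact: aP.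
by exists [::], y.
Qed.

(** Leibniz rule: on [lie y x] the operator [T] acts either as [ad y0] on [y] or as [T] on [x]. *)
Lemma gen_eigen_stable (y0 : g) a (T : {linear g -> g}) : (forall x, T x = lie y0 x - a *: x) ->
  forall m r i x y, (r + i)%N = m -> iter r T x = 0 -> iter i (lie y0) y = 0 -> iter m T (lie y x) = 0.
Proof.
move=> TE; elim=> [|m IHm] [|r] [|i] x y //= rim.
- by move=> -> _; rewrite lie0r.
- by move=> -> _; rewrite lie0r iter_lin0 linear0.
- by move=> _ ->; rewrite lie0l iter_lin0 linear0.
move=> rx iy; rewrite -[T (iter m _ _)]/(iter m.+1 T _) iterSr.
have -> : T (lie y x) = lie (lie y0 y) x + lie y (T x).
  by rewrite !TE lieJ !(linE (lie y)) /=; lmod K g.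
by rewrite iter_linD (IHm r.+1 i) ?(IHm r i.+1) ?addr0 -?iterSr //; lia.
Qed.

End CommonEigenvector.

Lemma submod_gen_sub (R : pzRingType) (M : lmodType R) (A B : set M) :
  (forall x, A x -> submod_gen B x) -> forall x, submod_gen A x -> submod_gen B x.
Proof.
move=> AB x; elim=> {x} [x /AB//||x y _ Bx _ By|a x _ Bx].
- exact: submod_gen0.
- exact: submod_genD.
- exact: submod_genZ.
Qed.

Section Structure.
Variables (K : numClosedFieldType) (g : fdLieAlgType K).
Hypothesis g_simple : lie_simple g.
Variable c : chevalley g.

Local Notation I := (node c).
Local Notation h := (cartan c).
Local Notation al := (sroot c).
Local Notation Xp := (Xplus c).
Local Notation Xm := (Xminus c).
Local Notation H := (coroot c).
Local Notation wt := (@wtv K g c).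

Let hlie := cartan_closed (@cartanP K g c).
Let hnil := cartan_nilpotent (@cartanP K g c).

(** [E] shifts the spectrum of [T] by [a]. Choosing [n] outside the finite set of spectral
    differences divided by [a], the spectrum shifted [n] times is disjoint from the original one. *)
Lemma shift_nilpotent (T E : {linear g -> g}) (a : K) : a != 0 ->
  (forall x, T (E x) = E (T x) + a *: E x) -> forall x, exists n, iter n E x = 0.
Proof.
move=> a0 TE x; have [s s0] := fd_tprod T.
have shift t (y : g) : tprod T [seq l + a | l <- t] (E y) = E (tprod T t y).
  by elim: t => //= l t ->; rewrite TE !(linE E) /=; lmod K g.
have shiftn n y : tprod T [seq l + a *+ n | l <- s] (iter n E y) = 0.
  elim: n y => [|n IHn] y; first by rewrite -[RHS](s0 y); congr tprod; rewrite -[RHS]map_id; apply: eq_map => l; rewrite mulr0n addr0.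
  rewrite iterSr; have -> : [seq l + a *+ n.+1 | l <- s] = [seq l + a | l <- [seq l + a *+ n | l <- s]].
    by rewrite -map_comp; apply: eq_map => l /=; rewrite mulrSr addrA.
  by rewrite -iterSr iterS shift IHn linear0.
have [n nP] : exists n, forall l, l \in s -> l + a *+ n \notin s.
  pose D := [seq (p.2 - p.1) / a | p <- [seq (l, k) | l <- s, k <- s]].
  have [n nD] : exists n : nat, n%:R \notin D.
    pose n := (size D).+1; apply: contrapT => /forallNP nn.
    have un : uniq [seq (k%:R : K) | k <- iota 0 n].
      by rewrite map_inj_uniq ?iota_uniq // => i j /eqP; rewrite eqr_nat => /eqP.
    have := @uniq_leq_size _ _ D un; rewrite size_map size_iota ltnn => sD.
    suff : false by []; apply: sD => _ /mapP[k _ ->].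
    by apply: contrapT => kD; apply: (nn k); apply/negP.
  exists n => l ls; apply: contra nD => ks; apply/mapP; exists (l, l + a *+ n).
    by apply/allpairsP; exists (l, l + a *+ n).
  by rewrite /= addrAC subrr add0r -(mulr_natl a n) mulfK.
exists n; apply: (@tprod_disjoint _ _ T [seq l + a *+ n | l <- s] s) => //.
by move=> _ /mapP[l ls ->]; exact: nP.
Qed.

Lemma Xp_nilpotent i x : exists n, iter n (lie (Xp i)) x = 0.
Proof.
apply: (@shift_nilpotent (lie (H i)) _ 2%:R) => [|y]; first by rewrite pnatr_eq0.
exact: sl2_HE (lie_sl2 i) y.
Qed.
Lemma Xm_nilpotent i x : exists n, iter n (lie (Xm i)) x = 0.
Proof.
apply: (@shift_nilpotent (lie (H i)) _ (- 2%:R)) => [|y]; first by rewrite oppr_eq0 pnatr_eq0.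
by rewrite (sl2_HF (lie_sl2 i)) scaleNr.
Qed.

Lemma coroot_comm i j x : lie (H i) (lie (H j) x) = lie (H j) (lie (H i) x).
Proof. by rewrite lieJ (coroot_central i (corootP j)) lie0l add0r. Qed.

(** Weights for the coroots alone. These are diagonalizable through their sl2 triples, while of [h]
    itself only nilpotency is known; that the coroots span [h] comes out in [cartan_coroots]. *)
Definition hwt (nu : I -> K) (x : g) := forall i, lie (H i) x = nu i *: x.

Lemma hwt_decomp (S : g -> Prop) x : (forall x y, S x -> S y -> S (x + y)) ->
  (forall a x, S x -> S (a *: x)) -> (forall i x, S x -> S (lie (H i) x)) -> S x ->
  submod_gen [set v | exists2 nu, S v & hwt nu v] x.
Proof.
move=> SD SZ SH Sx.
suff {x Sx} ind (l : seq I) : forall x, S x ->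
    submod_gen [set v | S v /\ forall i, i \in l -> exists a, lie (H i) v = a *: v] x.
  elim: (ind (enum I) x Sx) => {x Sx} [x [Sx ex]||x y _ IHx _ IHy|a x _ IHx].
  - have [nu nuP] := choice (fun i => ex i (mem_enum _ i)).
    by apply: submod_gen_in; exists nu.
  - exact: submod_gen0.
  - exact: submod_genD.
  - exact: submod_genZ.
elim: l => [|i l IHl] x Sx; first by apply: submod_gen_in.
apply: submod_gen_sub (IHl x Sx) => {x Sx} x [Sx ex].
(* [S'] remembers the eigenvalues of [x] for the coroots already treated, so that decomposing for
   [H i] preserves them. *)
pose S' v := S v /\ forall j, j \in l -> forall a, lie (H j) x = a *: x -> lie (H j) v = a *: v.
have [s s0] := fd_tprod (lie (H i)).
have gen : submod_gen [set v | S' v /\ exists a, lie (H i) v = a *: v] x.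
  apply: (@eigen_sum K g (lie (H i)) S' _ _ _ _ s x _ (s0 x)) => [y z [Sy ey] [Sz ez]|a y [Sy ey]|y [Sy ey]|a y _|].
  - by split=> [|j jl b xb]; [exact: SD | rewrite lieDr (ey j jl b) // (ez j jl b) // scalerDr].
  - split=> [|j jl b xb]; first exact: SZ.
    by rewrite lieZr (ey j jl b) // !scalerA mulrC.
  - split=> [|j jl b xb]; first exact: SH.
    by rewrite coroot_comm (ey j jl b) // lieZr.
  - exact: (sl2_semisimple (lie_sl2 i) (Xp_nilpotent i) (Xm_nilpotent i)).
  - by split.
apply: submod_gen_sub gen => v [[Sv ev] ei]; apply: submod_gen_in; split=> // j.
rewrite inE => /orP[/eqP -> //|jl]; have [a xa] := ex j jl; exists a.
exact: ev.
Qed.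

Lemma eigen_dual x : x <> 0 -> {in h, forall y, exists a, lie y x = a *: x} ->
  exists b : dual h, root_space b x.
Proof.
move=> /eqP x0 ex.
have [f fP] : exists f : g -> K, {in h, forall y, lie y x = f y *: x}.
  have [f fP] := choice (fun y => match pselect (y \in h) with
    | left yh => let: ex_intro a e := ex y yh in ex_intro (fun a => y \in h -> lie y x = a *: x) a (fun=> e)
    | right nyh => ex_intro _ 0 (fun yh => False_ind _ (nyh yh)) end).
  by exists f => y yh; exact: fP.
have inj (a b : K) : a *: x = b *: x -> a = b.
  by move/eqP; rewrite -subr_eq0 -scalerBl scaler_eq0 (negPf x0) orbF subr_eq0 => /eqP.
have [y z yh zh|a y yh|b bP] := @dual_of K g h f.
- by apply: inj; rewrite -fP ?rpredD // lieDl !fP // scalerDl.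
- by apply: inj; rewrite -fP ?rpredZ // lieZl fP // scalerA.
by exists b => y yh; rewrite bP // fP.
Qed.

Lemma root_of_stable (E : {vspace g}) : (E != 0)%VS ->
  {in h, forall y, {in E, forall x, lie y x \in E}} ->
  exists (b : dual h) x, [/\ x \in E, x <> 0, root_space b x & b = 0 \/ is_root b].
Proof.
move=> E0 hE; have [|||y yh x|x [xE x0 ex]] := @common_eigenvector K g h hlie hnil 0%VS E.
- exact: sub0v.
- by rewrite subv0.
- by move=> y yh x; rewrite memv0 => /eqP ->; rewrite lie0r mem0v.
- exact: hE.
rewrite memv0 in x0; have [b bx] : exists b : dual h, root_space b x.
  apply: eigen_dual => [|y yh]; first exact/eqP.
  by have [a] := ex y yh; rewrite memv0 subr_eq0 => /eqP ?; exists a.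
exists b, x; split=> //; first exact/eqP.
by have [b0|b0] := EM (b = 0); [left | right; split=> //; exists x => //; exact/eqP].
Qed.

(** The vectors of coroot weight [nu] form an [h]-stable space, because coroots are central in [h].
    A common eigenvector in it has weight zero or a root, which then determines [nu]. *)
Lemma hwt_root nu x : x <> 0 -> hwt nu x -> (forall i, nu i = 0) \/
  exists n, (exists i, n i <> 0%N) /\
    ((forall i, nu i = wt n (H i)) \/ (forall i, nu i = - wt n (H i))).
Proof.
move=> x0 wx.
have [|u v wu wv i|a u wu i|E EP] := @vspace_of K g (hwt nu).
- by move=> i; rewrite lie0r scaler0.
- by rewrite lieDr wu wv scalerDr.
- by rewrite lieZr wu !scalerA mulrC.
have [||b [z [zE z0 bz b0]]] := @root_of_stable E.
- by apply: contra_not_neq x0 => E0; apply/eqP; rewrite -memv0 -E0; apply/EP.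
- move=> y yh u /EP wu; apply/EP => i.
  by rewrite lieJ coroot_central // lie0l add0r wu lieZr.
have nub i : nu i = ev b (H i).
  apply/eqP; rewrite -subr_eq0; have /EP/(_ i) := zE; rewrite bz ?corootP // => /eqP.
  by rewrite eq_sym -subr_eq0 -scalerBl scaler_eq0 => /orP[//|/eqP].
case: b0 nub => [->|/root_sign[n [ni nb]]] nub; first by left=> i; rewrite nub ev0.
right; exists n; split=> //.
by case: nb => nb; [left | right] => i; rewrite nub nb.
Qed.

Lemma central_eq0 (x : g) : (forall y, lie y x = 0) -> x = 0.
Proof.
move=> cx; have [[y [z yz]] simple] := g_simple.
have [y1 z1|J0|Jf] := simple <[x]>%VS.
- by move=> /vlineP[a ->]; rewrite lieZr cx scaler0 mem0v.
- by apply/eqP; rewrite -memv0 -J0 memv_line.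
case: yz; have /vlineP[a ->] : z \in <[x]>%VS by rewrite Jf memvf.
by rewrite lieZr cx scaler0.
Qed.

(** Weights of [hwt] vectors are combinations of simple roots, so the corresponding combination of
    coroots kills all of them; it is central, hence zero, and the fundamental weights read off its
    coefficients. *)
Lemma cartan_mx_inj (d : I -> K) :
  (forall j, \sum_i d i * ev (al j) (H i) = 0) -> forall i, d i = 0.
Proof.
move=> d0; have Hd0 : \sum_i d i *: H i = 0.
  apply: central_eq0 => x; rewrite lieC; apply/eqP; rewrite oppr_eq0; apply/eqP.
  have : submod_gen [set v | exists2 nu, True & hwt nu v] x by apply: hwt_decomp.
  elim=> {x} [x [nu _ wx]||x y _ x0 _ y0|a x _ x0]; rewrite ?lie0r ?lieDr ?lieZr ?x0 ?y0 ?addr0 ?scaler0 //.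
  have [-> //|/eqP x0] := eqVneq x 0; first by rewrite lie0r.
  have dE : lie (\sum_i d i *: H i) x = (\sum_i d i * nu i) *: x.
    by rewrite lie_suml scaler_suml; apply: eq_bigr => i _; rewrite lieZl wx scalerA.
  rewrite dE.
  have dn n : \sum_i d i * wt n (H i) = 0.
    under eq_bigr do rewrite mulr_sumr; rewrite exchange_big big1 // => j _.
    rewrite -[RHS](mulr0 (n j)%:R) -[in RHS](d0 j) mulr_sumr.
    by apply: eq_bigr => i _; rewrite mulrCA.
  case: (hwt_root x0 wx) => [nu0|[n [_ [nun|nun]]]].
  - by rewrite big1 ?scale0r // => i _; rewrite nu0 mulr0.
  - by rewrite (eq_bigr _ (fun i _ => congr1 (fun t => d i * t) (nun i))) dn scale0r.
  rewrite (eq_bigr (fun i => - (d i * wt n (H i)))) => [|i _]; last by rewrite nun mulrN.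
  by rewrite sumrN dn oppr0 scale0r.
move=> i; have := ev0r (fweight c i); rewrite -Hd0 ev_sumr (bigD1 i) //= evZr fweightP eqxx mulr1.
by rewrite big1 ?addr0 // => j ji; rewrite evZr fweightP eq_sym (negPf ji) mulr0.
Qed.

Let A : 'M[K]_#|I| := \matrix_(i, j) ev (al (enum_val j)) (H (enum_val i)).

Let sum_enum_val (F : I -> K) : \sum_(k < #|I|) F (enum_val k) = \sum_i F i.
Proof. by rewrite [RHS](reindex (@enum_val _ I)) //; exact/onW_bij/enum_val_bij. Qed.

Let A_unit : A \in unitmx.
Proof.
rewrite -row_free_unit; apply: inj_row_free => v vA; apply/rowP => k; rewrite mxE.
have := @cartan_mx_inj (fun i => v 0 (enum_rank i)) _ (enum_val k); rewrite enum_valK; apply=> j.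
have /rowP/(_ (enum_rank j)) := vA; rewrite !mxE => e.
rewrite -sum_enum_val -[RHS]e; apply: eq_bigr => i _.
by rewrite mxE enum_rankK enum_valK.
Qed.

Lemma cartan_mx_injT (a : I -> K) :
  (forall i, \sum_j a j * ev (al j) (H i) = 0) -> forall j, a j = 0.
Proof.
move=> a0 j; pose v : 'cV[K]_#|I| := \col_k a (enum_val k).
have Av : A *m v = 0.
  apply/colP => i; rewrite !mxE -[RHS](a0 (enum_val i)) -sum_enum_val.
  by apply: eq_bigr => k _; rewrite !mxE mulrC.
have : v = 0 by rewrite -(mulKmx A_unit v) Av mulmx0.
by move/colP/(_ (enum_rank j)); rewrite !mxE enum_rankK.
Qed.

Lemma wtv_coroot_inj n k : (forall i, wt n (H i) = wt k (H i)) -> n =1 k.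
Proof.
move=> e i; apply/eqP; rewrite -(eqr_nat K) -subr_eq0; apply/eqP; move: i.
apply: cartan_mx_injT => i; rewrite (eq_bigr _ (fun j _ => mulrBl _ _ _)) sumrB.
by apply/eqP; rewrite subr_eq0; apply/eqP; exact: e.
Qed.

Lemma coweight_exists : exists y : I -> g,
  (forall i, exists d : I -> K, y i = \sum_k d k *: H k) /\
  forall i j, ev (al j) (y i) = (i == j)%:R.
Proof.
exists (fun i => \sum_k invmx A (enum_rank i) (enum_rank k) *: H k); split=> [i|i j].
  by exists (fun k => invmx A (enum_rank i) (enum_rank k)).
rewrite ev_sumr -sum_enum_val.
have /matrixP/(_ (enum_rank i) (enum_rank j)) := mulVmx A_unit.
rewrite !mxE (inj_eq enum_rank_inj) => <-; apply: eq_bigr => k _.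
by rewrite evZr !mxE enum_rankK enum_valK.
Qed.

(** Otherwise Lie's theorem gives an eigenvector [x0] of the centralizer modulo [h]. As [h] is its
    own normalizer, some [y0] in [h] has a nonzero eigenvalue [a] on it. Since [ad y0] is nilpotent
    on [h], the operator [T = ad y0 - a] is invertible there, so [x0] can be corrected to a true
    root vector; its root would vanish on all coroots. *)
Lemma coroot_centralizer x : (forall i, lie (H i) x = 0) -> x \in h.
Proof.
have [|u v wu wv i|a u wu i|Q QP] := @vspace_of K g (fun x => forall i, lie (H i) x = 0).
- by move=> i; rewrite lie0r.
- by rewrite lieDr wu wv addr0.
- by rewrite lieZr wu scaler0.
move=> /QP; move: x; apply/subvP; apply: contrapT => /negP nQh.
have hQ : (h <= Q)%VS by apply/subvP => y yh; apply/QP => i; exact: coroot_central.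
have [|y yh x /QP Qx|x0 [x0Q x0h ex]] := common_eigenvector hlie hnil hQ nQh.
- by move=> y yh x; exact: hlie.
- by apply/QP => i; rewrite lieJ coroot_central // lie0l Qx lie0r addr0.
have [y0 [y0h y0x]] : exists y0, y0 \in h /\ lie y0 x0 \notin h.
  apply: contrapT => /forallNP ne; case/negP: x0h.
  apply: (cartan_normalizer (cartanP c)) => y yh; rewrite lieC rpredN.
  by apply: contrapT => /negP yx; apply: (ne y).
have [a ax0] := ex y0 y0h.
have a0 : a != 0 by apply: contraNneq y0x => a0; rewrite a0 scale0r subr0 in ax0.
have lT : linear (fun x => lie y0 x - a *: x).
  by move=> b x y; rewrite lieDr lieZr; set u := lie _ x; lmod K g.
pose T : {linear g -> g} := mklin lT.
have [N hN] := hnil.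
have y0N z : z \in h -> iter N (lie y0) z = 0.
  move=> zh; rewrite -[RHS](hN (nseq N y0) z) ?size_nseq //.
    by elim: (N) => //= n ->.
  by move=> u /nseqP[->].
have Th z : z \in h -> T z \in h by move=> zh; rewrite rpredB ?rpredZ //= hlie.
have tN n z : tprod T (nseq n (- a)) z = iter n (lie y0) z.
  by elim: n z => //= n IHn z; rewrite IHn scaleNr opprK subrK.
have aN n : 0 \notin nseq n (- a) by rewrite mem_nseq negb_and eq_sym oppr_eq0 a0 orbT.
have Tinj z : z \in h -> T z = 0 -> z = 0.
  move=> zh Tz; apply: (@tprod_eigen_eq0 _ _ T (nseq N (- a)) z 0) => //.
    by rewrite Tz scale0r.
  by rewrite tN y0N.
have Tonto w : w \in h -> exists2 z, z \in h & T z = w.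
  move=> wh; apply: (@tprod_onto _ _ T (nseq N (- a)) (fun z => z \in h)) => //.
  - by move=> u v; exact: rpredD.
  - by move=> b u; exact: rpredZ.
  - by rewrite tN y0N.
have [z zh Tz] := Tonto _ ax0.
pose x := x0 - z; have Tx : T x = 0 by rewrite linearB Tz subrr.
have xh : x \notin h by apply: contra x0h => xh; rewrite -(subrK z x0) rpredD.
have x_neq0 : x <> 0 by move=> x_0; rewrite x_0 mem0v in xh.
(* The error [lie y x - e *: x] lies in [h] and is killed by a power of [T], which is injective on
   [h]. *)
have [b bx] : exists b : dual h, root_space b x.
  apply: eigen_dual => // y yh; have [e ye] := ex y yh.
  exists e; apply/subr0_eq; have vh : lie y x - e *: x \in h.
    have -> : lie y x - e *: x = lie y x0 - e *: x0 - (lie y z - e *: z).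
      by rewrite /x lieBr; lmod K g.
    by rewrite rpredB // rpredB ?rpredZ // hlie.
  have Tv : iter (1 + N) T (lie y x - e *: x) = 0.
    rewrite iter_linB iter_linZ (@gen_eigen_stable K g y0 a T (fun=> erefl) (1 + N) 1 N) ?y0N //.
    by rewrite iterSr Tx iter_lin0 scaler0 subr0.
  elim: (1 + N)%N vh Tv => [//|n IHn] vh; rewrite iterS => Tv; apply: IHn => //.
  apply: Tinj => //; elim: (n) => //= k; exact: Th.
have y0b : ev b y0 = a.
  apply/eqP; rewrite -subr_eq0; move/eqP: Tx; rewrite /= bx // -scalerBl scaler_eq0.
  by move=> /orP[//|/eqP].
have [n [[i ni] nb]] : exists n, (exists i, n i <> 0%N) /\
  ((forall y, ev b y = wt n y) \/ (forall y, ev b y = - wt n y)).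
  apply: root_sign; split=> [b0|]; last by exists x.
  by move: a0; rewrite -y0b b0 ev0 eqxx.
have xQ : forall i, lie (H i) x = 0.
  by apply/QP; rewrite rpredB // (subvP hQ).
case: ni; apply: (@wtv_coroot_inj n (fun=> 0%N)) => j.
have bH : ev b (H j) = 0.
  apply/eqP; have := xQ j; rewrite bx ?corootP // => /eqP; rewrite scaler_eq0.
  by move=> /orP[//|/eqP].
rewrite [RHS]big1 => [|k _]; last by rewrite mul0r.
by apply/eqP; case: nb bH => -> => [->|/eqP]; rewrite ?oppr_eq0.
Qed.

End Structure.

(** * Generation by simple root vectors and triangular decomposition *)

Section Triangular.
Variables (K : numClosedFieldType) (g : fdLieAlgType K).
Hypothesis g_simple : lie_simple g.
Variable c : chevalley g.

Local Notation I := (node c).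
Local Notation h := (cartan c).
Local Notation al := (sroot c).
Local Notation H := (coroot c).
Local Notation wt := (@wtv K g c).

Let hlie := cartan_closed (@cartanP K g c).
Let hnil := cartan_nilpotent (@cartanP K g c).

Definition Xpm (s : bool) (i : I) : g := if s then Xplus c i else Xminus c i.
Definition sgb (s : bool) : K := if s then 1 else - 1.

Lemma sgbN s : sgb (~~ s) = - sgb s.
Proof. by case: s; rewrite //= opprK. Qed.
Lemma sgbK s : sgb s * sgb s = 1.
Proof. by case: s; rewrite /= ?mulrNN mulr1. Qed.

Lemma XpmP s i : {in h, forall y, lie y (Xpm s i) = (sgb s * ev (al i) y) *: Xpm s i}.
Proof.
move=> y yh; case: s; rewrite /= ?mul1r ?mulN1r; first exact: XplusP.
by rewrite -evN; exact: XminusP.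
Qed.

Lemma Xpm_lie s i : lie (Xpm s i) (Xpm (~~ s) i) = sgb s *: H i.
Proof.
by case: s; rewrite /= ?scale1r ?scaleN1r -Xplus_Xminus // lieC.
Qed.

Lemma Xpm_lieN s i : lie (Xpm (~~ s) i) (Xpm s i) = - sgb s *: H i.
Proof. by rewrite lieC Xpm_lie scaleNr. Qed.

Lemma Xpm_lie_neq s i j : i != j -> lie (Xpm s i) (Xpm (~~ s) j) = 0.
Proof.
move=> ij; case: s => /=; first exact: Xp_Xm.
by rewrite lieC Xp_Xm ?oppr0 // eq_sym.
Qed.

Lemma wt0 y : wt (fun=> 0%N) y = 0.
Proof. by rewrite /wtv big1 // => i _; rewrite mul0r. Qed.

(* One step of the generation argument: modulo a subalgebra P containing h and
   the simple root vectors, the weights of sign s are permuted by each simple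
   sl2, so the trace of each coroot vanishes. *)
Lemma generation_sign (P : {vspace g}) s : (h <= P)%VS ->
  (forall s i, {in P, forall x, lie (Xpm s i) x \in P}) ->
  forall n x, (exists i, n i <> 0%N) -> hwt (fun i => sgb s * wt n (H i)) x -> x \in P.
Proof.
move=> hP XP n0 x0 n0P wx0.
pose W x := exists2 n, (exists i, n i <> 0%N) & hwt (fun i => sgb s * wt n (H i)) x.
have [r [u [phi [uW phiP phiu uE]]]] := basis_mod P W.
have uW' k : exists n, (exists i, n i <> 0%N) /\ hwt (fun i => sgb s * wt n (H i)) (u k).
  by have [n ? ?] := uW k; exists n.
have [n nW] := choice uW'; have n_0 k := (nW k).1; have wu k := (nW k).2.
have stepE i j : lie (Xpm s i) (u j) - \sum_k (phi k (lie (Xpm s i) (u j)) : K) *: u k \in P.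
  apply: uE; exists (fun k => n j k + (k == i))%N.
    by exists i; rewrite eqxx addn1.
  move=> k; rewrite lieJ XpmP ?corootP // wu lieZl lieZr -scalerDl -mulrDr addrC.
  by rewrite wtvD wtv_delta.
have stepF i j : lie (Xpm (~~ s) i) (u j) - \sum_k (phi k (lie (Xpm (~~ s) i) (u j)) : K) *: u k \in P.
  set x := lie _ _; have [->|/eqP x_0] := eqVneq x 0.
    by rewrite big1 ?subrr ?mem0v // => k _; rewrite linear0 scale0r.
  have wx : hwt (fun k => sgb s * (wt (n j) (H k) - ev (al i) (H k))) x.
    move=> k; rewrite lieJ XpmP ?corootP // wu lieZl lieZr -scalerDl sgbN.
    by congr (_ *: _); ring.
  have inP : x \in P -> x - \sum_k (phi k x : K) *: u k \in P.
    by move=> xP; rewrite big1 ?subr0 // => k _; rewrite phiP ?scale0r.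
  case: (hwt_root x_0 wx) => [w0|[k [[l kl] wk]]].
    by apply/inP/(subvP hP)/coroot_centralizer => // k; rewrite wx w0 scale0r.
  have {}wk : (forall t, wt (n j) (H t) - ev (al i) (H t) = wt k (H t)) \/
      (forall t, wt (n j) (H t) - ev (al i) (H t) = - wt k (H t)).
    by case: (s) wk => /= -[] wk; [left|right|right|left] => t; have := wk t; rewrite ?mul1r ?mulN1r // => /eqP; rewrite ?eqr_opp ?eqr_oppLR ?opprK => /eqP.
  case: wk => wk.
    by apply: uE; exists k; [exists l | move=> t; rewrite wx wk].
  have e : (fun t => n j t + k t)%N =1 (fun t => (t == i) : nat).
    apply: (wtv_coroot_inj g_simple) => t; rewrite wtvD wtv_delta.
    by apply/eqP; rewrite -[wt k _]opprK -wk opprB addrCA subrr addr0.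
  have [t nt] := n_0 j.
  have et := e t; have el := e l; case: eqP et => [ti|] et; last by move: nt et; lia.
  have lt : l = t.
    by case: (eqVneq l i) el => [->|_]; [rewrite ti | move: kl => /[swap]; lia].
  by move: nt et kl; rewrite lt; lia.
have trace0 i : \sum_k wt (n k) (H i) = 0.
  have := @trace_modC K g (fun x => x \in P) r u phi phiP (lie (Xpm s i)) (lie (Xpm (~~ s) i)).
  move=> /(_ (XP s i) (XP (~~ s) i) (stepE i) (stepF i)) /eqP; rewrite -subr_eq0 -sumrB => /eqP tr.
  rewrite -[RHS]tr.
  apply: eq_bigr => k _; rewrite -linearB /= lieJ addrK Xpm_lie lieZl linearZ_LR wu linearZ_LR phiu eqxx.
  by rewrite /GRing.scale /= mulr1 mulrA sgbK mul1r.
(* The traces say that the sum of the weights modulo [P] vanishes on all coroots, so it is zero; but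
   it is a sum of nonzero vectors of natural numbers, so there are none. *)
have N0 : (fun j => \sum_k n k j)%N =1 (fun=> 0%N).
  apply: (wtv_coroot_inj g_simple) => i; rewrite wt0 -[RHS](trace0 i) /wtv exchange_big.
  by apply: eq_bigr => j _; rewrite natr_sum mulr_suml.
have [r0|r0] := posnP r.
  have := uE x0; rewrite big1 => [|k _]; last by have := ltn_ord k; rewrite [X in (_ < X)%N]r0.
  by rewrite subr0; apply; exists n0.
have [t nt] := n_0 (Ordinal r0); have /eqP := N0 t; rewrite sum_nat_eq0 => /forallP/(_ (Ordinal r0)) /eqP.
by move/nt.
Qed.

Lemma generation (P : g -> Prop) : (forall x y, P x -> P y -> P (x + y)) ->
  (forall a x, P x -> P (a *: x)) -> {in h, forall y, P y} ->
  (forall s i, P (Xpm s i)) -> (forall x y, P x -> P y -> P (lie x y)) ->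
  forall x, P x.
Proof.
move=> PD PZ Ph PX Plie x.
have [|U UP] := @vspace_of K g P _ PD PZ; first exact/Ph/mem0v.
apply/UP; have : submod_gen [set v | exists2 nu, True & @hwt _ _ c nu v] x by apply: hwt_decomp.
have hU : (h <= U)%VS by apply/subvP => y /Ph/UP.
have XU s i : {in U, forall x, lie (Xpm s i) x \in U}.
  by move=> y /UP Py; apply/UP/Plie.
elim=> {x} [x [nu _ wx]||x y _ x0 _ y0|a x _ x0]; rewrite ?mem0v ?rpredD ?rpredZ //.
have [->|/eqP x0] := eqVneq x 0; first exact: mem0v.
case: (hwt_root x0 wx) => [nu0|[n [n0 nun]]].
  by apply/(subvP hU)/coroot_centralizer => // k; rewrite wx nu0 scale0r.
case: nun => nun; [apply: (@generation_sign U true hU XU n x n0) | apply: (@generation_sign U false hU XU n x n0)].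
  by move=> i; rewrite wx nun mul1r.
by move=> i; rewrite wx nun mulN1r.
Qed.

(** Iterated brackets with one generator added at a time: in this form the bracket with an opposite
    generator can be computed by induction. *)
Inductive npart (s : bool) : g -> Prop :=
| npart_X i : npart s (Xpm s i)
| npart_0 : npart s 0
| npart_D x y : npart s x -> npart s y -> npart s (x + y)
| npart_Z a x : npart s x -> npart s (a *: x)
| npart_lie i x : npart s x -> npart s (lie (Xpm s i) x).

Lemma npart_h s x : npart s x -> {in h, forall y, npart s (lie y x)}.
Proof.
elim=> {x} [i||x x' _ IHx _ IHx'|a x _ IHx|i x npx IHx] y yh.
- by rewrite XpmP //; apply: npart_Z; exact: npart_X.
- by rewrite lie0r; exact: npart_0.
- by rewrite lieDr; apply: npart_D; auto.
- by rewrite lieZr; apply: npart_Z; auto.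
by rewrite lieJ XpmP // lieZl; apply: npart_D; [apply: npart_Z | ]; apply: npart_lie; auto.
Qed.

Lemma npart_X_h s i y : y \in h -> npart s (lie (Xpm s i) y).
Proof.
move=> yh; rewrite lieC XpmP // -scaleNr; exact/npart_Z/npart_X.
Qed.

Let tri (x : g) := exists d y z, [/\ npart true y, npart false z & x = \sum_i d i *: H i + y + z].

Let triD x x' : tri x -> tri x' -> tri (x + x').
Proof.
move=> [d [y [z [py pz ->]]]] [d' [y' [z' [py' pz' ->]]]].
exists (fun i => d i + d' i), (y + y'), (z + z'); split; rewrite ?(npart_D) //.
- exact: npart_D.
- exact: npart_D.
rewrite (eq_bigr _ (fun i _ => scalerDl _ _ _)) big_split /=.
by rewrite addrACA [X in X + _]addrACA.
Qed.

Let triZ a x : tri x -> tri (a *: x).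
Proof.
move=> [d [y [z [py pz ->]]]]; exists (fun i => a * d i), (a *: y), (a *: z).
split; [exact: npart_Z | exact: npart_Z |].
by rewrite !scalerDr scaler_sumr; congr (_ + _ + _); apply: eq_bigr => i _; rewrite scalerA.
Qed.

Let tri_npart s x : npart s x -> tri x.
Proof.
move=> px; exists (fun=> 0); rewrite big1 => [|i _]; last by rewrite scale0r.
case: s px => px; [exists x, 0 | exists 0, x]; split; rewrite ?add0r ?addr0 //; exact: npart_0.
Qed.

Let tri_H i : tri (H i).
Proof.
exists (fun j => (j == i)%:R), 0, 0; split; rewrite ?addr0; [exact: npart_0 | exact: npart_0 |].
rewrite (bigD1 i) //= eqxx scale1r big1 ?addr0 // => j /negPf ->.
by rewrite scale0r.
Qed.

Let tri0 : tri 0.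
Proof. exact: tri_npart (npart_0 true). Qed.

Let half s x := exists d y, npart s y /\ x = \sum_i d i *: H i + y.

Let halfD s x x' : half s x -> half s x' -> half s (x + x').
Proof.
move=> [d [y [py ->]]] [d' [y' [py' ->]]].
exists (fun i => d i + d' i), (y + y'); split; first exact: npart_D.
by rewrite (eq_bigr _ (fun i _ => scalerDl _ _ _)) big_split addrACA.
Qed.

Let halfZ s a x : half s x -> half s (a *: x).
Proof.
move=> [d [y [py ->]]]; exists (fun i => a * d i), (a *: y); split; first exact: npart_Z.
by rewrite scalerDr scaler_sumr; congr (_ + _); apply: eq_bigr => i _; rewrite scalerA.
Qed.

Let half_npart s x : npart s x -> half s x.
Proof.
move=> px; exists (fun=> 0), x; split=> //.
by rewrite big1 ?add0r // => i _; rewrite scale0r.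
Qed.

Let half_H s i : half s (H i).
Proof.
exists (fun j => (j == i)%:R), 0; split; first exact: npart_0.
rewrite addr0 (bigD1 i) //= eqxx scale1r big1 ?addr0 // => j /negPf ->.
by rewrite scale0r.
Qed.

Let sum_H d : \sum_i d i *: H i \in h.
Proof. by apply: memv_suml => i _; exact/memvZ/corootP. Qed.

(** An opposite generator meets its partner in a multiple of a coroot and commutes with the other
    generators, so it moves [npart s] at most into [h + npart s]. *)
Let half_X s i y : npart s y -> half s (lie (Xpm (~~ s) i) y).
Proof.
have h0 : half s 0 by apply/half_npart/npart_0.
elim=> {y} [j||y z _ ty _ tz|a y _ ty|j y py ty].
- have [<-|ij] := eqVneq i j; first by rewrite Xpm_lieN; exact/halfZ/half_H.
  by rewrite lieC Xpm_lie_neq ?oppr0 // eq_sym.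
- by rewrite lie0r.
- by rewrite lieDr; exact: halfD.
- by rewrite lieZr; exact: halfZ.
rewrite lieJ; apply: halfD.
  have [<-|ij] := eqVneq i j.
    by rewrite Xpm_lieN lieZl; exact/halfZ/half_npart/npart_h/corootP.
  by rewrite [lie (Xpm _ _) _]lieC Xpm_lie_neq ?oppr0 ?lie0l // eq_sym.
have [d [u [pu ->]]] := ty; rewrite lieDr; apply/half_npart/npart_D.
  exact/npart_X_h/sum_H.
exact: npart_lie.
Qed.

Let half_tri s x : half s x -> tri x.
Proof.
case: s => -[d [y [py ->]]]; [exists d, y, 0 | exists d, 0, y]; rewrite addr0.
  by split=> //; exact: npart_0.
by split=> //; exact: npart_0.
Qed.

Let tri_X s i x : tri x -> tri (lie (Xpm s i) x).
Proof.
move=> [d [y [z [py pz ->]]]]; rewrite !lieDr; apply: triD; first apply: triD.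
- exact/tri_npart/npart_X_h/sum_H.
- by case: s; [exact/tri_npart/npart_lie | exact: half_tri (half_X i py)].
- by case: s; [exact: half_tri (half_X i pz) | exact/tri_npart/npart_lie].
Qed.

Let tri_h x y : y \in h -> tri x -> tri (lie y x).
Proof.
move=> yh [d [u [v [pu pv ->]]]]; rewrite !lieDr; apply: triD; first apply: triD.
- rewrite lie_sumr big1 => [|i _]; first exact: tri0.
  by rewrite lieZr lieC coroot_central // oppr0 scaler0.
- exact/(tri_npart (s := true))/npart_h.
- exact/(tri_npart (s := false))/npart_h.
Qed.

(** Without nodes the condition in [coroot_centralizer] is void, so [h] would be all of [g]; a
    common eigenvector could only have weight zero and would be central. *)
Lemma node_exists : exists i : I, True.
Proof.
apply: contrapT => noI'; have noI : forall i : I, False by move=> i; apply: noI'; exists i.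
have gh z : z \in h by apply: coroot_centralizer => // i; case: (noI i).
have [y [z yz]] := g_simple.1.
have [||b [v [_ v0 bv b0]]] := @root_of_stable K g c (fullv).
- by apply: contra_not_neq yz => f0; apply/eqP; rewrite -memv0 -f0 memvf.
- by move=> y' _ u _; exact: memvf.
case: v0; apply: (central_eq0 g_simple) => u; rewrite bv //.
case: b0 => [->|/root_sign[n [[i _] _]]]; last by case: (noI i).
by rewrite ev0 scale0r.
Qed.

(** Sums of the three parts form an ideal, since [generation] reduces stability to the generators;
    this ideal contains a coroot, so it is all of [g]. *)
Let tri_all x : tri x.
Proof.
have Zall z u : tri u -> tri (lie z u).
  move: z u; apply: generation => [z z' Pz Pz' u tu|a z Pz u tu|z zh u tu|s i u tu|z z' Pz Pz' u tu].
  - by rewrite lieDl; apply: triD; auto.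
  - by rewrite lieZl; apply: triZ; auto.
  - exact: tri_h.
  - exact: tri_X.
  rewrite -[lie (lie z z') u](addrK (lie z' (lie z u))) -lieJ -scaleN1r.
  by apply: triD; [|apply: triZ]; auto.
have [U UP] := vspace_of tri0 triD triZ.
have [y z /UP tz|U0|Uf] := g_simple.2 U; first exact/UP/Zall; last by apply/UP; rewrite Uf memvf.
have [i _] := node_exists.
by case: (@coroot_neq0 _ _ c i); apply/eqP; rewrite -memv0 -U0; exact/UP/tri_H.
Qed.

Definition root_vec s (n : I -> nat) (v : g) := {in h, forall y, lie y v = (sgb s * wt n y) *: v}.

Lemma npart_root s x : npart s x ->
  submod_gen [set v | exists2 n, (exists i, n i <> 0%N) & root_vec s n v] x.
Proof.
elim=> {x} [i||x y _ IHx _ IHy|a x _ IHx|i x _ IHx].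
- apply: submod_gen_in; exists (fun j => (j == i) : nat); first by exists i; rewrite eqxx.
  by move=> y yh; rewrite wtv_delta XpmP.
- exact: submod_gen0.
- exact: submod_genD.
- exact: submod_genZ.
elim: IHx => {x} [x [n [j nj] wx]||x y _ IHx _ IHy|a x _ IHx].
- apply: submod_gen_in; exists (fun k => (k == i) + n k)%N; first by exists j; lia.
  by move=> y yh; rewrite lieJ XpmP // (wx y yh) lieZl lieZr -scalerDl -mulrDr wtvD wtv_delta.
- by rewrite lie0r; exact: submod_gen0.
- by rewrite lieDr; exact: submod_genD.
- by rewrite lieZr; exact: submod_genZ.
Qed.

(** This element separates the triangular decomposition: its eigenvalues on the three parts are
    zero, positive integers and negative integers. *)
Lemma height_exists : exists y, [/\ exists d, y = \sum_i d i *: H i, forall j, ev (al j) y = 1 &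
  forall n, wt n y = (\sum_i n i)%:R].
Proof.
have [y [yd yal]] := coweight_exists g_simple c.
have ay j : ev (al j) (\sum_i y i) = 1.
  rewrite ev_sumr (bigD1 j) //= yal eqxx big1 ?addr0 // => i ij.
  by rewrite yal (negPf ij).
exists (\sum_i y i); split=> // [|n].
  have [d dP] := choice yd; exists (fun k => \sum_i d i k).
  rewrite (eq_bigr _ (fun i _ => dP i)) exchange_big; apply: eq_bigr => i _.
  by rewrite scaler_suml.
by rewrite /wtv natr_sum; apply: eq_bigr => i _; rewrite ay mulr1.
Qed.

Definition rootsum s : set g :=
  submod_gen [set v | exists2 n, (exists i, n i <> 0%N) & root_vec s n v].

Lemma rootsum_avoid y s x : (forall n, wt n y = (\sum_i n i)%:R) -> y \in h -> rootsum s x ->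
  submod_gen [set v | exists2 b : int, (0 < (if s then b else - b)) & lie y v = b%:~R *: v] x.
Proof.
move=> yn yh; apply: submod_gen_sub => v [n [i ni] wv]; apply: submod_gen_in.
have n_gt0 : (0 < \sum_j n j)%N by rewrite (bigD1 i) //= addn_gt0 lt0n; case: eqP ni.
exists (if s then (\sum_j n j)%:Z else - (\sum_j n j)%:Z); first by case: (s); rewrite ?opprK.
by rewrite wv // yn; case: (s); rewrite /= ?mul1r ?mulN1r ?rmorphN /= pmulrn.
Qed.

Lemma root_sum_central y x : (forall n, wt n y = (\sum_i n i)%:R) -> y \in h ->
  forall a b, rootsum true a -> rootsum false b -> x = a + b -> lie y x = 0 -> x = 0.
Proof.
move=> yn yh a b pa pb -> yx; apply: (@eigen_avoid _ _ (lie y) _ 0); last by rewrite scale0r.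
apply: submod_genD; [move: (rootsum_avoid yn yh pa) | move: (rootsum_avoid yn yh pb)];
  apply: submod_gen_sub => v [k k0 vk]; apply: submod_gen_in; exists k%:~R => //=.
  by rewrite intr_eq0 gt_eqF.
by rewrite intr_eq0 -oppr_eq0 gt_eqF.
Qed.

Lemma cartan_coroots x : x \in h -> exists d, x = \sum_i d i *: H i.
Proof.
move=> xh; have [d [a [b [/npart_root pa /npart_root pb xE]]]] := tri_all x; exists d.
have [y [[d' yd] _ yn]] := height_exists; have yh : y \in h by rewrite yd; exact: sum_H.
have y_h z : z \in h -> lie y z = 0.
  by move=> zh; rewrite yd lie_suml big1 // => i _; rewrite lieZl coroot_central ?scaler0.
apply/subr0_eq/(root_sum_central yn yh pa pb); last by rewrite y_h // rpredB // sum_H.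
by rewrite xE; lmod K g.
Qed.

Lemma cartan_abelian : {in h &, forall x y, lie x y = 0}.
Proof.
move=> x y /cartan_coroots[d ->] yh; rewrite lie_suml big1 // => i _.
by rewrite lieZl coroot_central // scaler0.
Qed.

Lemma coroots_cartan d : \sum_i d i *: H i \in h.
Proof. exact: sum_H. Qed.

Lemma triangular x : exists y a b, [/\ y \in h, rootsum true a, rootsum false b & x = y + a + b].
Proof.
by have [d [a [b [pa pb ->]]]] := tri_all x; exists (\sum_i d i *: H i), a, b; split=> //; exact: npart_root.
Qed.

Lemma height_centralizer y x : y \in h -> (forall n, wt n y = (\sum_i n i)%:R) ->
  lie y x = 0 -> x \in h.
Proof.
move=> yh yn yx; have [z [a [b [zh pa pb xE]]]] := triangular x.
rewrite -(subrK z x) rpredD //; have -> : x - z = 0; last exact: mem0v.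
apply: (root_sum_central yn yh pa pb); first by rewrite xE; lmod K g.
by rewrite lieBr yx cartan_abelian // subrr.
Qed.

Lemma rootsum_nplus x : rootsum true x <-> nplus c x.
Proof.
split=> [|[s [xs sP]]].
- elim=> {x} [x [n [i ni] wx]||x y _ [s [sx sP]] _ [t [ty tP]]|a x _ [s [sx sP]]].
  + have [->|/eqP x0] := eqVneq x 0; first by exists [::]; rewrite mem0v.
    exists [:: x]; split; first by rewrite memv_span ?mem_head.
    move=> _ /[1!inE] /eqP ->; have [b nb eb] := wtv_nspan n; exists b.
    have bx : root_space b x by move=> y yh; rewrite wx // mul1r eb.
    split=> //; split; last by exists x.
    move=> b0; apply: ni; apply: (@wtv_inj _ _ c n (fun=> 0%N)) => y _.
    by rewrite wt0 -eb b0 ev0.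
  + by exists [::]; rewrite mem0v.
  + exists (s ++ t); split; last by move=> z; rewrite mem_cat => /orP[/sP|/tP].
    by rewrite span_cat; apply: memv_add.
  + by exists s; split=> //; exact: memvZ.
have /coord_span -> : x \in <<in_tuple s>>%VS by [].
apply: big_ind => [||i _]; [exact: submod_gen0 | by move=> u v; exact: submod_genD|].
apply/submod_genZ/submod_gen_in.
have [b [rb nb bx]] := sP (in_tuple s)`_i (mem_nth 0 (ltn_ord i)).
have [n nbE] := nspanE nb; exists n; last by move=> y yh; rewrite bx // nbE mul1r.
apply: contrapT => /forallNP n0; apply: rb.1; apply: dual_ext => y _.
rewrite ev0 nbE -[RHS](wt0 y); congr (wtv _ _); apply: functional_extensionality_dep => k.
exact: contrapT (n0 k).
Qed.

End Triangular.

(** * The Killing form *)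

Section Killing.
Variables (K : numClosedFieldType) (g : fdLieAlgType K).
Hypothesis g_simple : lie_simple g.
Variable c : chevalley g.

Local Notation I := (node c).
Local Notation h := (cartan c).
Local Notation al := (sroot c).
Local Notation H := (coroot c).
Local Notation wt := (@wtv K g c).
Local Notation Xp := (Xplus c).
Local Notation Xm := (Xminus c).

(** A basis of weight vectors with its coordinate forms. A weight is stored as a sign and natural
    coordinates over the simple roots; in weight zero all coordinates vanish and the sign is
    arbitrary. *)
Record wbasis := WBasis {
  wb_size : nat;
  wb_u : 'I_wb_size -> g;
  wb_phi : 'I_wb_size -> {linear g -> K^o};
  wb_s : 'I_wb_size -> bool;
  wb_n : 'I_wb_size -> I -> nat;
  wb_root : forall k, root_vec (wb_s k) (wb_n k) (wb_u k);
  wb_dual : forall i j, wb_phi i (wb_u j) = (j == i)%:R;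
  wb_exp : forall x, x = \sum_k (wb_phi k x : K) *: wb_u k }.

Lemma wbasis_exists : exists B : wbasis, True.
Proof.
pose W x := exists s n, @root_vec K g c s n x.
have [r [u [phi [uW _ phiu uE]]]] := basis_mod (0%VS : {vspace g}) W.
have [s sP] := choice uW; have [n nP] := choice sP.
have exp x : x = \sum_k (phi k x : K) *: u k.
  have WE v : W v -> v = \sum_k (phi k v : K) *: u k.
    by move/uE; rewrite memv0 subr_eq0 => /eqP.
  have rE t v : rootsum c t v -> v = \sum_k (phi k v : K) *: u k.
    elim=> {v} [v [m _ wv]||v w _ {1}-> _ {1}->|a v _ {1}->].
    - by apply: WE; exists t, m.
    - by rewrite big1 // => k _; rewrite linear0 scale0r.
    - by rewrite -big_split; apply: eq_bigr => k _; rewrite linearD scalerDl.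
    - by rewrite scaler_sumr; apply: eq_bigr => k _; rewrite scalerA linearZ_LR.
  have [y [a [b [yh pa pb ->]]]] := triangular g_simple c x.
  have yE : y = \sum_k (phi k y : K) *: u k.
    by apply: WE; exists true, (fun=> 0%N) => z zh; rewrite wt0 mulr0 scale0r (cartan_abelian g_simple zh yh).
  rewrite {1}yE {1}(rE _ _ pa) {1}(rE _ _ pb) -!big_split; apply: eq_bigr => k _.
  by rewrite !linearD /= !scalerDl.
by exists (WBasis nP phiu exp).
Qed.

Variable B : wbasis.
Local Notation u := (@wb_u B).
Local Notation phi := (@wb_phi B).
Definition wb_wt k y : K := sgb K (wb_s k) * wt (@wb_n B k) y.
Local Notation nu := wb_wt.

Lemma wb_lie k : {in h, forall y, lie y (u k) = nu k y *: u k}.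
Proof. exact: wb_root. Qed.

Lemma phiZ k a x : (phi k (a *: x) : K) = a * (phi k x : K).
Proof. exact: (linearZ_LR (phi k)). Qed.
Lemma phiN k x : (phi k (- x) : K) = - (phi k x : K).
Proof. exact: (linearN (phi k)). Qed.
Lemma phi_sum k J (r : seq J) (P : pred J) F :
  (phi k (\sum_(j <- r | P j) F j) : K) = \sum_(j <- r | P j) (phi k (F j) : K).
Proof. exact: (linear_sum (phi k)). Qed.

Definition tr (T : g -> g) : K := trace_mod u phi T.

Lemma trC (E F : {linear g -> g}) : tr (E \o F) = tr (F \o E).
Proof.
apply: (@trace_modC K g (fun x => x = 0)) => [i x ->|x ->|x ->|j|j]; rewrite ?linear0 //.
  by rewrite -wb_exp subrr.
by rewrite -wb_exp subrr.
Qed.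

Definition kappa x y : K := tr (lie x \o lie y).

Lemma kappaC x y : kappa x y = kappa y x.
Proof. exact: trC. Qed.

Lemma kappaDl x x' y : kappa (x + x') y = kappa x y + kappa x' y.
Proof. by rewrite -big_split; apply: eq_bigr => k _ /=; rewrite lieDl linearD. Qed.
Lemma kappaZl a x y : kappa (a *: x) y = a * kappa x y.
Proof. by rewrite [RHS]mulr_sumr; apply: eq_bigr => k _ /=; rewrite lieZl linearZ_LR. Qed.
Lemma kappaDr x y y' : kappa x (y + y') = kappa x y + kappa x y'.
Proof. by rewrite kappaC kappaDl !(kappaC x). Qed.
Lemma kappaZr a x y : kappa x (a *: y) = a * kappa x y.
Proof. by rewrite kappaC kappaZl (kappaC x). Qed.
Lemma kappa0l y : kappa 0 y = 0.
Proof. by rewrite -(scale0r 0) kappaZl mul0r. Qed.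
Lemma kappaNl x y : kappa (- x) y = - kappa x y.
Proof. by rewrite -scaleN1r kappaZl mulN1r. Qed.
Lemma kappa_suml J (r : seq J) (P : pred J) F y :
  kappa (\sum_(j <- r | P j) F j) y = \sum_(j <- r | P j) kappa (F j) y.
Proof. by apply: (big_morph (fun x => kappa x y)) => [x x'|]; rewrite ?kappaDl ?kappa0l. Qed.
Lemma kappa_sumr J (r : seq J) (P : pred J) F y :
  kappa y (\sum_(j <- r | P j) F j) = \sum_(j <- r | P j) kappa y (F j).
Proof. by rewrite kappaC kappa_suml; apply: eq_bigr => j _; rewrite kappaC. Qed.

Lemma kappaA x y z : kappa (lie x y) z = kappa x (lie y z).
Proof.
have comp_lin (E F : {linear g -> g}) : linear (E \o F) by move=> a v w /=; rewrite !linearP.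
have e1 : kappa (lie x y) z = tr (lie x \o (lie y \o lie z)) - tr (lie y \o (lie x \o lie z)).
  by rewrite -sumrB; apply: eq_bigr => k _ /=; rewrite -linearB (lieJ x y) addrK.
have e2 : kappa x (lie y z) = tr (lie x \o (lie y \o lie z)) - tr ((lie x \o lie z) \o lie y).
  by rewrite -sumrB; apply: eq_bigr => k _ /=; rewrite -linearB -lieBr (lieJ y z) addrK.
by rewrite e1 e2; congr (_ - _); exact: (trC (lie y) (mklin (comp_lin (lie x) (lie z)))).
Qed.

Lemma kappa_cartan : {in h &, forall x y, kappa x y = \sum_k nu k x * nu k y}.
Proof.
move=> x y xh yh; apply: eq_bigr => k _ /=.
by rewrite wb_lie // lieZr wb_lie // !phiZ wb_dual eqxx mulr1 mulrC.
Qed.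

Lemma kappa_weight a b x z y : lie y x = a *: x -> lie y z = b *: z -> a + b != 0 -> kappa x z = 0.
Proof.
move=> wx wz ab; apply/eqP; have : (a + b) * kappa x z == 0.
  by rewrite mulrDl -kappaZl -kappaZr -wx -wz lieC kappaNl kappaA addNr.
by rewrite mulf_eq0 (negPf ab).
Qed.

Lemma ev_sum_cond (mu : dual h) J (r : seq J) (P : pred J) F :
  ev mu (\sum_(j <- r | P j) F j) = \sum_(j <- r | P j) ev mu (F j).
Proof. by apply: (big_morph (ev mu)); [exact: evDr | exact: ev0r]. Qed.

Lemma sroot_coroot_real i j : ev (al j) (H i) \is Num.real.
Proof.
have [z ->] := sl2_eig_int (lie_sl2 i) (Xp_nilpotent i) (Xm_nilpotent i) (coroot_lie_Xp i j) (@Xp_neq0 _ _ c j).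
exact: realz.
Qed.

Lemma wb_wt_real k (S : {pred I}) : nu k (\sum_(i in S) H i) \is Num.real.
Proof.
rewrite realM //; first by case: (wb_s k); rewrite /= ?realN real1.
rewrite /wtv rpred_sum // => i _; rewrite realM ?realn // ev_sum_cond rpred_sum // => j _.
exact: sroot_coroot_real.
Qed.

(** On [h] the form is the sum of the squares of the weights. If squares of real numbers add up to
    zero, then [y] acts by zero and is central. *)
Lemma kappa_pos y : y \in h -> y <> 0 -> (forall k, nu k y \is Num.real) -> 0 < kappa y y.
Proof.
move=> yh y0 yr; have sq k : 0 <= nu k y * nu k y by rewrite -expr2 -realEsqr.
rewrite lt_def kappa_cartan // sumr_ge0 // andbT; apply/eqP => /eqP.
rewrite psumr_eq0 // => /allP nu0; apply: y0; apply: (central_eq0 g_simple) => x.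
rewrite lieC (wb_exp B x) lie_sumr big1 ?oppr0 // => k _; rewrite lieZr wb_lie //.
have /(_ k) := nu0; rewrite mem_index_enum => /(_ isT) /eqP/eqP.
by rewrite mulf_eq0 orbb => /eqP ->; rewrite scale0r scaler0.
Qed.

Lemma coroot_sum_neq0 (S : {pred I}) i : i \in S -> \sum_(j in S) H j <> 0.
Proof.
move=> iS H0; have := fweightP i i; rewrite eqxx => /eqP; rewrite -[_ == _]negbK => /negP; apply.
have := ev0r (fweight c i); rewrite -H0 ev_sum_cond (bigD1 i) //= fweightP eqxx big1 ?addr0.
  by move/eqP; rewrite oner_eq0.
by move=> j /andP[_ ji]; rewrite fweightP eq_sym (negPf ji).
Qed.

Lemma kappa_coroot_pos (S : {pred I}) i : i \in S -> 0 < kappa (\sum_(j in S) H j) (\sum_(j in S) H j).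
Proof.
move=> iS; apply: kappa_pos; [|exact: coroot_sum_neq0 iS | by move=> k; exact: wb_wt_real].
by apply: memv_suml => j _; exact: corootP.
Qed.

Lemma kappa_Xp_Xm i : kappa (H i) (H i) = 2%:R * kappa (Xp i) (Xm i).
Proof.
by rewrite -{1}Xplus_Xminus kappaA lieC coroot_lie_Xm sroot_coroot scaleNr opprK kappaZr.
Qed.

Lemma kappa_Xp_Xm_pos i : 0 < kappa (Xp i) (Xm i).
Proof.
have /kappa_coroot_pos : i \in pred1 i by rewrite inE.
by rewrite big_pred1_eq kappa_Xp_Xm pmulr_rgt0 // ltr0n.
Qed.

(** The radical is an ideal, and it is not all of [g] because a coroot has positive length. *)
Lemma kappa_nondeg x : (forall y, kappa x y = 0) -> x = 0.
Proof.
have [|v w v0 w0 y|a v v0 y|U UP] := @vspace_of K g (fun x => forall y, kappa x y = 0).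
- by move=> y; rewrite kappa0l.
- by rewrite kappaDl v0 w0 addr0.
- by rewrite kappaZl v0 mulr0.
move=> /UP xU; have [y z /UP z0|U0|Uf] := g_simple.2 U.
- by apply/UP => v; rewrite lieC kappaNl kappaA z0 oppr0.
- by move: xU; rewrite U0 memv0 => /eqP.
have [i _] := node_exists g_simple c.
have /UP/(_ (H i)) : H i \in U by rewrite Uf memvf.
have /kappa_coroot_pos : i \in pred1 i by rewrite inE.
by rewrite big_pred1_eq => /lt0r_neq0 /eqP.
Qed.

Let G : 'M[K]_(wb_size B) := \matrix_(i, j) kappa (u i) (u j).

Let G_unit : G \in unitmx.
Proof.
rewrite -row_free_unit; apply: inj_row_free => v vG.
have x0 : \sum_k v 0 k *: u k = 0.
  apply: kappa_nondeg => y; rewrite (wb_exp B y) kappa_sumr big1 // => j _.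
  rewrite kappaZr kappa_suml; have /rowP/(_ j) := vG; rewrite !mxE => e.
  transitivity ((phi j y : K) * 0); last exact: mulr0.
  congr (_ * _); rewrite -[RHS]e.
  by apply: eq_bigr => k _; rewrite kappaZl mxE.
apply/rowP => k; rewrite mxE -[RHS](linear0 (phi k)) -x0 linear_sum (bigD1 k) //=.
rewrite linearZ_LR wb_dual eqxx big1 => [|j jk]; first by rewrite addr0; exact/esym/mulr1.
by rewrite linearZ_LR wb_dual (negPf jk) scaler0.
Qed.

Definition wb_ud k : g := \sum_j invmx G j k *: u j.
Local Notation ud := wb_ud.

Lemma kappa_ud x k : kappa x (ud k) = phi k x.
Proof.
rewrite {1}(wb_exp B x) kappa_suml (bigD1 k) //= kappaZl.
have e i : kappa (u i) (ud k) = (i == k)%:R.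
  have /matrixP/(_ i k) := mulmxV G_unit; rewrite !mxE => <-.
  by rewrite kappa_sumr; apply: eq_bigr => j _; rewrite kappaZr mxE mulrC.
rewrite e eqxx mulr1 big1 ?addr0 // => i ik; rewrite kappaZl e (negPf ik) mulr0 //.
Qed.

Lemma kappa_ext x y : (forall z, kappa x z = kappa y z) -> x = y.
Proof.
by move=> e; apply/subr0_eq/kappa_nondeg => z; rewrite kappaDl kappaNl e subrr.
Qed.

Lemma ud_exp x : x = \sum_k kappa x (u k) *: ud k.
Proof.
apply: kappa_ext => z; rewrite {1}(wb_exp B z) kappa_sumr kappa_suml.
by apply: eq_bigr => k _; rewrite kappaZr kappaZl (kappaC (ud k)) kappa_ud mulrC.
Qed.

Lemma u_exp x : x = \sum_k kappa x (ud k) *: u k.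
Proof. by rewrite {1}(wb_exp B x); apply: eq_bigr => k _; rewrite kappa_ud. Qed.

Lemma wb_lie_ud k : {in h, forall y, lie y (ud k) = - nu k y *: ud k}.
Proof.
move=> y yh; apply: kappa_ext => z; rewrite kappaZl (kappaC _ z) (kappaC _ z) -kappaA !kappa_ud.
rewrite lieC phiN mulNr; congr (- _); rewrite {1}(wb_exp B z) lie_sumr phi_sum.
rewrite (bigD1 k) //= lieZr wb_lie // !phiZ wb_dual eqxx mulr1 mulrC.
by rewrite big1 ?addr0 // => j jk; rewrite lieZr wb_lie // !phiZ wb_dual (negPf jk) !mulr0.
Qed.

End Killing.

Lemma sum_iterS (V : zmodType) (T : V -> V) n x : iter n T x = x ->
  \sum_(k < n) iter k.+1 T x = \sum_(k < n) iter k T x.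
Proof.
case: n => [|n] e; first by rewrite !big_ord0.
rewrite big_ord_recr [RHS]big_ord_recl addrC; congr (_ + _); exact: e.
Qed.

(** * Diagram automorphisms *)

Section DiagramAutomorphism.
Variables (K : numClosedFieldType) (g : fdLieAlgType K).
Hypothesis g_simple : lie_simple g.
Variable c : chevalley g.
Variables (m : nat) (sigma : diagram_aut c m).

Local Notation I := (node c).
Local Notation h := (cartan c).
Local Notation al := (sroot c).
Local Notation H := (coroot c).
Local Notation wt := (@wtv K g c).
Local Notation Xp := (Xplus c).
Local Notation Xm := (Xminus c).
Local Notation p := (node_perm sigma).
Local Notation Xs := (@Xpm K g c).

Lemma aut_order_gt0 : (0 < m)%N.
Proof. by rewrite -(node_perm_order sigma) order_gt0. Qed.

Lemma aut_lie x y : sigma (lie x y) = lie (sigma x) (sigma y).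
Proof. exact: lieHomP. Qed.

Lemma aut_Xpm s i : sigma (Xs s i) = Xs s (p i).
Proof. by case: s; [exact: daut_Xplus | exact: daut_Xminus]. Qed.

Lemma aut_cartan y : y \in h -> sigma y \in h.
Proof.
move=> /(cartan_coroots g_simple)[d ->]; rewrite linear_sum memv_suml // => i _.
by rewrite linearZ_LR daut_coroot memvZ // corootP.
Qed.

Lemma aut_sroot y j : y \in h -> ev (al (p j)) (sigma y) = ev (al j) y.
Proof.
move=> /(cartan_coroots g_simple)[d ->]; rewrite linear_sum !ev_sumr; apply: eq_bigr => i _.
by rewrite linearZ_LR daut_coroot !evZr node_perm_cartan.
Qed.

Lemma iter_aut_lie k x y : iter k sigma (lie x y) = lie (iter k sigma x) (iter k sigma y).
Proof. by elim: k => //= k ->; rewrite aut_lie. Qed.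

Lemma iter_aut_Xpm k s i : iter k sigma (Xs s i) = Xs s ((p ^+ k)%g i).
Proof. by elim: k => [|k IHk]; rewrite ?perm1 //= IHk aut_Xpm expgSr permM. Qed.

(** The order [m] is given on the nodes; [sigma^m] fixes the simple root vectors and therefore all
    that they generate. *)
Lemma iter_aut_order x : iter m sigma x = x.
Proof.
pose P x := iter m sigma x = x; rewrite -/(P x).
have PX s i : P (Xs s i).
  have pm : (p ^+ m)%g = 1%g by have := expg_order p; rewrite (node_perm_order sigma).
  by rewrite /P iter_aut_Xpm pm perm1.
have PD y z : P y -> P z -> P (y + z) by rewrite /P iter_linD => -> ->.
have PZ a y : P y -> P (a *: y) by rewrite /P iter_linZ => ->.
have Plie y z : P y -> P z -> P (lie y z) by rewrite /P iter_aut_lie => -> ->.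
move: x; apply: (generation g_simple PD PZ) => // y /(cartan_coroots g_simple)[d ->].
apply: big_ind => [||i _]; [by rewrite /P iter_lin0 | exact: PD |].
by apply: PZ; rewrite -Xplus_Xminus; apply: Plie; [exact: (PX true) | exact: (PX false)].
Qed.

Lemma aut_inv x : sigma (iter m.-1 sigma x) = x.
Proof. by rewrite -iterS prednK ?aut_order_gt0 // iter_aut_order. Qed.

Lemma aut_root_vec s n v : root_vec s n v -> root_vec s (fun i => n ((p^-1)%g i)) (sigma v).
Proof.
move=> wv y yh; set y' := iter m.-1 sigma y.
have y'h : y' \in h by rewrite /y'; elim: m.-1 => //= k; exact: aut_cartan.
rewrite -{1}(aut_inv y) -/y' -aut_lie wv // linearZ_LR; congr ((_ * _) *: _).
rewrite /wtv [RHS](reindex_inj (@perm_inj _ p)) /=; apply: eq_bigr => i _.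
by rewrite permK -(aut_inv y) -/y' aut_sroot.
Qed.

Lemma aut_rootsum s x : rootsum c s x -> rootsum c s (sigma x).
Proof.
elim=> {x} [x [n [i ni] wx]||x y _ IHx _ IHy|a x _ IHx].
- apply: submod_gen_in; exists (fun i => n ((p^-1)%g i)); last exact: aut_root_vec.
  by exists (p i); rewrite permK.
- by rewrite linear0; exact: submod_gen0.
- by rewrite linearD; exact: submod_genD.
- by rewrite linearZ_LR; exact: submod_genZ.
Qed.

Lemma sum_iter_autS x : \sum_(k < m) iter k.+1 sigma x = \sum_(k < m) iter k sigma x.
Proof.
exact/sum_iterS/iter_aut_order.
Qed.

Definition proj0 x := m%:R^-1 *: \sum_(k < m) iter k sigma x.
Local Notation pi := proj0.

Let m0 : m%:R != 0 :> K.
Proof. by rewrite pnatr_eq0 -lt0n aut_order_gt0. Qed.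

Lemma aut_proj0 x : sigma (pi x) = pi x.
Proof. by rewrite {2}/proj0 -sum_iter_autS linearZ_LR linear_sum. Qed.

Lemma proj0_linear : linear pi.
Proof.
move=> a x y; rewrite /proj0.
rewrite (eq_bigr (fun k : 'I_m => a *: iter k sigma x + iter k sigma y)) => [|k _]; last first.
  exact: iter_linear.
rewrite big_split /=.
by rewrite -scaler_sumr scalerDr !scalerA mulrC.
Qed.

Lemma proj0_id x : sigma x = x -> pi x = x.
Proof.
move=> sx; rewrite /proj0 (eq_bigr (fun=> x)) => [|k _].
  by rewrite sumr_const card_ord -[x *+ m]scaler_nat scalerA mulVf // scale1r.
by elim: (nat_of_ord k) => //= n ->.
Qed.

Lemma proj0K x : pi (pi x) = pi x.
Proof. exact/proj0_id/aut_proj0. Qed.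

Lemma proj0_lie z x : sigma z = z -> pi (lie z x) = lie z (pi x).
Proof.
move=> sz; rewrite /proj0 lieZr lie_sumr; congr (_ *: _); apply: eq_bigr => k _.
rewrite iter_aut_lie; congr (lie _ _); elim: (nat_of_ord k) => //= n ->; exact: sz.
Qed.

Lemma proj0_cartan y : y \in h -> pi y \in h.
Proof.
move=> yh; rewrite memvZ // memv_suml // => k _.
by elim: (nat_of_ord k) => //= n; exact: aut_cartan.
Qed.

Lemma proj0_rootsum s x : rootsum c s x -> rootsum c s (pi x).
Proof.
move=> rx; apply: submod_genZ; apply: big_ind => [||k _]; [exact: submod_gen0 | by move=> *; exact: submod_genD |].
by elim: (nat_of_ord k) => //= n; exact: aut_rootsum.
Qed.

Lemma cartan_sroot0 y : y \in h -> (forall j, ev (al j) y = 0) -> y = 0.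
Proof.
move=> /(cartan_coroots g_simple)[d ->] y0; rewrite big1 // => i _.
rewrite (@cartan_mx_inj _ _ g_simple c d) ?scale0r // => j.
by rewrite -[RHS](y0 j) ev_sumr; apply: eq_bigr => k _; rewrite evZr.
Qed.

Lemma height_fixed : exists y, [/\ y \in h, sigma y = y, forall j, ev (al j) y = 1 &
  forall n, wt n y = (\sum_i n i)%:R].
Proof.
have [y [[d yd] ay yn]] := height_exists g_simple c.
have yh : y \in h by rewrite yd; exact: coroots_cartan.
exists y; split=> //; apply/subr0_eq/cartan_sroot0; first by rewrite rpredB ?aut_cartan.
by move=> j; rewrite evDr evNr ay -(permKV p j) aut_sroot // ay subrr.
Qed.

Lemma h0P x : (x \in h0 sigma) = (x \in h) && (sigma x == x).
Proof.
rewrite memv_cap; congr (_ && _); apply/fixedSpaceP/eqP; by rewrite lfunE.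
Qed.

Definition eO j := \sum_(k in porbit p j) Xp k.
Definition fO j := \sum_(k in porbit p j) Xm k.
Definition hO j := \sum_(k in porbit p j) H k.

Lemma aut_orbit_sum (F : I -> g) j : (forall k, sigma (F k) = F (p k)) ->
  sigma (\sum_(k in porbit p j) F k) = \sum_(k in porbit p j) F k.
Proof.
move=> sF; rewrite linear_sum [RHS](reindex_inj (@perm_inj _ p)) /=.
apply: eq_big => k; last by move=> _; exact: sF.
by rewrite -!eq_porbit_mem -(porbit_perm p 1 k) expg1.
Qed.

Lemma aut_eO j : sigma (eO j) = eO j.
Proof. exact/aut_orbit_sum/daut_Xplus. Qed.
Lemma aut_fO j : sigma (fO j) = fO j.
Proof. exact/aut_orbit_sum/daut_Xminus. Qed.
Lemma aut_hO j : sigma (hO j) = hO j.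
Proof. exact/aut_orbit_sum/daut_coroot. Qed.
Lemma hO_cartan j : hO j \in h.
Proof. by apply: memv_suml => k _; exact: corootP. Qed.

Lemma sroot_orbit y j k : y \in h -> sigma y = y -> k \in porbit p j -> ev (al k) y = ev (al j) y.
Proof.
move=> yh sy /porbitP[n ->]; elim: n => [|n IHn]; first by rewrite perm1.
by rewrite expgSr permM -IHn -{1}sy aut_sroot.
Qed.

Lemma lie_eO y j : y \in h -> sigma y = y -> lie y (eO j) = ev (al j) y *: eO j.
Proof.
move=> yh sy; rewrite lie_sumr scaler_sumr; apply: eq_bigr => k kj.
by rewrite -(sroot_orbit yh sy kj); exact: XplusP.
Qed.

Lemma lie_fO y j : y \in h -> sigma y = y -> lie y (fO j) = - ev (al j) y *: fO j.
Proof.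
move=> yh sy; rewrite lie_sumr scaler_sumr; apply: eq_bigr => k kj.
by rewrite -(sroot_orbit yh sy kj) -evN; exact: XminusP.
Qed.

Lemma lie_Xp_fO i j : i \in porbit p j -> lie (Xp i) (fO j) = H i.
Proof.
move=> ij; rewrite lie_sumr (bigD1 i) //= Xplus_Xminus big1 ?addr0 // => k /andP[_ ki].
by rewrite Xp_Xm // eq_sym.
Qed.

Lemma lie_eO_fO j : lie (eO j) (fO j) = hO j.
Proof. by rewrite lie_suml; apply: eq_bigr => i ij; rewrite lie_Xp_fO. Qed.

(** It is 2 on an orbit without edges and 1 on an orbit made of pairs of adjacent nodes; scaling
    [eO j] and [hO j] by [2 / cO j] completes [fO j] to an sl2 triple. *)
Definition cO j := ev (al j) (hO j).

Variable B : wbasis c.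
Local Notation kappa := (kappa B).

Lemma kappa_aut x y : kappa (sigma x) (sigma y) = kappa x y.
Proof.
have comp_lin (E F : {linear g -> g}) : linear (E \o F) by move=> a v w /=; rewrite !linearP.
pose inv := mklin (iter_linear sigma m.-1).
pose T := mklin (comp_lin (lie x) (lie y)).
have -> : kappa (sigma x) (sigma y) = tr B (sigma \o mklin (comp_lin T inv)).
  by apply: eq_bigr => k _ /=; rewrite !aut_lie aut_inv.
rewrite trC; apply: eq_bigr => k _ /=.
by rewrite -iterSr prednK ?aut_order_gt0 // iter_aut_order.
Qed.

Lemma kappa_proj0 x y : kappa (pi x) y = kappa x (pi y).
Proof.
rewrite kappaZl kappaZr kappa_suml kappa_sumr; congr (_ * _).
have it k z w : kappa (iter k sigma z) (iter k sigma w) = kappa z w.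
  by elim: k => //= k; rewrite kappa_aut.
transitivity (\sum_(k < m) kappa x (iter (m - k) sigma y)).
  apply: eq_bigr => k _.
  have e : iter k sigma (iter (m - k) sigma y) = y.
    by rewrite -ssrnat.iterD subnKC ?iter_aut_order // ltnW.
  by rewrite -[in LHS]e it.
rewrite -!kappa_sumr -(sum_iter_autS y) (reindex_inj rev_ord_inj) /=; congr kappa.
by apply: eq_bigr => k _; rewrite subKn.
Qed.

Lemma kappa_Xp_Xm0 i j : i != j -> kappa (Xp i) (Xm j) = 0.
Proof.
move=> ij; have [y [yd yal]] := coweight_exists g_simple c.
have yh k : y k \in h by have [d ->] := yd k; exact: coroots_cartan.
have wi : lie (y i) (Xp i) = 1 *: Xp i.
  by have := XplusP i (yh i); rewrite yal eqxx.
have wj : lie (y i) (Xm j) = 0 *: Xm j.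
  by have := XminusP j (yh i); rewrite evN yal (negPf ij) oppr0.
by apply: (kappa_weight B wi wj); rewrite addr0 oner_eq0.
Qed.

Lemma kappa_eO_fO_pos j : 0 < kappa (eO j) (fO j).
Proof.
rewrite kappa_suml (eq_bigr (fun k => kappa (Xp k) (Xm k))) => [|k kj].
  rewrite (bigD1 j) ?porbit_id //= ltr_wpDr ?kappa_Xp_Xm_pos // sumr_ge0 // => k _.
  exact/ltW/kappa_Xp_Xm_pos.
rewrite kappa_sumr (bigD1 k) //= big1 ?addr0 // => l /andP[_ lk].
by rewrite kappa_Xp_Xm0 // eq_sym.
Qed.

Lemma kappa_hO y j : y \in h -> sigma y = y -> kappa (hO j) y = ev (al j) y * kappa (eO j) (fO j).
Proof.
by move=> yh sy; rewrite -lie_eO_fO kappaA lieC lie_fO // scaleNr opprK kappaZr.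
Qed.

(** [kappa (hO j) (hO j)] is [cO j] times [kappa (eO j) (fO j)], and both values of the form are
    positive. *)
Lemma cO_gt0 j : 0 < cO j.
Proof.
have := kappa_coroot_pos g_simple B (porbit_id p j).
by rewrite kappa_hO ?hO_cartan ?aut_hO // pmulr_lgt0 // kappa_eO_fO_pos.
Qed.

Lemma sroot_coroot_le0 i j : i != j -> exists n, ev (al j) (H i) = - n%:R.
Proof.
move=> ij; have [N XN] := Xp_nilpotent i (Xp j).
have [||n _ e] := hw_nat (sl2_sym (lie_sl2 i)) _ _ XN (@Xp_neq0 _ _ c j) (a := - ev (al j) (H i)).
- by change (lie (Xm i) (Xp j) = 0); rewrite lieC Xp_Xm ?oppr0 // eq_sym.
- by rewrite /= coroot_lie_Xp scaleNr.
by exists n; rewrite -e opprK.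
Qed.

Lemma kappa_corootl i j : kappa (H i) (H j) = ev (al j) (H i) * kappa (Xp j) (Xm j).
Proof. by rewrite -[H j]Xplus_Xminus -kappaA coroot_lie_Xp kappaZl. Qed.

Lemma sroot_coroot_sym0 i j : ev (al j) (H i) = 0 -> ev (al i) (H j) = 0.
Proof.
move=> e; have := kappa_corootl j i; rewrite kappaC kappa_corootl e mul0r => /esym/eqP.
by rewrite mulf_eq0 [X in _ || X]gt_eqF ?kappa_Xp_Xm_pos // orbF => /eqP.
Qed.

Lemma porbit_p j : porbit p (p j) = porbit p j.
Proof. by apply/eqP; rewrite eq_porbit_mem; apply/porbitP; exists 1%N; rewrite expg1. Qed.

Lemma cO_porbit j k : k \in porbit p j -> cO k = cO j.
Proof.
move=> kj; have e : porbit p k = porbit p j by apply/eqP; rewrite eq_porbit_mem.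
by rewrite /cO /hO e -/(hO j) (sroot_orbit _ _ kj) ?hO_cartan ?aut_hO.
Qed.

(** In the block of the Cartan matrix belonging to an orbit, [sigma] makes all row sums equal and
    all column sums equal. Adding up the block in two ways transfers positivity from [cO]. *)
Lemma cO_col_gt0 j : 0 < \sum_(k in porbit p j) ev (al k) (H j).
Proof.
pose S l := \sum_(k in porbit p l) ev (al k) (H l).
have Sp l : S (p l) = S l.
  rewrite /S porbit_p (reindex_inj (@perm_inj _ p)) /=; apply: eq_big => k.
    by rewrite -!eq_porbit_mem porbit_p.
  by move=> _; rewrite node_perm_cartan.
have SO l : l \in porbit p j -> S l = S j.
  by case/porbitP=> n ->; elim: n => [|n IHn]; rewrite ?perm1 // expgSr permM Sp.
have e : \sum_(l in porbit p j) S l = \sum_(l in porbit p j) cO l.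
  rewrite (eq_bigr (fun l => \sum_(k in porbit p j) ev (al k) (H l))) => [|l lj]; last first.
    by apply: eq_bigl => k; have /eqP -> : porbit p l == porbit p j by rewrite eq_porbit_mem.
  rewrite exchange_big /=; apply: eq_bigr => k kj.
  rewrite -ev_sum_cond /cO /hO; congr ev; apply: eq_bigl => l.
  by have /eqP -> : porbit p k == porbit p j by rewrite eq_porbit_mem.
rewrite (eq_bigr (fun=> S j)) // in e.
have e' : \sum_(l in porbit p j) cO l = \sum_(l in porbit p j) cO j.
  by apply: eq_bigr => k; exact: cO_porbit.
have o : (0 < #|porbit p j|)%N by rewrite card_gt0; apply/set0Pn; exists j; exact: porbit_id.
by rewrite -[0 < _](pmulrn_lgt0 _ o) -sumr_const e e' sumr_const pmulrn_lgt0 // cO_gt0.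
Qed.

(** An orbit is a disjoint union of diagrams [A_1] or of diagrams [A_2]: the positive sum of
    [cO_col_gt0] is 2 minus the natural numbers [n k], so at most one of these is nonzero, and it is
    1. Without a neighbour the witness is [j] itself. *)
Lemma orbit_neighbour j : exists2 j', j' \in porbit p j &
  (j' != j -> ev (al j') (H j) = - 1) /\
  forall k, k \in porbit p j -> k != j -> k != j' -> ev (al k) (H j) = 0.
Proof.
have /all_sig[n nE] : forall k, {n | k != j -> ev (al k) (H j) = - n%:R}.
  move=> k; apply: cid; have [->|kj] := eqVneq k j; first by exists 0%N.
  by have [|n e] := @sroot_coroot_le0 j k; [rewrite eq_sym | exists n].
have := cO_col_gt0 j; rewrite (bigD1 j) ?porbit_id //= sroot_coroot.
rewrite (eq_bigr (fun k => - (n k)%:R)) => [|k /andP[_ /nE]//].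
rewrite sumrN -natr_sum subr_gt0 ltr_nat ltnS => n1.
have [[j' [j'o j'j nj]]|no] := pselect (exists k, [/\ k \in porbit p j, k != j & n k != 0%N]).
  exists j' => //; move: n1; rewrite (bigD1 j') ?j'o //= => n1.
  have n1' : n j' = 1%N /\ (\sum_(i | (i \in porbit p j) && (i != j) && (i != j')) n i = 0)%N.
    by move: n1 nj; case: (n j') => // [[|k]] //=; case: (\sum_(i | _) _)%N.
  split=> [_|k ko kj kj']; first by rewrite nE // n1'.1.
  have /eqP := n1'.2; rewrite sum_nat_eq0 => /forallP/(_ k).
  by rewrite ko kj kj' /= nE // => /eqP ->; rewrite oppr0.
exists j; first exact: porbit_id.
split=> [/eqP//|k ko kj _]; rewrite nE //; have [->|nk] := eqVneq (n k) 0%N; first exact: oppr0.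
by case: no; exists k.
Qed.

End DiagramAutomorphism.

Lemma linZE (K : pzRingType) (M N : lmodType K) (f : M -> N) : linear f ->
  forall a x, f (a *: x) = a *: f x.
Proof. by move=> lf; exact: (linearZ_LR (mklin lf)). Qed.
Lemma lin0E (K : pzRingType) (M N : lmodType K) (f : M -> N) : linear f -> f 0 = 0.
Proof. by move=> lf; exact: (linear0 (mklin lf)). Qed.
Lemma lin_sumE (K : pzRingType) (M N : lmodType K) (f : M -> N) J (r : seq J) (P : pred J) (F : J -> M) :
  linear f -> f (\sum_(j <- r | P j) F j) = \sum_(j <- r | P j) f (F j).
Proof. by move=> lf; exact: (linear_sum (mklin lf)). Qed.

(** Operators for the elements of [L] only. The modules built from companion matrices and germs come
    in this form, and [env_action] recovers the action of the enveloping algebra. *)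
Record lrep (K : fieldType) (L : lieAlgType K) (M : lmodType K) := LRep {
  rop :> L -> {linear M -> M};
  ropD : forall x y m, rop (x + y) m = rop x m + rop y m;
  ropZ : forall a x m, rop (a *: x) m = a *: rop x m;
  rop_lie : forall x y m, rop (lie x y) m = rop x (rop y m) - rop y (rop x m)
}.

(** * The Casimir operator of the fixed-point algebra *)

Section RepBasics.
Variables (K : fieldType) (L : lieAlgType K) (M : lmodType K) (r : lrep L M).

Lemma rop0 m : r 0 m = 0.
Proof. by rewrite -(scale0r 0) ropZ scale0r. Qed.
Lemma rop_sum J (s : seq J) (P : pred J) (f : J -> L) m :
  r (\sum_(j <- s | P j) f j) m = \sum_(j <- s | P j) r (f j) m.
Proof. by apply: (big_morph (fun x => r x m)) => [x y|]; rewrite ?ropD ?rop0. Qed.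
Lemma ropC x y m : r x (r y m) = r y (r x m) + r (lie x y) m.
Proof. by rewrite rop_lie addrC subrK. Qed.

End RepBasics.

Section Casimir.
Variables (K : numClosedFieldType) (g : fdLieAlgType K).
Hypothesis g_simple : lie_simple g.
Variable c : chevalley g.
Variables (m : nat) (sigma : diagram_aut c m).

Local Notation I := (node c).
Local Notation h := (cartan c).
Local Notation al := (sroot c).
Local Notation H := (coroot c).
Local Notation wt := (@wtv K g c).
Local Notation Xp := (Xplus c).
Local Notation Xm := (Xminus c).
Local Notation p := (node_perm sigma).
Local Notation pi := (proj0 sigma).
Local Notation eO := (eO sigma).
Local Notation fO := (fO sigma).
Local Notation hO := (hO sigma).

Definition p0 x : g0 sigma := FixLie (introT eqP (aut_proj0 g_simple sigma x)).

Lemma p0_val (z : g0 sigma) : p0 (val z) = z.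
Proof. by apply: val_inj; apply: proj0_id => //; apply/eqP/(valP z). Qed.
Lemma p0_linear : linear p0.
Proof. by move=> a x y; apply: val_inj; rewrite /= proj0_linear. Qed.
Lemma p0_lie (z : g0 sigma) x : p0 (lie (val z) x) = lie z (p0 x).
Proof. by apply: val_inj; rewrite /= proj0_lie //; exact/eqP/(valP z). Qed.

Variable B : wbasis c.
Local Notation u := (@wb_u _ _ _ B).
Local Notation ud := (wb_ud (B := B)).
Local Notation phi := (@wb_phi _ _ _ B).
Local Notation nu := (wb_wt (B := B)).
Local Notation sg := (@wb_s _ _ _ B).
Local Notation nn := (@wb_n _ _ _ B).
Local Notation kappa := (kappa B).

(** Subtract a multiple of [X_i^+] so that the rest [z] is orthogonal to [X_i^-]. Then
    [lie z (Xm i)] lies in [h] and is orthogonal to everything, hence zero: [z] would be a lowest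
    weight vector of positive weight 2 on which [X_i^+] is nilpotent. *)
Lemma simple_root_space i x : {in h, forall y, lie y x = ev (al i) y *: x} ->
  exists a, x = a *: Xp i.
Proof.
move=> wx; have r0 := kappa_Xp_Xm_pos g_simple B i.
pose a := kappa x (Xm i) / kappa (Xp i) (Xm i); exists a.
apply/subr0_eq; set z := x - _.
have wz : {in h, forall y, lie y z = ev (al i) y *: z}.
  by move=> y yh; rewrite lieBr wx // lieZr XplusP // scalerBr !scalerA mulrC.
have z0 : kappa z (Xm i) = 0.
  by rewrite kappaDl -scaleNr kappaZl /a mulNr divfK ?gt_eqF // subrr.
have [y0 [y0h _ _ y0n]] := height_fixed g_simple sigma.
have y1 j : ev (al j) y0 = 1 by rewrite -(wtv_delta (c := c)) y0n (bigD1 j) //= eqxx big1 // => k /negPf ->.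
have zh : lie z (Xm i) \in h.
  apply: (height_centralizer g_simple y0h y0n).
  rewrite lieJ wz // (XminusP i y0h : lie _ _ = _) evN y1 scale1r scaleN1r lieNr.
  exact: subrr.
have F0 : lie (Xm i) z = 0.
  rewrite lieC; apply/eqP; rewrite oppr_eq0; apply/eqP.
  apply: (@kappa_nondeg _ _ g_simple c B) => w.
  have [y [a' [b [yh ra rb ->]]]] := triangular g_simple c w.
  have k0 s v : rootsum c s v -> kappa (lie z (Xm i)) v = 0.
    elim=> {v} [v [n [j nj] wv]||v w' _ IHv _ IHw|e v _ IHv].
    - apply: (kappa_weight B (y := y0) (a := 0) (b := sgb K s * wt n y0)).
      + by rewrite scale0r (cartan_abelian g_simple (c := c)).
      + exact: wv.
      + rewrite add0r y0n mulf_neq0 //; first by case: s {wv}; rewrite /= ?oppr_eq0 oner_eq0.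
        by rewrite pnatr_eq0 (bigD1 j) //=; case: (n j) nj.
    - by rewrite kappaC kappa0l.
    - by rewrite kappaDr IHv IHw addr0.
    - by rewrite kappaZr IHv mulr0.
  rewrite !kappaDr (k0 _ _ ra) (k0 _ _ rb) !addr0 kappaA lieC (XminusP i yh : lie _ _ = _) evN.
  by rewrite scaleNr opprK kappaZr z0 mulr0.
apply: contrapT => z_n0; have [N ZN] := Xp_nilpotent i z.
have [|k _] := hw_nat (sl2_sym (lie_sl2 i)) F0 (a := - 2%:R) _ ZN z_n0.
  by rewrite /= wz ?corootP // sroot_coroot scaleNr.
by move/eqP; rewrite eq_sym -addr_eq0 -natrD pnatr_eq0 addnC.
Qed.

Lemma phi_weight k y a x : y \in h -> lie y x = a *: x -> nu k y != a -> phi k x = 0.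
Proof.
move=> yh wx na; rewrite -(kappa_ud g_simple).
by apply: (kappa_weight B wx (wb_lie_ud g_simple k yh)); rewrite subr_eq0 eq_sym.
Qed.

Definition pos k := sg k && [exists i, nn k i != 0%N].
Definition neg k := ~~ sg k && [exists i, nn k i != 0%N].
Definition zer k := [forall i, nn k i == 0%N].

Lemma pos_rootsum k : pos k -> rootsum c true (u k).
Proof.
case/andP=> sk /existsP[i /eqP ni]; apply: submod_gen_in; exists (nn k); first by exists i.
by move: (wb_root (w := B) k); rewrite sk.
Qed.

Lemma neg_rootsum k : neg k -> rootsum c true (ud k).
Proof.
case/andP=> sk /existsP[i /eqP ni]; apply: submod_gen_in; exists (nn k); first by exists i.
by move=> y yh; rewrite wb_lie_ud // /wb_wt (negPf sk) /= mulN1r opprK mul1r.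
Qed.

Lemma zer_cartan k : zer k -> u k \in h /\ ud k \in h.
Proof.
move=> /forallP z; have [y0 [y0h _ _ y0n]] := height_fixed g_simple sigma.
have n0 : nu k y0 = 0.
  by rewrite /wb_wt y0n big1 ?mulr0 // => i _; exact/eqP/z.
split; apply: (height_centralizer g_simple y0h y0n).
  by rewrite wb_lie // n0 scale0r.
by rewrite wb_lie_ud // n0 oppr0 scale0r.
Qed.

Lemma triP k : [\/ zer k, pos k | neg k].
Proof.
case: (boolP (zer k)) => [|/forallPn zk]; first by constructor 1.
have [sk|sk] := boolP (sg k); [constructor 2 | constructor 3]; rewrite /pos /neg sk; exact/existsP.
Qed.

Lemma orbit_degree j : exists y, [/\ y \in h, sigma y = y &
  forall n, wt n y = (\sum_(i in porbit p j) n i)%:R].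
Proof.
have [y [yd yal]] := coweight_exists g_simple c.
have yh k : y k \in h by have [d ->] := yd k; exact: coroots_cartan.
exists (\sum_(k in porbit p j) y k); split; first by apply: memv_suml => k _.
  apply: aut_orbit_sum => k; apply/subr0_eq.
  apply: (cartan_sroot0 g_simple (c := c)) => [|i]; first by rewrite rpredB ?aut_cartan.
  by rewrite evDr evNr -(permKV p i) aut_sroot // !yal (inj_eq perm_inj) subrr.
move=> n; rewrite /wtv (eq_bigr (fun i => if i \in porbit p j then (n i)%:R else 0)) => [|i _].
  by rewrite -big_mkcond natr_sum.
rewrite ev_sum_cond; case: ifP => ij.
  rewrite (bigD1 i) //= yal eqxx big1 ?addr0 ?mulr1 // => k /andP[_ ki].
  by rewrite yal (negPf ki).
by rewrite big1 ?mulr0 // => k kj; rewrite yal; case: eqP => // e; rewrite -e kj in ij.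
Qed.

Lemma proj0_aut x : pi (sigma x) = pi x.
Proof.
rewrite /proj0 -[in RHS](sum_iter_autS g_simple); congr (_ *: _).
by apply: eq_bigr => k _; rewrite -iterSr.
Qed.

Lemma proj0_Xp i j : i \in porbit p j -> pi (Xp i) = pi (Xp j).
Proof.
case/porbitP=> n ->; elim: n => [|n IHn]; first by rewrite perm1.
by rewrite expgSr permM -daut_Xplus proj0_aut.
Qed.

Lemma proj0_eO j : pi (Xp j) = #|porbit p j|%:R^-1 *: eO j.
Proof.
rewrite -[eO j](proj0_id (aut_eO sigma j)) (lin_sumE _ _ _ (proj0_linear _)) //.
rewrite (eq_bigr (fun=> pi (Xp j))) => [|k]; last exact: proj0_Xp.
rewrite sumr_const -scaler_nat scalerA mulVf ?scale1r // pnatr_eq0 -lt0n card_gt0.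
by apply/set0Pn; exists j; exact: porbit_id.
Qed.

Section Rep.
Variables (M : lmodType K) (r : lrep (g0 sigma) M).
Let rho x := r (p0 x).

Let rhoD x y a : rho (x + y) a = rho x a + rho y a.
Proof. by rewrite /rho (linDE p0_linear) ropD. Qed.
Let rhoZ b x a : rho (b *: x) a = b *: rho x a.
Proof.
by rewrite /rho (linZE p0_linear) ropZ.
Qed.
Let rho_sum J (s : seq J) (P : pred J) (f : J -> g) a :
  rho (\sum_(j <- s | P j) f j) a = \sum_(j <- s | P j) rho (f j) a.
Proof.
apply: (big_morph (fun x => rho x a)) => [x y|]; first exact: rhoD.
by have := rhoZ 0 0 a; rewrite !scale0r.
Qed.
Let rho_lie z x a : rho (lie (val z) x) a = r z (rho x a) - rho x (r z a).
Proof. by rewrite /rho p0_lie rop_lie. Qed.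

(** Projecting dual bases of [g] to [g_0] gives the canonical element of the restricted form, so
    this is the Casimir operator of [g_0], written without a basis of [g_0]. *)
Definition casimir a := \sum_k rho (u k) (rho (ud k) a).

Lemma casimirD a b : casimir (a + b) = casimir a + casimir b.
Proof. by rewrite -big_split; apply: eq_bigr => k _; rewrite !linearD. Qed.
Lemma casimirZ e a : casimir (e *: a) = e *: casimir a.
Proof. by rewrite scaler_sumr; apply: eq_bigr => k _; rewrite !linearZ_LR. Qed.

(** The matrices of [ad z] in the dual bases are negative transposes of each other, so the two
    double sums cancel. *)
Lemma casimir_comm z a : r z (casimir a) = casimir (r z a).
Proof.
apply/subr0_eq; rewrite /casimir linear_sum -sumrB.
pose G k l := kappa (lie (val z) (u k)) (ud l) *: rho (u l) (rho (ud k) a).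
transitivity (\sum_k (\sum_l G k l - \sum_l G l k)).
  apply: eq_bigr => k _.
  have -> : \sum_l G k l = rho (lie (val z) (u k)) (rho (ud k) a).
    by rewrite [in RHS](u_exp g_simple B (lie (val z) (u k))) rho_sum; apply: eq_bigr => l _; rewrite rhoZ.
  have -> : \sum_l G l k = - rho (u k) (rho (lie (val z) (ud k)) a).
    rewrite [in RHS](ud_exp g_simple B (lie (val z) (ud k))) rho_sum linear_sum -sumrN.
    apply: eq_bigr => l _; rewrite rhoZ linearZ_LR -scaleNr; congr (_ *: _).
    by rewrite kappaC -kappaA -kappaNl -lieC.
  by rewrite !rho_lie (linearB (rho (u k))) opprK addrA subrK.
by rewrite sumrB exchange_big subrr.
Qed.

(** The element of [h] corresponding under [kappa] to [2 rho] of [g_0]: on a singular vector the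
    Casimir terms whose left factor is raising reduce to these commutators. *)
Definition hw_tail := \sum_(k | pos k) lie (pi (u k)) (pi (ud k)).

Lemma tail_fixed : sigma hw_tail = hw_tail.
Proof.
by rewrite linear_sum; apply: eq_bigr => k _; rewrite lieHomP !aut_proj0.
Qed.

Lemma tail_cartan : hw_tail \in h.
Proof.
have [y0 [y0h sy0 _ y0n]] := height_fixed g_simple sigma.
apply: (height_centralizer g_simple y0h y0n); rewrite lie_sumr big1 // => k _.
rewrite lieJ -(proj0_lie (u k) sy0) -(proj0_lie (ud k) sy0) wb_lie // wb_lie_ud // !(linZE (proj0_linear _)).
by rewrite scaleNr lieNr lieZl (lieZr (nu k y0)) subrr.
Qed.

Section Weight.
Variable mu : dual (h0 sigma).

Definition singular a := (forall x : g0 sigma, nplus c (val x) -> r x a = 0) /\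
  forall x : g0 sigma, val x \in h -> r x a = ev mu (val x) *: a.

(** In the usual notation [(mu, mu + 2 rho)]. *)
Definition chi := \sum_(k | zer k) ev mu (pi (u k)) * ev mu (pi (ud k)) + ev mu hw_tail.

Lemma casimir_singular a : singular a -> casimir a = chi *: a.
Proof.
move=> [pa wa].
have rp x : rootsum c true x -> rho x a = 0.
  by move=> rx; apply: pa; apply/rootsum_nplus => //; exact: proj0_rootsum.
have rh x : x \in h -> rho x a = ev mu (pi x) *: a.
  by move=> xh; rewrite /rho wa //= proj0_cartan.
have tl : \sum_(k | pos k) rho (u k) (rho (ud k) a) = ev mu hw_tail *: a.
  have -> : ev mu hw_tail *: a = rho hw_tail a.
    by rewrite rh ?tail_cartan // proj0_id // tail_fixed.
  rewrite rho_sum; apply: eq_bigr => k pk.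
  have := @rop_lie _ _ _ r (p0 (u k)) (p0 (ud k)) a; rewrite -/(rho _) -/(rho _ a).
  rewrite -[r (p0 (u k)) a]/(rho (u k) a) (rp _ (pos_rootsum pk)) linear0 subr0 => <-.
  congr (r _ a); apply: val_inj; rewrite /= [RHS]proj0_id //.
  by rewrite aut_lie !aut_proj0.
rewrite scalerDl -tl scaler_suml /casimir (bigID zer) /=; congr (_ + _).
  apply: eq_bigr => k zk; have [uh udh] := zer_cartan zk.
  by rewrite !rh // linearZ_LR rh // scalerA mulrC.
rewrite (bigID pos) /= [X in _ + X]big1 ?addr0 => [|k /andP[zk pk]].
  by apply: eq_bigl => k; apply: andb_idl => /andP[_]; rewrite /zer negb_forall.
by have [zk'|pk'|nk] := triP k; [rewrite zk' in zk | rewrite pk' in pk | rewrite (rp _ (neg_rootsum nk)) linear0].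
Qed.
End Weight.

End Rep.

Let al_hO y j : y \in h -> sigma y = y ->
  ev (al j) y = kappa (hO j) y / kappa (eO j) (fO j).
Proof. by move=> yh sy; rewrite kappa_hO // mulfK // gt_eqF // kappa_eO_fO_pos. Qed.

Lemma kappa_tail j : kappa (hO j) hw_tail = \sum_(k | pos k) (phi k (lie (hO j) (pi (u k))) : K).
Proof.
rewrite kappa_sumr; apply: eq_bigr => k _.
rewrite -kappaA -kappa_proj0 // proj0_id; first by rewrite kappa_ud.
by rewrite aut_lie aut_hO aut_proj0.
Qed.

(* [ad (hO j) = [ad (eO j), ad (fO j)]] is traceless on the sum of the positive
   root spaces outside the orbit of [j], which is a subquotient of [g] stable
   under [ad (eO j)] and [ad (fO j)]. *)
Lemma kappa_tail_gt0 j : 0 < kappa (hO j) hw_tail.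
Proof.
have [y0 [y0h sy0 _ y0n]] := height_fixed g_simple sigma.
have ht_pos k : (0 < \sum_l nn k l)%N = [exists i, nn k i != 0%N].
  by rewrite lt0n sum_nat_eq0 negb_forall.
have nu0 k : nu k y0 = sgb K (sg k) * (\sum_l nn k l)%:R by rewrite /wb_wt y0n.
have [z [zh sz zn]] := orbit_degree j.
pose simp k := [exists i in porbit p j, [forall l, nn k l == (l == i) :> nat]].
have simpP k : pos k -> simp k -> exists2 i, i \in porbit p j & {in h, forall y, nu k y = ev (al i) y}.
  move=> /andP[sk _] /existsP[i /andP[ij /forallP ni]]; exists i => // y _.
  rewrite /wb_wt sk mul1r -(wtv_delta (c := c)).
  by apply: eq_bigr => l _; rewrite (eqP (ni l)).
pose C k := pos k && ~~ simp k.
have adpi_lin w : linear (fun x => lie w (pi x)).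
  by move=> a x y; rewrite proj0_linear // lieDr lieZr.
pose E := mklin (adpi_lin (eO j)); pose F := mklin (adpi_lin (fO j)).
pose P x := forall k, C k -> (phi k x : K) = 0.
pose phi' k : {linear g -> K^o} := if C k then phi k else \0.
have phi'0 i x : P x -> phi' i x = 0.
  by rewrite /phi'; case: ifP => // Ci Px; rewrite Px.
have Pu (G : {linear g -> g}) : (forall l k, ~~ C l -> C k -> (phi k (G (u l)) : K) = 0) ->
    forall x, P x -> P (G x).
  move=> Gu x Px k Ck; rewrite [x in G x](wb_exp B) linear_sum phi_sum big1 // => l _.
  rewrite linearZ_LR phiZ; have [/Px ->|nC] := boolP (C l); first by rewrite mul0r.
  by rewrite Gu // mulr0.
have Pj (G : {linear g -> g}) i : P (G (u i) - \sum_k (phi' k (G (u i)) : K) *: u k).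
  move=> k Ck; rewrite linearB linear_sum (bigD1 k) //= [X in _ - (_ + X)]big1 => [|l lk].
    by rewrite /phi' Ck linearZ_LR wb_dual eqxx addr0 [_ *: _]mulr1 subrr.
  by rewrite linearZ_LR wb_dual (negPf lk) [_ *: _]mulr0.
have weq l k w b : sigma w = w -> {in h, forall y, sigma y = y -> lie y w = b y *: w} ->
    C k -> (forall y, y \in h -> sigma y = y -> nu k y = b y + nu l y) \/
    (phi k (lie w (pi (u l))) : K) = 0.
  move=> sw wb Ck; have [e|ne] := eqVneq (phi k (lie w (pi (u l))) : K) 0; [by right | left].
  move=> y yh sy; apply/eqP; apply: contraNT ne => ne; apply/eqP; apply: (phi_weight yh _ ne).
  rewrite lieJ wb // lieZl -(proj0_lie (u l) sy) wb_lie // (linZE (proj0_linear _)) (lieZr (nu l y)).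
  by rewrite -scalerDl.
have eOb : {in h, forall y, sigma y = y -> lie y (eO j) = ev (al j) y *: eO j}.
  by move=> y; exact: lie_eO.
have fOb : {in h, forall y, sigma y = y -> lie y (fO j) = - ev (al j) y *: fO j}.
  by move=> y; exact: lie_fO.
have al0 i : ev (al i) y0 = 1.
  by rewrite -(wtv_delta (c := c)) y0n (bigD1 i) //= eqxx big1 // => k /negPf ->.
have aljz : ev (al j) z = 1.
  by rewrite -(wtv_delta (c := c)) zn (bigD1 j) ?porbit_id //= eqxx big1 // => k /andP[_ /negPf ->].
have htC k : C k -> exists n, nu k y0 = n.+1%:R.
  move=> /andP[/andP[sk]]; rewrite -ht_pos => k0 _; exists (\sum_l nn k l).-1%N.
  by rewrite nu0 sk mul1r prednK.
have htnC l : ~~ C l -> [\/ pos l /\ simp l, nu l y0 = 0 | exists n, nu l y0 = - n.+1%:R].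
  rewrite negb_and negbK; have [zl|pl|/andP[sl]] := triP l.
  - by constructor 2; rewrite nu0 big1 ?mulr0 // => i _; apply/eqP/(forallP zl).
  - by rewrite pl /=; constructor 1.
  - rewrite -ht_pos => l0; constructor 3; exists (\sum_i nn l i).-1%N.
    by rewrite nu0 (negPf sl) mulN1r prednK.
have PE : forall x, P x -> P (E x).
  apply: Pu => l k nCl Ck /=; have [e|//] := weq l k _ _ (aut_eO sigma j) eOb Ck.
  have [n en] := htC _ Ck; have [[pl sl]|l0|[n' l0]] := htnC _ nCl.
  - have [i ij wl] := simpP _ pl sl.
    have [|a ->] := @simple_root_space i (u l).
      by move=> y yh; rewrite wb_lie // wl.
    rewrite (linZE (proj0_linear _)) (proj0_Xp ij) lieZr proj0_eO lieZr liexx !scaler0.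
    exact: linear0.
  (* From weight zero [eO j] reaches only height one and degree one on the orbit, that is, a simple
     root of the orbit, which [C] excludes. *)
  - case/andP: Ck => pk /negP[]; apply/existsP.
    have := e _ y0h sy0; rewrite al0 l0 addr0 nu0; case/andP: (pk) => -> _; rewrite mul1r => /eqP.
    rewrite pnatr_eq1 => /eqP h1.
    have := e _ zh sz; rewrite aljz; have -> : nu l z = 0.
      rewrite /wb_wt zn big1 ?mulr0 // => i _; apply/eqP.
      move/eqP: l0; rewrite nu0 mulf_eq0; case/orP=> [|/eqP l0].
        by case: (sg l); rewrite /= ?oppr_eq0 oner_eq0.
      move/eqP: l0; rewrite pnatr_eq0 sum_nat_eq0 => /forallP/(_ i).
      exact.
    rewrite addr0 /wb_wt zn; case/andP: (pk) => -> _; rewrite mul1r => /eqP.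
    rewrite pnatr_eq1 => /eqP hj.
    have [i ij ni] : exists2 i, i \in porbit p j & (0 < nn k i)%N.
      apply: contrapT => no; move: hj; rewrite big1 // => i ij.
      by case e0 : (nn k i) => // [q]; case: no; exists i; rewrite ?e0.
    exists i; rewrite ij; apply/forallP => l'.
    move: h1; rewrite (bigD1 i) //=; case e1: (nn k i) ni => [|q] // _.
    have [->|l'i] := eqVneq l' i; first by rewrite e1; case: q {e1} => // q; rewrite addSn => -[].
    rewrite (bigD1 l') //=; case: q {e1} => [|q]; rewrite !addSn => -[] //.
    by rewrite add0n; case: (nn k l').
  - have := ltr0Sn K n; rewrite -en (e _ y0h sy0) al0 l0 subr_gt0 -[X in _ < X]/(1%:R).
    by rewrite ltr_nat.
have PF : forall x, P x -> P (F x).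
  apply: Pu => l k nCl Ck /=; have [e|//] := weq l k _ _ (aut_fO sigma j) fOb Ck.
  have [n en] := htC _ Ck; have := ltr0Sn K n; rewrite -en (e _ y0h sy0) al0.
  have [[pl sl]|->|[n' ->]] := htnC _ nCl.
  - by have [i ij ->] := simpP _ pl sl; rewrite // al0 addNr ltxx.
  - by rewrite addr0 oppr_gt0 ltr10.
  - by rewrite -opprD oppr_gt0 -[1]/(1%:R) -natrD ltrn0.
have := trace_modC phi'0 PE PF (Pj E) (Pj F).
move/eqP; rewrite -subr_eq0 /trace_mod -sumrB => /eqP tr0.
have adh k : E (F (u k)) - F (E (u k)) = lie (hO j) (pi (u k)).
  rewrite /= !proj0_lie ?aut_eO ?aut_fO // !(proj0K g_simple) -lie_eO_fO.
  by rewrite [lie (eO j) (lie _ _)]lieJ addrK.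
have trC0 : \sum_(k | C k) (phi k (lie (hO j) (pi (u k))) : K) = 0.
  rewrite -[RHS]tr0 [RHS](bigID C) /= [X in _ + X]big1 ?addr0 => [|k /negPf nC].
    apply: eq_bigr => k Ck; rewrite -adh linearB /= /phi' Ck; reflexivity.
  by rewrite /phi' nC subrr.
rewrite kappa_tail (bigID simp) /= trC0 addr0.
have adhO k : pos k -> simp k -> lie (hO j) (pi (u k)) = cO sigma j *: pi (u k).
  move=> pk sk; have [i ij wk] := simpP _ pk sk.
  rewrite -(proj0_lie (u k) (aut_hO sigma j)) wb_lie ?hO_cartan // wk ?hO_cartan //.
  by rewrite (sroot_orbit g_simple _ _ ij) ?hO_cartan ?aut_hO // (linZE (proj0_linear _)).
have phi_simp k : pos k -> simp k -> 0 < (phi k (pi (u k)) : K).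
  move=> pk sk; have [i ij wk] := simpP _ pk sk.
  have [|a ea] := @simple_root_space i (u k); first by move=> y yh; rewrite wb_lie // wk.
  rewrite /proj0 phiZ phi_sum mulr_gt0 ?invr_gt0 ?ltr0n ?(aut_order_gt0 sigma) //.
  (* [sigma] permutes the simple root vectors, so the diagonal coefficient of an iterate is 1 if the
     node is fixed and 0 otherwise. *)
  have it0 n : (phi k (iter n sigma (u k)) : K) = 0 \/ (phi k (iter n sigma (u k)) : K) = 1.
    have itn : iter n sigma (u k) = a *: Xp ((p ^+ n)%g i).
      by rewrite ea iter_linZ (iter_aut_Xpm sigma n true).
    have [e|ne] := eqVneq ((p ^+ n)%g i) i; first by right; rewrite itn e -ea wb_dual eqxx.
    left; have [y [yd yal]] := coweight_exists g_simple c.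
    have yh : y i \in h by have [d ->] := yd i; exact: coroots_cartan.
    apply: (phi_weight (y := y i) (a := 0) yh); last by rewrite wk // yal eqxx oner_eq0.
    by rewrite itn lieZr (XplusP _ yh : lie _ _ = _) yal eq_sym (negPf ne) !scale0r scaler0.
  rewrite (bigD1 (Ordinal (aut_order_gt0 sigma))) //= wb_dual eqxx ltr_wpDr ?ltr01 // sumr_ge0 // => n _.
  by have [->|->] := it0 n; rewrite ?ler01.
have [k0 [pk0 sk0]] : exists k, pos k /\ simp k.
  apply: contrapT => no; apply: (@Xp_neq0 _ _ c j); rewrite [LHS](wb_exp B) big1 // => k _.
  have [y [yd yal]] := coweight_exists g_simple c.
  have yh i : y i \in h by have [d ->] := yd i; exact: coroots_cartan.
  have wi i : lie (y i) (Xp j) = (i == j)%:R *: Xp j.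
    by rewrite (XplusP _ (yh i) : lie _ _ = _) yal eq_sym.
  have [e|/existsP[i ni]] := boolP [forall i, nu k (y i) == (i == j)%:R]; last first.
    by rewrite (phi_weight (yh i) (wi i)) ?scale0r.
  case: no; exists k.
  have nuy i : nu k (y i) = sgb K (sg k) * (nn k i)%:R.
    rewrite /wb_wt /wtv; congr (_ * _); rewrite (bigD1 i) //= yal eqxx mulr1 big1 ?addr0 // => l li.
    by rewrite yal eq_sym (negPf li) mulr0.
  have sk : sg k.
    have := forallP e j; rewrite nuy eqxx; case: (sg k) => //=; rewrite mulN1r.
    by rewrite eq_sym -subr_eq0 opprK -[1]/(1%:R) -natrD pnatr_eq0.
  have ni i : nn k i = (i == j).
    by have := forallP e i; rewrite nuy sk mul1r eqr_nat => /eqP.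
  split; first by rewrite /pos sk; apply/existsP; exists j; rewrite ni eqxx.
  by apply/existsP; exists j; rewrite porbit_id; apply/forallP => l; rewrite ni.
have cc := cO_gt0 g_simple sigma B j.
rewrite (bigD1 k0) ?pk0 //= ltr_wpDr //.
  apply: sumr_ge0 => k /andP[/andP[pk sk] _].
  by rewrite adhO // phiZ mulr_ge0 // ltW // phi_simp.
by rewrite adhO // phiZ mulr_gt0 // phi_simp.
Qed.

Definition chi_form (a b : g -> K) := \sum_(k | zer k) a (pi (u k)) * b (pi (ud k)).

Let kappa_hO0 j w : ~~ zer w -> kappa (hO j) (u w) = 0 /\ kappa (hO j) (ud w) = 0.
Proof.
move=> zw; have [y0 [y0h sy0 _ y0n]] := height_fixed g_simple sigma.
have nw : nu w y0 != 0.
  rewrite /wb_wt y0n mulf_neq0 //; first by case: (sg w); rewrite /= ?oppr_eq0 oner_eq0.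
  by rewrite pnatr_eq0 sum_nat_eq0.
have hy : lie y0 (hO j) = 0 *: hO j.
  by rewrite scale0r (cartan_abelian g_simple (c := c)) // hO_cartan.
split; first by apply: (kappa_weight B hy (wb_lie _ y0h)); rewrite add0r.
by apply: (kappa_weight B hy (wb_lie_ud g_simple _ y0h)); rewrite add0r oppr_eq0.
Qed.
Let kappa_hOu0 j w (zw : ~~ zer w) := (kappa_hO0 j zw).1.
Let kappa_hOud0 j w (zw : ~~ zer w) := (kappa_hO0 j zw).2.

Lemma chi_forml j (mu : dual (h0 sigma)) :
  chi_form (ev (al j)) (ev mu) = ev mu (hO j) / kappa (eO j) (fO j).
Proof.
rewrite /chi_form -(proj0_id (aut_hO sigma j)) [in RHS](ud_exp g_simple B (hO j)).
rewrite (lin_sumE _ _ _ (proj0_linear sigma)) ev_sumr mulr_suml.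
rewrite [RHS](bigID zer) /= [X in _ + X]big1 ?addr0.
  apply: eq_bigr => k zk; have [uh _] := zer_cartan zk.
  rewrite al_hO ?proj0_cartan ?aut_proj0 // -kappa_proj0 // (proj0_id (aut_hO sigma j)).
  by rewrite (linZE (proj0_linear _)) (evZr _ (kappa _ _)) mulrAC.
move=> k zk; rewrite (kappa_hOu0 j zk) scale0r (lin0E (proj0_linear _)) ev0r mul0r //.
Qed.

Lemma chi_formr j (mu : dual (h0 sigma)) :
  chi_form (ev mu) (ev (al j)) = ev mu (hO j) / kappa (eO j) (fO j).
Proof.
rewrite /chi_form -(proj0_id (aut_hO sigma j)) [in RHS](u_exp g_simple B (hO j)).
rewrite (lin_sumE _ _ _ (proj0_linear sigma)) ev_sumr mulr_suml.
rewrite [RHS](bigID zer) /= [X in _ + X]big1 ?addr0.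
  apply: eq_bigr => k zk; have [_ udh] := zer_cartan zk.
  rewrite [ev (al j) _]al_hO ?proj0_cartan ?aut_proj0 // -kappa_proj0 // (proj0_id (aut_hO sigma j)).
  by rewrite (linZE (proj0_linear _)) (evZr _ (kappa _ _)) mulrA [X in X / _]mulrC.
move=> k zk; rewrite (kappa_hOud0 j zk) scale0r (lin0E (proj0_linear _)) ev0r mul0r //.
Qed.

(** The difference is [(lam + mu + 2 rho, lam - mu)], a sum over the simple roots with coefficients
    [n j]. Each pairing is positive: the two weights contribute nonnegative terms and [2 rho] a
    positive one. *)
Lemma casimir_neq (lam mu : dual (h0 sigma)) n :
  (forall y, y \in h0 sigma -> ev lam y = ev mu y + wt n y) ->
  (exists i, n i <> 0%N) -> (forall j, 0 <= ev lam (hO j)) -> (forall j, 0 <= ev mu (hO j)) ->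
  chi lam <> chi mu.
Proof.
move=> lm [i0 ni0] l0 mu0; apply/eqP; rewrite -subr_eq0.
pose r j := kappa (eO j) (fO j).
have r0 j : 0 < r j by exact: kappa_eO_fO_pos.
have h0pi k : zer k -> pi (u k) \in h0 sigma /\ pi (ud k) \in h0 sigma.
  by move=> /zer_cartan[uh udh]; rewrite !h0P !proj0_cartan // !aut_proj0 // !eqxx.
have Th0 : hw_tail \in h0 sigma by rewrite h0P tail_cartan tail_fixed eqxx.
have -> : chi lam - chi mu =
    \sum_j (n j)%:R * ((ev lam (hO j) + ev mu (hO j) + kappa (hO j) hw_tail) / r j).
  rewrite /chi lm // [X in X - _](_ : _ =
      \sum_(k | zer k) (ev mu (pi (u k)) * ev mu (pi (ud k)) + (wt n (pi (u k)) * ev lam (pi (ud k)) + ev mu (pi (u k)) * wt n (pi (ud k)))) + (ev mu hw_tail + wt n hw_tail)); last first.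
    by congr (_ + _); apply: eq_bigr => k /h0pi[uh udh]; rewrite !lm //; ring.
  rewrite big_split /=; set A := \sum_(k | zer k) _; set D := \sum_(k | zer k) _.
  have -> : A + D + (ev mu hw_tail + wt n hw_tail) - (A + ev mu hw_tail) = D + wt n hw_tail by ring.
  rewrite /D /wtv big_split /=.
  rewrite (eq_bigr (fun k => \sum_j (n j)%:R * (ev (al j) (pi (u k)) * ev lam (pi (ud k))))) => [|k _]; last first.
    by rewrite mulr_suml; apply: eq_bigr => j _; rewrite mulrA.
  rewrite [X in _ + X + _](eq_bigr (fun k => \sum_j (n j)%:R * (ev mu (pi (u k)) * ev (al j) (pi (ud k))))) => [|k _]; last first.
    by rewrite mulr_sumr; apply: eq_bigr => j _; rewrite mulrCA.
  rewrite ![\sum_(k | zer k) _]exchange_big -!big_split /=; apply: eq_bigr => j _.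
  rewrite -!mulr_sumr -!mulrDr -/(chi_form (ev (al j)) (ev lam)) -/(chi_form (ev mu) (ev (al j))).
  rewrite chi_forml chi_formr al_hO ?tail_cartan ?tail_fixed //.
  by rewrite !mulrDl.
have t0 j : 0 < (ev lam (hO j) + ev mu (hO j) + kappa (hO j) hw_tail) / r j.
  by rewrite divr_gt0 // ltr_wpDl ?addr_ge0 // kappa_tail_gt0.
have n0 : 0 < (n i0)%:R * ((ev lam (hO i0) + ev mu (hO i0) + kappa (hO i0) hw_tail) / r i0).
  by rewrite mulr_gt0 // ltr0n lt0n; apply/eqP.
rewrite (bigD1 i0) //= gt_eqF // ltr_wpDr // sumr_ge0 // => j _.
by rewrite mulr_ge0 // ltW.
Qed.

End Casimir.

(** * Modules over enveloping algebras and highest weight maps *)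

Section EnvelopingModules.
Variables (K : fieldType) (L : lieAlgType K).

Lemma monomialZ (a : K) k : << a *g k >> = a *: (mkmalgU k 1 : free_alg L).
Proof. by apply/malgP=> k'; rewrite [RHS](@mcoeffZ _ K) !mcoeffU mulr_natr. Qed.

Lemma monomial_letters (s : seq L) :
  mkmalgU (FMonom s) 1 = \prod_(x <- s) letter x :> free_alg L.
Proof.
elim: s => [|x s IHs]; first by rewrite big_nil -(fmE [::]).
rewrite big_cons -IHs /letter -[RHS]/(_ * _) malgM_def fgmulUU mulr1; congr mkmalgU.
apply: val_inj; rewrite [RHS]fmM fmU; reflexivity.
Qed.

Lemma env_gen_ind (P : env L -> Prop) : P 1 -> (forall u v, P u -> P v -> P (u + v)) ->
  (forall a u, P u -> P (a *: u)) -> (forall x u, P u -> P (emb x * u)) -> forall u, P u.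
Proof.
move=> P1 PD PZ Px; have P0 : P 0 by rewrite -(scale0r 1); exact: PZ.
elim/env_ind=> f; rewrite (monalgE f) -/(free_alg L) (linear_sum (@envcl K L)).
apply: big_ind => // k _.
have -> : << f@_k *g k >> = f@_k *: (mkmalgU k 1 : free_alg L).
  exact: monomialZ.
rewrite linearZ_LR; apply: PZ; case: k => s; rewrite monomial_letters rmorph_prod.
by elim: s => [|x s IHs]; rewrite ?big_nil // big_cons; exact: Px.
Qed.

End EnvelopingModules.

Section RestrictToScalars.
Variables (K : fieldType) (A : algType K) (N : lmodType A).

Definition kmod : lmodType K := resmod (in_alg A) N.

Lemma kmodZ a (x : kmod) : a *: x = a%:A *: (x : N).
Proof. by []. Qed.

Definition kmod_op (u : A) (x : kmod) : kmod := u *: (x : N).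

Lemma kmod_op_linear u : linear (kmod_op u).
Proof.
by move=> a x y; rewrite /kmod_op (scalerDr u (a *: x : N)) !kmodZ !scalerA mulr_algl mulr_algr.
Qed.

Lemma kmod_opDl u v x : kmod_op (u + v) x = kmod_op u x + kmod_op v x.
Proof. exact: (@scalerDl _ N x u v). Qed.
Lemma kmod_opZl a u x : kmod_op (a *: u) x = a *: kmod_op u x.
Proof. by rewrite kmodZ /kmod_op scalerA mulr_algl. Qed.
Lemma kmod_opM u v x : kmod_op (u * v) x = kmod_op u (kmod_op v x).
Proof. by rewrite /kmod_op scalerA. Qed.
Lemma kmod_opB (u v : A) x : kmod_op (u * v - v * u) x = kmod_op u (kmod_op v x) - kmod_op v (kmod_op u x).
Proof. by rewrite kmod_opDl -[- (v * u)]scaleN1r kmod_opZl scaleN1r !kmod_opM. Qed.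
Lemma kmod_op1 x : kmod_op 1 x = x.
Proof. exact: (@scale1r _ N x). Qed.

End RestrictToScalars.

Section EnvRep.
Variables (K : fieldType) (L : lieAlgType K) (N : lmodType (env L)).

Definition kmod_rep : lrep L (kmod N).
Proof.
apply: (@LRep K L (kmod N) (fun x => mklin (kmod_op_linear (N := N) (emb x)))) => [x y a|b x a|x y a].
- by rewrite [LHS]/= linearD; exact: kmod_opDl.
- by rewrite [LHS]/= linearZ_LR; exact: kmod_opZl.
- by rewrite [LHS]/= emb_lie; exact: kmod_opB.
Defined.

Lemma kmod_repE x a : kmod_rep x a = emb x *: (a : N).
Proof. by []. Qed.
End EnvRep.

Definition lrep_res (K : fieldType) (L L' : lieAlgType K) (phi : lieHom L' L) (M : lmodType K)
  (r : lrep L M) : lrep L' M.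
Proof.
apply: (@LRep K L' M (fun x => r (phi x))) => [x y a|b x a|x y a].
- by rewrite linearD ropD.
- by rewrite linearZ_LR ropZ.
- by rewrite lieHomP rop_lie.
Defined.

Section PairRep.
Variables (K : fieldType) (L : lieAlgType K) (M N : lmodType K) (r : lrep L M) (s : lrep L N).

Lemma pair_op_linear x : linear (fun z : M * N => (r x z.1, s x z.2)).
Proof. by move=> a y z; rewrite !linearP. Qed.

Definition pair_rep : lrep L (M * N)%type.
Proof.
apply: (@LRep K L (M * N)%type (fun x => mklin (pair_op_linear x))) => [x y a|b x a|x y a] /=.
- by rewrite !ropD.
- by rewrite !ropZ.
- by rewrite !rop_lie.
Defined.
End PairRep.

Section Cyclic.
Variables (K : fieldType) (L : lieAlgType K) (M : lmodType K) (r : lrep L M).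

Inductive cyc (w : M) : M -> Prop :=
| cyc_w : cyc w w
| cyc_D x y : cyc w x -> cyc w y -> cyc w (x + y)
| cyc_Z a x : cyc w x -> cyc w (a *: x)
| cyc_r z x : cyc w x -> cyc w (r z x).

Lemma iter_rop_nil z N y x a b : (a + b)%N = N -> iter a (lie z) y = 0 -> iter b (r z) x = 0 ->
  iter N (r z) (r y x) = 0.
Proof.
elim: N a b y x => [|N IHN] [|a] [|b] y x //.
- by move=> _ /= -> _; rewrite rop0.
- by move=> _ y0 _; rewrite [y]y0 rop0 (iter_lin0 (r z)).
- by move=> _ _ x0; rewrite [x]x0 linear0 (iter_lin0 (r z)).
move=> e ya xb; rewrite iterSr ropC iter_linD.
rewrite (IHN a.+1 b) //; last by rewrite -iterSr.
  rewrite add0r (IHN a b.+1) //; last by rewrite -iterSr.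
  by lia.
by lia.
Qed.

(** By the Leibniz rule, nilpotency of [z] passes from the generator to the whole cyclic module when
    [ad z] is locally nilpotent. *)
Lemma cyc_nilpotent z w : (forall y, exists n, iter n (lie z) y = 0) ->
  (exists k, iter k (r z) w = 0) -> forall x, cyc w x -> exists k, iter k (r z) x = 0.
Proof.
move=> nz [k wk] x; elim=> {x} [|x y _ [a xa] _ [b yb]|e x _ [a xa]|y x _ [b xb]].
- by exists k.
- by exists (a + b)%N; rewrite iter_linD (iter_le0 (leq_addr b a)) // (iter_le0 (leq_addl a b)) // addr0.
- by exists a; rewrite iter_linZ xa scaler0.
- by have [a ya] := nz y; exists (a + b)%N; exact: (@iter_rop_nil _ _ _ _ a b).
Qed.

End Cyclic.

(** * Spanning by lowering words *)

Section LowWords.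
Variables (K : fieldType) (L : lieAlgType K) (M : lmodType K) (r : lrep L M).
Variables (I : finType) (B : (I -> nat) -> L -> Prop) (T0 : M -> Prop).
Let letters : set L := [set b | exists n, B n b].

(** The spanning half of the Poincare-Birkhoff-Witt theorem for a triangular decomposition: lowering
    letters applied to a space [T0] of top vectors. The index records the weight lost, in
    coordinates over the simple roots. *)
Inductive low : (I -> nat) -> M -> Prop :=
| low0 t : T0 t -> low (fun=> 0%N) t
| lowS n k b s : B n b -> low k s -> low (fun i => n i + k i)%N (r b s).

Definition low_span : set M := submod_gen [set s | exists n, low n s].

Hypothesis L_span : forall x, exists y b,
  [/\ x = y + b, forall t, T0 t -> T0 (r y t) & submod_gen letters b].

Lemma low_span_letter b s : submod_gen letters b -> low_span s -> low_span (r b s).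
Proof.
move=> lb; elim=> {s} [s [n ns]||x y _ IHx _ IHy|a x _ IHx]; last 3 first.
- by rewrite linear0; exact: submod_gen0.
- by rewrite linearD; exact: submod_genD.
- by rewrite linearZ_LR; exact: submod_genZ.
elim: lb => {b} [b [k kb]||x y _ IHx _ IHy|a x _ IHx].
- by apply: submod_gen_in; exists (fun i => k i + n i)%N; exact: lowS.
- by rewrite rop0; exact: submod_gen0.
- by rewrite ropD; exact: submod_genD.
- by rewrite ropZ; exact: submod_genZ.
Qed.

Lemma low_span_stable x s : low_span s -> low_span (r x s).
Proof.
move=> ss; elim: ss x => {s} [s [n ns] x||u v _ IHu _ IHv x|a u _ IHu x]; last 3 first.
- by move=> x; rewrite linear0; exact: submod_gen0.
- by rewrite linearD; apply: submod_genD; [exact: IHu | exact: IHv].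
- by rewrite linearZ_LR; apply: submod_genZ; exact: IHu.
elim: ns x => {n s} [t Tt|n k b s nb ks IHs] x.
  have [y [b [-> yT lb]]] := L_span x; rewrite ropD; apply: submod_genD.
    by apply: submod_gen_in; exists (fun=> 0%N); apply/low0/yT.
  by apply: low_span_letter => //; apply: submod_gen_in; exists (fun=> 0%N); exact: low0.
rewrite ropC; apply: submod_genD; last exact: IHs.
by apply: low_span_letter; [apply: submod_gen_in; exists n | exact: IHs].
Qed.

Lemma cyc_low_span w s : T0 w -> cyc r w s -> low_span s.
Proof.
move=> Tw; elim=> {s} [|x y _ IHx _ IHy|a x _ IHx|z x _ IHx].
- by apply: submod_gen_in; exists (fun=> 0%N); exact: low0.
- exact: submod_genD.
- exact: submod_genZ.
- exact: low_span_stable.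
Qed.

Lemma low_weight d (lam : K) (a : I -> K) : (forall t, T0 t -> r d t = lam *: t) ->
  (forall n b, B n b -> lie d b = - (\sum_i (n i)%:R * a i) *: b) ->
  forall n s, low n s -> r d s = (lam - \sum_i (n i)%:R * a i) *: s.
Proof.
move=> dT dB n s; elim=> {n s} [t Tt|n k b s nb ks IHs].
  by rewrite dT // big1 ?subr0 // => i _; rewrite mul0r.
rewrite ropC IHs (dB n b nb) ropZ linearZ_LR /= -scalerDl; congr (_ *: _).
rewrite -addrA -opprD; congr (_ - _); rewrite addrC -big_split /=.
by apply: eq_bigr => i _; rewrite natrD mulrDl.
Qed.

Lemma low_T0 n s : (forall n b, B n b -> exists i, n i <> 0%N) -> low n s ->
  T0 s \/ exists i, n i <> 0%N.
Proof.
move=> B0; elim=> {n s} [t|n k b s nb _ _]; [by left | right].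
by have [i ni] := B0 _ _ nb; exists i; case: (n i) ni.
Qed.

End LowWords.

Section OrbitSl2.
Variables (K : numClosedFieldType) (g : fdLieAlgType K).
Hypothesis g_simple : lie_simple g.
Variable c : chevalley g.
Variables (m : nat) (sigma : diagram_aut c m).

Local Notation I := (node c).
Local Notation h := (cartan c).
Local Notation al := (sroot c).
Local Notation wt := (@wtv K g c).
Local Notation pi := (proj0 sigma).
Local Notation p0 := (p0 g_simple sigma).
Local Notation eO := (eO sigma).
Local Notation fO := (fO sigma).
Local Notation hO := (hO sigma).
Local Notation cO := (cO sigma).

Lemma cO_pos j : 0 < cO j.
Proof. by have [B _] := wbasis_exists g_simple c; exact: (cO_gt0 g_simple sigma B j). Qed.

Lemma fO_nilpotent j x : exists n, iter n (lie (fO j)) x = 0.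
Proof.
have [y0 [y0h sy0 y1 _]] := height_fixed g_simple sigma.
apply: (@shift_nilpotent _ _ (lie y0) _ (- 1)) => [|y]; first by rewrite oppr_eq0 oner_eq0.
change (lie y0 (lie (fO j) y) = lie (fO j) (lie y0 y) + -1 *: lie (fO j) y).
by rewrite lieJ lie_fO // y1 scaleN1r lieNl scaleN1r addrC.
Qed.

Lemma scale_linear (M : lmodType K) a (T : {linear M -> M}) : linear (fun x => a *: T x).
Proof. by move=> b x y; rewrite linearP scalerDr !scalerA mulrC. Qed.

Variables (M : lmodType K) (r : lrep (g0 sigma) M).

Lemma orbit_sl2 j : sl2 (mklin (scale_linear (2%:R / cO j) (r (p0 (eO j))))) (r (p0 (fO j)))
  (mklin (scale_linear (2%:R / cO j) (r (p0 (hO j))))).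
Proof.
have c0 : cO j != 0 by rewrite gt_eqF ?cO_pos.
have lie_p0 x y : sigma x = x -> lie (p0 x) (p0 y) = p0 (lie x y).
  by move=> sx; apply: val_inj; rewrite /= (proj0_lie y sx) (proj0_id sx).
have p0Z a x : p0 (a *: x) = a *: p0 x by rewrite (linZE (p0_linear g_simple sigma)).
have hh : ev (al j) (hO j) = cO j by [].
split=> x /=.
- rewrite ropC scalerDr linearZ_LR /= lie_p0 ?aut_eO // lie_eO_fO; lmod K M.
- rewrite linearZ_LR /= ropC lie_p0 ?aut_hO // lie_eO ?hO_cartan ?aut_hO // p0Z ropZ hh.
  by rewrite linearZ_LR /= !scalerDr !scalerA; congr (_ + _); congr (_ *: _); field.
- rewrite ropC lie_p0 ?aut_hO // lie_fO ?hO_cartan ?aut_hO // p0Z ropZ hh.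
  rewrite linearZ_LR /= scalerDr scalerA; congr (_ + _).
  by rewrite -scaleNr; congr (_ *: _); field.
Qed.

End OrbitSl2.

(** * Maps out of a simple module, by the Casimir operator *)

Section HighestWeightMap.
Variables (K : numClosedFieldType) (g : fdLieAlgType K).
Hypothesis g_simple : lie_simple g.
Variable c : chevalley g.
Variables (m : nat) (sigma : diagram_aut c m).

Local Notation I := (node c).
Local Notation h := (cartan c).
Local Notation al := (sroot c).
Local Notation wt := (@wtv K g c).
Local Notation pi := (proj0 sigma).
Local Notation p0 := (p0 g_simple sigma).
Local Notation fO := (fO sigma).
Local Notation hO := (hO sigma).

Definition low_letter (n : I -> nat) (b : g0 sigma) :=
  (exists i, n i <> 0%N) /\ exists2 f, root_vec false n f & b = p0 f.

Lemma low_letter_weight n b (y : g0 sigma) : low_letter n b -> val y \in h ->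
  lie y b = - wt n (val y) *: b.
Proof.
move=> [_ [f wf ->]] yh; rewrite -p0_lie wf // mulN1r.
by rewrite (linZE (p0_linear g_simple sigma)).
Qed.

Lemma g0_decomp (x : g0 sigma) : exists y a b, [/\ x = y + a + b, val y \in h,
  nplus c (val a) & submod_gen [set b | exists n, low_letter n b] b].
Proof.
have [y [a [b [yh ra rb e]]]] := triangular g_simple c (val x).
exists (p0 y), (p0 a), (p0 b); split.
- by rewrite -(p0_val g_simple x) e !(linDE (p0_linear g_simple sigma)).
- exact: proj0_cartan.
- by apply/rootsum_nplus => //; exact: proj0_rootsum.
- elim: rb => {b e} [b [n [i ni] wb]||b b' _ IHb _ IHb'|k b _ IHb].
  + by apply: submod_gen_in; exists n; split; [exists i | exists b].
  + by rewrite (lin0E (p0_linear g_simple sigma)); exact: submod_gen0.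
  + by rewrite (linDE (p0_linear g_simple sigma)); exact: submod_genD.
  + by rewrite (linZE (p0_linear g_simple sigma)); exact: submod_genZ.
Qed.

Variable lam : dual (h0 sigma).

Section Spectrum.
Variables (M : lmodType K) (r : lrep (g0 sigma) M) (w : M).
Hypothesis w_hw : singular r lam w.

Let T0 x := exists a : K, x = a *: w.

Lemma hw_low_span x : cyc r w x -> low_span r low_letter T0 x.
Proof.
apply: cyc_low_span; last by exists 1; rewrite scale1r.
move=> z; have [y [a [b [-> yh na lb]]]] := g0_decomp z.
exists (y + a), b; split=> // t [k ->]; exists (k * ev lam (val y)).
by rewrite linearZ_LR ropD (w_hw.1 a na) addr0 (w_hw.2 y yh) scalerA.
Qed.

Lemma hw_low_weight (y : g0 sigma) n x : val y \in h -> low r low_letter T0 n x ->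
  r y x = (ev lam (val y) - wt n (val y)) *: x.
Proof.
move=> yh; apply: (low_weight (a := fun i => ev (al i) (val y))).
  by move=> t [k ->]; rewrite linearZ_LR (w_hw.2 y yh) !scalerA mulrC.
by move=> k b kb; exact: low_letter_weight.
Qed.
End Spectrum.

Variables (V M : lmodType K) (rV : lrep (g0 sigma) V) (rM : lrep (g0 sigma) M).
Variables (v : V) (w : M).
Hypotheses (v_hw : singular rV lam v) (w_hw : singular rM lam w) (v_neq0 : v <> 0).
Hypothesis w_fin : forall j, exists k, iter k (rM (p0 (fO j))) w = 0.
Hypothesis v_gen : forall x, cyc rV v x.

Let r := pair_rep rV rM.
Let vw : (V * M)%type := (v, w).
Let N := cyc r vw.

Let vw_hw : singular r lam vw.
Proof.
split=> x hx; rewrite /r /=; first by rewrite (v_hw.1 x hx) (w_hw.1 x hx).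
by rewrite (v_hw.2 x hx) (w_hw.2 x hx).
Qed.

Let N_cycM x : N x -> cyc rM w x.2.
Proof.
elim=> {x} [|x y _ IHx _ IHy|a x _ IHx|z x _ IHx]; [exact: cyc_w | exact: cyc_D | exact: cyc_Z | exact: cyc_r].
Qed.

Let N0 : N 0.
Proof. by rewrite -(scale0r vw); apply/cyc_Z/cyc_w. Qed.

Let y0_ex := height_fixed g_simple sigma.
Let y0 := sval (cid y0_ex).
Let y0h : y0 \in h. Proof. by case: (svalP (cid y0_ex)). Qed.
Let sy0 : sigma y0 = y0. Proof. by case: (svalP (cid y0_ex)). Qed.
Let y0n n : wt n y0 = (\sum_i n i)%:R. Proof. by case: (svalP (cid y0_ex)). Qed.
Let Y : g0 sigma := FixLie (introT eqP sy0).

(* [N] is to be the graph of the map; the Casimir eigenvalue of a singular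
   vector forces its part over [0] to vanish. *)
Let G k x := [/\ N x, x.1 = 0 & r Y x = (ev lam y0 - k%:R) *: x].

Let low_eigen k x : r Y x = k *: x -> N x -> (forall n : nat, k != ev lam y0 - n%:R) -> x = 0.
Proof.
move=> ex Nx kn; have := hw_low_span vw_hw Nx => Sx.
apply: (eigen_avoid (T := r Y) (a := k)) => //.
elim: Sx => {x ex Nx} [x [n nx]|||]; [|exact: submod_gen0|by move=> *; exact: submod_genD|by move=> *; exact: submod_genZ].
apply: submod_gen_in; exists (ev lam y0 - (\sum_i n i)%:R); first by rewrite eq_sym.
by rewrite (hw_low_weight vw_hw _ nx) // y0n.
Qed.

(** In top degree [N] is the line spanned by [vw], whose first component is nonzero. *)
Let G0 x : G 0%N x -> x = 0.
Proof.
move=> [Nx x1 ex].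
have [a [z [xE]]] : exists a z, x = a *: vw + z /\
    submod_gen [set u | exists2 b, b != ev lam y0 & r Y u = b *: u] z.
  elim: (hw_low_span vw_hw Nx) => {x Nx x1 ex} [x [n nx]||x y _ [a [z [-> az]]] _ [b [t [-> bt]]]|b x _ [a [z [-> az]]]].
  - have [|[a ->]|[i ni]] := low_T0 _ nx; first by move=> k b [].
      by exists a, 0; rewrite addr0; split=> //; exact: submod_gen0.
    exists 0, x; rewrite scale0r add0r; split=> //; apply: submod_gen_in.
    exists (ev lam y0 - (\sum_i n i)%:R); last by rewrite (hw_low_weight vw_hw _ nx) // y0n.
    rewrite -[X in _ != X]subr0 (inj_eq (addrI _)) eqr_opp pnatr_eq0 sum_nat_eq0 negb_forall.
    by apply/existsP; exists i; apply/eqP.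
  - by exists 0, 0; rewrite scale0r addr0; split=> //; exact: submod_gen0.
  - by exists (a + b), (z + t); rewrite scalerDl addrACA; split=> //; exact: submod_genD.
  - by exists (b * a), (b *: z); rewrite scalerDr scalerA; split=> //; exact: submod_genZ.
move=> Sz; suff z0 : z = 0.
  move: x1; rewrite xE z0 addr0 => /= /eqP; rewrite scaler_eq0 => /orP[/eqP ->|/eqP//].
  by rewrite scale0r.
apply: (eigen_avoid (T := r Y) (a := ev lam y0)) => //.
have -> : z = x - a *: vw by rewrite xE addrC addKr.
by rewrite (linearB (r Y)) ex subr0 linearZ_LR (vw_hw.2 Y y0h) scalerBr !scalerA mulrC.
Qed.

Let Hw := {y : g0 sigma | val y \in h}.
Let wv (j : dual (h0 sigma)) x := forall y : Hw, r (sval y) x = ev j (val (sval y)) *: x.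
Let Om (j : dual (h0 sigma)) :=
  exists n, forall y, y \in h0 sigma -> ev lam y = ev j y + wt n y.

Let by_weight (E : V * M -> Prop) x :
  (forall x y, E x -> E y -> E (x + y)) -> (forall a x, E x -> E (a *: x)) ->
  (forall (y : Hw) x, E x -> E (r (sval y) x)) ->
  (forall j u, Om j -> wv j u -> E u -> u = 0) -> N x -> E x -> x = 0.
Proof.
move=> ED EZ Er Ej Nx Ex.
have h0h (y : Hw) : val (sval y) \in h0 sigma.
  by case: y => y /= yh; rewrite h0P yh; apply/eqP/eqP; exact: valP y.
have : submod_gen [set u | exists2 j, Om j & wv j u] x.
  apply: submod_gen_sub (hw_low_span vw_hw Nx) => u [n nu]; apply: submod_gen_in.
  have [b _ bn] := wtv_nspan n.
  exists (lam - Defs.restrict (h0 sigma) b).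
    by exists n => y yh; rewrite evB restrictE // bn subrK.
  move=> y; rewrite (hw_low_weight vw_hw _ nu) ?(svalP y) //.
  by rewrite evB restrictE // bn.
case/weight_decomp=> [j y|||s [f [us sO fw xE]]].
- by rewrite linear0 scaler0.
- by move=> j u u' ju ju' y; rewrite linearD ju ju' scalerDr.
- by move=> j a u ju y; rewrite linearZ_LR ju !scalerA mulrC.
rewrite xE big1_seq // => j /andP[_ js]; apply: (Ej j) => //; first exact: sO.
rewrite xE in Ex.
apply: (weight_component (T := fun y : Hw => r (sval y)) (chi := fun j y => ev j (val (sval y))) ED EZ _ Er us _ _ Ex js).
- by move=> y; exact: linearP.
- move=> j1 j2 _ _ j12; apply: contrapT => no; move/eqP: j12; apply.
  apply: dual_ext => y; rewrite h0P => /andP[yh sy].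
  pose Y' : Hw := exist _ (FixLie sy : g0 sigma) yh.
  by apply/eqP; apply: contraPT (no) => ne; apply: contra_not no; exists Y'.
- by move=> j' _ y; exact: fw.
Qed.

Let GD k x y : G k x -> G k y -> G k (x + y).
Proof.
move=> [Nx x1 ex] [Ny y1 ey]; split; [exact: cyc_D | by rewrite /= x1 y1 addr0 |].
by rewrite linearD ex ey scalerDr.
Qed.
Let GZ k a x : G k x -> G k (a *: x).
Proof.
move=> [Nx x1 ex]; split; [exact: cyc_Z | by rewrite /= x1 scaler0 |].
by rewrite linearZ_LR ex !scalerA mulrC.
Qed.
Let Gr k (y : Hw) x : G k x -> G k (r (sval y) x).
Proof.
move=> [Nx x1 ex]; split; [exact: cyc_r | by rewrite /= x1 linear0 |].
rewrite ropC ex linearZ_LR; have -> : lie Y (sval y) = 0; last by rewrite rop0 addr0.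
by apply: val_inj; rewrite /= (cartan_abelian g_simple (c := c)) ?(svalP y).
Qed.

Let weight_ge0 (mu : dual (h0 sigma)) x j : singular rM mu x -> x <> 0 ->
  (exists k, iter k (rM (p0 (fO j))) x = 0) -> 0 <= ev mu (hO j).
Proof.
move=> [nx wx] x0 [k kx].
have eh : rM (p0 (eO sigma j)) x = 0.
  apply: nx; apply/rootsum_nplus => //; apply: proj0_rootsum => //; apply: big_ind => [||i _].
  - exact: submod_gen0.
  - by move=> *; exact: submod_genD.
  - apply: submod_gen_in; exists (fun l => (l == i) : nat); first by exists i; rewrite eqxx.
    by move=> y yh; rewrite mul1r wtv_delta; exact: XplusP.
have [||n _] := hw_nat (orbit_sl2 g_simple rM j) _ _ kx x0 (a := 2%:R / cO sigma j * ev mu (hO j)).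
- by rewrite /= eh scaler0.
- by rewrite /= wx /= proj0_id ?aut_hO ?hO_cartan // scalerA.
have c0 := cO_pos g_simple sigma j => e.
have : 0 <= 2%:R / cO sigma j * ev mu (hO j) by rewrite e ler0n.
by rewrite pmulr_rge0 // divr_gt0 // ltr0n.
Qed.

Let w_fin_cyc j x : cyc rM w x -> exists k, iter k (rM (p0 (fO j))) x = 0.
Proof.
apply: cyc_nilpotent; last exact: w_fin.
move=> y; have [n yn] := fO_nilpotent g_simple sigma j (val y); exists n; apply: val_inj.
have it k : val (iter k (lie (p0 (fO j))) y) = iter k (lie (fO j)) (val y).
  by elim: k => //= k ->; rewrite proj0_id ?aut_fO.
by rewrite /= it yn.
Qed.

Let casimir_N (B : wbasis c) x : N x -> casimir g_simple B r x = chi B lam *: x.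
Proof.
elim=> {x} [|x y _ IHx _ IHy|a x _ IHx|z x _ IHx].
- exact: casimir_singular.
- by rewrite casimirD IHx IHy scalerDr.
- by rewrite casimirZ IHx !scalerA mulrC.
- by rewrite -casimir_comm IHx linearZ_LR.
Qed.

(** A weight vector in [G k] is singular, because raising leads to smaller depth. The Casimir
    operator acts on it by [chi j], but on all of [N] by [chi lam]. Nilpotency of the [f_O] makes
    both weights nonnegative on the [h_O], and [casimir_neq] leaves only zero. *)
Let GS k : (forall l, (l < k)%N -> forall x, G l x -> x = 0) -> (0 < k)%N -> forall x, G k x -> x = 0.
Proof.
move=> IH k0 x Gx; have [Nx _ _] := Gx.
apply: (by_weight (@GD k) (@GZ k) (@Gr k) _ Nx Gx) => j u [n jn] uw Gu.
have [Nu u1 eu] := Gu.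
have uwt (y : g0 sigma) : val y \in h -> r y u = ev j (val y) *: u.
  by move=> yh; exact: (uw (exist _ y yh)).
have sing : singular r j u.
  split=> // e ne; have re : rootsum c true (val e) by apply/rootsum_nplus.
  rewrite -(p0_val g_simple e).
  elim: re => {ne e} [e [n' [i ni] we]||y z _ IHy _ IHz|a y _ IHy].
  - have Ye : r Y (r (p0 e) u) = (ev lam y0 - k%:R + (\sum_l n' l)%:R) *: r (p0 e) u.
      rewrite ropC eu -p0_lie we // mul1r y0n (linZE (p0_linear g_simple sigma)) ropZ linearZ_LR.
      by rewrite -scalerDl.
    have [le|gt] := leqP (\sum_l n' l) k.
      apply: (IH (k - \sum_l n' l)%N); first by rewrite ltn_subrL k0 lt0n sum_nat_eq0 negb_forall andbT; apply/existsP; exists i; apply/eqP.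
      split; [exact: cyc_r | by rewrite /= u1 linear0 | rewrite Ye natrB //].
      by rewrite opprB addrA addrAC.
    apply: (low_eigen Ye); first exact: cyc_r.
    move=> q; apply/eqP => e0; have : ((\sum_l n' l + q)%:R == k%:R :> K).
      by apply/eqP/(addrI (ev lam y0 - k%:R)); rewrite natrD addrA e0; ring.
    by rewrite eqr_nat gtn_eqF // ltn_addr.
  - by rewrite (lin0E (p0_linear g_simple sigma)) rop0.
  - by rewrite (linDE (p0_linear g_simple sigma)) ropD IHy IHz addr0.
  - by rewrite (linZE (p0_linear g_simple sigma)) ropZ IHy scaler0.
apply: contrapT => u0; have u2 : u.2 <> 0 by move=> u2; apply: u0; case: (u) u1 u2 => ? ? /= -> ->.
have w0 : w <> 0.
  move=> w0; apply: u2; elim: (N_cycM Nu) => [|y z _ -> _ ->|a y _ ->|z y _ ->] //.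
  - exact: addr0.
  - exact: scaler0.
  - exact: linear0.
have singM : singular rM j u.2.
  by split=> y hy; [have := sing.1 y hy | have := sing.2 y hy] => /(congr1 snd).
have [B _] := wbasis_exists g_simple c.
have := casimir_singular g_simple B sing; rewrite casimir_N // => /eqP.
rewrite -subr_eq0 -scalerBl scaler_eq0 => /orP[|/eqP//]; rewrite subr_eq0 => /eqP.
apply: (casimir_neq g_simple jn) => [||l].
- apply: contrapT => no; move: k0; suff -> : k = 0%N by [].
  have : ev lam y0 - k%:R = ev j y0.
    apply/eqP; rewrite -subr_eq0 -[_ == 0]orbF -(introF eqP u0) -scaler_eq0 scalerBl subr_eq0.
    by rewrite -eu -(uwt Y y0h).
  rewrite (jn y0) ?h0P ?y0h ?sy0 ?eqxx // y0n => /eqP.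
  rewrite -addrA -subr_eq0 addrAC subrr add0r big1 => [|i _].
    by rewrite add0r oppr_eq0 pnatr_eq0 => /eqP.
  by case: (n i =P 0%N) => // ni; case: no; exists i.
- by move=> l; apply: (weight_ge0 w_hw w0 (w_fin l)).
- by apply: (weight_ge0 singM u2); apply: w_fin_cyc; exact: N_cycM.
Qed.

Let G_eq0 k x : G k x -> x = 0.
Proof.
elim/ltn_ind: k x => k IHk x; case: (posnP k) => [->|k0]; [exact: G0 | exact: (GS IHk k0)].
Qed.

Let N_graph x : N x -> x.1 = 0 -> x = 0.
Proof.
move=> Nx x1; apply: (@by_weight (fun x => N x /\ x.1 = 0)) => //.
- by move=> y z [Ny y1] [Nz z1]; split; [exact: cyc_D | rewrite /= y1 z1 addr0].
- by move=> a y [Ny y1]; split; [exact: cyc_Z | rewrite /= y1 scaler0].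
- by move=> y z [Nz z1]; split; [exact: cyc_r | rewrite /= z1 linear0].
move=> j u [n jn] uw [Nu u1]; apply: (@G_eq0 (\sum_i n i) u); split=> //.
by rewrite (uw (exist _ Y y0h)) /= (jn y0) ?h0P ?y0h ?sy0 ?eqxx // y0n addrK.
Qed.

(** [N] is the graph of the map: single valued by [N_graph], and defined on all of [V] because [v]
    generates. *)
Lemma hw_map : exists f : {linear V -> M}, f v = w /\ forall x y, f (rV x y) = rM x (f y).
Proof.
have /all_sig[f fN] : forall x, {y | N (x, y)}.
  move=> x; apply: cid; elim: (v_gen x) => {x} [|x y _ [x' Nx] _ [y' Ny]|a x _ [x' Nx]|z x _ [x' Nx]].
  - by exists w; exact: cyc_w.
  - by exists (x' + y'); exact: (cyc_D Nx Ny).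
  - by exists (a *: x'); exact: (cyc_Z a Nx).
  - by exists (rM z x'); exact: (cyc_r z Nx).
have uniqN x y y' : N (x, y) -> N (x, y') -> y = y'.
  move=> Ny Ny'; apply/subr0_eq; have Nd := cyc_D Ny (cyc_Z (-1) Ny').
  have := N_graph Nd; rewrite /= scaleN1r subrr => /(_ erefl) /(congr1 snd) /=.
  by rewrite scaleN1r.
have flin : linear f.
  by move=> a x y; apply: uniqN (fN _) _; exact: (cyc_D (cyc_Z a (fN x)) (fN y)).
exists (mklin flin); split; first exact: uniqN (fN _) (cyc_w _ _).
by move=> x y; apply: uniqN (fN _) _; exact: (cyc_r x (fN y)).
Qed.

End HighestWeightMap.

(** * The universal property of the twisted Weyl module *)

Section Descend.
Variables (R : pzRingType) (M N : lmodType R) (S : set M) (f : {linear M -> N}).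
Hypothesis fS : forall x, S x -> f x = 0.

Lemma submod_gen_ker x : submod_gen S x -> f x = 0.
Proof.
by elim=> {x} [|| x y _ x0 _ y0| a x _ x0]; rewrite ?(linear0, linearD, linearZ_LR) ?x0 ?y0 ?addr0 ?scaler0.
Qed.

Lemma modquot_lift : exists h : {linear modquot S -> N}, forall x, h (modcl S x) = f x.
Proof.
pose h (u : modquot S) := f (generic_quotient.repr u).
have hE x : h (modcl S x) = f x.
  by apply/eqP; rewrite -subr_eq0 -linearB; apply/eqP/submod_gen_ker; exact: repr_modcl.
have hlin : linear h.
  move=> a; elim/modcl_ind=> x; elim/modcl_ind=> y.
  by rewrite -(linearP (modcl S)) !hE linearP.
by exists (mklin hlin).
Qed.
End Descend.

Section WeightAvoid.
Variables (K : fieldType) (M : lmodType K) (J : eqType) (X : Type) (T : X -> {linear M -> M}).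
Variable chi : J -> X -> K.
Hypothesis chi_inj : forall j k, j != k -> exists x, chi j x != chi k x.
Let wt j u := forall x, T x u = chi j x *: u.

Lemma weight_avoid (Om : J -> Prop) mu q :
  submod_gen [set u | exists2 j, Om j & wt j u] q -> wt mu q -> ~ Om mu -> q = 0.
Proof.
move=> Sq qw nmu; have [|||s [v [us sO vw qE]]] := @weight_decomp K M J Om wt q _ _ _ Sq.
- by move=> j x; rewrite linear0 scaler0.
- by move=> j u u' ju ju' x; rewrite linearD ju ju' scalerDr.
- by move=> j a u ju x; rewrite linearZ_LR ju !scalerA mulrC.
rewrite qE big1_seq // => j /andP[_ js].
pose E u := exists a, u = a *: q.
have Eq : E (\sum_(j <- s) v j) by exists 1; rewrite scale1r.
have [||||||a va] := weight_component (T := fun x => T x) (chi := chi) (E := E) _ _ _ _ us _ _ Eq js.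
- by move=> _ _ [a ->] [b ->]; exists (a + b); rewrite scalerDl.
- by move=> b _ [a ->]; exists (b * a); rewrite scalerA.
- by move=> x; exact: linearP.
- by move=> x _ [a ->]; exists (a * chi mu x); rewrite linearZ_LR qw scalerA.
- by move=> j1 j2 _ _; exact: chi_inj.
- by move=> j' _ x; exact: vw.
have /chi_inj[x jx] : j != mu by apply/eqP => jmu; apply: nmu; rewrite -jmu; exact: sO.
apply/eqP; have := vw j x; rewrite {1}va linearZ_LR qw scalerA mulrC -scalerA -va => /eqP.
by rewrite -subr_eq0 -scalerBl scaler_eq0 subr_eq0 eq_sym (negPf jx).
Qed.
End WeightAvoid.

Section LoopBasics.
Variables (K : fieldType) (g : lieAlgType K).
Implicit Types (x y : loop g).

Lemma tmono_coef k (u : g) l : tmono k u l = if k == l then u else 0.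
Proof. by case: eqVneq => [<-|kl]; [exact: dsingle_in | exact: dsingle_out]. Qed.

Lemma loop_sum x : x = \sum_(k <- dsupp x) tmono k (x k).
Proof. exact: dsum_big. Qed.

Definition loop_in (S : set g) x := forall k, S (x k).

Lemma loop_in_ind (S : set g) (P : loop g -> Prop) : P 0 -> (forall x y, P x -> P y -> P (x + y)) ->
  (forall k u, S u -> P (tmono k u)) -> forall x, loop_in S x -> P x.
Proof. by move=> P0 PD PS x xS; rewrite [x]loop_sum; apply: (big_ind P) => // k _; exact: PS. Qed.

Lemma loop_in_tmono (S : set g) k u : S 0 -> S u -> loop_in S (tmono k u).
Proof. by move=> S0 Su l; rewrite tmono_coef; case: ifP. Qed.

End LoopBasics.

Section TwistedLoops.
Variables (K : numClosedFieldType) (g : fdLieAlgType K).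
Hypothesis g_simple : lie_simple g.
Variable c : chevalley g.
Variables (m : nat) (sigma : diagram_aut c m) (zeta : K) (zeta_prim : m.-primitive_root zeta).

Local Notation I := (node c).
Local Notation h := (cartan c).
Local Notation al := (sroot c).
Local Notation wt := (@wtv K g c).
Local Notation Lg := (Lgamma sigma zeta_prim).
Local Notation zeta_neq0 := (prim_root_neq0 zeta_prim).
Local Notation tau := (loop_twist sigma zeta_neq0).
Local Notation const := (const_loop sigma zeta_neq0).

Lemma iter_twist_mono n k u : iter n tau (tmono k u) = tmono k ((zeta ^ k) ^+ n *: iter n sigma u).
Proof.
elim: n => [|n IHn]; first by rewrite expr0 scale1r.
by rewrite !iterS IHn [LHS]loop_twist_mono (linearZ_LR sigma) scalerA -exprS.
Qed.

Lemma zetaX_m k : (zeta ^ k) ^+ m = 1.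
Proof. by rewrite exprnP exprzAC -[zeta ^ m]exprnP (prim_expr_order zeta_prim) exp1rz. Qed.

Lemma iter_twist_order x : iter m tau x = x.
Proof.
elim/loop_ind: x => [|x y Px Py|k u]; first exact: (iter_lin0 tau).
  by rewrite (iter_linD tau) Px Py.
by rewrite iter_twist_mono zetaX_m scale1r (iter_aut_order g_simple).
Qed.

Definition avg_loop (x : loop g) := m%:R^-1 *: \sum_(r < m) iter r tau x.

Fact avg_loop_fixed x : tau (avg_loop x) == avg_loop x.
Proof.
apply/eqP; rewrite /avg_loop (linearZ_LR tau) (linear_sum tau); congr (_ *: _).
exact/sum_iterS/iter_twist_order.
Qed.

Definition fixproj x : Lg := FixLie (avg_loop_fixed x).

Let m0 : m%:R != 0 :> K.
Proof. by rewrite pnatr_eq0 -lt0n (aut_order_gt0 sigma). Qed.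

Lemma fixproj_linear : linear fixproj.
Proof.
move=> a x y; apply: val_inj => /=; rewrite /avg_loop.
rewrite (eq_bigr (fun r : 'I_m => a *: iter r tau x + iter r tau y)) => [|r _]; last first.
  exact: (iter_linear tau).
by rewrite big_split /= -scaler_sumr scalerDr !scalerA mulrC.
Qed.

Lemma fixproj_val (x : Lg) : fixproj (val x) = x.
Proof.
apply: val_inj; rewrite /= /avg_loop (eq_bigr (fun=> val x)) => [|r _].
  by rewrite sumr_const card_ord -scaler_nat scalerA mulVf // scale1r.
by elim: (nat_of_ord r) => //= n ->; exact/eqP/(valP x).
Qed.

Lemma fixproj_lie (z : Lg) x : fixproj (lie (val z) x) = lie z (fixproj x).
Proof.
apply: val_inj => /=; rewrite /avg_loop lieZr lie_sumr; congr (_ *: _); apply: eq_bigr => r _.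
elim: (nat_of_ord r) => //= n ->; rewrite [LHS](lieHomP tau); congr lie; exact/eqP/(valP z).
Qed.

(** The projection of [u t^k] to the twisted loop algebra, for arbitrary [u]: it factors through the
    eigenspace of [sigma] for [zeta^-k], and these elements span. *)
Definition tw k u : Lg := fixproj (tmono k u).

Lemma tw_linear k : linear (tw k).
Proof. by move=> a x y; rewrite /tw linearP fixproj_linear. Qed.

Lemma tw_val k u : val (tw k u) = tmono k (m%:R^-1 *: \sum_(r < m) (zeta ^ k) ^+ r *: iter r sigma u).
Proof.
rewrite /= /avg_loop (linearZ_LR (@tmono K g k)) (linear_sum (@tmono K g k)); congr (_ *: _); apply: eq_bigr => r _.
exact: iter_twist_mono.
Qed.

Lemma tw_lie k l x y : lie (tw k x) (tw l y) =
  m%:R^-1 *: \sum_(r < m) (zeta ^ k) ^+ r *: tw (k + l) (lie (iter r sigma x) y).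
Proof.
rewrite {2}/tw -fixproj_lie tw_val lie_tmono lieZl lie_suml -/(tw _ _) (linZE (tw_linear _)); congr (_ *: _).
rewrite (lin_sumE _ _ _ (tw_linear _)); apply: eq_bigr => r _.
by rewrite lieZl (linZE (tw_linear _)).
Qed.

Lemma tw_aut k x : tw k (sigma x) = (zeta ^ k)^-1 *: tw k x.
Proof.
have z0 : zeta ^ k != 0 by rewrite expfz_neq0 // (prim_root_neq0 zeta_prim).
apply: (scalerI z0); rewrite scalerA divff // scale1r; apply: val_inj => /=.
rewrite /avg_loop -[X in _ = _ *: X](sum_iterS (iter_twist_order _)) scalerA mulrC -scalerA scaler_sumr.
congr (_ *: _); apply: eq_bigr => r _; rewrite iterSr [tau _]loop_twist_mono !iter_twist_mono.
by rewrite (iter_linZ sigma) -(linearZ_LR (@tmono K g k)) !scalerA [_ ^+ r * _]mulrC.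
Qed.

Lemma tw_span (x : Lg) : x = \sum_(k <- dsupp (val x)) tw k (val x k).
Proof.
rewrite -[LHS]fixproj_val {1}[val x]loop_sum (lin_sumE _ _ _ fixproj_linear); exact: eq_bigr.
Qed.

Lemma const_lie_tw (y : g0 sigma) k u : lie (const y) (tw k u) = tw k (lie (val y) u).
Proof. by rewrite /tw -fixproj_lie /= lie_tmono add0r. Qed.

Lemma const_tw (y : g0 sigma) : const y = tw 0 (val y).
Proof. by rewrite -[LHS]fixproj_val. Qed.

Section NplusLoops.

Definition nplus_loop (x : Lg) := loop_in (nplus c) (val x).

Lemma nplus_loop_ind (P : Lg -> Prop) : (forall x y, P x -> P y -> P (x + y)) ->
  (forall a x, P x -> P (a *: x)) ->
  (forall k n e, (exists i, n i <> 0%N) -> root_vec (c := c) true n e -> P (tw k e)) ->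
  forall x, nplus_loop x -> P x.
Proof.
move=> PD PZ Pe x nx; rewrite [x]tw_span.
have [i _] := node_exists g_simple c.
(* Zero is reached by scaling a positive root vector, which takes at least one node. *)
have P0 : P 0.
  rewrite -(scale0r (tw 0 (Xplus c i))); apply/PZ/(Pe _ (fun l => (l == i) : nat)).
    by exists i; rewrite eqxx.
  by move=> y yh; rewrite mul1r wtv_delta; exact: XplusP.
apply: (big_ind P) => // k _; have /rootsum_nplus : nplus c (val x k) by exact: nx.
elim=> [e [n n0 we]||y z _ Py _ Pz|a y _ Py]; first exact: (Pe k n e).
- by rewrite (lin0E (tw_linear k)).
- by rewrite (linDE (tw_linear k)); exact: PD.
- by rewrite (linZE (tw_linear k)); exact: PZ.
Qed.

Lemma rootsum_h s x y : y \in h -> rootsum c s x -> rootsum c s (lie y x).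
Proof.
move=> yh; elim=> {x} [x [n n0 wx]||x z _ IHx _ IHz|a x _ IHx].
- by rewrite wx //; apply: submod_genZ; apply: submod_gen_in; exists n.
- by rewrite lie0r; exact: submod_gen0.
- by rewrite lieDr; exact: submod_genD.
- by rewrite lieZr; exact: submod_genZ.
Qed.

Lemma iter_aut_rootsum s r x : rootsum c s x -> rootsum c s (iter r sigma x).
Proof. by move=> rx; elim: r => //= r; exact: aut_rootsum. Qed.

Lemma nplus_loop_tw k e : rootsum c true e -> nplus_loop (tw k e).
Proof.
move=> re l; rewrite tw_val tmono_coef; apply/rootsum_nplus; case: ifP => _; last exact: submod_gen0.
apply: submod_genZ; apply: (big_ind (rootsum c true)) => [||r _]; first exact: submod_gen0.
  by move=> *; exact: submod_genD.
exact/submod_genZ/iter_aut_rootsum.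
Qed.

Lemma nplus_loopD x y : nplus_loop x -> nplus_loop y -> nplus_loop (x + y).
Proof.
by move=> nx ny k; apply/rootsum_nplus; apply: submod_genD; apply/rootsum_nplus; [exact: nx | exact: ny].
Qed.
Lemma nplus_loopZ a x : nplus_loop x -> nplus_loop (a *: x).
Proof. by move=> nx k; apply/rootsum_nplus; apply: submod_genZ; apply/rootsum_nplus; exact: nx. Qed.
Lemma nplus_loop0 : nplus_loop 0.
Proof. by move=> k; apply/rootsum_nplus; exact: submod_gen0. Qed.
Lemma nplus_loop_sum J (s : seq J) (P : pred J) (F : J -> Lg) :
  (forall j, P j -> nplus_loop (F j)) -> nplus_loop (\sum_(j <- s | P j) F j).
Proof. by move=> FP; apply: (big_ind nplus_loop) => //; [exact: nplus_loop0 | exact: nplus_loopD]. Qed.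

Lemma nplus_loop_h x l y : y \in h -> nplus_loop x -> nplus_loop (lie x (tw l y)).
Proof.
move=> yh; elim/nplus_loop_ind=> {x} [x z Px Pz|a x Px|k n e n0 we].
- by rewrite lieDl; exact: nplus_loopD.
- by rewrite lieZl; exact: nplus_loopZ.
rewrite tw_lie; apply: nplus_loopZ; apply: nplus_loop_sum => r _; apply/nplus_loopZ/nplus_loop_tw.
rewrite lieC -scaleN1r; apply: submod_genZ; apply: rootsum_h => //.
by apply: iter_aut_rootsum; apply: submod_gen_in; exists n.
Qed.
End NplusLoops.

Section Restriction0.
Variable I0 : {set I}.
Hypothesis I0_repr : is_transversal I0 (porbits (node_perm sigma)) [set: I]%SET.

Lemma transversal_rep k : exists i, [/\ i \in I0, k \in porbit (node_perm sigma) i &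
  forall i', i' \in I0 -> k \in porbit (node_perm sigma) i' -> i' = i].
Proof.
have kp : porbit (node_perm sigma) k \in porbits (node_perm sigma) by apply/imsetP; exists k.
case/and3P: I0_repr => _ _ /forall_inP/(_ _ kp)/cards1P[i ei]; exists i.
have : i \in [set i]%SET by rewrite inE.
rewrite -ei inE => /andP[iI ik]; split=> //; first by rewrite porbit_sym.
move=> i' iI' ki'; apply/set1P; rewrite -ei inE iI' /= porbit_sym //.
Qed.

(** Simple roots of one orbit have the same restriction to [h_0], so their coordinates add up at the
    representative of the orbit in [I0]. *)
Lemma Q0plus_restrict n (mu : dual (h0 sigma)) :
  (forall y, y \in h0 sigma -> ev mu y = wt n y) -> Q0plus I0 mu.
Proof.
have /all_sig[f fP] k := cid (transversal_rep k).
move=> mun; exists (fun i => \sum_(k | f k == i) n k)%N; apply: dual_ext => y yh0.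
have [yh /eqP sy] : y \in h /\ sigma y == y by move: yh0; rewrite h0P => /andP.
rewrite mun // -big_filter ev_sum big_filter.
rewrite /wtv (partition_big f (mem I0)) /= => [|k _]; last by have [] := fP k.
apply: eq_bigr => i iI0; rewrite evMn restrictE // -[RHS]mulr_natl natr_sum mulr_suml.
apply: eq_bigr => k /eqP fk; have [_ ki _] := fP k.
by rewrite fk in ki; rewrite (sroot_orbit g_simple yh sy ki).
Qed.
End Restriction0.

Section UniversalProperty.
Variables (I0 : {set I}) (lam : dual (h0 sigma)).
Hypothesis I0_repr : is_transversal I0 (porbits (node_perm sigma)) [set: I]%SET.
Local Notation p0 := (p0 g_simple sigma).
Local Notation fO := (fO sigma).

Definition const_rep (M : lmodType K) (r : lrep Lg M) : lrep (g0 sigma) M := lrep_res const r.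

(** What a vector must satisfy to be the image of the generator of [W^Gamma(lambda)]. Nilpotency of
    the [f_O] on this one vector is the only integrability asked of the module. *)
Definition loop_singular (M : lmodType K) (r : lrep Lg M) (w : M) :=
  [/\ forall x, nplus_loop x -> r x w = 0,
      forall y : g0 sigma, val y \in h -> r (const y) w = ev lam (val y) *: w &
      forall j, exists k, iter k (r (const (p0 (fO j)))) w = 0].

Section LoopLow.
Variables (M : lmodType K) (r : lrep Lg M) (w : M).
Hypothesis w_hw : loop_singular r w.

(** The top is a whole space and not the line of [w], because the loops in [h] act inside it by more
    than scalars. *)
Let T0 t := (forall x, nplus_loop x -> r x t = 0) /\
  (forall y : g0 sigma, val y \in h -> r (const y) t = ev lam (val y) *: t).

Let B n b := (exists i, n i <> 0%N) /\ exists k f, root_vec (c := c) false n f /\ b = tw k f.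

Let T0D t u : T0 t -> T0 u -> T0 (t + u).
Proof.
move=> [nt ht] [nu hu]; split=> x hx; first by rewrite linearD nt // nu // addr0.
by rewrite linearD ht // hu // scalerDr.
Qed.
Let T00 : T0 0.
Proof. by split=> x hx; rewrite linear0 ?scaler0. Qed.

Let T0h k y t : y \in h -> T0 t -> T0 (r (tw k y) t).
Proof.
move=> yh [nt ht]; split=> [x nx|z zh].
  by rewrite ropC nt // linear0 add0r nt //; exact: nplus_loop_h.
rewrite ropC ht // linearZ_LR const_lie_tw (cartan_abelian g_simple (c := c)) //.
by rewrite (lin0E (tw_linear k)) rop0 addr0.
Qed.

Lemma loop_low_span x : cyc r w x -> low_span r B T0 x.
Proof.
apply: cyc_low_span; last by case: w_hw.
move=> z; rewrite (tw_span z); elim: (dsupp (val z)) => [|k s [y [b [e yT lb]]]].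
  by rewrite big_nil; exists 0, 0; rewrite addr0; split=> // [t _|]; [rewrite rop0; exact: T00 | exact: submod_gen0].
have [u [a [d [uh ra rd ed]]]] := triangular g_simple c (val z k).
exists (tw k u + tw k a + y), (tw k d + b); split.
- by rewrite big_cons e ed !(linDE (tw_linear k)) -!addrA; congr (_ + (_ + _)); rewrite addrCA.
- move=> t Tt; rewrite !ropD; apply: T0D; last exact: yT.
  apply: T0D; first exact: T0h.
  by rewrite Tt.1; [exact: T00 | exact: nplus_loop_tw].
- apply: submod_genD lb; elim: rd => {d ed} [d [n n0 wd]||d d' _ IHd _ IHd'|l d _ IHd].
  + by apply: submod_gen_in; exists n; split=> //; exists k, d.
  + by rewrite (lin0E (tw_linear k)); exact: submod_gen0.
  + by rewrite (linDE (tw_linear k)); exact: submod_genD.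
  + by rewrite (linZE (tw_linear k)); exact: submod_genZ.
Qed.

Lemma loop_low_weight (y : g0 sigma) n x : val y \in h -> low r B T0 n x ->
  r (const y) x = (ev lam (val y) - wt n (val y)) *: x.
Proof.
move=> yh; apply: (low_weight (a := fun i => ev (al i) (val y))).
  by move=> t [_]; apply.
move=> k b [_ [l [f [wf ->]]]]; rewrite const_lie_tw wf // mulN1r.
by rewrite (linZE (tw_linear l)).
Qed.

(** Lowering words have weights in [lambda - Q_0^+], so the vectors divided out in the definition of
    the twisted Weyl module are sent to zero. *)
Lemma high_weight_eq0 (mu : dual (h0 sigma)) x : cyc r w x -> ~ Q0plus I0 (lam - mu) ->
  (forall y : g0 sigma, val y \in h0 sigma -> r (const y) x = ev mu (val y) *: x) -> x = 0.
Proof.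
move=> /loop_low_span Sx nQ wx.
pose Hw := {y : g0 sigma | val y \in h}.
pose Om (j : dual (h0 sigma)) := Q0plus I0 (lam - j).
have h0h (y : g0 sigma) : val y \in h0 sigma = (val y \in h).
  by rewrite h0P (introT eqP (eqP (valP y))) andbT.
apply: (@weight_avoid K M _ Hw (fun y => r (const (sval y))) (fun (j : dual (h0 sigma)) y => ev j (val (sval y))) _ Om mu) => //.
- move=> j k jk; apply: contrapT => no; move/eqP: jk; apply; apply: dual_ext => y.
  rewrite h0P => /andP[yh sy]; pose Y' : Hw := exist _ (FixLie sy : g0 sigma) yh.
  by apply/eqP; apply: contraPT (no) => ne; apply: contra_not no; exists Y'.
- apply: submod_gen_sub Sx => u [n nu]; apply: submod_gen_in.
  have [b _ bn] := wtv_nspan n.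
  exists (lam - Defs.restrict (h0 sigma) b).
    rewrite /Om subKr; apply: (Q0plus_restrict I0_repr (n := n)) => y yh.
    by rewrite restrictE // bn.
  move=> y; rewrite (loop_low_weight _ nu) ?(svalP y) //.
  by rewrite evB restrictE ?h0h ?(svalP y) // bn.
- by move=> y; apply: wx; rewrite h0h; exact: svalP y.
Qed.

End LoopLow.

End UniversalProperty.

End TwistedLoops.

Section ExtensionMap.
Variables (R0 R : pzRingType) (phi : {rmorphism R0 -> R}) (V : lmodType R0) (M : lmodType R).
Variable f : V -> M.
Hypotheses (fD : forall x y, f (x + y) = f x + f y) (fZ : forall u x, f (u *: x) = phi u *: f x).

Lemma extmod_map : exists F : {linear extmod phi V -> M}, forall u x, F (tens phi u x) = u *: f x.
Proof.
have F_lin (x : V) : linear (fun u : R^o => (u : R) *: f x).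
  by move=> a u u' /=; rewrite scalerDl scalerA.
have [F FE] : exists F : {linear dsum (fun _ : V => R^o : lmodType R) -> M},
    forall (x : V) (u : R), F (@dsingle R V (fun _ => R^o) x u) = u *: f x.
  exists (mklin (@dsum_fold_linear _ _ (fun _ : V => R^o : lmodType R) M (fun x (u : R^o) => (u : R) *: f x) F_lin)) => x u.
  exact: (@dsum_fold_single R V (fun _ => R^o) M (fun x (u : R^o) => (u : R) *: f x) F_lin x u).
have Fk x : tensor_rel phi x -> F x = 0.
  by case=> [r y z|r r0 y]; rewrite !(linearB F) ?(linearD F) !FE ?fD ?fZ ?scalerDr ?scalerA subrr.
by have [h hE] := modquot_lift Fk; exists h => u x; rewrite /tens hE FE.
Qed.

Lemma tensE u (x : V) : tens phi u x = u *: tens phi 1 x.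
Proof.
rewrite /tens -linearZ_LR; congr modcl.
by rewrite -(linearZ_LR (@dsingle R V (fun _ => R^o) x)) [_ *: _]mulr1.
Qed.

Lemma tens_bal u u0 (x : V) : tens phi (u * phi u0) x = tens phi u (u0 *: x).
Proof. exact/modclP/submod_gen_in/tensor_bal. Qed.

Lemma extmod_ind (P : extmod phi V -> Prop) : P 0 -> (forall x y, P x -> P y -> P (x + y)) ->
  (forall u x, P (tens phi u x)) -> forall x, P x.
Proof.
move=> P0 PD Pt; elim/modcl_ind; elim/dsum_ind=> [|x y Px Py|x u].
- by rewrite linear0.
- by rewrite linearD; exact: PD.
- exact: Pt.
Qed.
End ExtensionMap.

Lemma kmod_map_eigen (K : fieldType) (A : algType K) (N M : lmodType A) (F : {linear N -> M}) u b x :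
  u *: x = b%:A *: x -> kmod_op u (F x : kmod M) = b *: (F x : kmod M).
Proof. by move=> e; rewrite /kmod_op kmodZ -!linearZ_LR e. Qed.

Lemma cyc_env (K : fieldType) (L : lieAlgType K) (M : lmodType (env L)) (w x : M) u :
  cyc (kmod_rep M) w x -> cyc (kmod_rep M) w (u *: x).
Proof.
move=> cx; elim/env_gen_ind: u => [|u u' Pu Pu'|a u Pu|z u Pu].
- by rewrite scale1r.
- by rewrite scalerDl; exact: (cyc_D Pu Pu').
- by rewrite -[_ *: x]/(kmod_op (a *: u) (x : kmod M)) kmod_opZl; exact: (cyc_Z a Pu).
- by rewrite -scalerA; exact: (cyc_r z Pu).
Qed.

Section SemilinearAt.
Variables (K : fieldType) (A B : algType K) (phi : {rmorphism A -> B}).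
Variables (V : lmodType A) (M : lmodType B) (f : {linear kmod V -> kmod M}).

(** A condition on one element, so that the cases of [env_gen_ind] can be settled for abstract
    algebras. *)
Definition semilinear_at (u : A) := forall x : V, f (u *: x : V) = phi u *: (f x : M).

Lemma semilinear_at1 : semilinear_at 1.
Proof. by move=> x; rewrite rmorph1 !scale1r. Qed.
Lemma semilinear_atD u v : semilinear_at u -> semilinear_at v -> semilinear_at (u + v).
Proof.
move=> Pu Pv x; rewrite rmorphD [in RHS]scalerDl -Pu -Pv scalerDl.
exact: (linearD f (u *: x : kmod V) (v *: x : kmod V)).
Qed.
Lemma semilinear_atZ a u : phi (a *: u) = a *: phi u -> semilinear_at u -> semilinear_at (a *: u).
Proof.
move=> e Pu x; rewrite e -[a *: u]mulr_algl -scalerA -[a *: phi u]mulr_algl -[in RHS]scalerA -Pu.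
exact: (linearZ_LR f a (u *: x : kmod V)).
Qed.
Lemma semilinear_atM u v : semilinear_at u -> semilinear_at v -> semilinear_at (u * v).
Proof. by move=> Pu Pv x; rewrite rmorphM -!scalerA Pu Pv. Qed.
Lemma semilinear_atI u u' : phi u = u' ->
  (forall y, f (kmod_op u y) = kmod_op u' (f y)) -> semilinear_at u.
Proof. by move=> eu e y; rewrite eu; exact: e. Qed.
End SemilinearAt.

Section TwistedWeyl.
Variables (K : numClosedFieldType) (g : fdLieAlgType K).
Hypothesis g_simple : lie_simple g.
Variable c : chevalley g.
Variables (m : nat) (sigma : diagram_aut c m) (zeta : K) (zeta_prim : m.-primitive_root zeta).

Local Notation I := (node c).
Local Notation h := (cartan c).
Local Notation al := (sroot c).
Local Notation wt := (@wtv K g c).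
Local Notation Lg := (Lgamma sigma zeta_prim).
Local Notation zeta_neq0 := (prim_root_neq0 zeta_prim).
Local Notation const := (const_loop sigma zeta_neq0).
Local Notation p0 := (p0 g_simple sigma).
Local Notation fO := (fO sigma).
Local Notation hO := (hO sigma).

Variables (I0 : {set I}) (lam : dual (h0 sigma)).
Hypothesis I0_repr : is_transversal I0 (porbits (node_perm sigma)) [set: I]%SET.
(** The vectors [f_O^k v] have pairwise different weights for [h_O], so a linear relation among
    [n+1] of them makes one of them zero. *)
Lemma fd_nilpotent (M : lmodType K) (r : lrep (g0 sigma) M) (v : M) n (e : 'I_n -> M) j :
  singular r lam v -> (forall x, exists a : 'I_n -> K, x = \sum_i a i *: e i) ->
  exists k, iter k (r (p0 (fO j))) v = 0.
Proof.
move=> v_hw eP; set F := r _; set x := fun k => iter k F v.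
have /all_sig[A AP] (k : 'I_n.+1) : {a : 'I_n -> K | x k = \sum_i a i *: e i}.
  by apply: cid; exact: (eP (x k)).
pose X : 'M_(n.+1, n) := \matrix_(k, i) A k i.
have [d d0 dX] : exists2 d : 'rV_n.+1, d != 0 & d *m X = 0.
  have : kermx X != 0.
    by rewrite -mxrank_eq0 mxrank_ker subn_eq0 -ltnNge ltnS rank_leq_col.
  case/rowV0Pn=> d /sub_kermxP dX d0; by exists d.
have sx : \sum_k d ord0 k *: x k = 0.
  rewrite (eq_bigr (fun k => \sum_i (d ord0 k * A k i) *: e i)) => [|k _]; last first.
    by rewrite AP scaler_sumr; apply: eq_bigr => i _; rewrite scalerA.
  rewrite exchange_big big1 // => i _; rewrite -scaler_suml.
  have /matrixP/(_ ord0 i) := dX; rewrite !mxE => e0.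
  by rewrite (eq_bigr (fun k => d ord0 k * X k i)) ?e0 ?scale0r // => k _; rewrite mxE.
have [k dk] : exists k, d ord0 k != 0.
  apply: contrapT => no; move/eqP: d0; apply; apply/rowP => k; rewrite mxE.
  by apply/eqP; apply: contrapT => dk; apply: no; exists k; exact/negP.
have c0 := cO_pos g_simple sigma j.
have wx q : r (p0 (hO j)) (x q) = (ev lam (hO j) - q%:R * cO sigma j) *: x q.
  elim: q => [|q IHq].
    rewrite mul0r subr0; have := v_hw.2 (p0 (hO j)).
    have -> : val (p0 (hO j)) = hO j by exact: proj0_id (aut_hO sigma j).
    by apply; exact: hO_cartan.
  have hf : lie (p0 (hO j)) (p0 (fO j)) = - cO sigma j *: p0 (fO j).
    apply: val_inj; rewrite /= !proj0_id ?aut_hO ?aut_fO // lie_fO ?hO_cartan ?aut_hO //.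
  rewrite {1}/x iterS -/(x q) ropC IHq hf ropZ linearZ_LR -scalerDl -iterS -/(x q.+1).
  by congr (_ *: _); rewrite mulrSr; ring.
exists k.
suff : d ord0 k *: x k = 0 by move=> /eqP; rewrite scaler_eq0 (negPf dk) => /eqP.
apply: (@weight_component K (M) _ unit (fun=> r (p0 (hO j))) (fun u => u = 0)
  (fun (q : 'I_n.+1) _ => ev lam (hO j) - q%:R * cO sigma j) (index_enum _) (fun q => d ord0 q *: x q)).
- by move=> _ _ -> ->; rewrite addr0.
- by move=> a _ ->; rewrite scaler0.
- by move=> _; exact: linearP.
- by move=> _ _ ->; rewrite linear0.
- exact: index_enum_uniq.
- move=> q q' _ _ qq'; exists tt; rewrite (inj_eq (addrI _)) eqr_opp -subr_eq0 -mulrBl.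
  by rewrite mulf_eq0 (gt_eqF c0) orbF subr_eq0 eqr_nat.
- by move=> q _ _; rewrite linearZ_LR wx !scalerA mulrC.
- exact: sx.
- exact: mem_index_enum.
Qed.

Variables (V : lmodType (env (g0 sigma))) (v : V).
Hypothesis V_lam : simple_fd_hw lam v.

Local Notation tweyl := (tweyl zeta_prim I0 lam V).
Local Notation gen := (tweyl_gen zeta_prim I0 lam v).

Lemma V_singular : singular (kmod_rep V) lam (v : kmod V).
Proof.
by split=> x hx; [exact: (hw_nplus V_lam) | exact: (hw_cartan V_lam)].
Qed.

Lemma V_cyclic (x : kmod V) : cyc (kmod_rep V) v x.
Proof.
pose N : set V := cyc (kmod_rep V) (v : kmod V).
have N0 : N 0 by rewrite /N -(scale0r (v : kmod V)); apply/cyc_Z/cyc_w.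
have Nu : forall u y, N y -> N (u *: y).
  by move=> u y; exact: cyc_env.
have ND (y z : V) : N y -> N z -> N (y + z) by exact: (@cyc_D _ _ (kmod V) (kmod_rep V) v y z).
have [e|e] := simple_module V_lam N0 ND Nu.
  by have : N v by [exact: cyc_w]; rewrite e => /(hw_neq0 V_lam).
have Nx : N x by rewrite e.
exact: Nx.
Qed.

Lemma V_nilpotent j : exists k, iter k (kmod_rep V (p0 (fO j))) v = 0.
Proof.
have [n [e eP]] := fd_module V_lam.
apply: (fd_nilpotent j V_singular (e := e : 'I_n -> kmod V)) => x; exact: eP.
Qed.

Section Map.
Variables (M : lmodType (env Lg)) (w : M).
Hypothesis w_hw : loop_singular g_simple lam (kmod_rep M) w.

Lemma hw_module_map : exists f : V -> M, [/\ f v = w, forall x y, f (x + y) = f x + f y,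
  forall u x, f (u *: x) = env_map const u *: f x & forall x, cyc (kmod_rep M) w (f x)].
Proof.
have [wn wh wf] := w_hw; pose r0 := const_rep (kmod_rep M).
have s0 : singular r0 lam (w : kmod M).
  split=> x hx; last exact: wh.
  apply: wn => k; rewrite [val _]/(tmono 0 (val x)) tmono_coef; case: eqP => // _; apply/rootsum_nplus; exact: submod_gen0.
have [f [fv fr]] := hw_map V_singular s0 (hw_neq0 V_lam) wf V_cyclic.
exists (f : V -> M); split=> // [x y|u x|x].
- exact: (linearD f (x : kmod V) y).
- suff : semilinear_at (env_map const) f u by apply.
  elim/env_gen_ind: u => [|u u'|a u|z u].
  + exact: semilinear_at1.
  + exact: semilinear_atD.
  + by apply: semilinear_atZ; exact: linearZ_LR.
  + apply: semilinear_atM; exact: (semilinear_atI (env_map_emb const z) (fr z)).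
- elim: (V_cyclic x) => {x} [|x y _ IHx _ IHy|a x _ IHx|z x _ IHx].
  + by rewrite fv; exact: cyc_w.
  + by rewrite linearD; exact: cyc_D.
  + by rewrite linearZ_LR; exact: cyc_Z.
  + by rewrite fr; exact: (cyc_r (const z) IHx).
Qed.

Lemma tweyl_map : exists f : {linear tweyl -> M}, f gen = w.
Proof.
have [f [fv fD fu fc]] := hw_module_map.
have [F FE] : exists F : {linear projmod zeta_prim V -> M},
    forall u x, F (tens (env_map const) u x) = u *: f x := extmod_map fD fu.
have Fc x : cyc (kmod_rep M) w (F x).
  elim/extmod_ind: x => [|x y Px Py|u x].
  - by rewrite linear0 -(scale0r (w : kmod M)); apply/cyc_Z/cyc_w.
  - by rewrite linearD; exact: (cyc_D Px Py).
  by rewrite FE; exact: cyc_env.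
have Fk x : high_weights I0 lam x -> F x = 0.
  move=> [mu [nQ wx]]; have hw := high_weight_eq0 I0_repr w_hw (mu := mu) (Fc x) nQ.
  refine (hw _) => y yh.
  have e := kmod_map_eigen F (wx y yh).
  rewrite kmod_repE.
  exact: e.
have [h hE] := modquot_lift Fk; exists h.
by rewrite [LHS]hE FE scale1r fv.
Qed.
End Map.

Lemma V_gen (x : V) : exists u, x = u *: v.
Proof.
elim: (V_cyclic x) => {x} [|x y _ [a ->] _ [b ->]|e x _ [a ->]|z x _ [a ->]].
- by exists 1; rewrite scale1r.
- by exists (a + b); rewrite scalerDl.
- by exists (e *: a); rewrite -[RHS]/(kmod_op (e *: a) (v : kmod V)) kmod_opZl.
- by exists (emb z * a); rewrite -scalerA.
Qed.

Lemma tweyl_gen_span (x : tweyl) : exists u, x = u *: gen.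
Proof.
elim/modcl_ind: x; elim/extmod_ind=> [|x y [a ax] [b bx]|u x].
- by exists 0; rewrite scale0r linear0.
- by exists (a + b); rewrite scalerDl -ax -bx; exact: (linearD (modcl (high_weights I0 lam (V:=V)))).
have [u0 ->] := V_gen x; exists (u * env_map const u0).
rewrite /tweyl_gen -(linearZ_LR (modcl (high_weights I0 lam (V:=V)))); congr modcl.
by rewrite -tens_bal tensE.
Qed.

End TwistedWeyl.

(** * The generator of the sum of the Weyl modules *)

Section OrbitNilpotence.
Variables (K : numClosedFieldType) (g : fdLieAlgType K).
Hypothesis g_simple : lie_simple g.
Variable c : chevalley g.
Variables (m : nat) (sigma : diagram_aut c m).

Local Notation I := (node c).
Local Notation h := (cartan c).
Local Notation al := (sroot c).
Local Notation H := (coroot c).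
Local Notation Xp := (Xplus c).
Local Notation Xm := (Xminus c).
Local Notation O := (porbit (node_perm sigma)).

Lemma rep_sl2 (M : lmodType K) (r : lrep g M) i : sl2 (r (Xp i)) (r (Xm i)) (r (H i)).
Proof.
split=> x.
- by rewrite ropC Xplus_Xminus.
- by rewrite ropC coroot_lie_Xp sroot_coroot ropZ.
- by rewrite ropC coroot_lie_Xm sroot_coroot ropZ scaleNr.
Qed.

Variables (M : lmodType K) (r : lrep g M) (w : M) (n : I -> nat).
Hypotheses (w_Xp : forall i, r (Xp i) w = 0) (w_H : forall i, r (H i) w = (n i)%:R *: w).
Hypothesis w_Xm : forall i, exists k, iter k (r (Xm i)) w = 0.
Variable o : I.

(** Combinations of words in the [X_k^-], [k] in the orbit of [o], with prescribed multiplicities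
    [a]. Powers of [f_O] on [w] expand into such words, so bounds on the multiplicities give
    nilpotency. *)
Inductive fword : (I -> nat) -> M -> Prop :=
| fword_w a : (forall i, a i = 0%N) -> fword a w
| fword_D a x y : fword a x -> fword a y -> fword a (x + y)
| fword_Z a e x : fword a x -> fword a (e *: x)
| fword_X a b k x : k \in O o -> fword a x -> (forall i, b i = (i == k) + a i)%N -> fword b (r (Xm k) x).

Lemma fword_cyc a x : fword a x -> cyc r w x.
Proof.
by elim=> {a x} [a _|a x y _ IHx _ IHy|a e x _ IHx|a b k x _ _ IHx _];
  [exact: cyc_w | exact: cyc_D | exact: cyc_Z | exact: cyc_r].
Qed.

Lemma fword_H a x j : fword a x -> r (H j) x = ((n j)%:R - \sum_i (a i)%:R * ev (al i) (H j)) *: x.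
Proof.
elim=> {a x} [a a0|a x y _ IHx _ IHy|a e x _ IHx|a b k x ko _ IHx ab].
- by rewrite w_H big1 ?subr0 // => i _; rewrite a0 mul0r.
- by rewrite linearD IHx IHy scalerDr.
- by rewrite linearZ_LR IHx !scalerA mulrC.
rewrite ropC IHx coroot_lie_Xm ropZ linearZ_LR /= -scalerDl; congr (_ *: _).
rewrite -addrA -opprD; congr (_ - _).
rewrite [RHS](eq_bigr (fun i => (i == k)%:R * ev (al i) (H j) + (a i)%:R * ev (al i) (H j))) => [|i _].
  rewrite big_split /= addrC; congr (_ + _).
  by rewrite (bigD1 k) //= eqxx mul1r big1 ?addr0 // => i /negPf ->; rewrite mul0r.
by rewrite ab natrD mulrDl.
Qed.

Lemma fword_E a x k : fword a x -> (a k = 0%N -> r (Xp k) x = 0) /\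
  (forall b, (forall i, a i = (i == k) + b i)%N -> fword b (r (Xp k) x)).
Proof.
elim=> {a x} [a a0|a x y _ IHx _ IHy|a e x _ IHx|a a' l x lo ax IHx aa'].
- by rewrite w_Xp; split=> // b /(_ k); rewrite a0 eqxx.
- rewrite linearD; split=> [a0|b ab]; first by rewrite IHx.1 // IHy.1 // addr0.
  by apply: fword_D; [exact: IHx.2 | exact: IHy.2].
- rewrite linearZ_LR; split=> [a0|b ab]; first by rewrite IHx.1 // scaler0.
  by apply: fword_Z; exact: IHx.2.
rewrite ropC; have [kl|kl] := eqVneq k l.
  subst l; rewrite Xplus_Xminus; split=> [|b ab]; first by rewrite aa' eqxx.
  have {}ab : b = a by apply/funext => i; apply/eqP; rewrite -(eqn_add2l (i == k)) -aa' -ab.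
  rewrite {}ab; apply: fword_D; last by rewrite (fword_H _ ax); exact: fword_Z.
  have [ak0|ak0] := eqVneq (a k) 0%N.
    by rewrite IHx.1 // linear0 -(scale0r x); exact: fword_Z.
  apply: (@fword_X (fun i => a i - (i == k))%N _ _ _ lo) => [|i].
    by apply: IHx.2 => i; rewrite subnKC //; case: eqP => // ->; rewrite lt0n.
  by rewrite subnKC //; case: eqP => // ->; rewrite lt0n.
rewrite Xp_Xm // rop0 addr0; split=> [|b ab].
  by rewrite aa' (negPf kl) => /IHx.1 ->; rewrite linear0.
have ak : (0 < a k)%N by have := ab k; rewrite aa' (negPf kl) eqxx /= add0n => ->.
have le i : ((i == k) <= a i)%N by case: eqP => // ->.
apply: (@fword_X (fun i => a i - (i == k))%N _ _ _ lo) => [|i].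
  by apply: IHx.2 => i; rewrite subnKC.
apply/eqP; rewrite -(eqn_add2l (i == k)) -ab aa' addnCA subnKC //.
Qed.

Lemma fword_Ek q a x k : fword a x -> (a k < q)%N -> iter q (r (Xp k)) x = 0.
Proof.
elim: q a x => // q IHq a x ax aq; rewrite iterSr.
have [ak|ak] := eqVneq (a k) 0%N; first by rewrite (fword_E k ax).1 // iter_lin0.
have le i : ((i == k) <= a i)%N by case: eqP => // ->; rewrite lt0n.
apply: (IHq (fun i => a i - (i == k))%N).
  by apply: (fword_E k ax).2 => i; rewrite subnKC.
by rewrite eqxx subn1 prednK ?lt0n.
Qed.

Lemma fword_Fk a x k : fword a x -> exists q, iter q (r (Xm k)) x = 0.
Proof.
move/fword_cyc; apply: cyc_nilpotent; last exact: w_Xm.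
exact: Xm_nilpotent.
Qed.

Lemma fword_iterE a x k q : fword a x -> (q <= a k)%N ->
  fword (fun i => if i == k then a k - q else a i)%N (iter q (r (Xp k)) x).
Proof.
move=> ax; elim: q => [|q IHq] qa.
  by rewrite (_ : (fun _ => _) = a) //; apply/funext => i; case: eqP => // ->; rewrite subn0.
rewrite iterS; apply: (fword_E k (IHq (ltnW qa))).2 => i.
by case: eqP => // _; lia.
Qed.

Lemma fword_supp a x : fword a x -> x <> 0 -> forall k, k \notin O o -> a k = 0%N.
Proof.
move=> + _; elim=> {a x} [a a0 k _|a x y _ IHx _ _ k|a e x _ IHx k|a b l x lo _ IHx ab k ko].
- exact: a0.
- exact: IHx.
- exact: IHx.
- by rewrite ab IHx // addn0; case: eqP => // kl; rewrite kl lo in ko.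
Qed.

Section Neighbours.
Variables (j j' : I).
Hypotheses (jo : j \in O o) (j'o : j' \in O o) (jj' : j' != j).
Hypothesis c_jj' : ev (al j') (H j) = -1.
Hypothesis c_j : forall k, k \in O o -> k != j -> k != j' -> ev (al k) (H j) = 0.

Let weight_j a x : fword a x -> x <> 0 ->
  r (H j) x = ((n j)%:R - (2 * a j)%:R + (a j')%:R) *: x.
Proof.
move=> ax x0; rewrite (fword_H _ ax); congr (_ *: _).
rewrite (bigD1 j) //= (bigD1 j') //= sroot_coroot c_jj' big1 => [|k /andP[kj kj']].
  by rewrite natrM; ring.
have [ko|ko] := boolP (k \in O o); first by rewrite c_j // mulr0.
by rewrite (fword_supp ax) // mul0r.
Qed.

(** The word has weight [n j - 2 a j + a j'] for [H j], and [X_j^+] can be applied at most [a j]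
    times. If [a j] exceeded the bound, the weight would be below [-a j], against [sl2_reflect]. *)
Lemma fword_bound1 a x : fword a x -> x <> 0 -> (a j <= n j + a j')%N.
Proof.
move=> ax x0; rewrite leqNgt; apply/negP => lt; apply: x0.
have [k kx] := fword_Fk j ax; have x0 : x <> 0 \/ x = 0 by have [->|/eqP] := eqVneq x 0; [right | left].
case: x0 => // x0.
have e : r (H j) x = - (2 * a j - a j' - n j)%:R *: x.
  by rewrite (weight_j ax x0); congr (_ *: _); rewrite !natrB; [ring | lia | lia].
apply: (sl2_reflect (rep_sl2 r j) kx e); apply: (fword_Ek ax); lia.
Qed.

(** The simple reflection at [j]: a nonzero word of negative weight is raised to a nonzero one of
    opposite weight, which replaces [a j] by [n j + a j' - a j]. *)
Lemma fword_raise a x : fword a x -> x <> 0 -> (n j + a j' < 2 * a j)%N ->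
  exists y, fword (fun i => if i == j then n j + a j' - a j else a i)%N y /\ y <> 0.
Proof.
move=> ax x0 lt; exists (iter (2 * a j - a j' - n j) (r (Xp j)) x).
have le := fword_bound1 ax x0.
split; last first.
  move=> e0; apply: x0; have [k kx] := fword_Fk j ax.
  have x0 : x <> 0 \/ x = 0 by have [->|/eqP] := eqVneq x 0; [right | left].
  case: x0 => // x0; apply: (sl2_reflect (rep_sl2 r j) kx _ e0).
  by rewrite (weight_j ax x0); congr (_ *: _); rewrite !natrB; [ring | lia | lia].
rewrite (_ : (fun _ => _) = (fun i => if i == j then a j - (2 * a j - a j' - n j) else a i)%N).
  by apply: fword_iterE => //; lia.
by apply/funext => i; case: eqP => // _; lia.
Qed.

End Neighbours.

Lemma fword_bound0 j a x : j \in O o -> (forall k, k \in O o -> k != j -> ev (al k) (H j) = 0) ->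
  fword a x -> x <> 0 -> (a j <= n j)%N.
Proof.
move=> jo cj ax x0; rewrite leqNgt; apply/negP => lt; apply: (x0).
have [k kx] := fword_Fk j ax.
apply: (sl2_reflect (rep_sl2 r j) kx (n := (2 * a j - n j)%N)); last by apply: (fword_Ek ax); lia.
rewrite (fword_H _ ax); congr (_ *: _); rewrite natrB; last by lia.
rewrite (bigD1 j) //= sroot_coroot big1 => [|i ij]; first by rewrite natrM; ring.
have [io|io] := boolP (i \in O o); first by rewrite cj // mulr0.
by rewrite (fword_supp ax) // mul0r.
Qed.

(** For an adjacent pair the bound is [n j + n j']. If the weight at [j] is nonnegative it follows
    from the bound at [j']; otherwise that bound is applied to the word reflected at [j]. *)
Lemma fword_bound j : j \in O o -> exists q, forall a x, fword a x -> x <> 0 -> (a j <= q)%N.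
Proof.
move=> jo; have [B _] := wbasis_exists g_simple c.
have Oj k : k \in O o -> O k = O o by move=> ko; apply/eqP; rewrite eq_porbit_mem.
have [j'] := orbit_neighbour g_simple sigma B j; rewrite Oj // => j'o [cjj' cj].
have [jj'|jj'] := eqVneq j' j.
  exists (n j) => a x; apply: fword_bound0 => // k ko kj; apply: cj => //; by rewrite jj'.
have [j''] := orbit_neighbour g_simple sigma B j'; rewrite Oj // => j''o [cjj'' cj''].
(* Adjacency is symmetric, so the only neighbour of [j'] in the orbit is [j]. *)
have jE : j = j''.
  apply/eqP; apply: contraT => ne; have := cj'' j jo; rewrite eq_sym jj' => /(_ isT ne).
  by move/(sroot_coroot_sym0 g_simple B)/eqP; rewrite cjj' // oppr_eq0 oner_eq0.
subst j''; have {}cjj' := cjj' jj'; have {}cjj'' : ev (al j) (H j') = -1 by apply: cjj''; rewrite eq_sym.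
have b1 a x := fword_bound1 jo j'o jj' cjj' cj (a := a) (x := x).
have jj2 : j != j' by rewrite eq_sym.
have b2 a x := fword_bound1 j'o jo jj2 cjj'' cj'' (a := a) (x := x).
exists (n j + n j')%N => a x ax x0.
have [le|lt] := leqP (2 * a j) (n j + a j').
  by have := b2 _ _ ax x0; lia.
have [y [ay y0]] := fword_raise jo j'o jj' cjj' cj ax x0 lt.
have := b2 _ _ ay y0; rewrite eqxx (negPf jj').
by have := b1 _ _ ax x0; lia.
Qed.

Lemma orbit_nilpotent : exists k, iter k (r (fO sigma o)) w = 0.
Proof.
have /all_sig[q qP] (j : I) : {q | j \in O o -> forall a x, fword a x -> x <> 0 -> (a j <= q)%N}.
  apply: cid; have [jo|jo] := boolP (j \in O o); last by exists 0%N.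
  by have [q qP] := fword_bound jo; exists q.
have [N ltN] : exists N, (\sum_(j in O o) q j < N)%N by exists (\sum_(j in O o) q j).+1.
exists N.
have : submod_gen [set u | exists2 a, fword a u & (\sum_(j in O o) a j = N)%N] (iter N (r (fO sigma o)) w).
  elim: N {ltN} => [|N IHN].
    by apply: submod_gen_in; exists (fun=> 0%N); [exact: fword_w | rewrite big1].
  rewrite iterS; elim: IHN => [u [a au aN]||x y _ IHx _ IHy|e x _ IHx].
  - rewrite rop_sum; apply: big_ind => [||k ko]; [exact: submod_gen0 | by move=> *; exact: submod_genD |].
    apply: submod_gen_in; exists (fun i => (i == k) + a i)%N; first exact: fword_X au _.
    by rewrite big_split /= aN (bigD1 k) //= eqxx big1 ?addn0 // => i /andP[_ /negPf ->].
  - by rewrite linear0; exact: submod_gen0.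
  - by rewrite linearD; exact: submod_genD.
  - by rewrite linearZ_LR; exact: submod_genZ.
elim=> [u [a au aN]||x y _ -> _ ->|e x _ ->]; rewrite ?addr0 ?scaler0 //.
have [//|/eqP u0] := eqVneq u 0; move: ltN; rewrite -aN ltnNge; case/negP.
by apply: leq_sum => j jo; exact: qP au u0.
Qed.
End OrbitNilpotence.

Lemma iter_kmod_op (K : fieldType) (A : algType K) (N : lmodType A) u k (x : kmod N) :
  iter k (kmod_op u) x = kmod_op (u ^+ k) x.
Proof. by elim: k => [|k IHk]; rewrite ?kmod_op1 // iterS IHk exprS kmod_opM. Qed.

Lemma iter_kmod_eq0 (K : fieldType) (A : algType K) (N : lmodType A) u k (x : N) :
  u ^+ k *: x = 0 -> iter k (kmod_op u) (x : kmod N) = 0.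
Proof. by rewrite iter_kmod_op. Qed.

Section WeylSum.
Variables (K : numClosedFieldType) (g : fdLieAlgType K).
Hypothesis g_simple : lie_simple g.
Variable c : chevalley g.
Variables (m : nat) (sigma : diagram_aut c m) (zeta : K) (zeta_prim : m.-primitive_root zeta).
Local Notation Lg := (Lgamma sigma zeta_prim).
Local Notation zeta_neq0 := (prim_root_neq0 zeta_prim).
Local Notation const := (const_loop sigma zeta_neq0).
Local Notation incl := (fixincl (loop_twist sigma zeta_neq0)).
Local Notation p0 := (p0 g_simple sigma).
Local Notation fO := (fO sigma).
Local Notation h := (cartan c).
Local Notation H := (coroot c).

Lemma nplus_Xp i : nplus c (Xplus c i).
Proof.
apply/rootsum_nplus => //; apply: submod_gen_in; exists (fun l => (l == i) : nat); first by exists i; rewrite eqxx.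
by move=> y yh; rewrite mul1r wtv_delta; exact: XplusP.
Qed.

Lemma tmono0_lie : {morph @tmono K g 0 : x y / lie x y}.
Proof. by move=> x y; rewrite lie_tmono addr0. Qed.
Definition tmono0 : lieHom g (loop g) := LieHom tmono0_lie.

Section Weyl.
Variable mu : dual h.
Hypothesis mu_dom : dominant mu.
Local Notation W := (weyl mu).
Let rW := kmod_rep W.
Let w : kmod W := weyl_gen mu.

Lemma weyl_kill u : weyl_rel mu u -> u *: weyl_gen mu = 0 :> W.
Proof.
move=> ru; rewrite /weyl_gen -(linearZ_LR (modcl (weyl_rel mu))) -(linear0 (modcl (weyl_rel mu))).
by apply/modclP; rewrite subr0 [_ *: _]mulr1; exact: submod_gen_in.
Qed.

Lemma dominant_coroot i : exists n, ev mu (H i) = n%:R.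
Proof.
have [a ->] := mu_dom; exists (a i).
rewrite (eq_bigl xpredT) => [|k]; last by rewrite finset.in_setT.
rewrite ev_sum (bigD1 i) //= evMn fweightP eqxx big1 ?addr0 // => k ki.
by rewrite evMn fweightP (negPf ki) mul0rn.
Qed.

Lemma weyl_nplus x : loop_in (nplus c) x -> rW x w = 0.
Proof. by move=> nx; apply: weyl_kill; exact: weyl_nplus. Qed.

Lemma weyl_cartan y : y \in h -> rW (tmono 0 y) w = ev mu y *: w.
Proof.
move=> yh; have := weyl_kill (weyl_cartan mu yh); rewrite scalerBl => /eqP.
by rewrite subr_eq0 => /eqP.
Qed.

Lemma weyl_fO j : exists k, iter k (rW (tmono 0 (fO j))) w = 0.
Proof.
have /all_sig[n nE] i := cid (dominant_coroot i).
have [|i|i|k e] := @orbit_nilpotent K g g_simple c m sigma _ (lrep_res tmono0 rW) w n _ _ _ j.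
- move=> i; apply: weyl_nplus; apply: loop_in_tmono.
    by apply/rootsum_nplus; exact: submod_gen0.
  exact: nplus_Xp.
- by rewrite -nE; apply: weyl_cartan; exact: corootP.
- by exists (n i).+1; exact: (iter_kmod_eq0 (weyl_kill (weyl_lower (nE i)))).
by exists k.
Qed.
End Weyl.

Variable lam : dual (h0 sigma).

Lemma fiber_setT_finite : finite_set [set: fiber lam].
Proof.
have ff := fiber_finite lam (@pchar_num K).
have -> : [set: fiber lam]%classic = preimage (fun x : fiber lam => val x) (fiber lam).
  by apply/seteqP; split=> // x _; exact: set_valP.
by apply: finite_preimage ff => x y _ _ /val_inj.
Qed.

Lemma fiber_mem (mu : fiber lam) : mu \in finmap.enum_fset (fset_set [set: fiber lam]).
Proof.
have e : _ = true := etrans (in_fset_set fiber_setT_finite mu) (mem_set I).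
exact: e.
Qed.

Lemma weyl_sum_genE (mu : fiber lam) : weyl_sum_gen zeta_prim lam mu = weyl_gen (val mu).
Proof.
rewrite /weyl_sum_gen fsbig_finite; last exact: fiber_setT_finite.
rewrite dsum_sumE (bigD1_seq mu) ?finmap.fset_uniq //=; last first.
  exact: fiber_mem.
by rewrite dfwith_in big1 ?addr0 // => nu nm; rewrite dfwith_out.
Qed.

Lemma weyl_sum_rep x (u : kmod (weyl_sum zeta_prim lam)) (mu : fiber lam) :
  (kmod_rep _ x u : weyl_sum zeta_prim lam) mu = kmod_rep (weyl (val mu)) (val x) ((u : weyl_sum zeta_prim lam) mu : weyl (val mu)).
Proof.
rewrite [RHS]kmod_repE -(env_map_emb incl x); reflexivity.
Qed.

(** The [K]-structures of the sum and of a summand come from two enveloping algebras; they agree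
    because [env_map incl] fixes the scalars. *)
Lemma weyl_sum_scale a (u : kmod (weyl_sum zeta_prim lam)) (mu : fiber lam) :
  ((a *: u : kmod _) : weyl_sum zeta_prim lam) mu = a *: ((u : weyl_sum zeta_prim lam) mu : kmod (weyl (val mu))).
Proof.
rewrite [RHS]kmodZ; have <- : env_map incl a%:A = a%:A; last by [].
by rewrite (linearZ_LR (env_map incl)) (rmorph1 (env_map incl)).
Qed.

Lemma weyl_sum_singular : loop_singular g_simple lam (kmod_rep (weyl_sum zeta_prim lam))
  (weyl_sum_gen zeta_prim lam).
Proof.
split=> [x nx|y yh|j].
- apply: dsumP => mu; rewrite [LHS]weyl_sum_rep weyl_sum_genE; exact: weyl_nplus.
- apply: dsumP => mu; rewrite [LHS]weyl_sum_rep weyl_sum_scale weyl_sum_genE.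
  have [_ rl] := set_valP mu.
  have -> : ev lam (val y) = ev (val mu) (val y).
    have := congr1 (fun nu => ev nu (val y)) rl.
    by rewrite restrictE // h0P yh; exact: valP y.
  exact: (weyl_cartan (val mu) yh).
have fin (mu : fiber lam) : exists k, iter k (kmod_rep (weyl (val mu)) (tmono 0 (fO j))) (weyl_gen (val mu)) = 0.
  by apply: weyl_fO; have [] := set_valP mu.
have /all_sig[k kP] mu := cid (fin mu).
pose s := finmap.enum_fset (fset_set [set: fiber lam]).
(* The fiber is finite, so one exponent serves for all summands. *)
exists (\max_(mu <- s) k mu)%N; apply: dsumP => mu.
have ks : (k mu <= \max_(nu <- s) k nu)%N.
  by apply: leq_bigmax_seq => //; exact: fiber_mem.
have hf : val (const (p0 (fO j))) = tmono 0 (fO j) := congr1 (tmono 0) (proj0_id (aut_fO sigma j)).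
have it q : (iter q (kmod_rep (weyl_sum zeta_prim lam) (const (p0 (fO j)))) (weyl_sum_gen zeta_prim lam) : weyl_sum zeta_prim lam) mu
   = iter q (kmod_rep (weyl (val mu)) (tmono 0 (fO j))) (weyl_gen (val mu)).
  elim: q => [|q IHq]; first exact: weyl_sum_genE.
  by rewrite !iterS [LHS]weyl_sum_rep IHq hf.
by rewrite [LHS]it; exact: iter_le0 ks (kP mu).
Qed.

End WeylSum.

(** * A criterion for annihilating the generator *)

Section Endomorphisms.
Variables (K : fieldType) (M : lmodType K) (w : M) (w0 : w <> 0).

Record endo := Endo { efun :> M -> M; efunP : linear efun }.
HB.instance Definition _ := gen_eqMixin endo.
HB.instance Definition _ := gen_choiceMixin endo.

Lemma endo_eq (S T : endo) : (forall x, S x = T x) -> S = T.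
Proof.
case: S T => [f fP] [f' fP'] /= e; have {}e : f = f' by apply: funext.
by case: f' / e fP' => fP'; congr Endo; exact: Prop_irrelevance.
Qed.

Fact endo0_subproof : linear (fun _ : M => 0 : M).
Proof. by move=> a x y; rewrite scaler0 addr0. Qed.
Fact endo1_subproof : linear (fun x : M => x).
Proof. by []. Qed.
Fact endoN_subproof (T : endo) : linear (fun x => - T x).
Proof. by move=> a x y; rewrite (efunP T) opprD scalerN. Qed.
Fact endoD_subproof (S T : endo) : linear (fun x => S x + T x).
Proof. by move=> a x y; rewrite !efunP scalerDr addrACA. Qed.
Fact endoM_subproof (S T : endo) : linear (fun x => S (T x)).
Proof. by move=> a x y; rewrite !efunP. Qed.
Fact endoZ_subproof b (T : endo) : linear (fun x => b *: T x).
Proof. by move=> a x y; rewrite efunP scalerDr !scalerA mulrC. Qed.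

Definition endo_zero := Endo endo0_subproof.
Definition endo_one := Endo endo1_subproof.
Definition endo_opp T := Endo (endoN_subproof T).
Definition endo_add S T := Endo (endoD_subproof S T).
Definition endo_mul S T := Endo (endoM_subproof S T).
Definition endo_scale b T := Endo (endoZ_subproof b T).

Fact endo_addA : associative endo_add.
Proof. by move=> R S T; apply: endo_eq => x /=; rewrite addrA. Qed.
Fact endo_addC : commutative endo_add.
Proof. by move=> S T; apply: endo_eq => x /=; rewrite addrC. Qed.
Fact endo_add0 : left_id endo_zero endo_add.
Proof. by move=> T; apply: endo_eq => x /=; rewrite add0r. Qed.
Fact endo_addN : left_inverse endo_zero endo_opp endo_add.
Proof. by move=> T; apply: endo_eq => x /=; rewrite addNr. Qed.
HB.instance Definition _ := GRing.isZmodule.Build endo endo_addA endo_addC endo_add0 endo_addN.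

Lemma endo_lin (T : endo) : [/\ forall x y, T (x + y) = T x + T y, T 0 = 0 & forall a x, T (a *: x) = a *: T x].
Proof.
have [D Z] : (forall x y, T (x + y) = T x + T y) /\ T 0 = 0.
  have D x y : T (x + y) = T x + T y by have := efunP T 1 x y; rewrite !scale1r.
  by split=> //; apply: (addrI (T 0)); rewrite -D !addr0.
by split=> // a x; have := efunP T a x 0; rewrite Z !addr0.
Qed.

Fact endo_mulA : associative endo_mul. Proof. by move=> R S T; apply: endo_eq. Qed.
Fact endo_mul1 : left_id endo_one endo_mul. Proof. by move=> T; apply: endo_eq. Qed.
Fact endo_mulr1 : right_id endo_one endo_mul. Proof. by move=> T; apply: endo_eq. Qed.
Fact endo_mulDl : left_distributive endo_mul endo_add. Proof. by move=> R S T; apply: endo_eq. Qed.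
Fact endo_mulDr : right_distributive endo_mul endo_add.
Proof. by move=> R S T; apply: endo_eq => x /=; have [-> _ _] := endo_lin R. Qed.
HB.instance Definition _ :=
  GRing.Zmodule_isPzRing.Build endo endo_mulA endo_mul1 endo_mulr1 endo_mulDl endo_mulDr.

Fact endo_scaleA a b T : endo_scale a (endo_scale b T) = endo_scale (a * b) T.
Proof. by apply: endo_eq => x /=; rewrite scalerA. Qed.
Fact endo_scale1 : left_id 1 endo_scale.
Proof. by move=> T; apply: endo_eq => x /=; rewrite scale1r. Qed.
Fact endo_scaleDr : right_distributive endo_scale +%R.
Proof. by move=> a S T; apply: endo_eq => x /=; rewrite scalerDr. Qed.
Fact endo_scaleDl T : {morph endo_scale^~ T : a b / a + b}.
Proof. by move=> a b; apply: endo_eq => x /=; rewrite scalerDl. Qed.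
HB.instance Definition _ := GRing.Zmodule_isLmodule.Build K endo
  endo_scaleA endo_scale1 endo_scaleDr endo_scaleDl.

End Endomorphisms.

(* The dummy argument makes nontriviality of the ring a canonical instance. *)
Definition nzendo (K : fieldType) (M : lmodType K) (w : M) (w0 : w <> 0) : Type := endo M.

Section NzEndo.
Variables (K : fieldType) (M : lmodType K) (w : M) (w0 : w <> 0).
Local Notation E := (nzendo w0).
HB.instance Definition _ := GRing.PzRing.on E.
HB.instance Definition _ := GRing.Lmodule.on E.
Fact nzendo_1neq0 : 1 != 0 :> E.
Proof. by apply/eqP => /(congr1 (fun T : endo M => T w)); exact: w0. Qed.
HB.instance Definition _ := GRing.PzSemiRing_isNonZero.Build E nzendo_1neq0.
Fact nzendo_scaleAl a (S T : E) : a *: (S * T) = (a *: S) * T.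
Proof. by apply: endo_eq. Qed.
HB.instance Definition _ := GRing.Lmodule_isLalgebra.Build K E nzendo_scaleAl.
Fact nzendo_scaleAr a (S T : E) : a *: (S * T) = S * (a *: T).
Proof. by apply: endo_eq => x; have [_ _ e] := endo_lin (S : endo M); rewrite /= e. Qed.
HB.instance Definition _ := GRing.Lalgebra_isAlgebra.Build K E nzendo_scaleAr.
End NzEndo.

Section EnvAction.
Variables (K : fieldType) (L : lieAlgType K) (M : lmodType K) (r : lrep L M).

Lemma env_action : exists act : env L -> M -> M,
  [/\ forall u v x, act (u + v) x = act u x + act v x,
      forall a u x, act (a *: u) x = a *: act u x,
      forall u v x, act (u * v) x = act u (act v x),
      forall x, act 1 x = x & forall z x, act (emb z) x = r z x].
Proof.
(* On the zero module any action will do; otherwise the endomorphisms form a nontrivial ring, as the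
   universal property of [env L] demands of its target. *)
have [[w w0]|triv] := pselect (exists w : M, w <> 0); last first.
  have M0 (x y : M) : x = y.
    by apply/subr0_eq; apply: contrapT => e; apply: triv; exists (x - y).
  by exists (fun _ x => x); split=> *; exact: M0.
pose f z : nzendo w0 := Endo (linearP (r z)).
have fl : linear f by move=> a x y; apply: endo_eq => v /=; rewrite ropD ropZ.
have f_lie x y : mklin fl (lie x y) = mklin fl x * mklin fl y - mklin fl y * mklin fl x.
  by apply: endo_eq => v /=; rewrite rop_lie.
pose act u x := (env_lift (mklin fl) u : endo M) x.
have aM := env_lift_monoid f_lie; have al := env_lift_linear f_lie.
exists act; split=> [u v x|a u x|u v x|x|z x].
- by rewrite /act (linDE al).
- by rewrite /act (linZE al).
- by rewrite /act (aM.2 u v).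
- by rewrite /act aM.1.
- by rewrite /act env_lift_emb.
Qed.

End EnvAction.

Lemma joint_decomp (K : fieldType) (M : lmodType K) (I : finType) (T : I -> {linear M -> M}) (S : M -> Prop) x :
  (forall i j v, T i (T j v) = T j (T i v)) ->
  (forall x y, S x -> S y -> S (x + y)) -> (forall a x, S x -> S (a *: x)) -> (forall i x, S x -> S (T i x)) ->
  (forall i x, S x -> exists s, tprod (T i) s x = 0) ->
  (forall i a v, S v -> T i (T i v - a *: v) = a *: (T i v - a *: v) -> T i v = a *: v) ->
  S x -> submod_gen [set v | exists2 nu, S v & forall i, T i v = nu i *: v] x.
Proof.
move=> TC SD SZ ST tp ss Sx.
suff {x Sx} ind (l : seq I) : forall x, S x ->
    submod_gen [set v | S v /\ forall i, i \in l -> exists a, T i v = a *: v] x.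
  elim: (ind (enum I) x Sx) => {x Sx} [x [Sx ex]||x y _ IHx _ IHy|a x _ IHx].
  - have [nu nuP] := choice (fun i => ex i (mem_enum _ i)).
    by apply: submod_gen_in; exists nu.
  - exact: submod_gen0.
  - exact: submod_genD.
  - exact: submod_genZ.
elim: l => [|i l IHl] x Sx; first by apply: submod_gen_in.
apply: submod_gen_sub (IHl x Sx) => {x Sx} x [Sx ex].
pose S' v := S v /\ forall j, j \in l -> forall a, T j x = a *: x -> T j v = a *: v.
have [s s0] := tp i x Sx.
have gen : submod_gen [set v | S' v /\ exists a, T i v = a *: v] x.
  apply: (@eigen_sum K M (T i) S' _ _ _ _ s x _ s0) => [y z [Sy ey] [Sz ez]|a y [Sy ey]|y [Sy ey]|a y [Sy _]|].
  - by split=> [|j jl b xb]; [exact: SD | rewrite linearD (ey j jl b) // (ez j jl b) // scalerDr].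
  - split=> [|j jl b xb]; first exact: SZ.
    by rewrite linearZ_LR (ey j jl b) // !scalerA mulrC.
  - split=> [|j jl b xb]; first exact: ST.
    by rewrite TC (ey j jl b) // linearZ_LR.
  - exact: ss.
  - by split.
apply: submod_gen_sub gen => v [[Sv ev] ei]; apply: submod_gen_in; split=> // j.
rewrite inE => /orP[/eqP -> //|jl]; have [a xa] := ex j jl; exists a.
exact: ev.
Qed.

Section Criterion.
Variables (K : numClosedFieldType) (g : fdLieAlgType K).
Hypothesis g_simple : lie_simple g.
Variable c : chevalley g.
Variables (m : nat) (sigma : diagram_aut c m).
Local Notation I := (node c).
Local Notation h := (cartan c).
Local Notation H := (coroot c).
Local Notation Xp := (Xplus c).
Local Notation Xm := (Xminus c).
Local Notation t0 := (@tmono K g 0).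

Variables (lam : dual (h0 sigma)) (M : lmodType K) (r : lrep (loop g) M) (w : M).
Hypotheses (w_n : forall x, loop_in (nplus c) x -> r x w = 0)
  (w_h : forall y : g0 sigma, val y \in h -> r (t0 (val y)) w = ev lam (val y) *: w)
  (w_f : forall i, exists k, iter k (r (t0 (Xm i))) w = 0).

Let r0 : lrep g M := lrep_res (tmono0 g) r.

Let S x := [/\ forall z, loop_in (nplus c) z -> r z x = 0,
  forall y : g0 sigma, val y \in h -> r0 (val y) x = ev lam (val y) *: x &
  forall i, exists k, iter k (r0 (Xm i)) x = 0].

Let SD x y : S x -> S y -> S (x + y).
Proof.
move=> [nx hx fx] [ny hy fy]; split=> [z nz|z zh|i].
- by rewrite linearD nx // ny // addr0.
- by rewrite linearD hx // hy // scalerDr.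
have [[a xa] [b yb]] := (fx i, fy i).
by exists (a + b)%N; rewrite iter_linD (iter_le0 (leq_addr b a)) // (iter_le0 (leq_addl a b)) // addr0.
Qed.

Let SZ a x : S x -> S (a *: x).
Proof.
move=> [nx hx fx]; split=> [z nz|z zh|i].
- by rewrite linearZ_LR nx // scaler0.
- by rewrite linearZ_LR hx // !scalerA mulrC.
by have [k xk] := fx i; exists k; rewrite iter_linZ xk scaler0.
Qed.

Lemma nplus_loop_cartan y z : y \in h -> loop_in (nplus c) z -> loop_in (nplus c) (lie z (t0 y)).
Proof.
move=> yh; elim/loop_in_ind=> [|u v Pu Pv|k e ne].
- by rewrite lie0l => k; apply/rootsum_nplus => //; exact: submod_gen0.
- by rewrite lieDl => k; apply/rootsum_nplus => //; apply: submod_genD; apply/rootsum_nplus.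
rewrite lie_tmono; apply: loop_in_tmono; apply/rootsum_nplus => //; first exact: submod_gen0.
rewrite lieC -scaleN1r; apply/submod_genZ/rootsum_h => //.
by apply/rootsum_nplus.
Qed.

Let Sh y x : y \in h -> S x -> S (r0 y x).
Proof.
move=> yh [nx hx fx]; split=> [z nz|z zh|i].
- rewrite /r0 /= ropC nx // linear0 add0r; apply: nx; exact: nplus_loop_cartan.
- by rewrite ropC hx // linearZ_LR (cartan_abelian g_simple (c := c)) // rop0 addr0.
have [k xk] := fx i; exists k.
have e q : iter q (r0 (Xm i)) (r0 y x) = r0 y (iter q (r0 (Xm i)) x) + (q%:R * ev (sroot c i) y) *: iter q (r0 (Xm i)) x.
  elim: q => [|q IHq]; first by rewrite mul0r scale0r addr0.
  rewrite !iterS IHq linearD linearZ_LR; set v := iter q _ _; rewrite (ropC r0 (Xm i) y v) lieC (XminusP i yh : lie _ _ = _) evN scaleNr opprK ropZ.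
  by rewrite -addrA -scalerDl mulrSr mulrDl mul1r [X in _ + X *: _]addrC.
by rewrite e xk linear0 scaler0 addr0.
Qed.

Lemma weight_vector_decomp : submod_gen [set v | exists2 mu : dual h, S v & forall y, y \in h -> r0 y v = ev mu y *: v] w.
Proof.
have sl i := rep_sl2 (c := c) r0 i.
have Xp0 i x : S x -> r0 (Xp i) x = 0.
  case=> nx _ _; apply: nx; apply: loop_in_tmono; last exact: nplus_Xp.
  by apply/rootsum_nplus => //; exact: submod_gen0.
have tp i x : S x -> exists2 n, uniq [seq k%:R : K | k <- iota 0 n] & tprod (r0 (H i)) [seq k%:R | k <- iota 0 n] x = 0.
  move=> Sx; have [_ _ /(_ i)[k xk]] := Sx; exists k; last exact: (sl2_tprod (sl i) (Xp0 i x Sx) xk).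
  by rewrite map_inj_uniq ?iota_uniq // => a b /eqP; rewrite eqr_nat => /eqP.
have Sw : S w by split.
have := @joint_decomp K M I (fun i => r0 (H i)) S w _ SD SZ _ _ _ Sw.
move=> jd; apply: submod_gen_sub (jd _ _ _ _) => [v [nu Sv nuv]|i j v|i x|i x Sx|i a v Sv].
- apply: submod_gen_in; exists (\sum_i nu i *: fweight c i) => // y /(cartan_coroots g_simple)[d ->].
  rewrite rop_sum ev_sumr scaler_suml; apply: eq_bigr => i _; rewrite ropZ nuv evZr -scalerA; congr (_ *: (_ *: _)).
  rewrite ev_sum (bigD1 i) //= evZ fweightP eqxx mulr1 big1 ?addr0 // => k ki.
  by rewrite evZ fweightP (negPf ki) mulr0.
- by rewrite ropC (cartan_abelian g_simple (c := c)) ?corootP // rop0 addr0.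
- by apply: Sh; exact: corootP.
- by have [n _ e] := tp i x Sx; eexists; exact: e.
- by have [n u e] := tp i v Sv; exact: tprod_simple u e.
Qed.

Variable act : env (loop g) -> M -> M.
Hypotheses (actD : forall u v x, act (u + v) x = act u x + act v x)
  (actZ : forall a u x, act (a *: u) x = a *: act u x)
  (actM : forall u v x, act (u * v) x = act u (act v x))
  (act1 : forall x, act 1 x = x) (act_emb : forall z x, act (emb z) x = r z x).

Let act_lin u : linear (act u).
Proof.
elim/env_gen_ind: u => [|u v Pu Pv|a u Pu|z u Pu] b x y.
- by rewrite !act1.
- by rewrite !actD Pu Pv scalerDr addrACA.
- by rewrite !actZ Pu scalerDr !scalerA mulrC.
- by rewrite !actM !act_emb Pu linearP.
Qed.

Let actN u x : act (- u) x = - act u x.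
Proof. by apply/eqP; rewrite -addr_eq0 -actD addNr; have := actZ 0 0 x; rewrite !scale0r => ->. Qed.
Let actA a x : act a%:A x = a *: x.
Proof. by rewrite actZ act1. Qed.

(** Each weight vector [v] of [weight_vector_decomp] has a dominant integral weight by sl2 theory,
    and this weight restricts to [lam]; so [v] satisfies the relations of some [w_mu] in the fiber,
    and whatever kills [w_mu] kills [v]. *)
Lemma weyl_criterion U : (forall mu, fiber lam mu -> U *: weyl_gen mu = 0 :> weyl mu) -> act U w = 0.
Proof.
move=> U0; elim: weight_vector_decomp => [v [mu Sv muv]||x y _ IHx _ IHy|a x _ IHx].
- have [->|/eqP v0] := eqVneq v 0; first by rewrite (lin0E (act_lin U)).
  have [nv hv fv] := Sv.
  have Xp0 i : r0 (Xp i) v = 0.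
    apply: nv; apply: loop_in_tmono; last exact: nplus_Xp.
    by apply/rootsum_nplus => //; exact: submod_gen0.
  have dom i : exists n, ev mu (H i) = n%:R.
    have [k vk] := fv i.
    by have [n _ e] := hw_nat (rep_sl2 (c := c) r0 i) (Xp0 i) (muv _ (corootP i)) vk v0; exists n.
  have /all_sig[n nE] i := cid (dom i).
  have muE : mu = \sum_(i in [set: I]%SET) fweight c i *+ n i.
    apply: dual_ext => y /(cartan_coroots g_simple)[d ->]; rewrite !ev_sumr; apply: eq_bigr => i _.
    rewrite !evZr nE; congr (_ * _); rewrite [in RHS](eq_bigl xpredT) => [|k]; last by rewrite finset.in_setT.
    rewrite ev_sum (bigD1 i) //= evMn fweightP eqxx big1 ?addr0 // => k ki.
    by rewrite evMn fweightP (negPf ki) mul0rn.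
  have fib : fiber lam mu.
    split; first by exists n.
    apply: dual_ext => y yh0; have [yh sy] : y \in h /\ sigma y == y by apply/andP; rewrite -h0P.
    rewrite restrictE //; have := hv (FixLie sy : g0 sigma) yh; rewrite /= muv // => /eqP.
    by rewrite -subr_eq0 -scalerBl scaler_eq0 subr_eq0 (introF eqP v0) orbF => /eqP.
  have := U0 mu fib; rewrite -[weyl_gen mu]/(modcl (weyl_rel mu) 1) => e.
  have {e} : submod_gen (weyl_rel mu) U.
    have e' : modcl (weyl_rel mu) (U *: (1 : (env (loop g))^o)) = modcl (weyl_rel mu) 0.
      by rewrite [LHS](linearZ_LR (modcl (weyl_rel mu))) [RHS]linear0; exact: e.
    by move/modclP: e'; rewrite subr0 [_ *: _]mulr1.
  elim=> [_ [z nz|y yh|i q nq]||x y _ IHx _ IHy|a x _ IHx].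
  + by rewrite act_emb nv.
  + rewrite actD actN actA act_emb.
    by have := muv y yh; rewrite /r0 /= => ->; rewrite subrr.
  + have it k x : act (emb (t0 (Xm i)) ^+ k) x = iter k (r0 (Xm i)) x.
      by elim: k => [|k IHk]; rewrite ?expr0 ?act1 // exprS actM act_emb IHk.
    rewrite it; have [k vk] := fv i.
    by apply: (hw_kill (rep_sl2 (c := c) r0 i) (Xp0 i) _ vk); rewrite muv ?corootP // nq.
  + by have := actZ 0 0 v; rewrite !scale0r.
  + by rewrite actD IHx IHy addr0.
  + by rewrite -[_ *: _]/(a * x) actM IHx (lin0E (act_lin a)).
- by rewrite (lin0E (act_lin U)).
- by rewrite (linDE (act_lin U)) IHx IHy addr0.
- by rewrite (linZE (act_lin U)) IHx scaler0.
Qed.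

End Criterion.

(** * Modules with a commutative ring of scalars *)

(** A representation of [L] with a commutative ring of endomorphisms. The ring need not act
    faithfully: identities between scalars are only claimed modulo the elements that act by zero. *)
Record sys (K : fieldType) (L : lieAlgType K) := Sys {
  sr : comNzRingType;
  sm : lmodType K;
  scl : {rmorphism K -> sr};
  sact : sr -> sm -> sm;
  sactDl : forall s t v, sact (s + t) v = sact s v + sact t v;
  sactDr : forall s u v, sact s (u + v) = sact s u + sact s v;
  sactM : forall s t v, sact (s * t) v = sact s (sact t v);
  sact_scl : forall a v, sact (scl a) v = a *: v;
  srp : lrep L sm;
  srp_act : forall x s v, srp x (sact s v) = sact s (srp x v)
}.
Arguments scl {K L} _.

Section SysBasics.
Variables (K : fieldType) (L : lieAlgType K) (A : sys L).

Lemma sact1 v : sact 1 v = v :> sm A.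
Proof. by rewrite -(rmorph1 (scl A)) sact_scl scale1r. Qed.
Lemma sact0l v : sact 0 v = 0 :> sm A.
Proof. by rewrite -(rmorph0 (scl A)) sact_scl scale0r. Qed.
Lemma sactC s t v : sact s (sact t v) = sact t (sact s v) :> sm A.
Proof. by rewrite -!sactM mulrC. Qed.
Lemma sact_lin s : linear (sact s : sm A -> sm A).
Proof. by move=> a u v; rewrite sactDr -!(@sact_scl _ _ A) sactC. Qed.
Lemma sact0r s : sact s 0 = 0 :> sm A.
Proof. exact: (lin0E (sact_lin s)). Qed.
Lemma sactNl s v : sact (- s) v = - sact s v :> sm A.
Proof. by apply/eqP; rewrite -addr_eq0 -sactDl addNr sact0l. Qed.
Lemma sactBr s u v : sact s (u - v) = sact s u - sact s v :> sm A.
Proof. by rewrite sactDr -scaleN1r -(@sact_scl _ _ A) sactC sact_scl scaleN1r. Qed.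
Lemma sactZ s a v : sact s (a *: v) = a *: sact s v :> sm A.
Proof. exact: (linZE (sact_lin s)). Qed.
Lemma sact_sumr s J (r : seq J) (P : pred J) F :
  sact s (\sum_(j <- r | P j) F j) = \sum_(j <- r | P j) sact s (F j) :> sm A.
Proof. exact: (lin_sumE _ _ _ (sact_lin s)). Qed.
Lemma sact_suml v J (r : seq J) (P : pred J) (F : J -> sr A) :
  sact (\sum_(j <- r | P j) F j) v = \sum_(j <- r | P j) sact (F j) v :> sm A.
Proof. by apply: (big_morph (fun s => sact s v)) => [s t|]; rewrite ?sactDl ?sact0l. Qed.

Definition annih (s : sr A) := forall v : sm A, sact s v = 0.

(* An operator of the system is a sum of products of a scalar and at most one
   element of [L]. *)
Definition oact (o : option L) (v : sm A) := if o is Some x then srp A x v else v.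
End SysBasics.

(** The image of [si] need not generate the new module, so identities between operators do not carry
    over by themselves. [s_pres] demands this for sums of scalars times at most one element of [L],
    the shape of the identities behind [vanish] and [annih]. *)
Record sext (K : fieldType) (L : lieAlgType K) (A B : sys L) := Sext {
  sf : {rmorphism sr A -> sr B};
  si : {linear sm A -> sm B};
  sf_scl : forall a, sf (scl A a) = scl B a;
  si_act : forall s v, si (sact s v) = sact (sf s) (si v);
  si_rp : forall x v, si (srp A x v) = srp B x (si v);
  s_pres : forall l : seq (sr A * option L),
    (forall v, \sum_(p <- l) sact p.1 (oact p.2 v) = 0 :> sm A) ->
    forall v, \sum_(p <- l) sact (sf p.1) (oact p.2 v) = 0 :> sm B
}.

Section Extensions.
Variables (K : fieldType) (L : lieAlgType K).

Lemma sext_annih (A B : sys L) (e : sext A B) s : annih s -> annih (sf e s).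
Proof.
move=> s0 v; have := @s_pres _ _ _ _ e [:: (s, None)] _ v; rewrite !big_seq1; apply => u.
by rewrite big_seq1; exact: s0.
Qed.

Definition sext_id (A : sys L) : sext A A.
Proof. by apply: (@Sext K L A A idfun idfun). Defined.

Definition sext_trans (A B C : sys L) (e : sext A B) (e' : sext B C) : sext A C.
Proof.
apply: (@Sext K L A C (sf e' \o sf e) (si e' \o si e)) => [a|s v|x v|l l0 v] /=.
- by rewrite !sf_scl.
- by rewrite !si_act.
- by rewrite !si_rp.
have := @s_pres _ _ _ _ e' [seq (sf e p.1, p.2) | p <- l] _ v; rewrite big_map; apply => u.
by rewrite big_map; exact: s_pres.
Defined.
End Extensions.

Section PolySystem.
Variables (K : fieldType) (L : lieAlgType K) (S : comNzRingType) (c0 : {rmorphism K -> S}).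
Variables (M : lmodType K) (a0 : S -> M -> M) (X : {linear M -> M}) (r : lrep L M).
Hypotheses (a0Dl : forall s t v, a0 (s + t) v = a0 s v + a0 t v)
  (a0Dr : forall s u v, a0 s (u + v) = a0 s u + a0 s v)
  (a0M : forall s t v, a0 (s * t) v = a0 s (a0 t v))
  (a0c : forall a v, a0 (c0 a) v = a *: v)
  (r_a0 : forall x s v, r x (a0 s v) = a0 s (r x v))
  (X_a0 : forall s v, X (a0 s v) = a0 s (X v)) (r_X : forall x v, r x (X v) = X (r x v)).

Let XD := linearD X.

(** Both adjoining a root and inverting a scalar are of this form: the indeterminate acts by a new
    operator, and the relation wanted of it holds modulo what acts by zero. *)
Definition poly_sys : sys L.
Proof.
apply: (@Sys K L {poly S} M (polyC \o c0) (pact a0 X)) => [s t v|s u v|s t v|a v|x s v].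
- exact: pactDl.
- exact: pactDr.
- exact: pactM.
- by rewrite /= pactC.
- by apply: (pact_fun (T := r x)) => //; exact: linearD.
Defined.

Lemma poly_sysC s v : sact (s%:P : sr poly_sys) v = a0 s v :> sm poly_sys.
Proof. exact: pactC. Qed.
Lemma poly_sysX v : sact ('X : sr poly_sys) v = X v :> sm poly_sys.
Proof.
rewrite -[LHS]/(pact a0 X 'X v) -(mul1r 'X) pactMX // -polyC1 pactC //.
by rewrite -(rmorph1 c0) a0c scale1r.
Qed.
End PolySystem.

Section Vanishing.
Variables (K : numClosedFieldType) (g : fdLieAlgType K).
Hypothesis g_simple : lie_simple g.
Variable c : chevalley g.
Variables (m : nat) (sigma : diagram_aut c m) (zeta : K) (zeta_prim : m.-primitive_root zeta).
Local Notation Lg := (Lgamma sigma zeta_prim).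
Local Notation tw := (tw g_simple sigma zeta_prim).

Section OneSystem.
Variable A : sys Lg.
Implicit Types (a b : {poly sr A}) (f : int -> sm A).

Let sF (s : sr A) f : int -> sm A := fun k => sact s (f k).
Let Xs f : int -> sm A := fun k => f (k + 1).

Let sFDl s t f : sF (s + t) f = sF s f + sF t f.
Proof. by apply/funext => k; exact: sactDl. Qed.
Let sFDr s f f' : sF s (f + f') = sF s f + sF s f'.
Proof. by apply/funext => k; exact: sactDr. Qed.
Let sFM s t f : sF (s * t) f = sF s (sF t f).
Proof. by apply/funext => k; exact: sactM. Qed.
Let XsD f f' : Xs (f + f') = Xs f + Xs f'. Proof. by []. Qed.
Let XsF s f : Xs (sF s f) = sF s (Xs f). Proof. by []. Qed.

(** The indeterminate acts on functions of the loop degree by the shift, as multiplication by [t]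
    does on degrees. *)
Definition evalf a f := pact sF Xs a f.

Lemma evalfDl a b f : evalf (a + b) f = evalf a f + evalf b f.
Proof. exact: pactDl. Qed.
Lemma evalfDr a f f' : evalf a (f + f') = evalf a f + evalf a f'.
Proof. exact: pactDr. Qed.
Lemma evalfM a b f : evalf (a * b) f = evalf a (evalf b f).
Proof. exact: pactM. Qed.
Lemma evalfC s f k : evalf s%:P f k = sact s (f k).
Proof. by rewrite /evalf pactC. Qed.
Lemma evalf1 f : evalf 1 f = f.
Proof. by apply/funext => k; rewrite -polyC1 evalfC sact1. Qed.
Lemma evalf0r a : evalf a 0 = 0.
Proof. by apply: (addrI (evalf a 0)); rewrite -evalfDr !addr0. Qed.

Lemma iterXs i f k : iter i Xs f k = f (k + i%:Z).
Proof.
elim: i k => [|i IHi] k; first by rewrite addr0.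
by rewrite iterS /Xs IHi -addrA -PoszD add1n.
Qed.

Lemma evalfE n a f k : (size a <= n)%N -> evalf a f k = \sum_(i < n) sact a`_i (f (k + i%:Z)).
Proof.
move=> an; rewrite /evalf (pact_widen Xs sFDl f an) fct_sumE; apply: eq_bigr => i _; by rewrite /sF iterXs.
Qed.

(* [evalf a (yf x v) k] is the action on [v] of the projection of
   [x t^k a(t)] to the twisted loop algebra. *)
Definition yf x v : int -> sm A := fun k => srp A (tw k x) v.

Lemma yf0 x : yf x 0 = 0.
Proof. by apply/funext => k; exact: linear0. Qed.
Lemma yfD x u v : yf x (u + v) = yf x u + yf x v.
Proof. by apply/funext => k; exact: linearD. Qed.

Definition vanish a := forall x v, evalf a (yf x v) = 0.

Lemma vanishD a b : vanish a -> vanish b -> vanish (a + b).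
Proof. by move=> va vb x v; rewrite evalfDl va vb addr0. Qed.
Lemma vanishM a b : vanish b -> vanish (a * b).
Proof. by move=> vb x v; rewrite evalfM vb evalf0r. Qed.
Lemma vanishMr a b : vanish a -> vanish (a * b).
Proof. by rewrite mulrC; exact: vanishM. Qed.
Lemma vanishN a : vanish a -> vanish (- a).
Proof. by rewrite -mulN1r; exact: vanishM. Qed.
Lemma vanishB a b : vanish a -> vanish b -> vanish (a - b).
Proof. by move=> va vb; apply: vanishD => //; exact: vanishN. Qed.
Lemma vanish0 : vanish 0.
Proof. by move=> x v; apply: (addrI (evalf 0 (yf x v))); rewrite -evalfDl !addr0. Qed.

(** The substitution of [zeta^n t] for [t], by which [Gamma] acts on polynomials. *)
Definition rotp n a := a \Po ((scl A (zeta ^+ n))%:P * 'X).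

Lemma coef_rot n a i : (rotp n a)`_i = scl A (zeta ^+ n) ^+ i * a`_i.
Proof.
rewrite /rotp comp_polyE coef_sum; have [lt|ge] := ltnP i (size a).
  rewrite (bigD1 (Ordinal lt)) //= big1 ?addr0 => [|j ji].
    by rewrite coefZ exprMn -polyC_exp coefCM coefXn eqxx mulr1 mulrC.
  by rewrite coefZ exprMn -polyC_exp coefCM coefXn; case: eqP => [e|]; rewrite ?mulr0 //; case/eqP: ji; apply: val_inj.
rewrite big1 ?[a`_i]nth_default ?mulr0 // => j _; rewrite coefZ exprMn -polyC_exp coefCM coefXn.
by rewrite eqn_leq leqNgt (leq_trans (ltn_ord j)) // !mulr0.
Qed.

Lemma size_rot n a : (size (rotp n a) <= size a)%N.
Proof. by apply/leq_sizeP => i ai; rewrite coef_rot nth_default ?mulr0. Qed.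

Lemma evalf_rot n a f f' : (forall k, f' k = (zeta ^+ n) ^ k *: f k) ->
  forall k, evalf a f' k = (zeta ^+ n) ^ k *: evalf (rotp n a) f k.
Proof.
move=> e k; rewrite (evalfE (n := size a)) // (evalfE (n := size a) _ _ (size_rot n a)).
rewrite scaler_sumr; apply: eq_bigr => i _; rewrite coef_rot e sactZ -rmorphXn mulrC sactM sact_scl.
rewrite sactZ scalerA; congr (_ *: _).
by rewrite expfzDr ?expf_neq0 ?(prim_root_neq0 zeta_prim) // -exprnP.
Qed.

Lemma yf_aut n x v k : yf x v k = (zeta ^+ n) ^ k *: yf (iter n sigma x) v k.
Proof.
have z0 := prim_root_neq0 zeta_prim.
elim: n => [|n IHn]; first by rewrite expr0 exp1rz scale1r.
rewrite IHn /yf iterS tw_aut ropZ scalerA; congr (_ *: _).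
by rewrite exprSr exprzMl ?unitfE ?expf_neq0 // mulfK // expfz_neq0.
Qed.

Lemma vanish_rot n a : vanish a -> vanish (rotp n a).
Proof.
move=> va x v; have [y ->] : exists y, x = iter n sigma y.
  exists (iter (m * n - n) sigma x); rewrite -ssrnat.iterD subnKC; last first.
    by rewrite leq_pmull // (aut_order_gt0 sigma).
  by rewrite mulnC; elim: n => [|n IHn] //; rewrite mulSn ssrnat.iterD -IHn (iter_aut_order g_simple).
apply/funext => k; have := evalf_rot a (yf_aut n y v) k; rewrite va => /esym/eqP.
rewrite scaler_eq0 => /orP[|/eqP//].
by rewrite expfz_eq0 expf_eq0 (negPf (prim_root_neq0 zeta_prim)) !andbF.
Qed.

(** The bracket of the projections of [x t^k a(t)] and [y t^l b(t)]. Averaging the first factor over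
    [Gamma] replaces [x] by its images under [sigma] and [a] by its rotations. *)
Lemma evalf_lie a b x y v k l :
  evalf a (yf x (evalf b (yf y v) l)) k - evalf b (yf y (evalf a (yf x v) k)) l =
  m%:R^-1 *: \sum_(r < m) (zeta ^ k) ^+ r *: evalf (rotp r a * b) (yf (lie (iter r sigma x) y) v) (k + l).
Proof.
have -> : evalf b (yf y (evalf a (yf x v) k)) l = \sum_(i < size a) \sum_(j < size b)
    sact a`_i (sact b`_j (srp A (tw (l + j%:Z) y) (srp A (tw (k + i%:Z) x) v))).
  rewrite (evalfE (n := size b)) // exchange_big; apply: eq_bigr => j _.
  rewrite /yf (evalfE (n := size a)) // linear_sum sact_sumr; apply: eq_bigr => i _.
  by rewrite srp_act sactC.
have -> : evalf a (yf x (evalf b (yf y v) l)) k = \sum_(i < size a) \sum_(j < size b)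
    sact a`_i (sact b`_j (srp A (tw (k + i%:Z) x) (srp A (tw (l + j%:Z) y) v))).
  rewrite (evalfE (n := size a)) //; apply: eq_bigr => i _.
  rewrite /yf (evalfE (n := size b)) // linear_sum sact_sumr; apply: eq_bigr => j _.
  by rewrite srp_act.
rewrite -sumrB (eq_bigr (fun i : 'I_(size a) => \sum_(r < m) m%:R^-1 *: ((zeta ^ k) ^+ r *:
   sact (rotp r a)`_i (evalf b (yf (lie (iter r sigma x) y) v) (k + l + i%:Z))))) => [|i _]; last first.
  rewrite -sumrB (eq_bigr (fun j : 'I_(size b) => \sum_(r < m) m%:R^-1 *: ((zeta ^ k) ^+ r *:
    sact (rotp r a)`_i (sact b`_j (yf (lie (iter r sigma x) y) v (k + l + i%:Z + j%:Z)))))) => [|j _]; last first.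
    rewrite -!sactBr -rop_lie tw_lie ropZ rop_sum !sactZ !sact_sumr scaler_sumr.
    apply: eq_bigr => r _; congr (_ *: _).
    rewrite ropZ !sactZ coef_rot mulrC sactM -rmorphXn sact_scl -!sactZ.
    congr (sact _ (sact _ _)); rewrite scalerA; congr (_ *: _).
      rewrite expfzDr ?(prim_root_neq0 zeta_prim) // exprMn; congr (_ * _).
      by rewrite -exprnP exprAC.
    by rewrite /yf addrAC !addrA (addrAC _ i%:Z).
  rewrite exchange_big; apply: eq_bigr => r _; rewrite -!scaler_sumr; congr (_ *: (_ *: _)).
  by rewrite (evalfE (n := size b)) // sact_sumr.
rewrite exchange_big scaler_sumr; apply: eq_bigr => r _; rewrite -!scaler_sumr; congr (_ *: (_ *: _)).
by rewrite evalfM (evalfE (n := size a)) // size_rot.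
Qed.

Lemma zeta_sum r : \sum_(i < m) (zeta ^+ i) ^+ r = if (m %| r)%N then m%:R else 0.
Proof.
have m0 := prim_order_gt0 zeta_prim; case: ifP => [/dvdnP[n ->]|mr].
  rewrite (eq_bigr (fun=> 1)) ?sumr_const ?card_ord // => i _.
  by rewrite -exprM mulnA mulnC exprM (prim_expr_order zeta_prim) expr1n.
have z1 : zeta ^+ r != 1 by rewrite -(prim_order_dvd zeta_prim) mr.
apply/eqP; rewrite -(mulrI_eq0 _ (mulfI (_ : zeta ^+ r - 1 != 0))) ?subr_eq0 //; apply/eqP.
rewrite (eq_bigr (fun i : 'I_m => (zeta ^+ r) ^+ i)) => [|i _]; last by rewrite exprAC.
by rewrite -subrX1 exprAC (prim_expr_order zeta_prim) expr1n subrr.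
Qed.

Lemma rotp0 a : rotp 0 a = a.
Proof. by rewrite /rotp expr0 rmorph1 mul1r comp_polyXr. Qed.
Lemma rotpS n a : rotp n.+1 a = rotp 1 (rotp n a).
Proof. by apply/polyP => i; rewrite !coef_rot exprS !rmorphM exprMn mulrA. Qed.
Lemma rotp_fix n a : rotp 1 a = a -> rotp n a = a.
Proof. by move=> a1; elim: n => [|n IHn]; rewrite ?rotp0 // rotpS IHn. Qed.
Lemma rotpM n a b : rotp n (a * b) = rotp n a * rotp n b.
Proof. exact: comp_polyM. Qed.
Lemma rotpD n a b : rotp n (a + b) = rotp n a + rotp n b.
Proof. exact: comp_polyD. Qed.
Lemma rotpC n s : rotp n s%:P = s%:P.
Proof. exact: comp_polyC. Qed.

Definition kills a (w : sm A) x := evalf a (yf x w) = 0.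

(* Shifting [k] by multiples of [i] and averaging isolates the term [r = 0] in
   [evalf_lie]. *)
Lemma kills_lie a b w x y : rotp 1 a = a -> kills a w x -> kills b w y -> kills (a * b) w (lie x y).
Proof.
move=> ra ax bY.
have e k l : \sum_(r < m) (zeta ^ k) ^+ r *: evalf (a * b) (yf (lie (iter r sigma x) y) w) (k + l) = 0.
  have := evalf_lie a b x y w k l; rewrite ax bY /=.
  rewrite [yf x (0 l)]yf0 [yf y (0 k)]yf0 !evalf0r subrr => /esym/eqP; rewrite scaler_eq0 invr_eq0 => /orP[|/eqP e].
    by rewrite Num.Theory.pnatr_eq0 -leqn0 leqNgt (prim_order_gt0 zeta_prim).
  by rewrite -[RHS]e; apply: eq_bigr => r _; rewrite (rotp_fix r ra).
apply/funext => k.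
have : \sum_(i < m) \sum_(r < m) (zeta ^ i%:Z) ^+ r *:
    evalf (a * b) (yf (lie (iter r sigma x) y) w) (i%:Z + (k - i%:Z)) = 0.
  by rewrite big1.
rewrite exchange_big (bigD1 (Ordinal (prim_order_gt0 zeta_prim))) //= [X in _ + X]big1 => [|r r0].
  rewrite addr0 (eq_bigr (fun=> evalf (a * b) (yf (lie x y) w) k)) => [|i _]; last first.
    by rewrite expr0 scale1r addrC subrK.
  rewrite sumr_const card_ord -scaler_nat => /eqP; rewrite scaler_eq0 => /orP[|/eqP//].
  by rewrite Num.Theory.pnatr_eq0 -leqn0 leqNgt (prim_order_gt0 zeta_prim).
rewrite (eq_bigr (fun i : 'I_m => (zeta ^+ i) ^+ r *: evalf (a * b) (yf (lie (iter r sigma x) y) w) k)) => [|i _].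
  rewrite -scaler_suml zeta_sum ifF ?scale0r //; apply/negP => /dvdn_leq le.
  have r1 : (0 < r)%N by rewrite lt0n; apply: contra_neq r0 => r0; exact: val_inj.
  by have := le r1; rewrite leqNgt ltn_ord.
by rewrite addrC subrK.
Qed.

(** For a rotation-invariant [a], commuting an operator of [L] past those given by [a] yields again
    operators given by [a]; so killing propagates from the generator. *)
Lemma kills_cyc a w : rotp 1 a = a -> (forall x, kills a w x) ->
  forall v, cyc (srp A) w v -> forall x, kills a v x.
Proof.
move=> ra aw v; elim=> {v} [|u v _ Pu _ Pv|s v _ Pv|z v _ Pv] x //.
- by rewrite /kills yfD evalfDr Pu Pv addr0.
- apply/funext => k; transitivity (s *: evalf a (yf x v) k); last by rewrite Pv; exact: scaler0.
  rewrite !(evalfE (n := size a)) // scaler_sumr; apply: eq_bigr => i _.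
  by rewrite /yf linearZ_LR sactZ.
rewrite /kills {1}[z]tw_span rop_sum.
elim: (dsupp (val z)) => [|l s IHs].
  by rewrite big_nil yf0 evalf0r.
have -> : yf x (\sum_(j <- l :: s) srp A (tw j (val z j)) v) =
    yf x (evalf 1 (yf (val z l) v) l) + yf x (\sum_(j <- s) srp A (tw j (val z j)) v).
  by rewrite big_cons evalf1 yfD.
rewrite evalfDr IHs addr0; apply/funext => k.
have /eqP := evalf_lie a 1 x (val z l) v k l.
rewrite [in X in _ - X](Pv x) [yf _ (0 k)]yf0 evalf0r subr0 => /eqP ->; rewrite big1 ?scaler0 // => r _.
by rewrite mulr1 (rotp_fix r ra) Pv scaler0.
Qed.
End OneSystem.

Lemma vanish_ext (A B : sys Lg) (e : sext A B) a : vanish a -> vanish (map_poly (sf e) a).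
Proof.
move=> va x v; apply/funext => k.
have := @s_pres _ _ _ _ e [seq (a`_i, Some (tw (k + i%:Z) x)) | i <- index_iota 0 (size a)] _ v.
rewrite big_map => p; rewrite (evalfE (n := size a)) ?size_poly //.
have -> : (0 : int -> sm B) k = 0 by [].
rewrite -[RHS]p => [|u]; last first.
  rewrite big_map big_mkord -[RHS]/((0 : int -> sm A) k) -(va x u).
  by rewrite (evalfE (n := size a)).
rewrite big_mkord; apply: eq_bigr => i _.
by rewrite coef_map.
Qed.
End Vanishing.

(** * A polynomial annihilating the twisted loops *)

Section LoopSl2.
Variables (K : numFieldType) (S : comNzRingType) (M : lmodType K) (act : S -> M -> M).
Hypotheses (actDl : forall s t v, act (s + t) v = act s v + act t v)
  (actDr : forall s u v, act s (u + v) = act s u + act s v)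
  (actM : forall s t v, act (s * t) v = act s (act t v)).
Variable scal : {rmorphism K -> S}.
Hypothesis act_scal : forall a v, act (scal a) v = a *: v.
Variables (E : {linear M -> M}) (F H : nat -> {linear M -> M}) (h : nat -> S) (w : M) (c : K).
Hypotheses (EF : forall i v, E (F i v) = F i (E v) + H i.+1 v)
  (HF : forall k i v, H k (F i v) = F i (H k v) - c *: F (k + i)%N v)
  (Ew : E w = 0) (Hw : forall k, H k w = act (h k) w)
  (act_E : forall s v, E (act s v) = act s (E v))
  (act_F : forall i s v, F i (act s v) = act s (F i v))
  (act_H : forall k s v, H k (act s v) = act s (H k v)).

Let word l := foldr (fun i v => F i v) w l.

(* [wd n d b p]: modulo words of degree less than [d], [p] is a combination of
   words of length [n] and degree [d] with scalar coefficients of sum [b]. *)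
Inductive wd (n d : nat) : K -> M -> Prop :=
| wd_0 : wd n d 0 0
| wd_word l : size l = n -> sumn l = d -> wd n d 1 (word l)
| wd_low l s : size l = n -> (sumn l < d)%N -> wd n d 0 (act s (word l))
| wd_add b b' p p' : wd n d b p -> wd n d b' p' -> wd n d (b + b') (p + p')
| wd_scale a b p : wd n d b p -> wd n d (a * b) (a *: p).

Let wd_eq n d b b' p : wd n d b p -> b = b' -> wd n d b' p.
Proof. by move=> ? <-. Qed.
Let act0 s : act s 0 = 0.
Proof. by apply: (addrI (act s 0)); rewrite -actDr !addr0. Qed.
Let actZ s a v : act s (a *: v) = act (s * scal a) v.
Proof. by rewrite actM act_scal. Qed.

Let wd_act n d d' b p s : (d < d')%N -> wd n d b p -> wd n d' 0 (act s p).
Proof.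
move=> dd wp; elim: wp s => {b p} [|l sl el|l s' sl ll|b b' p p' _ IH _ IH'|a b p _ IH] s.
- by rewrite act0; exact: wd_0.
- by apply: wd_low => //; rewrite el.
- by rewrite -actM; apply: wd_low => //; exact: ltn_trans dd.
- by rewrite actDr -[0](addr0 0); exact: wd_add.
- by rewrite actZ; exact: IH.
Qed.

Let wd_F n d b p i : wd n d b p -> wd n.+1 (i + d) b (F i p).
Proof.
elim=> {b p} [|l sl el|l s sl ll|b b' p p' _ IH _ IH'|a b p _ IH].
- by rewrite linear0; exact: wd_0.
- by apply: (@wd_word _ _ (i :: l)) => /=; rewrite ?sl ?el.
- by rewrite act_F; apply: (@wd_low _ _ (i :: l)) => /=; rewrite ?sl ?ltn_add2l.
- by rewrite linearD; exact: wd_add.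
- by rewrite linearZ_LR; exact: wd_scale.
Qed.

Let wd_H n d k l : (0 < k)%N -> size l = n -> sumn l = d -> wd n (k + d) (- c * n%:R) (H k (word l)).
Proof.
move=> k0; elim: l n d => [|i l IH] n d /=.
  move=> <- <-; rewrite Hw mulr0; apply: (@wd_low _ _ [::]) => //=.
  by rewrite addn0.
case: n => // n [sl] <-; rewrite HF; apply: wd_eq (_ : - c * n%:R + - c * 1 = _); last first.
  by rewrite -mulrDr -natr1.
apply: wd_add; first by rewrite addnCA; apply: wd_F; exact: IH.
by rewrite -scaleNr; apply: wd_scale; apply: (@wd_word _ _ ((k + i)%N :: l)); rewrite /= ?sl ?addnA.
Qed.

(** [E] turns a letter [F i] into [H i.+1], which then merges with each letter after it at the cost
    of a factor [-c]. Hence one contribution [-c] for each pair of letters, the action of [H] on [w]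
    giving only lower degree. *)
Let wd_E1 n d l : size l = n.+1 -> sumn l = d -> wd n d.+1 (- c * 'C(n.+1, 2)%:R) (E (word l)).
Proof.
elim: l n d => [|i l IH] n d //= [sl] <-; rewrite EF.
apply: wd_eq (_ : - c * 'C(n, 2)%:R + - c * n%:R = _); last first.
  by rewrite -mulrDr -natrD binS bin1.
apply: wd_add; last by rewrite -addSn; exact: wd_H.
case: n l sl IH => [[]//= _ _|n l sl IH]; first by rewrite Ew linear0 mulr0; exact: wd_0.
by rewrite -addnS; apply: wd_F; exact: IH.
Qed.

Let wd_E n d b p : wd n.+1 d b p -> wd n d.+1 (- c * 'C(n.+1, 2)%:R * b) (E p).
Proof.
elim=> {b p} [|l sl el|l s sl ll|b b' p p' _ IH _ IH'|a b p _ IH].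
- by rewrite linear0 mulr0; exact: wd_0.
- by rewrite mulr1; exact: wd_E1.
- by rewrite act_E mulr0; apply: wd_act (wd_E1 sl erefl); rewrite ltnS.
- by rewrite linearD mulrDr; exact: wd_add.
- by rewrite linearZ_LR mulrCA; exact: wd_scale.
Qed.

Let wd_iter n d b p : c != 0 -> b != 0 -> wd n.+1 d b p ->
  exists2 b', b' != 0 & wd 1 (d + n) b' (iter n E p).
Proof.
move=> c0; elim: n d b p => [|n IH] d b p b0 wp; first by exists b => //; rewrite addn0.
rewrite iterSr -addSnnS; apply: (IH _ _ _ _ (wd_E wp)).
by rewrite !mulf_neq0 ?oppr_eq0 // pnatr_eq0 -lt0n bin_gt0.
Qed.

Let wd1 d b p : wd 1 d b p -> exists s : nat -> S,
  p = b *: F d w + \sum_(i < d) act (s i) (F i w).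
Proof.
elim=> {b p} [|l sl el|l s sl ll|b b' p p' _ [s ->] _ [s' ->]|a b p _ [s ->]].
- exists (fun=> 0); rewrite scale0r big1 ?addr0 // => i _.
  by rewrite -(rmorph0 scal) act_scal scale0r.
- exists (fun=> 0); case: l sl el => [|i []] //= _; rewrite addn0 => ->.
  by rewrite scale1r big1 ?addr0 // => j _; rewrite -(rmorph0 scal) act_scal scale0r.
- case: l sl ll => [|i []] //= _; rewrite addn0 => id.
  exists (fun j => if j == i then s else 0); rewrite scale0r add0r (bigD1 (Ordinal id)) //= eqxx.
  rewrite big1 ?addr0 // => j ji; rewrite ifF; last by apply/negbTE; apply: contra_neq ji => ji; exact: val_inj.
  by rewrite -(rmorph0 scal) act_scal scale0r.
- exists (fun i => s i + s' i); rewrite scalerDl addrACA -big_split; congr (_ + _).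
  by apply: eq_bigr => i _; rewrite actDl.
- exists (fun i => scal a * s i); rewrite scalerDr scalerA scaler_sumr; congr (_ + _).
  by apply: eq_bigr => i _; rewrite actM act_scal.
Qed.

(** Apply [E^N] to [F_0^(N+1) w = 0]. Each step shortens the words by one letter and raises the
    degree by one, so a nonzero multiple of [F_N w] remains, together with terms of smaller
    degree. *)
Lemma loop_sl2_relation N : c != 0 -> iter N.+1 (F 0%N) w = 0 ->
  exists s : nat -> S, F N w + \sum_(i < N) act (s i) (F i w) = 0.
Proof.
move=> c0 wN.
have wp : wd N.+1 0 1 0.
  rewrite -wN; have -> : iter N.+1 (F 0%N) w = word (nseq N.+1 0%N).
    by elim: N.+1 => //= k ->.
  by apply: wd_word; rewrite ?size_nseq // sumn_nseq mul0n.
have [b b0] := wd_iter c0 (oner_neq0 _) wp.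
rewrite add0n (iter_lin0 E) => /wd1[s /esym e]; exists (fun i => scal b^-1 * s i).
apply: (scalerI b0); rewrite scaler0 -{}[RHS]e scalerDr scaler_sumr; congr (_ + _).
by apply: eq_bigr => i _; rewrite actM act_scal scalerA mulfV // scale1r.
Qed.
End LoopSl2.

(** * The commutative ring of endomorphisms *)

Section Commutant.
Variables (K : numClosedFieldType) (L : lieAlgType K) (M : lmodType K) (r : lrep L M) (w : M).
Variable Lh : set L.

Inductive hop : (M -> M) -> Prop :=
| hop_id : hop id
| hop_D f f' : hop f -> hop f' -> hop (fun v => f v + f' v)
| hop_Z a f : hop f -> hop (fun v => a *: f v)
| hop_r z f : Lh z -> hop f -> hop (fun v => r z (f v)).

Let commutes (T : M -> M) := forall z v, T (r z v) = r z (T v).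

Let hop_lin f : hop f -> linear f.
Proof.
elim=> {f} [|f f' _ IH _ IH'|a f _ IH|z f _ _ IH] b u v //.
- by rewrite IH IH' scalerDr addrACA.
- by rewrite IH scalerDr !scalerA mulrC.
- by rewrite IH linearP.
Qed.

Let hop_com (T : {linear M -> M}) f : commutes T -> hop f -> forall v, T (f v) = f (T v).
Proof.
move=> Tr; elim=> {f} [|f f' _ IH _ IH'|a f _ IH|z f _ _ IH] v //.
- by rewrite linearD IH IH'.
- by rewrite linearZ_LR IH.
- by rewrite Tr IH.
Qed.

Hypothesis Lh_abelian : forall x y, Lh x -> Lh y -> lie x y = 0.

Let hop_hop f f' : hop f -> hop f' -> forall v, f (f' v) = f' (f v).
Proof.
move=> hf; elim=> {f'} [|f1 f2 _ IH1 _ IH2|a f1 _ IH|z f1 Lz _ IH] v //.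
- by rewrite (linDE (hop_lin hf)) IH1 IH2.
- by rewrite (linZE (hop_lin hf)) IH.
rewrite -IH; move: (f1 v) => {IH} u; elim: hf u => {f} [|f f' _ IH _ IH'|a f _ IH|x f Lx _ IH] u //.
- by rewrite linearD IH IH'.
- by rewrite linearZ_LR IH.
- by rewrite IH ropC Lh_abelian // rop0 addr0.
Qed.

Hypothesis w0 : w <> 0.
Hypothesis w_cyc : forall v, cyc r w v.

Let hop_mul f f' : hop f -> hop f' -> hop (fun v => f (f' v)).
Proof.
move=> + hf'; elim=> {f} [|f1 f2 _ IH1 _ IH2|a f1 _ IH|z f1 Lz _ IH] //.
- exact: (hop_D IH1 IH2).
- exact: (hop_Z a IH).
- exact: (hop_r Lz IH).
Qed.

(** An operator [f] coming from [Lh] does not commute with [L], so it is not itself a scalar; the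
    scalar that stands for it is the endomorphism agreeing with [f] at the generator [w]. *)
Definition hcomm (T : nzendo w0) : bool :=
  `[< (forall z v, (T : endo M) (r z v) = r z ((T : endo M) v)) /\ exists2 f, hop f & (T : endo M) w = f w >].

Fact hcomm_subalg : subalg_closed hcomm.
Proof.
split=> [|a S T|S T].
- by apply/asboolP; split=> //; exists id => //; exact: hop_id.
- move=> /asboolP[Sr [f hf Sw]] /asboolP[Tr [f' hf' Tw]]; apply/asboolP; split=> [z v|] /=.
    by rewrite Sr Tr linearP.
  exists (fun v => a *: f v + f' v); first exact/hop_D/hf'/hop_Z.
  by rewrite /= Sw Tw.
move=> /asboolP[Sr [f hf Sw]] /asboolP[Tr [f' hf' Tw]]; apply/asboolP; split=> [z v|] /=.
  by rewrite Tr Sr.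
exists (fun v => f' (f v)); first exact: hop_mul.
by rewrite Tw -Sw; exact: (hop_com (T := mklin (efunP S))).
Qed.

Record commutant := Commutant { cendo :> nzendo w0; cendoP : hcomm cendo }.
HB.instance Definition _ := [isSub for cendo].
HB.instance Definition _ := [Choice of commutant by <:].
HB.instance Definition _ := GRing.isSubalgClosed.Build K (nzendo w0) hcomm hcomm_subalg.
HB.instance Definition _ := [SubChoice_isSubAlgebra of commutant by <:].

(** At [w] both composites are composites of operators from [Lh], which commute; and [w] generates
    the module. *)
Lemma commutant_mulC : commutative (@GRing.mul commutant).
Proof.
move=> [S SP] [T TP]; apply: val_inj; apply: endo_eq => /= v.
move: SP TP => /asboolP[Sr [f hf Sw]] /asboolP[Tr [f' hf' Tw]].
elim: (w_cyc v) => {v} [|u v _ Pu _ Pv|a v _ Pv|z v _ Pv].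
- transitivity (f' (f w)).
    by rewrite Tw -Sw; exact: (hop_com (T := mklin (efunP S))).
  by rewrite Sw (hop_hop hf' hf) -Tw; exact/esym/(hop_com (T := mklin (efunP T))).
- by rewrite !(linDE (efunP S), linDE (efunP T)) Pu Pv.
- by rewrite !(linZE (efunP S), linZE (efunP T)) Pv.
- by rewrite (Tr z v) (Sr z v) (Sr z) (Tr z) Pv.
Qed.

(* The proof of cyclicity is an argument so that commutativity is a canonical
   instance. *)
Definition commring (_ : forall v, cyc r w v) : Type := commutant.
HB.instance Definition _ := GRing.NzRing.on (commring w_cyc).
HB.instance Definition _ := GRing.PzRing_hasCommutativeMul.Build (commring w_cyc) commutant_mulC.

Definition comm_scal : {rmorphism K -> commring w_cyc} := in_alg commutant.

Definition comm_sys : sys L.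
Proof.
apply: (@Sys K L (commring w_cyc) M comm_scal (fun s v => (val (s : commutant) : endo M) v) _ _ _ _ r) => //.
- by move=> s u v; exact: (linDE (efunP (val (s : commutant)))).
- by move=> x [s sP] v /=; move/asboolP: sP => [sr _].
Defined.

Hypothesis up : forall f, hop f -> exists T : {linear M -> M}, (forall z v, T (r z v) = r z (T v)) /\ T w = f w.

Lemma comm_hop f : hop f -> exists s : sr comm_sys, f w = sact s w :> sm comm_sys.
Proof.
move=> hf; have [T [Tr Tw]] := up hf.
have TP : linear T by exact: linearP.
have hT : hcomm (Endo TP : nzendo w0) by apply/asboolP; split=> //; exists f.
by exists (Commutant hT).
Qed.
End Commutant.

Section TwistedCommutant.
Variables (K : numClosedFieldType) (g : fdLieAlgType K).
Hypothesis g_simple : lie_simple g.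
Variable c : chevalley g.
Variables (m : nat) (sigma : diagram_aut c m) (zeta : K) (zeta_prim : m.-primitive_root zeta).
Local Notation Lg := (Lgamma sigma zeta_prim).
Local Notation tw := (tw g_simple sigma zeta_prim).
Local Notation h := (cartan c).
Local Notation H := (coroot c).
Local Notation I := (node c).
Local Notation eO := (eO sigma).
Local Notation fO := (fO sigma).
Local Notation hO := (hO sigma).
Local Notation cO := (cO sigma).
Local Notation const := (const_loop sigma (prim_root_neq0 zeta_prim)).

Definition h_loop : set Lg := [set z | exists k y, y \in h /\ z = tw k y].

Lemma h_loop_abelian x y : h_loop x -> h_loop y -> lie x y = 0.
Proof.
move=> [k [u [uh ->]]] [l [v [vh ->]]]; rewrite tw_lie big1 ?scaler0 // => r _.
have uh' : iter r sigma u \in h by elim: (nat_of_ord r) => //= n; exact: (aut_cartan g_simple sigma).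
by rewrite (cartan_abelian g_simple uh' vh) (lin0E (tw_linear _ _ _ _)) scaler0.
Qed.

Lemma zeta_mul k : zeta ^ (k * m%:Z) = 1.
Proof. by rewrite mulrC -exprz_exp -exprnP (prim_expr_order zeta_prim) exp1rz. Qed.

Lemma tw_lie_fix k l x y : sigma x = x -> lie (tw (k * m%:Z) x) (tw l y) = tw (k * m%:Z + l) (lie x y).
Proof.
move=> sx; rewrite tw_lie zeta_mul (eq_bigr (fun=> tw (k * m%:Z + l) (lie x y))) => [|r _]; last first.
  rewrite expr1n scale1r; congr (tw _ (lie _ _)); elim: (nat_of_ord r) => //= n ->; exact: sx.
rewrite sumr_const card_ord -[X in _ *: X]scaler_nat scalerA mulVf ?scale1r //.
by rewrite pnatr_eq0 -lt0n (prim_order_gt0 zeta_prim).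
Qed.

Lemma const_p0_fO j : const (p0 g_simple sigma (fO j)) = tw 0 (fO j).
Proof. by rewrite (const_tw g_simple) /= proj0_id ?aut_fO. Qed.

Lemma rootsum_eO j : rootsum c true (eO j).
Proof.
apply: (big_ind (rootsum c true)) => [||k _]; first exact: submod_gen0.
  by move=> *; exact: submod_genD.
by apply/rootsum_nplus => //; exact: nplus_Xp.
Qed.

Variables (M : lmodType K) (r : lrep Lg M) (w : M) (w0 : w <> 0) (w_cyc : forall v, cyc r w v).
Variable lam : dual (h0 sigma).
Hypothesis w_sing : loop_singular g_simple lam r w.
Hypothesis up : forall x, loop_singular g_simple lam r x ->
  exists T : {linear M -> M}, (forall z v, T (r z v) = r z (T v)) /\ T w = x.

(** Bracketing with loops in [h] preserves the loops in [n^+], and [f_O] stays nilpotent on the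
    whole cyclic module. So [f w] is again a possible image of the generator, and [up] turns it into
    an endomorphism. *)
Lemma hop_singular f : hop r h_loop f -> loop_singular g_simple lam r (f w).
Proof.
have [wn wh wf] := w_sing.
move=> hf; have [fn fh] : (forall x, nplus_loop x -> r x (f w) = 0) /\
    (forall y : g0 sigma, val y \in h -> r (const y) (f w) = ev lam (val y) *: f w).
  elim: hf => {f} [//|f f' _ [n1 h1] _ [n2 h2]|a f _ [n1 h1]|z f [k [y [yh ->]]] _ [n1 h1]].
  - split=> x px; first by rewrite linearD n1 // n2 // addr0.
    by rewrite linearD h1 // h2 // scalerDr.
  - split=> x px; first by rewrite linearZ_LR n1 // scaler0.
    by rewrite linearZ_LR h1 // !scalerA mulrC.
  split=> x px; first by rewrite ropC n1 // linear0 add0r n1 //; exact: nplus_loop_h.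
  rewrite ropC h1 // linearZ_LR const_lie_tw (cartan_abelian g_simple (c := c)) //.
  by rewrite (lin0E (tw_linear _ _ _ _)) rop0 addr0.
split=> // j; apply: cyc_nilpotent (wf j) _ (w_cyc _) => y; rewrite [y]tw_span.
have tn n k u : iter n (lie (const (p0 g_simple sigma (fO j)))) (tw k u) = tw k (iter n (lie (fO j)) u).
  by elim: n => //= n ->; rewrite const_lie_tw /= proj0_id ?aut_fO.
elim: (dsupp (val y)) => [|k s [n sn]]; first by exists 0%N; rewrite big_nil.
have [n' yn'] := fO_nilpotent g_simple sigma j (val y k); exists (n' + n)%N.
rewrite big_cons iter_linD [X in _ + X](iter_le0 (leq_addl n' n) sn) addr0.
by apply: iter_le0 (leq_addr n n') _; rewrite tn yn' (lin0E (tw_linear _ _ _ _)).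
Qed.

Local Notation A := (comm_sys h_loop_abelian w0 w_cyc).

Lemma h_loop_act k y : y \in h -> exists s : sr A, r (tw k y) w = sact s w :> sm A.
Proof.
move=> yh; have hf : hop r h_loop (fun v => r (tw k y) v) by apply: hop_r; [exists k, y | exact: hop_id].
by apply: comm_hop hf => f /hop_singular; exact: up.
Qed.

Section Orbit.
Variable j : I.
Let yF : int -> sm A := yf g_simple (zeta_prim := zeta_prim) (A := A) (fO j) w.
Let c0 : cO j != 0. Proof. by rewrite gt_eqF // (cO_pos g_simple). Qed.
Let hOw k : {s : sr A | r (tw k (hO j)) w = sact s w :> sm A}.
Proof. exact/cid/h_loop_act/hO_cartan. Qed.
Let lie_hf : lie (hO j) (fO j) = - cO j *: fO j.
Proof. by rewrite lie_fO ?hO_cartan ?aut_hO. Qed.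

(** The element [h_O t^(k m)] acts on [w] by a scalar, and its bracket with [f_O t^l] is a nonzero
    multiple of [f_O t^(l + k m)]. *)
Let relation_shift (P : {poly sr A}) k k0 : evalf P yF k0 = 0 -> evalf P yF (k * m%:Z + k0) = 0.
Proof.
move=> P0; have [s sE] := hOw (k * m%:Z).
have := congr1 (r (tw (k * m%:Z) (hO j))) P0; rewrite linear0.
have -> : r (tw (k * m%:Z) (hO j)) (evalf P yF k0) =
    sact s (evalf P yF k0) - cO j *: evalf P yF (k * m%:Z + k0) :> sm A.
  rewrite !(evalfE (n := size P)) // linear_sum sact_sumr scaler_sumr -sumrB; apply: eq_bigr => i _.
  rewrite (@srp_act _ _ A) (sactC s) -sactZ -sactBr; congr (sact _ _).
  rewrite /yF /yf [LHS]ropC sE tw_lie_fix ?aut_hO // lie_hf (linZE (tw_linear _ _ _ _)) ropZ scaleNr.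
  by rewrite (@srp_act _ _ A) addrA.
rewrite P0 sact0r sub0r => /eqP; rewrite oppr_eq0 scaler_eq0 (negPf c0); exact/eqP.
Qed.

(** The sign [e] selects [t^m] or [t^-m]. The first gives a relation with leading coefficient 1, the
    second, read upwards, one with constant term 1. *)
Let relation (e : int) : exists N (s : nat -> sr A),
  yF (e * N%:Z * m%:Z) + \sum_(i < N) sact (s i) (yF (e * i%:Z * m%:Z)) = 0.
Proof.
have [N wN] : exists N, iter N (r (tw (e * 0 * m%:Z) (fO j))) w = 0.
  have [_ _ /(_ j)[N wN]] := w_sing; exists N.
  by rewrite -wN const_p0_fO mulr0 mul0r.
exists N; apply: (@loop_sl2_relation K (sr A) M (@sact _ _ A) (@sactDl _ _ A) (@sactDr _ _ A)
  (@sactM _ _ A) (scl A) (@sact_scl _ _ A) (r (tw (e * 1 * m%:Z) (eO j)))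
  (fun i => r (tw (e * i%:Z * m%:Z) (fO j))) (fun i => r (tw (e * i%:Z * m%:Z) (hO j)))
  (fun i => sval (hOw (e * i%:Z * m%:Z))) w (cO j)) => //.
- move=> i v; rewrite ropC tw_lie_fix ?aut_eO // lie_eO_fO //; congr (_ + r (tw _ _) _).
  by rewrite -mulrDl -mulrDr -PoszD add1n.
- move=> k i v; rewrite ropC tw_lie_fix ?aut_hO // lie_hf (linZE (tw_linear _ _ _ _)) ropZ scaleNr.
  by rewrite -mulrDl -mulrDr -PoszD.
- by have [n _ _] := w_sing; apply/n/nplus_loop_tw/rootsum_eO.
- by move=> k; exact: svalP (hOw _).
- by move=> s v; rewrite (@srp_act _ _ A).
- by move=> i s v; rewrite (@srp_act _ _ A).
- by rewrite iterS [iter N _ w]wN linear0.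
Qed.

Let evalf_CX s n f k : evalf (A := A) (s%:P * 'X^n) f k = sact s (f (k + n%:Z)).
Proof.
rewrite (evalfE (n := n.+1)) => [|]; last first.
  apply: leq_trans (size_polyMleq _ _) _; rewrite size_polyXn addnS /=.
  by rewrite -add1n leq_add2r size_polyC_leq1.
rewrite (bigD1 ord_max) //= coefCM coefXn eqxx mulr1 big1 ?addr0 // => i ni.
have /negPf e : (i : nat) != n by apply: contra_neq ni => ni; exact: val_inj.
by rewrite (_ : (s%:P * 'X^n)`_i = 0) ?sact0l // coefCM coefXn e mulr0.
Qed.

Let evalf_sum (J : Type) (l : seq J) (P : pred J) (a : J -> {poly sr A}) f k :
  evalf (\sum_(i <- l | P i) a i) f k = \sum_(i <- l | P i) evalf (a i) f k.
Proof.
apply: (big_morph (fun a => evalf a f k)) => [x y|]; first by rewrite evalfDl.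
by rewrite (evalfE (n := 0)) ?big_ord0 // size_poly0.
Qed.

Let rotp_X n i : rotp n 'X^(i * m) = 'X^(i * m) :> {poly sr A}.
Proof.
apply/polyP => k; rewrite coef_rot coefXn; case: eqP => [->|]; last by rewrite mulr0.
by rewrite -rmorphXn -exprM mulnA mulnC exprM (prim_expr_order zeta_prim) expr1n rmorph1 mul1r.
Qed.

Let rotp_poly N (s : nat -> sr A) (d : nat -> nat) :
  rotp 1 (\sum_(i < N) (s i)%:P * 'X^(d i * m)) = \sum_(i < N) (s i)%:P * 'X^(d i * m).
Proof. rewrite (big_morph (rotp 1) (rotpD 1) (comp_poly0 _)).
by apply: eq_bigr => i _; rewrite rotpM rotpC rotp_X. Qed.

Lemma orbit_poly : exists C : {poly sr A},
  [/\ C \is monic, C`_0 = 1, rotp 1 C = C & kills (zeta_prim := zeta_prim) g_simple C w (fO j)].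
Proof.
have m0 := prim_order_gt0 zeta_prim.
have [N [s e1]] := relation 1; have [N' [s' e2]] := relation (-1).
pose P := 'X^(N * m) + \sum_(i < N) (s i)%:P * 'X^(i * m).
pose Q := 1 + \sum_(i < N') (s' i)%:P * 'X^((N' - i) * m).
have P0 k : evalf P yF (k * m%:Z) = 0.
  rewrite -[_ * _]addr0; apply: relation_shift.
  rewrite /P evalfDl -['X^_]mul1r -polyC1 -[RHS]e1; congr (_ + _).
    by rewrite evalf_CX sact1 add0r mul1r PoszM.
  by rewrite evalf_sum; apply: eq_bigr => i _; rewrite evalf_CX add0r mul1r PoszM.
have Q0 k : evalf Q yF (k * m%:Z) = 0.
  have -> : k * m%:Z = (k + N'%:Z) * m%:Z + -1 * N'%:Z * m%:Z by ring.
  apply: relation_shift; rewrite /Q evalfDl evalf1 -[RHS]e2; congr (_ + _).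
  rewrite evalf_sum; apply: eq_bigr => i _; rewrite evalf_CX; congr (sact _ (yF _)).
  by rewrite PoszM -subzn ?(ltnW (ltn_ord i)) //; ring.
have rPQ : rotp 1 ('X^(N'.+1 * m) * P + Q) = 'X^(N'.+1 * m) * P + Q.
  rewrite rotpD rotpM !rotpD (rotp_poly N s id) (rotp_poly N' s' (fun i => N' - i)%N) !rotp_X.
  by rewrite -polyC1 rotpC.
have szP : (size (\sum_(i < N) (s i)%:P * 'X^(i * m))%R <= N * m)%N.
  apply/leq_sizeP => k Nk; rewrite coef_sum big1 // => i _; rewrite coefCM coefXn (_ : (_ == _) = false) ?mulr0 //.
  by apply/negbTE; rewrite gtn_eqF // (leq_trans _ Nk) // ltn_pmul2r.
have szQ : (size Q <= (N' * m).+1)%N.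
  apply/leq_sizeP => k Nk; rewrite coefD coef1 coef_sum gtn_eqF ?(leq_trans _ Nk) // add0r.
  rewrite big1 // => i _; rewrite coefCM coefXn (_ : (_ == _) = false) ?mulr0 //.
  by apply/negbTE; rewrite gtn_eqF // (leq_trans _ Nk) // ltnS leq_pmul2r // leq_subr.
(* [P] is monic and [Q] has constant term 1; the exponent [N'.+1] lifts the product above the degree
   of [Q] and away from the constant term. *)
exists ('X^(N'.+1 * m) * P + Q); split.
- have sP : size P = (N * m).+1 by rewrite size_polyDl size_polyXn // ltnS.
  have mP : P \is monic by rewrite monicE lead_coefDl ?size_polyXn // lead_coefXn.
  rewrite monicE lead_coefDl ?lead_coef_Mmonic ?lead_coefXn //.
  rewrite size_Mmonic ?monic_neq0 ?monicXn // size_polyXn sP addSn /= (leq_ltn_trans szQ) //.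
  by rewrite addnS ltnS (leq_trans _ (leq_addr _ _)) // ltn_pmul2r.
- rewrite coefD coef0M coefXn ltn_eqF ?muln_gt0 ?m0 // mul0r add0r coefD coef1 coef_sum big1 ?addr0 // => i _.
  rewrite coefCM coefXn (_ : (_ == _) = false) ?mulr0 //.
  by rewrite ltn_eqF // muln_gt0 subn_gt0 ltn_ord.
- exact: rPQ.
apply/funext => k; rewrite evalfDl evalfM.
(* In degrees not divisible by [m] the value equals [zeta ^ k] times itself, because [sigma] fixes
   [f_O], and so it vanishes. *)
have [/eqP k1|zk] := boolP (zeta ^ k == 1).
  have [k' ->] : exists k', k = k' * m%:Z.
    exists (k %/ m%:Z)%Z; rewrite {1}(divz_eq k m%:Z) -[RHS]addr0; congr (_ + _).
    have : (0 <= k %% m%:Z)%Z by rewrite modz_ge0 // -lt0n.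
    case e : (k %% m%:Z)%Z => [n|//] _.
    have : zeta ^+ n == 1.
      rewrite -[zeta ^+ n]/(zeta ^ n%:Z) -e -[X in X == _]mul1r -(zeta_mul (k %/ m)%Z) -expfzDr ?(prim_root_neq0 zeta_prim) //.
      by rewrite -divz_eq k1 zeta_mul.
    rewrite -(prim_order_dvd zeta_prim) => /dvdn_leq; case: n e => // n e /(_ isT).
    by rewrite leqNgt -ltz_nat -e ltz_pmod // ltz_nat.
  rewrite -[LHS]/(evalf 'X^(N'.+1 * m) (evalf P yF) (k' * m%:Z) + evalf Q yF (k' * m%:Z)).
  by rewrite -['X^_]mul1r -polyC1 evalf_CX sact1 PoszM -mulrDl [evalf P yF _]P0 [evalf Q yF _]Q0 addr0.
have z0 P' : rotp 1 P' = P' -> evalf (A := A) P' yF k = 0.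
  move=> rP; have e := evalf_rot P' (yf_aut g_simple (zeta_prim := zeta_prim) (A := A) 1 (fO j) w) k.
  move: e; rewrite rP /= aut_fO expr1 => /eqP; rewrite -subr_eq0 -[X in X - _]scale1r -scalerBl.
  by rewrite scaler_eq0 subr_eq0 eq_sym (negPf zk) => /eqP.
by rewrite -evalfM; have := z0 _ rPQ; rewrite evalfDl.
Qed.
End Orbit.

(** Some power of the product of the orbit polynomials kills each generator of [g]. Brackets add
    exponents, so every element has an exponent, and a basis of [g] gives a common one. *)
Lemma vanishing_poly : exists q : {poly sr A},
  [/\ q \is monic, q`_0 = 1, rotp 1 q = q & vanish (zeta_prim := zeta_prim) g_simple q].
Proof.
have [C CP] := choice orbit_poly.
pose F := \prod_j C j.
have [Fm F0 Fr] : [/\ F \is monic, F`_0 = 1 & rotp 1 F = F].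
  split; first by apply: monic_prod => j _; have [] := CP j.
    rewrite -horner_coef0 horner_prod big1 // => j _.
    by rewrite horner_coef0; have [] := CP j.
  rewrite (big_morph (rotp 1) (rotpM 1) (comp_polyC 1 _)).
  by apply: eq_bigr => j _; have [] := CP j.
have Fn n : [/\ F ^+ n \is monic, (F ^+ n)`_0 = 1 & rotp 1 (F ^+ n) = F ^+ n].
  split; first exact: monic_exp.
    by rewrite -horner_coef0 horner_exp horner_coef0 F0 expr1n.
  by elim: n => [|n IHn]; [rewrite expr0 -polyC1 rotpC | rewrite exprS rotpM Fr IHn].
pose yA x := yf (zeta_prim := zeta_prim) (A := A) g_simple x w.
pose kl n := kills (zeta_prim := zeta_prim) g_simple (A := A) (F ^+ n) w.
have kl_le n n' x : (n <= n')%N -> kl n x -> kl n' x.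
  by move=> /subnK <- nx; rewrite /kl /kills exprD evalfM nx evalf0r.
have klD n x y : kl n x -> kl n y -> kl n (x + y).
  move=> nx ny; rewrite /kl /kills [yf _ _ _](_ : _ = yA x + yA y); last first.
    by apply/funext => k; rewrite /yA /yf (linDE (tw_linear _ _ _ _)) ropD.
  by rewrite evalfDr nx ny addr0.
have kl0 n : kl n 0.
  rewrite /kl /kills [yf _ _ _](_ : _ = 0); last first.
    by apply/funext => k; rewrite /yf (lin0E (tw_linear _ _ _ _)) rop0.
  exact: evalf0r.
have klZ n a x : kl n x -> kl n (a *: x).
  move=> nx; rewrite /kl /kills [yf _ _ _](_ : _ = evalf (scl A a)%:P (yA x)); last first.
    by apply/funext => k; rewrite evalfC sact_scl /yA /yf (linZE (tw_linear _ _ _ _)) ropZ.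
  by rewrite -evalfM mulrC evalfM nx evalf0r.
pose P x := exists n, kl n x.
have kX i : kl 0 (Xplus c i).
  rewrite /kl /kills expr0 evalf1; apply/funext => k; have [n _ _] := w_sing.
  apply/n/nplus_loop_tw; apply/rootsum_nplus => //; exact: nplus_Xp.
have kF j : kl 1 (fO j).
  have [_ _ _ jw] := CP j; rewrite /kl /kills expr1 /F (bigD1 j) //= mulrC evalfM.
  by rewrite [evalf (C j) _]jw evalf0r.
have PD x y : P x -> P y -> P (x + y).
  by move=> [a xa] [b yb]; exists (maxn a b); apply: klD; apply: kl_le; [exact: leq_maxl | | exact: leq_maxr |].
have PZ a x : P x -> P (a *: x) by move=> [n nx]; exists n; exact: klZ.
have Plie x y : P x -> P y -> P (lie x y).
  move=> [a xa] [b yb]; exists (a + b)%N; rewrite /kl exprD.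
  by apply: kills_lie => //; have [_ _] := Fn a.
have PH i : P (H i).
  rewrite -(lie_Xp_fO (sigma := sigma) (porbit_id _ i)); apply: Plie; [by exists 0%N | by exists 1%N].
have Ph : {in h, forall y, P y}.
  move=> y /(cartan_coroots g_simple)[d ->]; apply: (big_ind P) => [|//|i _]; last exact: PZ.
  by exists 0%N.
have PX s i : P (Xpm (c := c) s i).
  case: s; first by exists 0%N; exact: kX.
  have [y [yd yal]] := coweight_exists g_simple c.
  have yh : y i \in h by have [d ->] := yd i; exact: coroots_cartan.
  (* The fundamental coweight [y i] singles out the term of index [i] in the orbit sum. *)
  have -> : Xpm (c := c) false i = -1 *: lie (y i) (fO i).
    rewrite lie_sumr (bigD1 i) ?porbit_id //= big1 => [|k /andP[_ ki]].
      by rewrite (XminusP i yh) evN yal eqxx addr0 scalerA mulrNN mulr1 scale1r.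
    by rewrite (XminusP k yh) evN yal eq_sym (negPf ki) oppr0 scale0r.
  by apply/PZ/Plie; [exact: Ph | exists 1%N].
have allP x : P x := generation g_simple PD PZ Ph PX Plie x.
have [f fP] := choice allP; pose N := \max_(i < \dim {:g}) f ((vbasis {:g})`_i)%R.
have kN x : kl N x.
  rewrite (coord_vbasis (memvf x)); apply: (big_ind (kl N)) => [|y z|i _]; last 2 first.
  - exact: klD.
  - by apply: klZ; apply: kl_le (fP _); exact: (leq_bigmax (F := fun i : 'I_(\dim {:g}) => f ((vbasis {:g})`_i)%R) i).
  exact: kl0.
exists (F ^+ N); split; rewrite ?(Fn N) //; try by have [] := Fn N.
move=> x v; have [_ _ rN] := Fn N.
exact: (kills_cyc rN kN (w_cyc v)).
Qed.
End TwistedCommutant.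

(** * Adjoining roots and localizing *)

Section RootAdjunction.
Variables (K : fieldType) (L : lieAlgType K) (A : sys L).
Variables (n : nat) (q : {poly sr A}) (q_monic : q \is monic) (size_q : size q = n.+2).
Local Notation N := {ffun 'I_n.+1 -> sm A}.
Implicit Types v : N.

Definition comp_act (s : sr A) v : N := [ffun i => sact s (v i)].
(** Multiplication by [X] on the module tensored with [S[X]/(q)], in the basis of the powers of
    [X]. *)
Definition companion v : N :=
  [ffun i : 'I_n.+1 => (if (i : nat) is k.+1 then v (inord k) else 0) - sact q`_i (v ord_max)].

Fact companion_linear : linear companion.
Proof.
move=> a u v; apply/ffunP => i; rewrite !ffunE /= sactDr sactZ scalerBr opprD addrACA; congr (_ + _).
by case: (i : nat) => [|k]; rewrite ?scaler0 ?addr0 // !ffunE.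
Qed.

Fact comp_rop_linear z : linear (fun v => [ffun i => srp A z (v i)] : N).
Proof. by move=> a u v; apply/ffunP => i; rewrite !ffunE linearP. Qed.

Definition comp_rep : lrep L N.
Proof.
apply: (@LRep K L N (fun z => mklin (comp_rop_linear z))) => [x y v|a x v|x y v] /=;
  apply/ffunP => i; rewrite !ffunE.
- exact: ropD.
- exact: ropZ.
- exact: rop_lie.
Defined.

Definition adjunction : sys L.
Proof.
apply: (@poly_sys K L (sr A) (scl A) N comp_act (mklin companion_linear) comp_rep) => [s t v|s u v|s t v|a v|x s v|s v|x v] /=;
  apply/ffunP => i; rewrite !ffunE /=.
- exact: sactDl.
- exact: sactDr.
- exact: sactM.
- exact: sact_scl.
- exact: srp_act.
- by rewrite sactBr sactC; congr (_ - _); case: (i : nat) => [|k]; rewrite ?sact0r ?ffunE.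
- by rewrite linearB srp_act; congr (_ - _); case: (i : nat) => [|k]; rewrite ?linear0 ?ffunE.
Defined.

Let adjC s v : sact (s%:P : sr adjunction) v = comp_act s v :> N.
Proof. exact: poly_sysC. Qed.
Let adjX v : sact ('X : sr adjunction) v = companion v :> N.
Proof. exact: poly_sysX. Qed.

Definition delta (i : nat) (u : sm A) : N := [ffun j : 'I_n.+1 => if (j : nat) == i then u else 0].

Fact delta_linear i : linear (delta i).
Proof. by move=> a u v; apply/ffunP => j; rewrite !ffunE; case: ifP; rewrite ?scaler0 ?addr0. Qed.

Definition adj_ext : sext A adjunction.
Proof.
apply: (@Sext K L A adjunction polyC (mklin (delta_linear 0))) => [a|s v|x v|l l0 v] //.
- rewrite [RHS](poly_sysC) /=; apply/ffunP => j; rewrite !ffunE; case: ifP => // _; exact/esym/sact0r.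
- by apply/ffunP => j; rewrite !ffunE; case: ifP => // _; rewrite linear0.
apply/ffunP => j; rewrite sum_ffunE ffunE -[RHS](l0 (v j)); apply: eq_bigr => [[s o]] _.
apply: etrans (congr1 (fun u : N => u j) (adjC _ _)) _.
by rewrite ffunE; case: o => //= x; rewrite ffunE.
Defined.

Let delta_sum v : v = \sum_(i < n.+1) delta i (v i).
Proof.
apply/ffunP => j; rewrite sum_ffunE (bigD1 j) //= ffunE eqxx big1 ?addr0 // => i ij.
by rewrite ffunE ifF //; apply/negbTE; apply: contra_neq ij => /val_inj.
Qed.

Let companion_delta i u : (i < n)%N -> companion (delta i u) = delta i.+1 u.
Proof.
move=> ni; apply/ffunP => j; rewrite !ffunE ifF ?sact0r ?subr0; last by rewrite gtn_eqF.
case ej : (j : nat) => [|k] //; rewrite ffunE inordK ?eqSS // -ltnS -ej; exact: ltnW (ltn_ord j).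
Qed.

Let iter_companion i u : (i <= n)%N -> iter i companion (delta 0 u) = delta i u.
Proof.
elim: i => [|i IHi] // ni; rewrite iterS IHi ?companion_delta //; exact: ltnW.
Qed.

Let act_delta s i u : comp_act s (delta i u) = delta i (sact s u).
Proof. by apply/ffunP => j; rewrite !ffunE; case: ifP; rewrite ?sact0r. Qed.

Let delta_X i u : (i <= n)%N -> delta i u = sact ('X^i : sr adjunction) (delta 0 u : sm adjunction).
Proof.
elim: i => [|i IHi] lt_in; first by rewrite expr0 sact1.
by rewrite exprS sactM -(IHi (ltnW lt_in)) adjX companion_delta.
Qed.

Lemma adjunction_root : annih (map_poly (sf adj_ext) q).['X].
Proof.
(* The new ring is [{poly sr A}] itself, so the value of [q] at the new root is [q] viewed as a
   scalar; it has to kill the copies of the old module in degree 0, from which powers of [X] give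
   the rest. *)
have -> : (map_poly (sf adj_ext) q).['X] = q :> sr adjunction by rewrite -[RHS]comp_polyXr.
move=> v; have compD (s t : sr A) w : comp_act (s + t) w = comp_act s w + comp_act t w.
  by apply/ffunP => i; rewrite !ffunE sactDl.
have q0 u : sact (q : sr adjunction) (delta 0 u : sm adjunction) = 0.
  rewrite -[LHS]/(pact comp_act companion q (delta 0 u)).
  rewrite (pact_widen companion compD (n := n.+2)) ?size_q // big_ord_recr iterS iter_companion //.
  have -> : q`_n.+1 = 1 by have := q_monic; rewrite monicE lead_coefE size_q => /eqP.
  rewrite (eq_bigr (fun i : 'I_n.+1 => delta i (sact q`_i u))) => [|i _]; last first.
    have le_i : (i <= n)%N by rewrite -ltnS.
    exact: etrans (congr1 (comp_act _) (iter_companion _ le_i)) (act_delta _ _ _).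
  pose v0 : N := [ffun i : 'I_n.+1 => sact q`_i u].
  rewrite (_ : \sum_(i < n.+1) _ = v0) => [|]; last first.
    by rewrite [RHS]delta_sum; apply: eq_bigr => i _; rewrite ffunE.
  apply/ffunP => j; rewrite !ffunE eqxx sact1; case ej : (j : nat) => [|k]; first by rewrite sub0r subrr.
  have kn : (k < n)%N by rewrite -ltnS -ej ltn_ord.
  have -> : delta n u (inord k) = 0 by rewrite ffunE inordK ?ltn_eqF // ltnW.
  by rewrite sub0r subrr.
have -> : v = \sum_(i < n.+1) sact ('X^i : sr adjunction) (delta 0 ((v : N) i) : sm adjunction).
  rewrite {1}[v]delta_sum; apply: eq_bigr => i _; apply: delta_X; rewrite -ltnS; exact: ltn_ord.
by rewrite sact_sumr big1 // => i _; rewrite sactC q0 sact0r.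
Qed.

Lemma adj_ext_inj : injective (si adj_ext).
Proof. by move=> u v /(congr1 (fun f : N => f ord0)); rewrite !ffunE. Qed.
End RootAdjunction.

Section Splitting.
Variables (K : fieldType) (L : lieAlgType K).

Definition annihp (A : sys L) (a : {poly sr A}) := forall i, annih a`_i.

Lemma annihpD (A : sys L) (a b : {poly sr A}) : annihp a -> annihp b -> annihp (a + b).
Proof. by move=> a0 b0 i v; rewrite coefD sactDl a0 b0 addr0. Qed.

Lemma annihpM (A : sys L) (a b : {poly sr A}) : annihp a -> annihp (a * b).
Proof.
move=> a0 i v; rewrite coefM sact_suml big1 // => j _.
by rewrite mulrC sactM a0 sact0r.
Qed.

Lemma annihp_ext (A B : sys L) (e : sext A B) (a : {poly sr A}) : annihp a -> annihp (map_poly (sf e) a).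
Proof. by move=> a0 i; rewrite coef_map; exact: sext_annih. Qed.

(** With an adjoined root [a], the difference [q - q(a)] is divisible by [X - a] and [q(a)] acts by
    zero; so factorization proceeds modulo coefficients that act by zero. *)
Lemma split_ext n (A : sys L) (q : {poly sr A}) : q \is monic -> size q = n.+1 ->
  exists (B : sys L) (e : sext A B) (s : seq (sr B)), injective (si e) /\
    annihp (map_poly (sf e) q - \prod_(a <- s) ('X - a%:P)).
Proof.
elim: n A q => [|n IHn] A q qm sq.
  exists A, (sext_id A), [::]; split=> // i v; rewrite big_nil.
  have -> : q = 1.
    by rewrite [q]size1_polyC ?sq // -[q`_0]/(q`_(1%N).-1) -sq -lead_coefE (monicP qm).
  by rewrite rmorph1 subrr coef0 sact0l.
pose A1 := adjunction n q; pose e1 : sext A A1 := adj_ext n q.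
pose q1 : {poly sr A1} := map_poly (sf e1) q; pose a1 : sr A1 := 'X.
have q1a : annih q1.[a1] := adjunction_root qm sq.
have /factor_theorem[h hE] : root (q1 - (q1.[a1])%:P) a1 by rewrite /root hornerD hornerN hornerC subrr.
have q1m : q1 \is monic by exact: monic_map.
have sq1 : size q1 = n.+2 by rewrite size_map_poly_id0 // (monicP qm) rmorph1 oner_neq0.
have hm : h \is monic.
  rewrite -(monicMr _ (monicXsubC a1)) -hE monicE lead_coefDl ?(monicP q1m) //.
  by rewrite size_polyN sq1 (leq_ltn_trans (size_polyC_leq1 _)).
have sh : size h = n.+1.
  have : size (h * ('X - a1%:P)) = n.+2.
    by rewrite -hE size_polyDl ?sq1 // size_polyN (leq_ltn_trans (size_polyC_leq1 _)).
  by rewrite size_Mmonic ?monicXsubC ?monic_neq0 // size_XsubC addn2 => [[]].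
have [B [e2 [s [inj2 es]]]] := IHn _ h hm sh.
exists B, (sext_trans e1 e2), (sf e2 a1 :: s); split.
  by move=> u v /inj2; exact: (@adj_ext_inj _ _ _ n q).
have -> : map_poly (sf (sext_trans e1 e2)) q = map_poly (sf e2) q1.
  by rewrite -map_poly_comp.
rewrite big_cons.
have -> : map_poly (sf e2) q1 - ('X - (sf e2 a1)%:P) * \prod_(j <- s) ('X - j%:P) =
    (map_poly (sf e2) h - \prod_(j <- s) ('X - j%:P)) * ('X - (sf e2 a1)%:P) + map_poly (sf e2) (q1.[a1])%:P.
  have -> : map_poly (sf e2) q1 = map_poly (sf e2) (h * ('X - a1%:P)) + map_poly (sf e2) (q1.[a1])%:P.
    by rewrite -rmorphD -hE subrK.
  rewrite rmorphM rmorphB /= map_polyX map_polyC /=; ring.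
apply: annihpD; first exact: annihpM.
by apply: annihp_ext => i v; rewrite coefC; case: eqP => _; [exact: q1a | exact: sact0l].
Qed.
End Splitting.

Section ModquotMap.
Variables (R : pzRingType) (M : lmodType R) (S : set M) (G : {linear M -> M}).
Hypothesis GS : forall x, S x -> S (G x).

Lemma modquot_map_exists : exists h : {linear modquot S -> modquot S}, forall x, h (modcl S x) = modcl S (G x).
Proof.
have lin : linear (fun x => modcl S (G x)) by move=> a x y; rewrite !linearP.
apply: (modquot_lift (f := mklin lin)) => x Sx /=.
by rewrite -(linear0 (modcl S)); apply/modclP; rewrite subr0; exact/submod_gen_in/GS.
Qed.

Definition modquot_map := sval (cid modquot_map_exists).
Lemma modquot_mapE x : modquot_map (modcl S x) = modcl S (G x).
Proof. exact: (svalP (cid modquot_map_exists)). Qed.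
End ModquotMap.

(* The localization at [D] consists of the germs at infinity of sequences
   satisfying [s (k + 1) = D (s k)] for large [k]: [v / D ^ n] is the germ of
   [D ^ (k - n) v]. *)
Section Localization.
Variables (K : fieldType) (L : lieAlgType K) (A : sys L) (D : sr A).

Definition evgeo (s : nat -> sm A) : bool :=
  `[< exists n, forall k, (n <= k)%N -> s k.+1 = sact D (s k) >].

Fact evgeo_submod : submod_closed evgeo.
Proof.
split=> [|a s t]; first by apply/asboolP; exists 0%N => k _; rewrite sact0r.
move=> /asboolP[n sn] /asboolP[n' tn]; apply/asboolP; exists (maxn n n') => k.
rewrite geq_max => /andP[nk nk']; rewrite -[LHS]/(a *: s k.+1 + t k.+1) sn // tn //.
by rewrite -sactZ -sactDr.
Qed.
HB.instance Definition _ := GRing.isSubmodClosed.Build K (nat -> sm A) evgeo evgeo_submod.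

Record geo := Geo { gval :> nat -> sm A; gvalP : evgeo gval }.
HB.instance Definition _ := [isSub for gval].
HB.instance Definition _ := [Choice of geo by <:].
HB.instance Definition _ := [SubChoice_isSubLmodule of geo by <:].

Definition null_germ : set geo := [set s | exists n, forall k, (n <= k)%N -> s k = 0].
Definition germ : Type := modquot null_germ.
HB.instance Definition _ := GRing.Lmodule.on germ.
Local Notation cl := (modcl null_germ).

Lemma germ0P s : cl s = 0 -> null_germ s.
Proof.
rewrite -(linear0 cl) => /modclP; rewrite subr0; elim=> {s} [//||s t _ [n sn] _ [n' tn]|a s _ [n sn]].
- by exists 0%N.
- exists (maxn n n') => k; rewrite geq_max => /andP[nk nk'].
  by rewrite -[LHS]/(s k + t k) sn // tn // addr0.
- by exists n => k nk; rewrite -[LHS]/(a *: s k) sn // scaler0.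
Qed.

Lemma germ_eq (s t : geo) n : (forall k, (n <= k)%N -> s k = t k) -> cl s = cl t.
Proof.
move=> st; apply/modclP/submod_gen_in; exists n => k nk.
by rewrite -[LHS]/(s k - t k) st // subrr.
Qed.

Section Componentwise.
Variables (T : {linear sm A -> sm A}) (TD : forall v, T (sact D v) = sact D (T v)).

Fact gmap_subproof (s : geo) : evgeo (fun k => T (s k)).
Proof.
have /asboolP[n sn] := gvalP s; apply/asboolP; exists n => k nk.
by rewrite sn // TD.
Qed.
Definition gmap s := Geo (gmap_subproof s).
Fact gmap_linear : linear gmap.
Proof. by move=> a s t; apply: val_inj; apply/funext => k; exact: linearP. Qed.
Fact gmap_null s : null_germ s -> null_germ (mklin gmap_linear s).
Proof. by move=> [n sn]; exists n => k nk; rewrite /= sn // linear0. Qed.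
Definition germ_map := modquot_map gmap_null.
Lemma germ_mapE s : germ_map (cl s) = cl (gmap s).
Proof. exact: (modquot_mapE gmap_null). Qed.
End Componentwise.

Definition gshift_fun (s : geo) k := if k is k'.+1 then s k' else 0.
Fact gshift_subproof s : evgeo (gshift_fun s).
Proof.
have /asboolP[n sn] := gvalP s; apply/asboolP; exists n.+1 => -[|k] // nk.
by rewrite /= sn.
Qed.
Definition gshift s := Geo (gshift_subproof s).
Fact gshift_linear : linear gshift.
Proof.
move=> a s t; apply: val_inj; apply/funext => -[|k] //=.
by rewrite -[RHS]/(a *: 0 + 0) scaler0 addr0.
Qed.
Fact gshift_null s : null_germ s -> null_germ (mklin gshift_linear s).
Proof. by move=> [n sn]; exists n.+1 => -[|k] // nk; rewrite /= sn. Qed.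
Definition germ_shift := modquot_map gshift_null.
Lemma germ_shiftE s : germ_shift (cl s) = cl (gshift s).
Proof. exact: (modquot_mapE gshift_null). Qed.

Fact act_mul_D s v : mklin (sact_lin (A := A) s) (sact D v) = sact D (mklin (sact_lin s) v).
Proof. exact: sactC. Qed.
Definition germ_act s : germ -> germ := germ_map (act_mul_D s).

Lemma germ_actE s x : germ_act s (cl x) = cl (gmap (act_mul_D s) x).
Proof. exact: germ_mapE. Qed.

Fact rop_D z v : srp A z (sact D v) = sact D (srp A z v).
Proof. exact: srp_act. Qed.

Let clD x y : cl (x + y) = cl x + cl y := linearD cl x y.

Definition germ_rep : lrep L germ.
Proof.
apply: (@LRep K L germ (fun z => germ_map (rop_D z))) => [x y|a x|x y]; elim/modcl_ind=> s;
  rewrite !germ_mapE.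
- rewrite -clD; congr modcl; apply: val_inj; apply/funext => k; exact: ropD.
- rewrite -(linearZ_LR cl); congr modcl; apply: val_inj; apply/funext => k; exact: ropZ.
- rewrite -(linearB cl); congr modcl; apply: val_inj; apply/funext => k; exact: rop_lie.
Defined.

Definition localization : sys L.
Proof.
apply: (@poly_sys K L (sr A) (scl A) germ germ_act germ_shift germ_rep) => [s t|s u v|s t|a|x s|s|x].
- elim/modcl_ind=> v; rewrite !germ_actE -clD; congr modcl; apply: val_inj; apply/funext => k; exact: sactDl.
- exact: linearD.
- elim/modcl_ind=> v; rewrite !germ_actE; congr modcl; apply: val_inj; apply/funext => k; exact: sactM.
- elim/modcl_ind=> v; rewrite !germ_actE -(linearZ_LR cl); congr modcl.
  apply: val_inj; apply/funext => k; exact: sact_scl.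
- elim/modcl_ind=> v; rewrite germ_actE !germ_mapE germ_actE; congr modcl.
  apply: val_inj; apply/funext => k; exact: srp_act.
- elim/modcl_ind=> v; rewrite !(germ_actE, germ_shiftE); congr modcl.
  by apply: val_inj; apply/funext => -[|k] //=; rewrite sact0r.
- elim/modcl_ind=> v; rewrite !(germ_mapE, germ_shiftE); congr modcl.
  by apply: val_inj; apply/funext => -[|k] //=; rewrite linear0.
Defined.

Let locC s v : sact (s%:P : sr localization) v = germ_act s v :> germ.
Proof. exact: poly_sysC. Qed.

Let locX v : sact ('X : sr localization) v = germ_shift v :> germ.
Proof. exact: poly_sysX. Qed.

Lemma localization_inv v : sact (D%:P : sr localization) (sact ('X : sr localization) v) = v :> sm localization.
Proof.
rewrite locC locX; elim/modcl_ind: v => s.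
rewrite germ_shiftE germ_actE; have /asboolP[n sn] := gvalP s.
by apply: (@germ_eq _ _ n.+1) => -[|k] // nk; rewrite /= sn.
Qed.

Fact geo_subproof v : evgeo (fun k => sact (D ^+ k) v).
Proof. by apply/asboolP; exists 0%N => k _; rewrite exprS sactM. Qed.
Definition geo_of v := Geo (geo_subproof v).
Fact geo_of_linear : linear (fun v => cl (geo_of v)).
Proof.
move=> a u v; rewrite -(linearP cl); congr modcl; apply: val_inj; apply/funext => k /=.
by rewrite sactDr sactZ.
Qed.

Definition loc_ext : sext A localization.
Proof.
apply: (@Sext K L A localization polyC (mklin geo_of_linear)) => [a|s v|x v|l l0] //.
- apply: etrans _ (esym (locC _ _)); rewrite germ_actE; congr modcl; apply: val_inj; apply/funext => k.
  exact: sactC.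
- apply: etrans _ (esym (germ_mapE _ _)); congr modcl; apply: val_inj; apply/funext => k.
  by rewrite /= srp_act.
elim/modcl_ind=> s.
pose G (p : sr A * option L) : geo :=
  if p.2 is Some x then gmap (act_mul_D p.1) (gmap (rop_D x) s) else gmap (act_mul_D p.1) s.
rewrite (eq_bigr (fun p => cl (G p))) => [|[a o] _]; last first.
  apply: etrans (locC _ _) _; case: o => [x|]; last exact: germ_actE.
  by rewrite -germ_actE -germ_mapE.
rewrite -(linear_sum cl) -[RHS](linear0 cl); congr modcl; apply: val_inj; apply/funext => k.
rewrite -[RHS](l0 (s k)) raddf_sum fct_sumE; apply: eq_bigr => [[a [x|]]] _ //.
Defined.

Lemma loc_ext_eq0 v : si loc_ext v = 0 -> exists n, sact (D ^+ n) v = 0.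
Proof. by move=> /germ0P[n e]; exists n; exact: (e n). Qed.
End Localization.

Section Greedy.
Variables (K : fieldType) (L : lieAlgType K).

Definition inv_mod (A : sys L) (d : sr A) := exists d', annih (d * d' - 1).

Lemma inv_mod_ext (A B : sys L) (e : sext A B) d : inv_mod d -> inv_mod (sf e d).
Proof.
move=> [d' dd]; exists (sf e d'); rewrite -rmorphM -(rmorph1 (sf e)) -rmorphB.
exact: sext_annih.
Qed.

(** For each [d], either no power of [d] kills the current vector, and localizing at [d] keeps it
    nonzero, or the vector is replaced by its last nonzero multiple by a power of [d], which [d]
    kills. Both outcomes persist in later steps. *)
Lemma localize_seq (A : sys L) (ds : seq (sr A)) (p : sm A) : p <> 0 ->
  exists (B : sys L) (e : sext A B) (s : sr B), sact s (si e p) <> 0 /\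
    forall d, d \in ds -> inv_mod (sf e d) \/ sact (sf e d) (sact s (si e p)) = 0.
Proof.
move=> p0; elim: ds => [|d ds [B [e [s [p'0 dsP]]]]].
  by exists A, (sext_id A), 1; rewrite sact1.
pose p' := sact s (si e p); pose D := sf e d.
have [DN|nD] := pselect (exists N, sact (D ^+ N) p' = 0); last first.
  pose e' := loc_ext D; exists _, (sext_trans e e'), (sf e' s).
  have -> : sact (sf e' s) (si (sext_trans e e') p) = si e' p' by rewrite -si_act.
  split=> [/loc_ext_eq0//|d1]; rewrite in_cons => /predU1P[->|/dsP[dinv|d0]].
  - left; exists 'X => v; rewrite sactDl sactNl sact1 sactM [sact _ (sact _ _)]localization_inv.
    exact: subrr.
  - by left; exact: (inv_mod_ext e' dinv).
  - right; apply: etrans (esym (si_act e' _ _)) _; rewrite [sact _ _]d0; exact: linear0.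
have /ex_minnP[[|N]] : exists N, `[< sact (D ^+ N) p' = 0 >] by case: DN => N ?; exists N; exact/asboolP.
  by move=> /asboolP; rewrite expr0 sact1.
move=> /asboolP DN0 min; exists B, e, (D ^+ N * s); rewrite sactM -/p'; split=> [/asboolP/min|d1].
  by rewrite ltnn.
rewrite in_cons => /predU1P[->|/dsP[dinv|d0]]; [right | by left | right].
  by rewrite -sactM -exprS.
by rewrite sactC [sact (sf e d1) _]d0 sact0r.
Qed.
End Greedy.

Lemma big_iterS (R : Type) (idx : R) (op : Monoid.com_law idx) m (F : nat -> R) :
  F m = F 0%N -> \big[op/idx]_(n < m) F n.+1 = \big[op/idx]_(n < m) F n.
Proof.
case: m => [|k] Fk; first by rewrite !big_ord0.
by rewrite big_ord_recr /= Fk [RHS]big_ord_recl Monoid.mulmC.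
Qed.

(** * The idempotent and the extended action *)

Section Idempotent.
Variables (K : numClosedFieldType) (g : fdLieAlgType K).
Hypothesis g_simple : lie_simple g.
Variable c : chevalley g.
Variables (m : nat) (sigma : diagram_aut c m) (zeta : K) (zeta_prim : m.-primitive_root zeta).
Local Notation Lg := (Lgamma sigma zeta_prim).
Variable A : sys Lg.
Local Notation van := (vanish (zeta_prim := zeta_prim) (A := A) g_simple).
Local Notation z n := (scl A (zeta ^+ n)).
Implicit Types (a b : sr A) (P Q : {poly sr A}).

Let m_gt0 : (0 < m)%N := prim_order_gt0 zeta_prim.

Lemma annihp_vanish P : annihp P -> van P.
Proof.
move=> P0 x v; apply/funext => k; rewrite (evalfE (n := size P)) // big1 // => i _.
exact: P0.
Qed.

Lemma vanish_sum J (l : seq J) (C : pred J) (F : J -> {poly sr A}) :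
  (forall j, C j -> van (F j)) -> van (\sum_(j <- l | C j) F j).
Proof. by move=> FP; apply: (big_ind van) => //; [exact: vanish0 | exact: vanishD]. Qed.

(** Comaximality in the ring of polynomials modulo those acting by zero. *)
Definition comax P Q := exists u v, van (u * P + v * Q - 1).

Lemma comaxC P Q : comax P Q -> comax Q P.
Proof. by move=> [u [v uv]]; exists v, u; rewrite (addrC (v * Q)). Qed.

Lemma comaxM P Q Q' : comax P Q -> comax P Q' -> comax P (Q * Q').
Proof.
move=> [u [v uv]] [u' [v' uv']]; exists (u * P * u' + u * v' * Q' + v * Q * u'), (v * v').
have -> : (u * P * u' + u * v' * Q' + v * Q * u') * P + v * v' * (Q * Q') - 1 =
  (u * P + v * Q - 1) * (u' * P + v' * Q') + (u' * P + v' * Q' - 1) by ring.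
by apply: vanishD => //; exact: vanishMr.
Qed.

Lemma comax1 P : comax P 1.
Proof. by exists 0, 1; rewrite mul0r mulr1 add0r subrr; exact: vanish0. Qed.

Lemma comax_prod J (l : seq J) (C : pred J) P (F : J -> {poly sr A}) :
  (forall j, C j -> comax P (F j)) -> comax P (\prod_(j <- l | C j) F j).
Proof. by move=> FP; apply: (big_ind (comax P)) => //; [exact: comax1 | exact: comaxM]. Qed.

Lemma rotp_prod n J (l : seq J) (C : pred J) (F : J -> {poly sr A}) :
  rotp n (\prod_(j <- l | C j) F j) = \prod_(j <- l | C j) rotp n (F j).
Proof. by rewrite (big_morph (rotp n) (rotpM n) (comp_polyC 1 _)). Qed.

Lemma rotp_XsubC n a : rotp n ('X - a%:P) = (z n)%:P * 'X - a%:P.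
Proof. by rewrite /rotp comp_polyB comp_polyX comp_polyC. Qed.

Lemma rotp_add n k P : rotp n (rotp k P) = rotp (n + k) P.
Proof. by elim: n => [|n IHn]; rewrite ?rotp0 // rotpS IHn -rotpS. Qed.

Lemma rotp_order P : rotp m P = P.
Proof.
by apply/polyP => i; rewrite coef_rot (prim_expr_order zeta_prim) rmorph1 expr1n mul1r.
Qed.

(** Multiplying [a] by [zeta] permutes the rotated factors cyclically up to the scalar [zeta], and
    [zeta^m = 1]. *)
Lemma norm_XsubC a i : \prod_(n < m) rotp n ('X - (z i * a)%:P) = \prod_(n < m) rotp n ('X - a%:P).
Proof.
elim: i => [|i IHi]; first by rewrite expr0 rmorph1 mul1r.
rewrite -{}IHi; set b := z i * a.
have -> : z i.+1 * a = z 1 * b by rewrite exprS expr1 rmorphM mulrA.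
rewrite -(@big_iterS _ _ _ m (fun n => rotp n ('X - (z 1 * b)%:P))) => [|]; last by rewrite rotp_order rotp0.
rewrite (eq_bigr (fun n : 'I_m => (z 1)%:P * rotp n ('X - b%:P))) => [|n _]; last first.
  by rewrite !rotp_XsubC exprS rmorphM !polyCM mulrBr !mulrA expr1.
rewrite big_split prodr_const card_ord -polyC_exp -rmorphXn expr1 (prim_expr_order zeta_prim) rmorph1.
by rewrite polyC1; exact: mul1r.
Qed.

Lemma inv_comax (b b' : sr A) k : inv_mod (b' - z k * b) -> comax ('X - b%:P) (rotp k ('X - b'%:P)).
Proof.
move=> [d dP]; exists (d * z k)%:P, (- d)%:P; apply: annihp_vanish => i v.
rewrite (_ : _ - 1 = ((b' - z k * b) * d - 1)%:P) => [|]; last first.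
  by rewrite rotp_XsubC !polyCD !polyCN !polyCM !polyCD !polyCN !polyCM polyC1; ring.
by rewrite coefC; case: eqP => _; rewrite ?sact0l // dP.
Qed.

Section FromRoots.
Variables (s : seq (sr A)) (p : sm A).
Hypothesis s_van : van (\prod_(a <- s) ('X - a%:P)).
Hypothesis s_p : forall a, a \in s -> sact a p <> 0.
Hypothesis s_sep : forall a a' l, a \in s -> a' \in s -> (l < m)%N ->
  inv_mod (a - z l * a') \/ sact (a - z l * a') p = 0.

(** The choice function, applied to the whole orbit of [u] under the [m]-th roots of unity, gives a
    representative [canon u] that depends on the orbit only. *)
Let orb (u : sm A) := [pred u' : sm A | [exists k : 'I_m, u' == (zeta ^+ k) *: u]].
Let canon u := choose (orb u) u.

Let orb_canon u : orb u (canon u).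
Proof.
apply: chooseP; apply/existsP; exists (Ordinal m_gt0) => /=.
by rewrite expr0 scale1r.
Qed.

Let canonZ u k : canon (zeta ^+ k *: u) = canon u.
Proof.
have e : orb (zeta ^+ k *: u) =1 orb u.
  move=> u'; apply/existsP/existsP => -[i /eqP ->].
    exists (Ordinal (ltn_pmod (i + k) m_gt0)); rewrite scalerA -exprD /=.
    by rewrite -(prim_expr_mod zeta_prim).
  exists (Ordinal (ltn_pmod (i + (m - k %% m)) m_gt0)); rewrite scalerA /=; apply/eqP.
  congr (_ *: _); rewrite (prim_expr_mod zeta_prim) exprD -mulrA -[X in _ = _ * (_ * X)](prim_expr_mod zeta_prim).
  by rewrite -exprD subnK ?(prim_expr_order zeta_prim) ?mulr1 // ltnW // ltn_pmod.
have orbu u' : orb u' u' by apply/existsP; exists (Ordinal m_gt0); rewrite /= expr0 scale1r.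
by rewrite /canon (eq_choose e); apply: choose_id; [rewrite -e orbu | rewrite orbu].
Qed.

Let exponent (a : sr A) : {k : 'I_m | canon (sact a p) = zeta ^+ k *: sact a p}.
Proof. by apply: cid; have /existsP[k /eqP e] := orb_canon (sact a p); exists k. Qed.

(* The representative of the class of [a] modulo the [m]-th roots of unity. *)
Let b a := z (sval (exponent a)) * a.

Let bp a : sact (b a) p = canon (sact a p).
Proof. by rewrite /b sactM sact_scl; case: exponent. Qed.

(** If the difference is not invertible, it kills [p]. Then [a p] and [a' p] lie in one orbit under
    the roots of unity, so [b a] and [b a'] agree on [p]; their common value is fixed by [zeta^k],
    hence zero, against [s_p]. *)
Let b_sep a a' k : a \in s -> a' \in s -> (0 < k < m)%N -> inv_mod (b a' - z k * b a).
Proof.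
move=> sa sa' /andP[k0 km]; rewrite /b; set i := sval (exponent a'); set j := sval (exponent a).
pose l := ((k + j + (m - i)) %% m)%N.
have e : z i * a' - z k * (z j * a) = z i * (a' - z l * a).
  rewrite mulrBr !mulrA -!rmorphM -!exprD; congr (_ - scl A _ * _).
  rewrite [RHS]exprD (prim_expr_mod zeta_prim) -exprD addnCA subnKC ?(ltnW (ltn_ord i)) //.
  by rewrite [RHS]exprD (prim_expr_order zeta_prim) mulr1.
have [[d dP]|ap] := s_sep sa' sa (ltn_pmod (k + j + (m - i)) m_gt0).
  exists (scl A (zeta ^+ i)^-1 * d); rewrite e mulrACA -rmorphM.
  by rewrite divff ?expf_neq0 ?(prim_root_neq0 zeta_prim) // rmorph1 mul1r.
have : sact (b a' - z k * b a) p = 0 by rewrite /b e sactM ap sact0r.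
rewrite sactDl sactNl sactM !bp sact_scl => /eqP; rewrite subr_eq0 => /eqP ee.
have : canon (sact a' p) = canon (sact a p).
  have [n <-] : exists n, zeta ^+ n *: sact a p = sact a' p.
    have ea' : sact a' p = zeta ^+ l *: sact a p.
      by have /eqP := ap; rewrite sactDl sactNl sactM sact_scl subr_eq0 => /eqP.
    by exists l.
  exact: canonZ.
move=> eq; move: ee; rewrite eq => /eqP; rewrite -subr_eq0 -[X in X - _]scale1r -scalerBl scaler_eq0.
rewrite subr_eq0 eq_sym -(prim_order_dvd zeta_prim) gtnNdvd //= -eq -bp => /eqP b0.
by case: (s_p sa'); move/eqP: b0; rewrite /b sactM sact_scl scaler_eq0 expf_eq0 (negPf (prim_root_neq0 zeta_prim)) andbF => /eqP.
Qed.

(** Chinese remainders: [F] has the adjusted roots [b a], and [G] is the product of its nontrivial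
    rotations. [F * G] is a product of norms, unchanged by the adjustment, so it vanishes by
    [s_van]; [e = v * G] is 1 modulo [F] and 0 modulo [G]. *)
Lemma idempotent_exists : exists e, [/\ van (e * e - e),
  forall r, (0 < r < m)%N -> van (rotp r e * e) & van (\sum_(r < m) rotp r e - 1)].
Proof.
pose F := \prod_(a <- s) ('X - (b a)%:P).
pose G := \prod_(k < m | (0 < k)%N) rotp k F.
have FGE : \prod_(k < m) rotp k F = F * G.
  rewrite (bigD1 (Ordinal m_gt0)) //= rotp0; congr (_ * _); apply: eq_bigl => k.
  by rewrite lt0n -val_eqE.
have FG0 : van (F * G).
  rewrite -FGE (eq_bigr (fun k : 'I_m => \prod_(a <- s) rotp k ('X - (b a)%:P))) => [|k _]; last exact: rotp_prod.
  rewrite exchange_big (eq_bigr (fun a => \prod_(k < m) rotp k ('X - a%:P))) => [|a _]; last exact: norm_XsubC.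
  rewrite exchange_big (bigD1 (Ordinal m_gt0)) //=; apply: vanishMr.
  by rewrite -rotp_prod rotp0.
have [u [v uv]] : comax F G.
  apply: comax_prod => k k0; rewrite [rotp k F]rotp_prod big_seq; apply: comax_prod => a' sa'.
  apply: comaxC; rewrite /F big_seq; apply: comax_prod => a sa; apply: comaxC.
  by apply/inv_comax/b_sep => //; rewrite k0 ltn_ord.
have rFG r : (0 < r < m)%N -> van (rotp r G * G).
  move=> /andP[r0 rm]; have mr : (m - r < m)%N by rewrite ltn_subrL r0.
  rewrite [rotp r G]rotp_prod (bigD1 (Ordinal mr)) /= ?subn_gt0 //.
  rewrite rotp_add subnKC ?(ltnW rm) // rotp_order mulrAC; exact: vanishMr.
pose e := v * G; exists e.
have e1 : van (e - 1 + u * F).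
  by have -> : e - 1 + u * F = u * F + v * G - 1 by rewrite /e; ring.
have ee r : (0 < r < m)%N -> van (rotp r e * e).
  move=> rm; rewrite /e rotpM mulrACA; exact/vanishM/rFG.
split=> //.
  have -> : e * e - e = e * (e - 1 + u * F) - u * v * (F * G) by rewrite /e; ring.
  by apply: vanishB; apply: vanishM.
have er k n : (k < n < m)%N -> van (rotp k e * rotp n e).
  move=> /andP[kn nm]; have -> : n = (k + (n - k))%N by rewrite subnKC // ltnW.
  rewrite -rotp_add -rotpM mulrC; apply/vanish_rot/ee; rewrite subn_gt0 kn.
  exact: leq_ltn_trans (leq_subr _ _) nm.
(* Orthogonality of the rotations turns the product of the [1 - rotp k e] into 1 minus their sum. *)
have prodE n : (n <= m)%N -> van (\prod_(k < n) (1 - rotp k e) - (1 - \sum_(k < n) rotp k e)).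
  elim: n => [|n IHn] nm; first by rewrite !big_ord0 subr0 subrr; exact: vanish0.
  rewrite !big_ord_recr /=.
  have -> : (\prod_(k < n) (1 - rotp k e)) * (1 - rotp n e) - (1 - (\sum_(k < n) rotp k e + rotp n e)) =
    (\prod_(k < n) (1 - rotp k e) - (1 - \sum_(k < n) rotp k e)) * (1 - rotp n e) +
      \sum_(k < n) rotp k e * rotp n e.
    by rewrite -mulr_suml; ring.
  apply: vanishD; first by apply/vanishMr/IHn/ltnW.
  by apply: vanish_sum => k _; apply: er; rewrite ltn_ord.
(* Modulo vanishing polynomials [1 - e] is [u * F], and the rotations of [F] multiply to [F * G]. *)
have : van (\prod_(k < m) (1 - rotp k e)).
  have prodF n : van (\prod_(k < n) (1 - rotp k e) - \prod_(k < n) rotp k (u * F)).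
    elim: n => [|n IHn]; first by rewrite !big_ord0 subrr; exact: vanish0.
    rewrite !big_ord_recr /=.
    have -> : forall x x' y y' : {poly sr A}, x * y - x' * y' = (x - x') * y + x' * (y - y').
      by move=> *; ring.
    apply: vanishD; [exact: vanishMr | apply: vanishM].
    have -> : 1 - rotp n e - rotp n (u * F) = - rotp n (e - 1 + u * F).
      rewrite !rotpD; rewrite [rotp n (- 1)](_ : _ = - 1); last by have := rotpC n (- 1 : sr A); rewrite polyCN polyC1.
      by ring.
    by apply/vanishN/vanish_rot.
  move: (prodF m) => /vanishD; move=> /(_ (\prod_(k < m) rotp k (u * F))); rewrite subrK; apply.
  rewrite (eq_bigr (fun k : 'I_m => rotp k u * rotp k F)) => [|k _]; last by rewrite rotpM.
  by rewrite big_split FGE; exact: vanishM.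
move=> /vanishB/(_ (prodE m (leqnn _))); rewrite subKr => h.
by rewrite -[X in van X]opprK opprB; exact: vanishN.
Qed.
End FromRoots.

Section LoopRep.
Variable e : {poly sr A}.
Hypothesis e_idem : van (e * e - e).
Hypothesis e_orth : forall r, (0 < r < m)%N -> van (rotp r e * e).
Hypothesis e_sum : van (\sum_(r < m) rotp r e - 1).
Local Notation yfA := (yf (zeta_prim := zeta_prim) g_simple (A := A)).
Local Notation tw := (tw g_simple sigma zeta_prim).

Let m0 : m%:R != 0 :> K. Proof. by rewrite pnatr_eq0 -lt0n. Qed.

Let evanish P Q x v k : van (P - Q) -> evalf P (yfA x v) k = evalf Q (yfA x v) k.
Proof. by move=> PQ; rewrite -[P](subrK Q) evalfDl PQ add0r. Qed.

(** The factor [m] compensates for the average over [Gamma] in [tw]. *)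
Definition loop_op k x v := m%:R *: evalf e (yfA x v) k.

Let yf_linl v : linear (fun x => yfA x v).
Proof.
by move=> a x y; apply/funext => k; rewrite /yf (tw_linear _ _ _ _) ropD ropZ.
Qed.

Let evalfZ P (a : K) (f : int -> sm A) : evalf P (a *: f : int -> sm A) = a *: evalf P f.
Proof.
apply/funext => k; rewrite -[RHS]/(a *: evalf P f k) !(evalfE (n := size P)) // scaler_sumr.
by apply: eq_bigr => i _; rewrite -[(a *: f) _]/(a *: f _) sactZ.
Qed.

Let loop_op_linl k v : linear (fun x => loop_op k x v).
Proof.
move=> a x y; rewrite /loop_op (yf_linl v) evalfDr evalfZ.
by rewrite -[(_ + _) k]/(a *: evalf e (yfA x v) k + evalf e (yfA y v) k) scalerDr !scalerA mulrC.
Qed.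

Let loop_op_linr k x : linear (loop_op k x).
Proof.
move=> a u v; rewrite /loop_op yfD evalfDr.
have -> : yfA x (a *: u) = a *: yfA x u by apply/funext => l; exact: linearZ_LR.
rewrite evalfZ -[(_ + _) k]/(a *: evalf e (yfA x u) k + evalf e (yfA x v) k).
by rewrite scalerDr !scalerA mulrC.
Qed.

Definition loop_fun (u : loop g) (v : sm A) : sm A := dsum_fold (fun k x => loop_op k x v) u.

Let loop_fun_linl v : linear (loop_fun^~ v).
Proof. by apply: dsum_fold_linear => k; exact: loop_op_linl. Qed.

Let loop_fun_mono k x v : loop_fun (tmono k x) v = loop_op k x v.
Proof. by rewrite /loop_fun dsum_fold_single // => l; exact: loop_op_linl. Qed.

Let loop_fun_linr u : linear (loop_fun u).
Proof.
move=> a v v'; rewrite /loop_fun /dsum_fold scaler_sumr -big_split; apply: eq_bigr => k _.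
exact: loop_op_linr.
Qed.

(** In [evalf_lie] with [a = b = e] orthogonality leaves only the term [r = 0], where [e * e] acts
    as [e]. *)
Let loop_op_lie k l x y v : loop_op (k + l) (lie x y) v =
  loop_op k x (loop_op l y v) - loop_op l y (loop_op k x v).
Proof.
rewrite {3 5}/loop_op !(linZE (loop_op_linr _ _)) /loop_op -!scalerBr (evalf_lie g_simple).
rewrite (bigD1 (Ordinal m_gt0)) //= big1 ?addr0 => [|r r0]; last first.
  rewrite e_orth ?scaler0 // ltn_ord andbT lt0n.
  by apply: contra_neq r0 => r0; exact: val_inj.
rewrite rotp0 expr0 scale1r (evanish _ _ _ e_idem) !scalerA; congr (_ *: _).
by rewrite mulfK.
Qed.

Definition loop_rep : lrep (loop g) (sm A).
Proof.
apply: (@LRep K (loop g) (sm A) (fun u => mklin (loop_fun_linr u))) => [u u' v|a u v|u u' v] /=.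
- exact: (linDE (loop_fun_linl v)).
- exact: (linZE (loop_fun_linl v)).
elim/loop_ind: u => [|u1 u2 P1 P2|k x].
- by rewrite lie0l !(lin0E (loop_fun_linl _)) (lin0E (loop_fun_linr _)) subrr.
- by rewrite lieDl !(linDE (loop_fun_linl _)) (linDE (loop_fun_linr _)) P1 P2 addrACA opprD.
elim/loop_ind: u' => [|u1 u2 P1 P2|l y].
- by rewrite lie0r !(lin0E (loop_fun_linl _)) (lin0E (loop_fun_linr _)) subrr.
- by rewrite lieDr !(linDE (loop_fun_linl _)) (linDE (loop_fun_linr _)) P1 P2 addrACA opprD.
rewrite lie_tmono !loop_fun_mono; exact: loop_op_lie.
Defined.

Lemma loop_rep_mono k x v : loop_rep (tmono k x) v = m%:R *: evalf e (yfA x v) k.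
Proof. exact: loop_fun_mono. Qed.

Lemma loop_rep_ext (u : Lg) v : loop_rep (val u) v = srp A u v.
Proof.
have twE k x : loop_rep (val (tw k x)) v = srp A (tw k x) v.
  rewrite tw_val loop_rep_mono.
  transitivity (evalf (\sum_(r < m) rotp r e) (yfA x v) k); last first.
    by rewrite (evanish _ _ _ e_sum) evalf1.
  rewrite (linZE (yf_linl v)) (lin_sumE _ _ _ (yf_linl v)) evalfZ.
  rewrite -[(m%:R^-1 *: _) k]/(m%:R^-1 *: _) scalerA divff // scale1r.
  (* Moving [sigma^r] from [x] to the polynomial rotates [e] by [m - r], so the sum is put in this
     order. *)
  have -> : \sum_(r < m) rotp r e = \sum_(r < m) rotp (m - r) e.
    rewrite [RHS](reindex_inj rev_ord_inj) /=.
    rewrite [RHS](eq_bigr (fun r : 'I_m => rotp r.+1 e)) => [|r _]; last by rewrite subKn.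
    by rewrite (@big_iterS _ _ _ m (fun r => rotp r e)) // rotp_order rotp0.
  rewrite (big_morph (fun P => evalf P (yfA x v) k) (id1 := 0) (op1 := +%R)) => [|P Q|]; last 2 first.
  - by rewrite evalfDl.
  - by rewrite (evalfE (n := 0)) ?size_poly0 // big_ord0.
  rewrite (big_morph (fun f : int -> sm A => evalf e f k) (id1 := 0) (op1 := +%R)) => [|f f'|]; last 2 first.
  - by rewrite evalfDr.
  - by rewrite evalf0r.
  apply: eq_bigr => r _; rewrite (linZE (yf_linl v)) evalfZ.
  rewrite (evalf_rot _ (yf_aut g_simple r x v)) rotp_add subnKC ?(ltnW (ltn_ord r)) // rotp_order.
  by rewrite -[LHS]/((zeta ^ k) ^+ r *: evalf e _ k) !exprnP exprzAC.
rewrite [u](tw_span g_simple) rop_sum (linear_sum (val : Lg -> loop g)) rop_sum.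
by apply: eq_bigr => k _; exact: twE.
Qed.
End LoopRep.
End Idempotent.

(** * Extension to the untwisted loop algebra *)

Section OrbitToNode.
Variables (K : numClosedFieldType) (g : fdLieAlgType K).
Hypothesis g_simple : lie_simple g.
Variable c : chevalley g.
Variables (m : nat) (sigma : diagram_aut c m).
Local Notation Xp := (Xplus c).
Local Notation Xm := (Xminus c).
Local Notation H := (coroot c).
Local Notation eO := (eO sigma).
Local Notation fO := (fO sigma).
Local Notation hO := (hO sigma).
Local Notation cO := (cO sigma).
Variables (M : lmodType K) (r : lrep g M) (w : M) (i : node c) (a : K).
Hypotheses (w_Xp : forall k, r (Xp k) w = 0) (w_hO : r (hO i) w = a *: w)
  (w_fO : exists k, iter k (r (fO i)) w = 0).

Let T0 v := forall k, r (Xp k) v = 0.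

(** Powers of the single [X_i^-] on vectors killed by all [X_k^+]. Since [e_O] brackets with [X_i^-]
    to [H_i], it lowers this degree by one, and [e_O^(q+1)] kills degree [q]. *)
Inductive deg_word : nat -> M -> Prop :=
| deg_word0 v : T0 v -> deg_word 0 v
| deg_wordD q u v : deg_word q u -> deg_word q v -> deg_word q (u + v)
| deg_wordZ q b v : deg_word q v -> deg_word q (b *: v)
| deg_wordX q v : deg_word q v -> deg_word q.+1 (r (Xm i) v).

Let deg_word_H q v : deg_word q v -> deg_word q (r (H i) v).
Proof.
elim=> {q v} [v Tv|q u v _ IHu _ IHv|q b v _ IHv|q v dv IHv].
- apply: deg_word0 => k; rewrite ropC Tv linear0 add0r.
  have -> : lie (Xp k) (H i) = - ev (sroot c k) (H i) *: Xp k.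
    by rewrite lieC (XplusP k (corootP i) : lie _ _ = _) scaleNr.
  by rewrite ropZ Tv scaler0.
- by rewrite linearD; exact: deg_wordD.
- by rewrite linearZ_LR; exact: deg_wordZ.
rewrite ropC coroot_lie_Xm ropZ; apply: deg_wordD; first exact: deg_wordX.
by apply/deg_wordZ/deg_wordX.
Qed.

Let r_eO v : T0 v -> r (eO i) v = 0.
Proof. by move=> Tv; rewrite rop_sum big1. Qed.

Let deg_word_e q v : deg_word q v -> (q = 0%N -> r (eO i) v = 0) /\
  (forall q', q = q'.+1 -> deg_word q' (r (eO i) v)).
Proof.
have lie_ef : lie (eO i) (Xm i) = H i.
  rewrite lie_suml (bigD1 i) ?porbit_id //= Xplus_Xminus big1 ?addr0 // => k /andP[_ ki].
  exact: Xp_Xm.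
elim=> {q v} [v Tv|q u v _ IHu _ IHv|q b v _ IHv|q v dv IHv].
- by split=> // _; exact: r_eO.
- split=> [q0|q' qq]; first by rewrite linearD IHu.1 // IHv.1 // addr0.
  by rewrite linearD; apply: deg_wordD; [exact: IHu.2 | exact: IHv.2].
- split=> [q0|q' qq]; first by rewrite linearZ_LR IHv.1 // scaler0.
  by rewrite linearZ_LR; apply: deg_wordZ; exact: IHv.2.
split=> // q' [<-]; rewrite ropC lie_ef; case: q dv IHv => [|q] dv IHv.
  by rewrite IHv.1 // linear0 add0r; exact: deg_word_H.
by apply: deg_wordD; [apply/deg_wordX/IHv.2 | exact: deg_word_H].
Qed.

Let r0 : lrep (g0 sigma) M := lrep_res (fixincl sigma) r.
Let sl := orbit_sl2 g_simple r0 i.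
Let r0E x y : sigma x = x -> r0 (p0 g_simple sigma x) y = r x y.
Proof. by move=> sx; rewrite -[LHS]/(r (proj0 sigma x) y) proj0_id. Qed.

(** If [w] has weight [N] for the normalized triple of the orbit, then [(X_i^-)^(N+1) w] has weight
    [N - 2(N+1) = -(N+2)] and is killed by [e_O^(N+2)]. As [f_O] is nilpotent on it, [sl2_reflect]
    makes it zero. *)
Lemma node_nilpotent : exists k, iter k (r (Xm i)) w = 0.
Proof.
have c0 : cO i != 0 by rewrite gt_eqF // (cO_pos g_simple).
have [w0|/eqP w0] := eqVneq w 0; first by exists 0%N.
have [k0 wk] := w_fO.
have fE k u : iter k (r0 (p0 g_simple sigma (fO i))) u = iter k (r (fO i)) u.
  by elim: k => //= k ->; rewrite -[LHS]/(r0 (p0 g_simple sigma (fO i)) _) r0E ?aut_fO.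
have [N _ aN] : exists2 k, (k < k0)%N & 2%:R / cO i * a = k%:R.
  apply: (hw_nat sl (m := w)) => //=; last by rewrite fE.
    by rewrite [X in _ *: X](r0E _ (aut_eO sigma i)) r_eO // scaler0.
  by rewrite [X in _ *: X](r0E _ (aut_hO sigma i)) w_hO scalerA.
pose u q := iter q (r (Xm i)) w.
have ud q : deg_word q (u q) by elim: q => [|q IHq]; [exact: deg_word0 | exact: deg_wordX].
have uh q : r (hO i) (u q) = (a - q%:R * cO i) *: u q.
  elim: q => [|q IHq]; first by rewrite mul0r subr0.
  rewrite {1}/u iterS -/(u q) ropC IHq (XminusP i (hO_cartan sigma i) : lie _ _ = _) evN ropZ.
  rewrite linearZ_LR -scalerDl -iterS -/(u q.+1) -/(cO i); congr (_ *: _).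
  by rewrite mulrSr; ring.
have uf q : exists k, iter k (r (fO i)) (u q) = 0.
  have := @cyc_nilpotent K g M r (fO i) w (fO_nilpotent g_simple sigma i) w_fO; apply.
  by elim: q => [|q IHq]; [exact: cyc_w | exact: cyc_r].
exists N.+1; rewrite -/(u N.+1); have [k uk] := uf N.+1.
apply: (sl2_reflect sl (k := k) (n := N.+2)).
- by rewrite fE.
- rewrite -[LHS]/(2%:R / cO i *: r0 (p0 g_simple sigma (hO i)) (u N.+1)) r0E ?aut_hO // uh scalerA; congr (_ *: _).
  rewrite mulrBr aN mulrCA mulfVK // -[N.+2%:R]natr1 -[N.+1%:R]natr1; ring.
set E := mklin _; have EE v : E v = (2%:R / cO i) *: r (eO i) v.
  by rewrite -[LHS]/(2%:R / cO i *: r0 (p0 g_simple sigma (eO i)) v) r0E ?aut_eO.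
have eN q v : deg_word q v -> iter q.+1 E v = 0.
  elim: q v => [|q IHq] v dv; rewrite iterSr EE; first by rewrite (deg_word_e dv).1 // scaler0.
  by apply: IHq; apply/deg_wordZ/(deg_word_e dv).2.
exact: eN (ud N.+1).
Qed.
End OrbitToNode.

Section Extension.
Variables (K : numClosedFieldType) (g : fdLieAlgType K).
Hypothesis g_simple : lie_simple g.
Variable c : chevalley g.
Variables (m : nat) (sigma : diagram_aut c m) (zeta : K) (zeta_prim : m.-primitive_root zeta).
Local Notation Lg := (Lgamma sigma zeta_prim).
Local Notation tw := (tw g_simple sigma zeta_prim).
Local Notation const := (const_loop sigma (prim_root_neq0 zeta_prim)).
Local Notation h := (cartan c).
Variables (M : lmodType K) (r : lrep Lg M) (w : M) (w_cyc : forall v, cyc r w v).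
Variable lam : dual (h0 sigma).
Hypothesis w_sing : loop_singular g_simple lam r w.
Hypothesis up : forall x, loop_singular g_simple lam r x ->
  exists T : {linear M -> M}, (forall z v, T (r z v) = r z (T v)) /\ T w = x.

Lemma loop_extension (p : M) : p <> 0 ->
  exists (N : lmodType K) (f : {linear M -> N}) (rho : lrep (loop g) N),
    [/\ forall z v, f (r z v) = rho (val z) (f v), f p <> 0,
      forall x, loop_in (nplus c) x -> rho x (f w) = 0,
      forall y : g0 sigma, val y \in h -> rho (tmono 0 (val y)) (f w) = ev lam (val y) *: f w &
      forall i, exists k, iter k (rho (tmono 0 (Xminus c i))) (f w) = 0].
Proof.
move=> pn0; have w0 : w <> 0.
  move=> w0; apply: pn0; elim: (w_cyc p) => [|u v _ -> _ ->|a v _ ->|z v _ ->];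
    by rewrite ?w0 ?addr0 ?scaler0 ?linear0.
pose A := comm_sys (@h_loop_abelian K g g_simple c m sigma zeta zeta_prim) w0 w_cyc.
have [q [qm q0 _ vq]] : exists q : {poly sr A},
  [/\ q \is monic, q`_0 = 1, rotp 1 q = q & vanish (zeta_prim := zeta_prim) g_simple q] :=
  vanishing_poly w0 w_cyc w_sing up.
have sq : size q = (size q).-1.+1 by rewrite prednK // lt0n size_poly_eq0 monic_neq0.
have [A1 [e1 [s1 [inj1 qs1]]]] := split_ext qm sq.
pose p1 := si e1 p.
have p10 : p1 <> 0 by move=> e; apply: pn0; apply: inj1; rewrite linear0.
(* All differences [a - zeta^l a'] of roots, which are to become invertible or to kill the surviving
   vector. *)
pose ds := [seq t.1 - scl A1 (zeta ^+ t.2.2) * t.2.1 |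
  t <- [seq (a, x) | a <- s1, x <- [seq (a', l) | a' <- s1, l <- iota 0 m]]].
have [B [e2 [s [p'0 dsP]]]] := localize_seq ds p10.
set p' := sact s (si e2 p1) in p'0 dsP.
pose s2 := [seq sf e2 a | a <- s1].
pose P1 := \prod_(a <- s1) ('X - a%:P).
have vP : vanish (zeta_prim := zeta_prim) (A := B) g_simple (\prod_(a <- s2) ('X - a%:P)).
  rewrite big_map; have -> : \prod_(a <- s1) ('X - (sf e2 a)%:P) = map_poly (sf e2) P1.
    by rewrite rmorph_prod; apply: eq_bigr => a _; rewrite rmorphB /= map_polyX map_polyC.
  apply: vanish_ext; rewrite -[P1](subKr (map_poly (sf e1) q)); apply: vanishB.
    exact: vanish_ext.
  exact: annihp_vanish.
(* The constant term of [q] is 1, so the product of the negated roots acts as the identity and no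
   root kills [p']. *)
have s2p a : a \in s2 -> sact a p' <> 0.
  move=> as2 ap; apply: p'0.
  have /(sext_annih e2)/(_ p') := qs1 0%N.
  have e11 : (map_poly (sf e1) q)`_0 = 1 by rewrite coef_map [q`_0]q0; exact: rmorph1 (sf e1).
  rewrite coefB e11 -horner_coef0 horner_prod (eq_bigr (fun a => - a)) => [|b _]; last first.
    by rewrite hornerXsubC sub0r.
  have e21 : sf e2 1 = 1 := rmorph1 (sf e2).
  rewrite rmorphB e21 rmorph_prod (eq_bigr (fun a => - sf e2 a)) => [|b _]; last by rewrite rmorphN.
  have -> : \prod_(a <- s1) - sf e2 a = \prod_(a <- s2) - a by rewrite big_map.
  rewrite (big_rem a) //= mulrC sactDl sactNl sactM sactNl ap oppr0 sact0r subr0 sact1 //.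
have s2sep a a' l : a \in s2 -> a' \in s2 -> (l < m)%N ->
    inv_mod (a - scl B (zeta ^+ l) * a') \/ sact (a - scl B (zeta ^+ l) * a') p' = 0.
  move=> /mapP[b bs ->] /mapP[b' bs' ->] lm; rewrite -(sf_scl e2) -rmorphM -rmorphB.
  apply: dsP; apply/mapP; exists (b, (b', l)) => //; apply: allpairs_f => //.
  by apply: allpairs_f => //; rewrite mem_iota.
have [e [ee eo es]] := idempotent_exists vP s2p s2sep.
pose rho := loop_rep ee eo; pose f := si (sext_trans e1 e2).
have fr z v : f (r z v) = rho (val z) (f v).
  by rewrite (loop_rep_ext ee eo es) -(si_rp (sext_trans e1 e2)).
have [wn wh wf] := w_sing.
have rho_nplus x : loop_in (nplus c) x -> rho x (f w) = 0.
  elim/loop_in_ind=> [|u v Pu Pv|k x' nx]; first exact: rop0.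
    by rewrite ropD Pu Pv addr0.
  rewrite loop_rep_mono [yf _ _ _](_ : _ = 0) ?evalf0r ?scaler0 //.
  apply/funext => l; rewrite /yf -(si_rp (sext_trans e1 e2)).
  rewrite [srp _ _ _]wn ?linear0 //; apply: nplus_loop_tw; exact/rootsum_nplus.
have rho_h (y : g0 sigma) : val y \in h -> rho (tmono 0 (val y)) (f w) = ev lam (val y) *: f w.
  by move=> yh; rewrite -[tmono 0 (val y)]/(val (const y)) -fr wh // linearZ_LR.
exists (sm B), f, rho; split=> // [fp|i].
  by apply: p'0; rewrite /p' -[si e2 p1]/(f p) fp sact0r.
pose rg : lrep g (sm B) := lrep_res (tmono0 g) rho.
have fixr x v : sigma x = x -> rg x (f v) = f (r (tw 0 x) v).
  move=> sx; have -> : tw 0 x = const (p0 g_simple sigma x) by rewrite (const_tw g_simple) /= proj0_id.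
  by rewrite fr -[val _]/(tmono 0 (proj0 sigma x)) proj0_id.
apply: (node_nilpotent g_simple (sigma := sigma) (r := rg) (a := ev lam (hO sigma i))).
- move=> k; apply: rho_nplus; apply: loop_in_tmono; last exact: nplus_Xp.
  by apply/rootsum_nplus => //; exact: submod_gen0.
- have e0 : val (p0 g_simple sigma (hO sigma i)) = hO sigma i by exact: proj0_id (aut_hO sigma i).
  by have := rho_h (p0 g_simple sigma (hO sigma i)); rewrite e0; apply; exact: hO_cartan.
have [k wk] := wf i; exists k.
have -> : iter k (rg (fO sigma i)) (f w) = f (iter k (r (tw 0 (fO sigma i))) w).
  elim: k {wk} => [//|k IHk]; rewrite !iterS IHk; exact: fixr (aut_fO sigma i).
by rewrite -const_p0_fO wk linear0.
Qed.
End Extension.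

(** * The generator of the twisted Weyl module, and injectivity *)

Lemma tens_scale (R0 R : pzRingType) (phi : {rmorphism R0 -> R}) (V : lmodType R0) u u0 (x : V) :
  phi u0 = u -> u *: tens phi 1 x = tens phi 1 (u0 *: x).
Proof. by move=> <-; rewrite -tens_bal mul1r -tensE. Qed.

Lemma tens0 (R0 R : pzRingType) (phi : {rmorphism R0 -> R}) (V : lmodType R0) : tens phi 1 (0 : V) = 0.
Proof. by rewrite -(scale0r 0) -(tens_scale _ (rmorph0 phi)) scale0r. Qed.

Lemma alg_weight (K : fieldType) (A : algType K) (N : lmodType A) (e f : A) (t : N) a b :
  e *: t = a%:A *: t -> e * f - f * e = b *: f -> e *: (f *: t) = (a + b)%:A *: (f *: t).
Proof.
move=> et /(canRL (subrK _)) ef; rewrite scalerA ef [LHS]scalerDl -(scalerA f e t) et !scalerA.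
by rewrite mulr_algr mulr_algl -[LHS]scalerDl -scalerDl addrC.
Qed.

Lemma emb_weight (K : fieldType) (L : lieAlgType K) (N : lmodType (env L)) y x (t : N) a b :
  emb y *: t = a%:A *: t -> lie y x = b *: x -> emb y *: (emb x *: t) = (a + b)%:A *: (emb x *: t).
Proof. by move=> yt yx; apply: alg_weight yt _; rewrite -emb_lie yx; exact: linearZ_LR. Qed.

Lemma rmorphXn_eq (R R' : pzRingType) (phi : {rmorphism R -> R'}) u u' k :
  phi u = u' -> phi (u ^+ k) = u' ^+ k.
Proof. by move=> <-; exact: rmorphXn. Qed.

Section TwistedWeylSingular.
Variables (K : numClosedFieldType) (g : fdLieAlgType K).
Hypothesis g_simple : lie_simple g.
Variable c : chevalley g.
Variables (m : nat) (sigma : diagram_aut c m) (zeta : K) (zeta_prim : m.-primitive_root zeta).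
Local Notation Lg := (Lgamma sigma zeta_prim).
Local Notation zeta_neq0 := (prim_root_neq0 zeta_prim).
Local Notation const := (const_loop sigma zeta_neq0).
Local Notation h := (cartan c).
Local Notation p0 := (p0 g_simple sigma).
Local Notation fO := (fO sigma).
Variables (I0 : {set node c}) (lam : dual (h0 sigma)).
Variables (V : lmodType (env (g0 sigma))) (v : V).
Hypothesis V_lam : simple_fd_hw lam v.
Local Notation tweyl := (tweyl zeta_prim I0 lam V).
Local Notation gen := (tweyl_gen zeta_prim I0 lam v).
Local Notation P := (projmod zeta_prim V).

Let tens_emb (y : g0 sigma) x : emb (const y) *: (tens (env_map const) 1 x : P) = tens (env_map const) 1 (emb y *: x).
Proof. exact: tens_scale (env_map_emb const y). Qed.

Let tens_scal a x : tens (env_map const) 1 (a%:A *: x) = a%:A *: (tens (env_map const) 1 x : P).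
Proof.
apply/esym/tens_scale.
by apply: etrans (linearZ_LR _ a 1) _; congr (_ *: _); exact: rmorph1.
Qed.

Let tens_h (y : g0 sigma) : val y \in h ->
  emb (const y) *: (tens (env_map const) 1 v : P) = (ev lam (val y))%:A *: (tens (env_map const) 1 v : P).
Proof. by move=> yh; rewrite tens_emb (hw_cartan V_lam yh) tens_scal. Qed.

Let gen_cl : gen = modcl (high_weights I0 lam (V := V)) (tens (env_map const) 1 v) := erefl.

(** Applying a positive root loop to the generator raises its weight out of [lambda - Q_0^+], so the
    result is divided out; the weight and the nilpotency of [f_O] come from the finite-dimensional
    [V]. *)
Lemma tweyl_singular : loop_singular g_simple lam (kmod_rep tweyl) (gen : kmod tweyl).
Proof.
have cl0 x : high_weights I0 lam x -> modcl (high_weights I0 lam (V := V)) x = 0.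
  move=> hx; rewrite -(linear0 (modcl (high_weights I0 lam (V := V)))).
  by apply/modclP; rewrite subr0; exact: submod_gen_in.
split=> [x|y yh|j].
- elim/nplus_loop_ind=> {x} [x y x0 y0|a x x0|k n f n0 wf].
  + by rewrite ropD x0 y0 addr0.
  + by rewrite ropZ x0 scaler0.
  rewrite kmod_repE gen_cl -linearZ_LR; apply: cl0.
  have [b _ bn] := wtv_nspan n; exists (lam + Defs.restrict (h0 sigma) b); split.
    (* Evaluated at the fixed height element, minus a positive number would equal a sum of natural
       numbers. *)
    move=> [d e].
    have [y [yh sy y1 yn]] := height_fixed g_simple sigma.
    have yh0 : y \in h0 sigma by rewrite h0P yh sy eqxx.
    have := congr1 (fun mu : dual (h0 sigma) => ev mu y) e => /=.
    rewrite -big_filter ev_sum big_filter opprD addrA subrr add0r evN restrictE // bn yn.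
    rewrite [\sum_(i in I0) _](eq_bigr (fun i => (d i)%:R)) => [|i _]; last by rewrite evMn restrictE // y1.
    rewrite -natr_sum => /eqP; rewrite eq_sym -subr_eq0 opprK -natrD pnatr_eq0 addn_eq0 => /andP[_].
    rewrite sum_nat_eq0 => /forallP n00; have [i ni] := n0; apply: ni; exact/eqP/n00.
  move=> y yh0; have yh : val y \in h by move: yh0; rewrite h0P => /andP[].
  rewrite evD restrictE // bn; apply: (emb_weight (tens_h yh)).
  by rewrite const_lie_tw wf // mul1r (linZE (tw_linear _ _ _ _)).
- exact: (kmod_map_eigen (modcl (high_weights I0 lam (V := V))) (tens_h yh)).
have [k vk] := V_nilpotent g_simple V_lam j; exists k; apply: iter_kmod_eq0.
have {}vk : emb (p0 (fO j)) ^+ k *: v = 0 by rewrite -[RHS]vk [RHS]iter_kmod_op.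
rewrite gen_cl -linearZ_LR (tens_scale _ (u0 := emb (p0 (fO j)) ^+ k)).
  by rewrite vk tens0 linear0.
exact: rmorphXn_eq (env_map_emb const _).
Qed.
End TwistedWeylSingular.

Section Intertwines.
Variables (K : fieldType) (A B : algType K) (phi : {rmorphism A -> B}).
Variables (V : lmodType A) (N : lmodType K) (f : {linear kmod V -> N}) (act : B -> N -> N).
Hypotheses (actD : forall u v x, act (u + v) x = act u x + act v x)
  (actZ : forall a u x, act (a *: u) x = a *: act u x)
  (actM : forall u v x, act (u * v) x = act u (act v x)) (act1 : forall x, act 1 x = x).

Definition intertwines u := forall x : V, f (u *: x : V) = act (phi u) (f x).

Lemma intertwines1 : intertwines 1.
Proof. by move=> x; rewrite rmorph1 act1 scale1r. Qed.
Lemma intertwinesD u v : intertwines u -> intertwines v -> intertwines (u + v).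
Proof.
by move=> Pu Pv x; rewrite rmorphD actD -Pu -Pv scalerDl; exact: (linearD f (u *: x : kmod V) (v *: x : kmod V)).
Qed.
Lemma intertwinesZ a u : phi (a *: u) = a *: phi u -> intertwines u -> intertwines (a *: u).
Proof.
move=> e Pu x; rewrite e actZ -Pu -[a *: u]mulr_algl -scalerA.
exact: (linearZ_LR f a (u *: x : kmod V)).
Qed.
Lemma intertwinesM u v : intertwines u -> intertwines v -> intertwines (u * v).
Proof. by move=> Pu Pv x; rewrite rmorphM actM -Pv -Pu scalerA. Qed.
Lemma intertwinesI u u' : phi u = u' -> (forall y, f (kmod_op u y) = act u' (f y)) -> intertwines u.
Proof. by move=> <-. Qed.
End Intertwines.

Section Injectivity.
Variables (K : numClosedFieldType) (g : fdLieAlgType K).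
Hypothesis g_simple : lie_simple g.
Variable c : chevalley g.
Variables (m : nat) (sigma : diagram_aut c m) (zeta : K) (zeta_prim : m.-primitive_root zeta).
Local Notation Lg := (Lgamma sigma zeta_prim).
Local Notation incl := (fixincl (loop_twist sigma (prim_root_neq0 zeta_prim))).
Variables (I0 : {set node c}) (lam : dual (h0 sigma)).
Hypothesis I0_repr : is_transversal I0 (porbits (node_perm sigma)) [set: node c]%SET.
Variables (V : lmodType (env (g0 sigma))) (v : V).
Hypothesis V_lam : simple_fd_hw lam v.
Local Notation tweyl := (tweyl zeta_prim I0 lam V).
Local Notation gen := (tweyl_gen zeta_prim I0 lam v).

Lemma tweyl_cyc (x : kmod tweyl) : cyc (kmod_rep tweyl) gen x.
Proof. by have [u ->] := tweyl_gen_span V_lam x; apply/cyc_env/cyc_w. Qed.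

Lemma tweyl_endo (x : kmod tweyl) : loop_singular g_simple lam (kmod_rep tweyl) x ->
  exists T : {linear kmod tweyl -> kmod tweyl},
    (forall z y, T (kmod_rep tweyl z y) = kmod_rep tweyl z (T y)) /\ T (gen : kmod tweyl) = x.
Proof.
move=> /(tweyl_map I0_repr V_lam)[f fx].
have lin : linear (f : kmod tweyl -> kmod tweyl).
  by move=> a y z; exact: (linearP f a%:A y z).
by exists (mklin lin); split=> // z y; exact: (linearZ_LR f).
Qed.

Lemma tweyl_annihilator (u : env Lg) :
  (forall mu, fiber lam mu -> env_map incl u *: weyl_gen mu = 0 :> weyl mu) -> u *: gen = 0.
Proof.
move=> u0; apply: contrapT => ug0.
have [N [f [rho [fr fp nk wk xk]]]] := loop_extension tweyl_cyc
  (tweyl_singular g_simple zeta_prim I0 V_lam) tweyl_endo ug0.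
have [act [aD aZ aM a1 ae]] := env_action rho.
have fu x : intertwines (env_map incl) f act x.
  elim/env_gen_ind: x => [|x x'|a x|z x].
  - exact: intertwines1.
  - exact: intertwinesD.
  - by apply: intertwinesZ => //; exact: linearZ_LR.
  - apply: intertwinesM => //; apply: (intertwinesI (env_map_emb incl z)) => y.
    by rewrite [RHS]ae; exact: fr.
apply: fp; apply: etrans (fu u gen) _.
exact: (weyl_criterion g_simple nk wk xk aD aZ aM a1 ae u0).
Qed.

Lemma tweyl_injective (f : {linear tweyl -> weyl_sum zeta_prim lam}) :
  f gen = weyl_sum_gen zeta_prim lam -> injective f.
Proof.
move=> fg x y /eqP; rewrite -subr_eq0 -linearB => /eqP fxy; apply/subr0_eq.
have [u e] := tweyl_gen_span V_lam (x - y); rewrite e; apply: tweyl_annihilator => mu hmu.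
have [mu' <-] : exists mu' : fiber lam, val mu' = mu by exists (exist _ mu (mem_set hmu)).
have := congr1 (fun s : weyl_sum zeta_prim lam => s mu') fxy.
by rewrite e linearZ_LR fg dsumZE weyl_sum_genE.
Qed.
End Injectivity.

Local Open Scope complex_scope.

Theorem theorem3p4 (R : realType) (g : fdLieAlgType R[i])
    (g_simple : lie_simple g) (c : chevalley g)
    (m : nat) (sigma : diagram_aut c m)
    (zeta : R[i]) (zeta_prim : m.-primitive_root zeta)
    (I0 : {set node c})
    (I0_repr : is_transversal I0 (porbits (node_perm sigma)) [set: node c]%SET)
    (lambda : dual (h0 sigma)) (lambda_P0 : P0plus I0 lambda)
    (V : lmodType (env (g0 sigma))) (v : V)
    (V_lambda : simple_fd_hw lambda v) :
  exists f : {linear tweyl zeta_prim I0 lambda V -> weyl_sum zeta_prim lambda},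
    f (tweyl_gen zeta_prim I0 lambda v) = weyl_sum_gen zeta_prim lambda
    /\ injective f.
Proof.
have [f fg] := tweyl_map I0_repr V_lambda (weyl_sum_singular g_simple zeta_prim lambda).
by exists f; split=> //; exact: (tweyl_injective g_simple I0_repr V_lambda).
Qed.
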